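(* Let $\Omega$ and $\Omega'$ be adjoining Stokes domains with a common turning point $a$ such that $\mathcal C=\partial\Omega\cap\partial\Omega'$ is a Stokes curve emanating from $a$ and ending at $\infty$, and let $\widetilde\Omega=\Omega\cup\Omega'\cup(\mathcal C\setminus\{a\})$, with a holomorphic branch of $\sqrt Q$ on $\widetilde\Omega$ such that $\operatorname{Im}\mathfrak S_a>0$ on $\Omega$ and $\operatorname{Im}\mathfrak S_a<0$ on $\Omega'$. For every $\epsilon,\delta>0$ there exists $H_{\epsilon,\delta}>0$ such that for all $0<h<H_{\epsilon,\delta}$: (1) if $\operatorname{Re}\mathfrak S_a(x)<0$ for all $x\in\mathcal C\setminus\{a\}$, then $U_+(x,h)$ (defined on $\Omega$) extends holomorphically to $\widetilde\Omega_{\epsilon,\delta}(+)$; (2) if $\operatorname{Re}\mathfrak S_a(x)>0$ for all $x\in\mathcal C\setminus\{a\}$, then $U_-(x,h)$ (defined on $\Omega$) extends holomorphically to $\widetilde\Omega_{\epsilon,\delta}(-)$.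
   Context: Let $Q$ be a complex polynomial of degree $m\ge 1$. A turning point is a zero of $Q$. For a turning point $a$, $\mathfrak S_a(x)=\int_a^x\sqrt{Q(\tau)}\,d\tau$. The Stokes curves emanating from a turning point $a$ are the arcs of $\{x:\operatorname{Im}\mathfrak S_a(x)=0\}$ starting at $a$; each ends at $\infty$ or at another turning point (a Stokes curve ending at a turning point $b$ is joined with the Stokes curves emanating from $b$). The Stokes curves divide $\mathbb C$ into regions called Stokes domains. With the branch of $\sqrt Q$ on $\widetilde\Omega$ fixed, $\varphi(z,x)$ denotes the solution of $\frac{dy}{dz}=\frac{1}{\sqrt{Q(y)}}$, $y(0)=x$; it satisfies $\mathfrak S_a(\varphi(z,x))=\mathfrak S_a(x)+z$. Let $\mu=\sup_{x\in\Omega}\operatorname{Im}\mathfrak S_a(x)$, $\mu'=\inf_{x\in\Omega'}\operatorname{Im}\mathfrak S_a(x)$ (so $-\infty\le\mu'<0<\mu\le+\infty$), $\widetilde\Omega_\delta=\{x\in\widetilde\Omega:\mu'+\delta<\operatorname{Im}\mathfrak S_a(x)<\mu-\delta\}$, $\widetilde\Omega_{\epsilon,\delta}(+)=\widetilde\Omega_\delta\setminus\{x\in\widetilde\Omega:\operatorname{Re}\mathfrak S_a(x)>-\epsilon,\ |\operatorname{Im}\mathfrak S_a(x)|<\delta\}$ and $\widetilde\Omega_{\epsilon,\delta}(-)=\widetilde\Omega_\delta\setminus\{x\in\widetilde\Omega:\operatorname{Re}\mathfrak S_a(x)<\epsilon,\ |\operatorname{Im}\mathfrak S_a(x)|<\delta\}$.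 Let $C(x)=\frac{4Q(x)Q''(x)-5Q'(x)^2}{16Q(x)^2}$. For $h>0$ define $(K_+f)(x,h)=\sqrt{Q(x)}\int_{-\infty}^{0}e^{2t/h}\frac{f(\varphi(t,x))}{Q(\varphi(t,x))}dt$ and $(K_-f)(x,h)=\sqrt{Q(x)}\int_{+\infty}^{0}e^{-2t/h}\frac{f(\varphi(t,x))}{Q(\varphi(t,x))}dt$. For each sign $\pm$, define $W_{\pm,1}=K_\pm C$, $W_{\pm,n}=-\sum_{i+j=n,\,i,j\ge1}K_\pm(W_{\pm,i}W_{\pm,j})$ ($n\ge2$), $W_\pm=\sum_{n\ge1}W_{\pm,n}$, $g_\pm=W_\pm/\sqrt Q$. With a holomorphic branch $Q^{1/4}$, $(Q^{1/4})^2=\sqrt Q$, $U_+(x,h)=Q(x)^{-1/4}\exp\big(\frac1h\mathfrak S_a(x)+\int_{-\infty}^0 g_+(\varphi(t,x),h)\,dt\big)$ and $U_-(x,h)=Q(x)^{-1/4}\exp\big(-\frac1h\mathfrak S_a(x)+\int_{+\infty}^0 g_-(\varphi(t,x),h)\,dt\big)$; on $\Omega$ these are solutions of $h^2y''-Qy=0$ for small $h$. *)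

(* Defs.v *)
From Stdlib Require Import Reals Lra ClassicalEpsilon.
From Coquelicot Require Import Coquelicot.
Set Implicit Arguments.
Open Scope R_scope.

Definition cexp (z : C) : C :=
  Cmult (RtoC (exp (Re z))) (cos (Im z), sin (Im z)).

Definition cdiff (f : C -> C) (z : C) : Prop :=
  @ex_derive C_AbsRing C_NormedModule f z.
Definition cderiv_is (f : C -> C) (z l : C) : Prop :=
  @is_derive C_AbsRing C_NormedModule f z l.

Definition holomorphic_on (A : C -> Prop) (f : C -> C) : Prop :=
  forall z, A z -> cdiff f z.

Definition rderiv_is (g : R -> C) (t : R) (l : C) : Prop :=
  @is_derive R_AbsRing C_R_NormedModule g t l.

Fixpoint csum (f : nat -> C) (n : nat) : C :=
  match n with O => RtoC 0 | S k => Cplus (csum f k) (f k) end.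

Fixpoint cpow (x : C) (n : nat) : C :=
  match n with O => RtoC 1 | S k => Cmult x (cpow x k) end.

Definition peval (c : nat -> C) (m : nat) (x : C) : C :=
  csum (fun k => Cmult (c k) (cpow x k)) (S m).
Definition pderiv (c : nat -> C) : nat -> C :=
  fun k => Cmult (RtoC (INR (S k))) (c (S k)).

Definition is_poly_deg (c : nat -> C) (m : nat) : Prop :=
  (1 <= m)%nat /\ c m <> RtoC 0 /\ forall k, (m < k)%nat -> c k = RtoC 0.

(** [gam] on [0,T) is an arc of { Im S_b = 0 } starting at the turning point
    [b]: gam(0)=b, gam continuous at 0 from the right, and on (0,T) the curve is
    differentiable with sqrt(Q) gam' real (nonzero), i.e. Q(gam) gam'^2 > 0.
    (Im S_b(gam t) = Im int_0^t sqrt Q(gam) gam' ds is then constantly 0.) *)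
Definition stokes_arc (c : nat -> C) (m : nat) (b : C) (gam : R -> C) (T : Rbar)
  : Prop :=
  peval c m b = RtoC 0 /\ Rbar_lt 0 T /\ gam 0 = b /\
  filterlim gam (at_right 0) (locally b) /\
  forall t, 0 < t -> Rbar_lt t T ->
    exists d : C, rderiv_is gam t d /\
      Im (Cmult (peval c m (gam t)) (Cmult d d)) = 0 /\
      0 < Re (Cmult (peval c m (gam t)) (Cmult d d)).

Definition on_stokes (c : nat -> C) (m : nat) (x : C) : Prop :=
  exists b gam T t, stokes_arc c m b gam T /\ 0 <= t /\ Rbar_lt t T /\ gam t = x.

Definition path_in (A : C -> Prop) (x y : C) : Prop :=
  exists p : R -> C, p 0 = x /\ p 1 = y /\
    (forall t, 0 <= t <= 1 -> A (p t) /\ continuous p t).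

Definition stokes_domain (c : nat -> C) (m : nat) (Om : C -> Prop) : Prop :=
  exists x0, ~ on_stokes c m x0 /\
    forall x, Om x <-> path_in (fun y => ~ on_stokes c m y) x0 x.

Definition closure_of (A : C -> Prop) (x : C) : Prop :=
  forall eps : R, 0 < eps -> exists y, A y /\ Cmod (Cminus y x) < eps.
Definition boundary (A : C -> Prop) (x : C) : Prop := closure_of A x /\ ~ A x.

Definition flowP (sq : C -> C) (D : C -> Prop) (fwd : bool) (x : C) (y : R -> C)
  : Prop :=
  y 0 = x /\ forall t, (if fwd then 0 <= t else t <= 0) ->
     D (y t) /\ rderiv_is y t (Cinv (sq (y t))).

(** phi(t,x) : the (unique when it exists) such solution *)
Definition phi (sq : C -> C) (D : C -> Prop) (fwd : bool) (t : R) (x : C) : C :=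
  epsilon (inhabits (fun _ : R => RtoC 0)) (flowP sq D fwd x) t.

Definition Cfun (c : nat -> C) (m : nat) (x : C) : C :=
  let Q := peval c m x in
  let Q1 := peval (pderiv c) m x in
  let Q2 := peval (pderiv (pderiv c)) m x in
  Cdiv (Cminus (Cmult (RtoC 4) (Cmult Q Q2)) (Cmult (RtoC 5) (Cmult Q1 Q1)))
       (Cmult (RtoC 16) (Cmult Q Q)).

(** integrand of K_+ ([fwd=false], t in (-oo,0]) or K_- ([fwd=true], t in [0,+oo)) *)
Definition Kintegrand (c : nat -> C) (m : nat) (sq : C -> C) (D : C -> Prop)
  (fwd : bool) (f : C -> R -> C) (x : C) (h : R) (t : R) : C :=
  let y := phi sq D fwd t x in
  Cmult (RtoC (exp ((if fwd then -2 else 2) * t / h)))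
        (Cdiv (f y h) (peval c m y)).

Definition Klow (fwd : bool) : (R -> Prop) -> Prop :=
  Rbar_locally (if fwd then p_infty else m_infty).

Definition Kop c m sq D fwd (f : C -> R -> C) (x : C) (h : R) : C :=
  Cmult (sq x) (@RInt_gen C_R_CompleteNormedModule (Kintegrand c m sq D fwd f x h) (Klow fwd) (at_point 0)).

Definition Kconv c m sq D fwd (f : C -> R -> C) (x : C) (h : R) : Prop :=
  @ex_RInt_gen C_R_NormedModule (Kintegrand c m sq D fwd f x h) (Klow fwd) (at_point 0).

Definition fmul (f g : C -> R -> C) : C -> R -> C := fun x h => Cmult (f x h) (g x h).

Definition Wnext c m sq D fwd (n : nat) (prev : nat -> C -> R -> C) : C -> R -> C :=
  match n with
  | 1%nat => Kop c m sq D fwd (fun x _ => Cfun c m x)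
  | _ => fun x h => Copp (csum (fun i =>
            Kop c m sq D fwd (fmul (prev (S i)) (prev (n - S i)%nat)) x h) (n - 1))
  end.

(** Wupto n k = W_k for 1 <= k <= n *)
Fixpoint Wupto c m sq D fwd (n : nat) : nat -> C -> R -> C :=
  match n with
  | O => fun _ _ _ => RtoC 0
  | S n' => fun k => if Nat.leb k n' then Wupto c m sq D fwd n' k
                     else Wnext c m sq D fwd (S n') (Wupto c m sq D fwd n')
  end.

Definition Wn c m sq D fwd (n : nat) : C -> R -> C := Wupto c m sq D fwd n n.

Definition Wn_defined c m sq D fwd (n : nat) (x : C) (h : R) : Prop :=
  match n with
  | 1%nat => Kconv c m sq D fwd (fun y _ => Cfun c m y) x h
  | _ => forall i, (1 <= i <= n - 1)%nat ->
           Kconv c m sq D fwd (fmul (Wn c m sq D fwd i) (Wn c m sq D fwd (n - i))) x h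
  end.

Definition Wseries c m sq D fwd (x : C) (h : R) : nat -> C :=
  fun n => Wn c m sq D fwd (S n) x h.

Definition Wsum c m sq D fwd (x : C) (h : R) : C :=
  epsilon (inhabits (RtoC 0)) (@is_series C_AbsRing C_NormedModule (Wseries c m sq D fwd x h)).

Definition gfun c m sq D fwd (x : C) (h : R) : C := Cdiv (Wsum c m sq D fwd x h) (sq x).

Definition Uintegrand c m sq D fwd (x : C) (h : R) (t : R) : C :=
  gfun c m sq D fwd (phi sq D fwd t x) h.

(** U_+ ([fwd=false]) and U_- ([fwd=true]); [q4] is the branch Q^{1/4}, [S] = S_a *)
Definition Ufun c m sq (q4 S : C -> C) D (fwd : bool) (x : C) (h : R) : C :=
  Cmult (Cinv (q4 x))
   (cexp (Cplus (Cmult (RtoC (if fwd then -1 else 1)) (Cdiv (S x) (RtoC h)))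
                (@RInt_gen C_R_CompleteNormedModule (Uintegrand c m sq D fwd x h) (Klow fwd) (at_point 0)))).

Definition U_defined c m sq D fwd (x : C) (h : R) : Prop :=
  (exists y, flowP sq D fwd x y) /\
  (forall n, (1 <= n)%nat -> Wn_defined c m sq D fwd n x h) /\
  (exists l, @is_series C_AbsRing C_NormedModule (Wseries c m sq D fwd x h) l) /\
  @ex_RInt_gen C_R_NormedModule (Uintegrand c m sq D fwd x h) (Klow fwd) (at_point 0).

Definition mu_sup (S : C -> C) (Om : C -> Prop) : Rbar :=
  Lub_Rbar (fun r => exists x, Om x /\ r = Im (S x)).
Definition mu_inf (S : C -> C) (Om' : C -> Prop) : Rbar :=
  Glb_Rbar (fun r => exists x, Om' x /\ r = Im (S x)).

Definition Omt_delta (S : C -> C) (Om Om' Omt : C -> Prop) (delta : R) (x : C) : Prop :=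
  Omt x /\ Rbar_lt (Rbar_plus (mu_inf S Om') delta) (Im (S x)) /\
  Rbar_lt (Im (S x)) (Rbar_minus (mu_sup S Om) delta).

Definition Omt_ed (S : C -> C) (Om Om' Omt : C -> Prop) (fwd : bool) (eps delta : R)
  (x : C) : Prop :=
  Omt_delta S Om Om' Omt delta x /\
  ~ (Omt x /\ (if fwd then Re (S x) < eps else - eps < Re (S x)) /\
     Rabs (Im (S x)) < delta).

(* Main.v *)
Require Import Defs.
From Stdlib Require Import Reals Lra Lia Arith ClassicalEpsilon Psatz Ranalysis5.
From Coquelicot Require Import Coquelicot.
Open Scope R_scope.

(** In the coordinate [zeta = S x] the flow is a horizontal translation, so everything reduces to
    functions on a subset of the [zeta]-plane. On a Stokes domain every point lies on a complete
    horizontal trajectory and the trajectories cross one maximal vertical trajectory; hence [S] is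
    injective there. Across the common Stokes curve the charts of the two domains fit together,
    and [S] maps the union conformally onto a horizontal strip slit along half of the real axis,
    with inverse [psi]. Removing [eps] and [delta] neighbourhoods of the slit and of the edges
    leaves points with a disc of fixed radius [r] around the whole ray of integration. A path of
    length [L] on which [sqrt |Q| L < r] lifts through [psi], so zeros of [Q] keep their distance:
    [|Q(psi)| >= c (1 + |psi|)^m], and the potential [C/Q] at [psi] is [O(omega)] together with its
    derivatives, where [omega = (1 + |psi|)^-(m+2)] decays like [t^-2] along rays.
    The operator [K] becomes integration against [exp (2t/h)] along a ray and gains a factor [h/2]
    in a norm weighted by [omega]. With [a_n = (24h)^-1 2^-n n^-2] the convolution estimate
    [sum a_i a_j <= 8 (24h)^-1 a_n] propagates the bound [a_n] through the recursion as soon as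
    [24 M h^2 <= 1], [M] being the norm of the potential. So the series converges in the norm, the
    integral in the exponent converges because [omega] is integrable, and both are holomorphic. *)

(** No Cauchy theory and no planar topology enter. Holomorphy of an integral or of a limit is read
    off from second order remainder bounds that survive integration and passage to the limit, and
    injectivity of [S] comes from the uniqueness of horizontal and vertical trajectories. Stokes
    domains are path components of the complement of all Stokes curves. Two facts usually taken for
    granted must then be earned. A domain avoids the zeros of [Q] only after a Stokes arc has been
    constructed at each zero, of whatever order. And a domain is not known to be open, so charts are
    compared with it along curves and chords inside it. The continuation of [U_+] or [U_-] is its
    defining formula read on the larger set, which is why the rays of integration must stay in the
    slit strip. The constant 24 is [6 * 8 / 2]: a product costs 6 in the norm, the convolution of
    the majorants 8, and [K] gains [h / 2]. So [a = 1 / (24 h)] is the scale at which the recursion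
    reproduces its own bound, and [24 M h^2 <= 1] is what the first iterate, bounded by [M h / 2],
    requires. [M] depends on the distance kept from the slit and the edges, hence [H] on [eps] and
    [delta]. *)

Arguments RtoC x%_R_scope.

(** * Derivatives and curves *)

(** Derivative with respect to the coordinate [i]: complex derivatives for [i = id], velocities of
    curves for [i = RtoC]. *)
Definition deriv_via {X : Type} (i f : X -> C) (x : X) (l : C) : Prop :=
  forall eps, 0 < eps -> exists d, 0 < d /\ forall y, Cmod (i y - i x)%C < d ->
    Cmod (f y - f x - l * (i y - i x))%C <= eps * Cmod (i y - i x)%C.
Definition cont_via {X : Type} (i f : X -> C) (x : X) : Prop :=
  forall eps, 0 < eps -> exists d, 0 < d /\ forall y, Cmod (i y - i x)%C < d ->
    Cmod (f y - f x)%C < eps.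
Notation cder := (deriv_via (fun z : C => z)).
Notation rder := (deriv_via RtoC).
Notation ccont := (cont_via (fun z : C => z)).
Notation rcont := (cont_via RtoC).

Lemma C_ext (x y : C) : Re x = Re y -> Im x = Im y -> x = y.
Proof. destruct x, y; simpl; intros -> ->; reflexivity. Qed.

Lemma Cmod_sub_sym (x y : C) : Cmod (x - y)%C = Cmod (y - x)%C.
Proof. rewrite <- Cmod_opp. f_equal. ring. Qed.

Lemma Cmod_le_Re_Im (z : C) : Cmod z <= Rabs (Re z) + Rabs (Im z).
Proof.
  replace z with (RtoC (Re z) + Ci * RtoC (Im z))%C.
  - eapply Rle_trans; [apply Cmod_triangle|].
    rewrite Cmod_mult, Cmod_Ci, !Cmod_R.
    replace (Re (RtoC (Re z) + Ci * RtoC (Im z))%C) with (Re z) by (destruct z; simpl; ring).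
    replace (Im (RtoC (Re z) + Ci * RtoC (Im z))%C) with (Im z) by (destruct z; simpl; ring).
    lra.
  - apply C_ext; destruct z; simpl; ring.
Qed.

Lemma im_le_Cmod (z : C) : Rabs (Im z) <= Cmod z.
Proof. eapply Rle_trans; [apply Rmax_r|apply Rmax_Cmod]. Qed.

Lemma Cmod_triangle_inv (x y : C) : Cmod x - Cmod y <= Cmod (x - y)%C.
Proof.
  assert (H := Cmod_triangle (x - y) y). replace (x - y + y)%C with x in H by ring. lra.
Qed.

Lemma Cmod_sub_triangle (x y z : C) : Cmod (x - z)%C <= Cmod (x - y)%C + Cmod (y - z)%C.
Proof. eapply Rle_trans; [|apply Cmod_triangle]. right. f_equal. ring. Qed.

Lemma Cmod_sub_le (x y : C) : Cmod (x - y)%C <= Cmod x + Cmod y.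
Proof. unfold Cminus. eapply Rle_trans; [apply Cmod_triangle|]. rewrite Cmod_opp. lra. Qed.

Lemma Cmod_small_eq (x y : C) : (forall e, 0 < e -> Cmod (x - y)%C <= e) -> x = y.
Proof.
  intros H. assert (H0 : Cmod (x - y)%C = 0).
  { apply Rle_antisym; [|apply Cmod_ge_0]. apply Rnot_lt_le. intros Hl.
    specialize (H (Cmod (x - y)%C / 2)). lra. }
  apply Cmod_eq_0 in H0. replace x with (x - y + y)%C by ring. rewrite H0. ring.
Qed.

(** The passage from filters to epsilons. Through it [cderiv_is_cder] and [rderiv_is_rder] translate
    the two derivatives of the statement into [deriv_via], where one proof serves complex
    derivatives and velocities of curves alike. *)
Lemma is_derive_eps {K : AbsRing} {V : NormedModule K} (f : K -> V) (x : K) (l : V) :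
  is_derive f x l <-> forall eps, 0 < eps -> exists d, 0 < d /\ forall y, norm (minus y x) < d ->
    norm (minus (minus (f y) (f x)) (scal (minus y x) l)) <= eps * norm (minus y x).
Proof.
  split.
  - intros [_ H] eps He.
    specialize (H x (fun P h => h) (mkposreal eps He)).
    apply (locally_le_locally_norm x) in H.
    destruct H as [d Hd]. exists d. split; [apply cond_pos|].
    intros y Hy. apply Hd. exact Hy.
  - intros H. split; [apply is_linear_scal_l|].
    intros z Hz. apply (@is_filter_lim_locally_unique K (AbsRing_NormedModule K)) in Hz. rewrite <- Hz. clear Hz z.
    intros eps. destruct (H eps (cond_pos eps)) as [d [Hd H']].
    apply (locally_norm_le_locally x).
    exists (mkposreal d Hd). intros y Hy. apply H'. exact Hy.
Qed.

Lemma cderiv_is_cder f z l : cderiv_is f z l <-> cder f z l.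
Proof.
  unfold cderiv_is. rewrite is_derive_eps. unfold deriv_via.
  assert (E : forall y : C, (f y - f z - l * (y - z) = f y - f z - (y - z) * l)%C)
    by (intros; ring).
  split; intros H eps He; destruct (H eps He) as [d [Hd H']]; exists d; (split; [exact Hd|]);
  intros y Hy; specialize (H' y Hy).
  - rewrite E. exact H'.
  - rewrite E in H'. exact H'.
Qed.

Lemma C_R_norm_Cmod (x : C) : @norm R_AbsRing C_R_NormedModule x = Cmod x.
Proof. symmetry. apply Cmod_norm. Qed.

Lemma C_R_scal (k : R) (x : C) : @scal R_AbsRing C_R_NormedModule k x = (RtoC k * x)%C.
Proof. apply C_ext; destruct x; simpl; unfold scal; simpl; unfold mult; simpl; ring. Qed.

Lemma rderiv_is_rder g t l : rderiv_is g t l <-> rder g t l.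
Proof.
  unfold rderiv_is. rewrite is_derive_eps. unfold deriv_via.
  assert (E : forall y : R, Cmod (RtoC y - RtoC t)%C = @norm R_AbsRing R_NormedModule (minus y t)).
  { intros y. rewrite <- RtoC_minus, Cmod_R. reflexivity. }
  assert (E2 : forall y : R, Cmod (g y - g t - l * (RtoC y - RtoC t))%C =
     @norm R_AbsRing C_R_NormedModule (minus (minus (g y) (g t)) (scal (minus y t) l))).
  { intros y. rewrite C_R_norm_Cmod, C_R_scal.
    f_equal. unfold minus, plus, opp; simpl.
    unfold Cminus. rewrite RtoC_plus, RtoC_opp. ring_simplify.
    apply C_ext; unfold prod_plus, prod_opp, plus, opp; simpl; ring. }
  split; intros H eps He; destruct (H eps He) as [d [Hd H']]; exists d; (split; [exact Hd|]);
  intros y Hy.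
  - rewrite E2, E. apply H'. rewrite <- E. exact Hy.
  - specialize (H' y). rewrite E in H'. specialize (H' Hy). rewrite E2 in H'. exact H'.
Qed.

Lemma deriv_ext {X} (i f g : X -> C) x l d : 0 < d ->
  (forall y, Cmod (i y - i x)%C < d -> f y = g y) -> deriv_via i f x l -> deriv_via i g x l.
Proof.
  intros Hd He Hf eps Heps. destruct (Hf eps Heps) as [d1 [Hd1 H1]].
  exists (Rmin d d1). split; [now apply Rmin_pos|].
  intros y Hy. rewrite <- (He y), <- (He x).
  - apply H1. eapply Rlt_le_trans; [exact Hy|apply Rmin_r].
  - replace (i x - i x)%C with (RtoC 0) by ring. rewrite Cmod_0. exact Hd.
  - eapply Rlt_le_trans; [exact Hy|apply Rmin_l].
Qed.

Lemma deriv_cont {X} (i f : X -> C) x l : deriv_via i f x l -> cont_via i f x.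
Proof.
  intros Hf eps Heps. destruct (Hf 1 Rlt_0_1) as [d [Hd H]].
  assert (Hl := Cmod_ge_0 l).
  assert (H0 : 0 < eps / (Cmod l + 1 + 1)) by (apply Rdiv_lt_0_compat; lra).
  exists (Rmin d (eps / (Cmod l + 1 + 1))). split; [now apply Rmin_pos|].
  intros y Hy. assert (H1 := Rmin_l d (eps / (Cmod l + 1 + 1))).
  assert (H2 := Rmin_r d (eps / (Cmod l + 1 + 1))).
  specialize (H y ltac:(lra)).
  assert (E := Cmod_triangle (f y - f x - l * (i y - i x)) (l * (i y - i x))).
  replace (f y - f x - l * (i y - i x) + l * (i y - i x))%C with (f y - f x)%C in E by ring.
  rewrite Cmod_mult in E.
  assert (H3 : Cmod (i y - i x)%C < eps / (Cmod l + 1 + 1)) by lra.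
  apply Rmult_lt_compat_r with (r := Cmod l + 1 + 1) in H3; [|lra].
  replace (eps / (Cmod l + 1 + 1) * (Cmod l + 1 + 1)) with eps in H3 by (field; lra).
  assert (Hk := Cmod_ge_0 (i y - i x)%C). nra.
Qed.

Lemma deriv_const {X} (i : X -> C) (c : C) x : deriv_via i (fun _ => c) x 0.
Proof.
  intros eps He. exists 1. split; [lra|]. intros y _.
  replace (c - c - 0 * (i y - i x))%C with (RtoC 0) by ring. rewrite Cmod_0.
  apply Rmult_le_pos; [lra|apply Cmod_ge_0].
Qed.

Lemma deriv_self {X} (i : X -> C) x : deriv_via i i x 1.
Proof.
  intros eps He. exists 1. split; [lra|]. intros y _.
  replace (i y - i x - 1 * (i y - i x))%C with (RtoC 0) by ring. rewrite Cmod_0.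
  apply Rmult_le_pos; [lra|apply Cmod_ge_0].
Qed.

Lemma deriv_plus {X} (i f g : X -> C) x l m : deriv_via i f x l -> deriv_via i g x m ->
  deriv_via i (fun y => f y + g y)%C x (l + m)%C.
Proof.
  intros Hf Hg eps He.
  destruct (Hf (eps / 2) ltac:(lra)) as [d1 [Hd1 H1]].
  destruct (Hg (eps / 2) ltac:(lra)) as [d2 [Hd2 H2]].
  exists (Rmin d1 d2). split; [now apply Rmin_pos|].
  intros y Hy. assert (A1 := Rmin_l d1 d2). assert (A2 := Rmin_r d1 d2).
  specialize (H1 y ltac:(lra)). specialize (H2 y ltac:(lra)).
  replace (f y + g y - (f x + g x) - (l + m) * (i y - i x))%C with
    ((f y - f x - l * (i y - i x)) + (g y - g x - m * (i y - i x)))%C by ring.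
  eapply Rle_trans; [apply Cmod_triangle|]. lra.
Qed.

Lemma deriv_comp {X} (i f : X -> C) (g : C -> C) x l m :
  deriv_via i f x l -> cder g (f x) m -> deriv_via i (fun y => g (f y)) x (m * l)%C.
Proof.
  intros Hf Hg eps He.
  assert (Hl := Cmod_ge_0 l). assert (Hm := Cmod_ge_0 m).
  destruct (Hg (eps / (2 * (Cmod l + 1)))) as [d1 [Hd1 H1]]; [apply Rdiv_lt_0_compat; lra|].
  destruct (deriv_cont _ _ _ _ Hf d1 Hd1) as [d2 [Hd2 H2]].
  destruct (Hf (eps / (2 * (Cmod m + 1)))) as [d3 [Hd3 H3]]; [apply Rdiv_lt_0_compat; lra|].
  destruct (Hf 1 Rlt_0_1) as [d4 [Hd4 H4]].
  exists (Rmin (Rmin d2 d3) d4). split; [repeat apply Rmin_pos; assumption|].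
  intros y Hy.
  assert (A1 := Rmin_l (Rmin d2 d3) d4). assert (A2 := Rmin_r (Rmin d2 d3) d4).
  assert (A3 := Rmin_l d2 d3). assert (A4 := Rmin_r d2 d3).
  specialize (H2 y ltac:(lra)). specialize (H3 y ltac:(lra)). specialize (H4 y ltac:(lra)).
  specialize (H1 (f y) H2).
  set (k := (i y - i x)%C) in *. assert (Hk := Cmod_ge_0 k).
  replace (g (f y) - g (f x) - m * l * k)%C with
    ((g (f y) - g (f x) - m * (f y - f x)) + m * (f y - f x - l * k))%C by ring.
  eapply Rle_trans; [apply Cmod_triangle|]. rewrite Cmod_mult.
  assert (H5 : Cmod (f y - f x)%C <= (Cmod l + 1) * Cmod k).
  { replace (f y - f x)%C with ((f y - f x - l * k) + l * k)%C by ring.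
    eapply Rle_trans; [apply Cmod_triangle|]. rewrite Cmod_mult. lra. }
  assert (H6 : eps / (2 * (Cmod l + 1)) * Cmod (f y - f x)%C <= eps / 2 * Cmod k).
  { apply Rle_trans with (eps / (2 * (Cmod l + 1)) * ((Cmod l + 1) * Cmod k)).
    - apply Rmult_le_compat_l; [|exact H5]. apply Rlt_le, Rdiv_lt_0_compat; lra.
    - right. field. lra. }
  assert (H7 : Cmod m * Cmod (f y - f x - l * k)%C <= eps / 2 * Cmod k).
  { apply Rle_trans with ((Cmod m + 1) * (eps / (2 * (Cmod m + 1)) * Cmod k)).
    - apply Rmult_le_compat; try lra; try apply Cmod_ge_0.
    - right. field. lra. }
  lra.
Qed.

Lemma cder_sqr z : cder (fun w => w * w)%C z (2 * z)%C.
Proof.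
  intros eps He. exists eps. split; [exact He|]. intros y Hy.
  replace (y * y - z * z - 2 * z * (y - z))%C with ((y - z) * (y - z))%C by ring.
  rewrite Cmod_mult. assert (H := Cmod_ge_0 (y - z)%C). nra.
Qed.

Lemma cder_scal (a z : C) : cder (fun w => a * w)%C z a.
Proof.
  intros eps He. exists 1. split; [lra|]. intros y Hy.
  replace (a * y - a * z - a * (y - z))%C with (RtoC 0) by ring. rewrite Cmod_0.
  apply Rmult_le_pos; [lra|apply Cmod_ge_0].
Qed.

Lemma cder_inv (z : C) : z <> RtoC 0 -> cder (fun w => / w)%C z (- / (z * z))%C.
Proof.
  intros Hz eps He. assert (Hz' : 0 < Cmod z) by (apply Cmod_gt_0; exact Hz).
  set (c := Cmod z) in *.
  assert (Hc : 0 < eps * (c * c * c) / 2) by (apply Rdiv_lt_0_compat; [repeat apply Rmult_lt_0_compat; lra|lra]).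
  exists (Rmin (c / 2) (eps * (c * c * c) / 2)). split; [apply Rmin_pos; lra|].
  intros y Hy. assert (A1 := Rmin_l (c / 2) (eps * (c * c * c) / 2)).
  assert (A2 := Rmin_r (c / 2) (eps * (c * c * c) / 2)).
  assert (Hyz : c / 2 <= Cmod y).
  { assert (H := Cmod_triangle_inv z y). rewrite Cmod_sub_sym in H. fold c in H. lra. }
  assert (Hy0 : y <> RtoC 0) by (apply Cmod_gt_0; lra).
  replace (/ y - / z - - / (z * z) * (y - z))%C with ((y - z) * (y - z) / (y * (z * z)))%C
    by (field; auto).
  assert (Hn : (y * (z * z))%C <> RtoC 0) by (repeat apply Cmult_neq_0; auto).
  rewrite Cmod_div by exact Hn. rewrite !Cmod_mult. fold c.
  set (k := Cmod (y - z)%C) in *. assert (Hk : 0 <= k) by apply Cmod_ge_0.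
  assert (Hp : 0 < c * c) by nra.
  apply Rmult_le_reg_r with (Cmod y * (c * c)); [nra|].
  replace (k * k / (Cmod y * (c * c)) * (Cmod y * (c * c))) with (k * k)
    by (field; split; lra).
  assert (eps * (c * c * c) / 2 <= eps * (Cmod y * (c * c))).
  { replace (eps * (c * c * c) / 2) with (eps * (c * c) * (c / 2)) by field.
    replace (eps * (Cmod y * (c * c))) with (eps * (c * c) * Cmod y) by ring.
    apply Rmult_le_compat_l; [nra|exact Hyz]. }
  nra.
Qed.

Lemma deriv_scal {X} (i f : X -> C) (a : C) x l :
  deriv_via i f x l -> deriv_via i (fun y => a * f y)%C x (a * l)%C.
Proof. intros H. exact (deriv_comp i f (fun w => a * w)%C x l a H (cder_scal a _)). Qed.

Lemma deriv_opp {X} (i f : X -> C) x l :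
  deriv_via i f x l -> deriv_via i (fun y => - f y)%C x (- l)%C.
Proof.
  intros H. replace (- l)%C with ((-(1)) * l)%C by ring.
  apply deriv_ext with (f := fun y => ((-(1)) * f y)%C) (d := 1); [lra|intros; ring|].
  now apply deriv_scal.
Qed.

Lemma deriv_minus {X} (i f g : X -> C) x l m : deriv_via i f x l -> deriv_via i g x m ->
  deriv_via i (fun y => f y - g y)%C x (l - m)%C.
Proof. intros Hf Hg. apply deriv_plus; [exact Hf|]. now apply deriv_opp. Qed.

(** Polarisation reduces products to squares. *)
Lemma deriv_mult {X} (i f g : X -> C) x l m : deriv_via i f x l -> deriv_via i g x m ->
  deriv_via i (fun y => f y * g y)%C x (l * g x + f x * m)%C.
Proof.
  intros Hf Hg.
  assert (Hp := deriv_comp _ _ _ _ _ _ (deriv_plus _ _ _ _ _ _ Hf Hg) (cder_sqr _)).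
  assert (Hm := deriv_comp _ _ _ _ _ _ (deriv_minus _ _ _ _ _ _ Hf Hg) (cder_sqr _)).
  assert (H := deriv_scal _ _ (/ 4)%C _ _ (deriv_minus _ _ _ _ _ _ Hp Hm)).
  replace (l * g x + f x * m)%C with
   (/ 4 * (2 * (f x + g x) * (l + m) - 2 * (f x - g x) * (l - m)))%C.
  - eapply deriv_ext; [apply Rlt_0_1| |exact H]. intros y _. simpl. field.
  - field.
Qed.

Lemma deriv_inv {X} (i f : X -> C) x l : f x <> RtoC 0 -> deriv_via i f x l ->
  deriv_via i (fun y => / f y)%C x (- (l / (f x * f x)))%C.
Proof.
  intros H0 H. replace (- (l / (f x * f x)))%C with (- / (f x * f x) * l)%C by (field; auto).
  exact (deriv_comp i f (fun w => / w)%C x l _ H (cder_inv _ H0)).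
Qed.

Lemma deriv_eq {X} (i f : X -> C) x l m : deriv_via i f x l -> l = m -> deriv_via i f x m.
Proof. now intros H <-. Qed.

Lemma cder_rder (f : C -> C) (a b : C) t l : cder f (a + b * RtoC t)%C l ->
  rder (fun s => f (a + b * RtoC s))%C t (l * b)%C.
Proof.
  intros H. apply (deriv_comp RtoC (fun s => a + b * RtoC s)%C f t b l); [|exact H].
  apply (deriv_eq _ _ _ (0 + b * 1)%C); [|ring].
  apply deriv_plus; [apply deriv_const|apply deriv_scal, deriv_self].
Qed.

Lemma cont_comp {X} (i f : X -> C) (g : C -> C) x :
  cont_via i f x -> ccont g (f x) -> cont_via i (fun y => g (f y)) x.
Proof.
  intros Hf Hg eps He. destruct (Hg eps He) as [d [Hd H]].
  destruct (Hf d Hd) as [e [He' H']]. exists e. split; [exact He'|]. intros y Hy. apply H, H', Hy.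
Qed.

Lemma cont_mult {X} (i f g : X -> C) x :
  cont_via i f x -> cont_via i g x -> cont_via i (fun y => f y * g y)%C x.
Proof.
  intros Hf Hg eps He.
  assert (Af := Cmod_ge_0 (f x)). assert (Ag := Cmod_ge_0 (g x)).
  destruct (Hf (Rmin 1 (eps / (2 * (Cmod (g x) + 1))))) as [d1 [Hd1 H1]].
  { apply Rmin_pos; [lra|apply Rdiv_lt_0_compat; lra]. }
  destruct (Hg (Rmin 1 (eps / (2 * (Cmod (f x) + 1))))) as [d2 [Hd2 H2]].
  { apply Rmin_pos; [lra|apply Rdiv_lt_0_compat; lra]. }
  exists (Rmin d1 d2). split; [now apply Rmin_pos|]. intros y Hy.
  assert (A1 := Rmin_l d1 d2). assert (A2 := Rmin_r d1 d2).
  specialize (H1 y ltac:(lra)). specialize (H2 y ltac:(lra)).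
  assert (B1 := Rmin_l 1 (eps / (2 * (Cmod (g x) + 1)))).
  assert (B2 := Rmin_r 1 (eps / (2 * (Cmod (g x) + 1)))).
  assert (B3 := Rmin_l 1 (eps / (2 * (Cmod (f x) + 1)))).
  assert (B4 := Rmin_r 1 (eps / (2 * (Cmod (f x) + 1)))).
  replace (f y * g y - f x * g x)%C with ((f y - f x) * g y + f x * (g y - g x))%C by ring.
  eapply Rle_lt_trans; [apply Cmod_triangle|]. rewrite !Cmod_mult.
  assert (G : Cmod (g y) <= Cmod (g x) + 1).
  { assert (E := Cmod_triangle_inv (g y) (g x)). lra. }
  assert (C1 : Cmod (f y - f x)%C * Cmod (g y) < eps / 2).
  { apply Rle_lt_trans with (Cmod (f y - f x)%C * (Cmod (g x) + 1)).
    - apply Rmult_le_compat_l; [apply Cmod_ge_0|exact G].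
    - apply Rlt_le_trans with (eps / (2 * (Cmod (g x) + 1)) * (Cmod (g x) + 1)).
      + apply Rmult_lt_compat_r; lra.
      + right. field. lra. }
  assert (C2 : Cmod (f x) * Cmod (g y - g x)%C <= eps / 2).
  { apply Rle_trans with ((Cmod (f x) + 1) * (eps / (2 * (Cmod (f x) + 1)))).
    - apply Rmult_le_compat; try lra; apply Cmod_ge_0.
    - right. field. lra. }
  lra.
Qed.

Lemma cont_plus {X} (i f g : X -> C) x :
  cont_via i f x -> cont_via i g x -> cont_via i (fun y => f y + g y)%C x.
Proof.
  intros Hf Hg eps He.
  destruct (Hf (eps / 2) ltac:(lra)) as [d1 [Hd1 H1]].
  destruct (Hg (eps / 2) ltac:(lra)) as [d2 [Hd2 H2]].
  exists (Rmin d1 d2). split; [now apply Rmin_pos|]. intros y Hy.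
  assert (A1 := Rmin_l d1 d2). assert (A2 := Rmin_r d1 d2).
  specialize (H1 y ltac:(lra)). specialize (H2 y ltac:(lra)).
  replace (f y + g y - (f x + g x))%C with ((f y - f x) + (g y - g x))%C by ring.
  eapply Rle_lt_trans; [apply Cmod_triangle|]. lra.
Qed.

Lemma cont_const {X} (i : X -> C) c x : cont_via i (fun _ => c) x.
Proof. exact (deriv_cont _ _ _ _ (deriv_const i c x)). Qed.

Lemma cont_ext {X} (i f g : X -> C) x d : 0 < d ->
  (forall y, Cmod (i y - i x)%C < d -> f y = g y) -> cont_via i f x -> cont_via i g x.
Proof.
  intros Hd He Hf eps Heps. destruct (Hf eps Heps) as [d1 [Hd1 H1]].
  exists (Rmin d d1). split; [now apply Rmin_pos|].
  intros y Hy. rewrite <- (He y), <- (He x).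
  - apply H1. eapply Rlt_le_trans; [exact Hy|apply Rmin_r].
  - replace (i x - i x)%C with (RtoC 0) by ring. rewrite Cmod_0. exact Hd.
  - eapply Rlt_le_trans; [exact Hy|apply Rmin_l].
Qed.

Lemma cont_inv {X} (i f : X -> C) x : f x <> RtoC 0 -> cont_via i f x -> cont_via i (fun y => / f y)%C x.
Proof.
  intros H0 H. apply (cont_comp i f (fun w => / w)%C); [exact H|].
  exact (deriv_cont _ _ _ _ (cder_inv _ H0)).
Qed.

Lemma RtoC_dist (s t : R) : Cmod (RtoC s - RtoC t)%C = Rabs (s - t).
Proof. rewrite <- RtoC_minus, Cmod_R. reflexivity. Qed.

(** Continuous induction, by the supremum of the initial segments on which [P] holds. It carries the
    continuation arguments along paths and trajectories below. *)
Lemma real_induction (P : R -> Prop) a b : a <= b -> P a ->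
  (forall s, a <= s < b -> (forall t, a <= t <= s -> P t) ->
     exists d, 0 < d /\ forall t, s < t < s + d -> t <= b -> P t) ->
  (forall s, a < s <= b -> (forall t, a <= t < s -> P t) -> P s) ->
  forall s, a <= s <= b -> P s.
Proof.
  intros Hab Ha Hr Hl.
  set (E := fun s => a <= s <= b /\ forall t, a <= t <= s -> P t).
  assert (Ea : E a). { split; [lra|]. intros t Ht. now replace t with a by lra. }
  destruct (completeness E) as [m [Hub Hlub]].
  { exists b. intros s [Hs _]. lra. }
  { now exists a. }
  assert (Hm : a <= m <= b).
  { split; [now apply Hub|]. apply Hlub. intros s [Hs _]. lra. }
  assert (Hlt : forall t, a <= t < m -> P t).
  { intros t Ht. apply NNPP. intros Hn.
    assert (m <= t); [|lra]. apply Hlub. intros s [Hs H]. apply Rnot_lt_le. intros Hts.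
    apply Hn, H. lra. }
  assert (Em : E m).
  { split; [exact Hm|]. intros t Ht. destruct (Rle_lt_or_eq_dec _ _ (proj2 Ht)) as [H|H].
    - apply Hlt. lra.
    - subst t. destruct (Rle_lt_or_eq_dec _ _ (proj1 Hm)) as [H'|H'].
      + apply Hl; [lra|exact Hlt].
      + now rewrite <- H'. }
  assert (m = b).
  { apply Rle_antisym; [apply Hm|]. apply Rnot_lt_le. intros Hmb.
    destruct (Hr m) as [d [Hd H]]; [lra|apply Em|].
    assert (E (Rmin b (m + d / 2))).
    { assert (A1 := Rmin_l b (m + d / 2)). assert (A2 := Rmin_r b (m + d / 2)).
      split; [split; [apply Rmin_glb; lra|exact A1]|]. intros t Ht.
      destruct (Rle_lt_dec t m) as [H1|H1]; [apply Em; lra|apply H; lra]. }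
    apply Hub in H0. assert (m < Rmin b (m + d / 2)) by (apply Rmin_glb_lt; lra). lra. }
  subst m. intros s Hs. apply Em. exact Hs.
Qed.

Lemma locally_const_right (P : R -> Prop) a b :
  (forall t0, a <= t0 <= b -> exists d, 0 < d /\ forall s t, a <= s <= b -> a <= t <= b ->
     Rabs (s - t0) < d -> Rabs (t - t0) < d -> P s -> P t) ->
  P a -> forall s, a <= s <= b -> P s.
Proof.
  intros H Ha s Hs. apply (real_induction P a b); try lra; auto.
  - intros t Ht Hp. destruct (H t) as [d [Hd H']]; [lra|]. exists d. split; [exact Hd|].
    intros u Hu Hub. apply (H' t u); try lra.
    + rewrite Rminus_diag, Rabs_R0. exact Hd.
    + rewrite Rabs_pos_eq; lra.
    + apply Hp. lra.
  - intros t Ht Hp. destruct (H t) as [d [Hd H']]; [lra|].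
    assert (A1 := Rmax_l a (t - d / 2)). assert (A2 := Rmax_r a (t - d / 2)).
    assert (A3 : Rmax a (t - d / 2) < t) by (apply Rmax_lub_lt; lra).
    apply (H' (Rmax a (t - d / 2)) t); try lra.
    + rewrite Rabs_left; lra.
    + rewrite Rminus_diag, Rabs_R0. exact Hd.
    + apply Hp. lra.
Qed.

(** Connectedness of an interval in the form used below: near each parameter [P] passes from any
    point to any other, so it cannot change along [J]. The descending case is the ascending one for
    [P (- s)]. *)
Lemma locally_const (P : R -> Prop) (J : R -> Prop) :
  (forall t0, J t0 -> exists d, 0 < d /\ forall s t, J s -> J t ->
     Rabs (s - t0) < d -> Rabs (t - t0) < d -> P s -> P t) ->
  (forall r s t, J r -> J t -> r <= s <= t -> J s) ->
  forall u v, J u -> J v -> P u -> P v.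
Proof.
  intros H Hc u v Hu Hv HP. destruct (Rle_lt_dec u v) as [L|L].
  - apply (locally_const_right P u v); try lra; auto.
    intros t0 Ht0. destruct (H t0) as [d [Hd H']]; [apply (Hc u _ v); auto; lra|].
    exists d. split; [exact Hd|]. intros s t Hs Ht. apply H'; apply (Hc u _ v); auto; lra.
  - assert (HQ : forall s, - u <= s <= - v -> P (- s)).
    { apply (locally_const_right (fun s => P (- s)) (- u) (- v)).
      - intros t0 Ht0. destruct (H (- t0)) as [d [Hd H']]; [apply (Hc v _ u); auto; lra|].
        exists d. split; [exact Hd|]. intros s t Hs Ht A B. apply H'.
        + apply (Hc v _ u); auto; lra.
        + apply (Hc v _ u); auto; lra.
        + replace (- s - - t0) with (- (s - t0)) by ring. now rewrite Rabs_Ropp.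
        + replace (- t - - t0) with (- (t - t0)) by ring. now rewrite Rabs_Ropp.
      - now rewrite Ropp_involutive. }
    rewrite <- (Ropp_involutive v). apply HQ. lra.
Qed.

(** Bolzano-Weierstrass from compactness of a square. Without a cluster point every point has a
    radius [delta] such that all terms of index at least [1 / delta] stay [2 delta] away from it; a
    uniform lower bound [d] for these radii is refuted by a single term of index beyond [1 / d]. *)
Lemma cluster_point (z : nat -> C) (M : R) : (forall n, Cmod (z n) <= M) ->
  exists p, forall eps N, 0 < eps -> exists n, (N <= n)%nat /\ Cmod (z n - p)%C < eps.
Proof.
  intros Hz. apply NNPP. intros Hn.
  assert (H : forall x y, exists d : posreal, forall n, / d <= INR n -> 2 * d <= Cmod (z n - (x, y))%C).
  { intros x y. apply NNPP. intros H. apply Hn. exists (x, y). intros eps N He.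
    apply NNPP. intros H1. apply H.
    assert (Hp : 0 < Rmin (eps / 2) (/ (INR N + 1))).
    { apply Rmin_pos; [lra|]. apply Rinv_0_lt_compat. assert (A := pos_INR N). lra. }
    exists (mkposreal _ Hp). simpl. intros n Hn1. apply Rnot_lt_le. intros H2. apply H1.
    exists n. split.
    - apply INR_le. assert (A := pos_INR N).
      assert (B : / (/ (INR N + 1)) <= / Rmin (eps / 2) (/ (INR N + 1))).
      { apply Rinv_le_contravar; [exact Hp|apply Rmin_r]. }
      rewrite Rinv_inv in B. lra.
    - assert (B := Rmin_l (eps / 2) (/ (INR N + 1))). lra. }
  pose (delta := fun x y => proj1_sig (constructive_indefinite_description _ (H x y))).
  assert (Hdel : forall x y n, / delta x y <= INR n -> 2 * delta x y <= Cmod (z n - (x, y))%C).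
  { intros x y. unfold delta. apply proj2_sig. }
  destruct (compactness_value_2d (- M) M (- M) M delta) as [d Hd].
  destruct (INR_unbounded (/ d)) as [n Hn1].
  assert (B1 := re_le_Cmod (z n)). assert (B2 := im_le_Cmod (z n)). specialize (Hz n).
  apply (Hd (Re (z n)) (Im (z n))).
  - apply Rabs_le_between. lra.
  - apply Rabs_le_between. lra.
  - intros [u [v [_ [_ [Hu [Hv Hdd]]]]]].
    specialize (Hdel u v n).
    assert (/ delta u v <= / d) by (apply Rinv_le_contravar; [apply cond_pos|exact Hdd]).
    specialize (Hdel ltac:(lra)).
    assert (A := Cmod_le_Re_Im (z n - (u, v))%C).
    replace (Re (z n - (u, v))%C) with (Re (z n) - u) in A by (destruct (z n); reflexivity).
    replace (Im (z n - (u, v))%C) with (Im (z n) - v) in A by (destruct (z n); reflexivity).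
    lra.
Qed.

Lemma is_derive_R_eps (f : R -> R) x l :
  is_derive f x l <-> forall eps, 0 < eps -> exists d, 0 < d /\ forall y, Rabs (y - x) < d ->
    Rabs (f y - f x - l * (y - x)) <= eps * Rabs (y - x).
Proof.
  rewrite is_derive_eps. split; intros H eps He; destruct (H eps He) as [d [Hd H']]; exists d;
  (split; [exact Hd|]); intros y Hy; specialize (H' y Hy).
  - replace (f y - f x - l * (y - x)) with (f y - f x - (y - x) * l) by ring. exact H'.
  - replace (f y - f x - l * (y - x)) with (f y - f x - (y - x) * l) in H' by ring. exact H'.
Qed.

Lemma rder_Re (g : R -> C) t l : rder g t l -> is_derive (fun s => Re (g s)) t (Re l).
Proof.
  intros H. apply is_derive_R_eps. intros eps He. destruct (H eps He) as [d [Hd H']].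
  exists d. split; [exact Hd|]. intros y Hy. specialize (H' y). rewrite RtoC_dist in H'.
  specialize (H' Hy). eapply Rle_trans; [|exact H'].
  replace (Re (g y) - Re (g t) - Re l * (y - t)) with (Re (g y - g t - l * (RtoC y - RtoC t))%C).
  - apply re_le_Cmod.
  - destruct (g y), (g t), l. simpl. ring.
Qed.

Lemma rder_Im (g : R -> C) t l : rder g t l -> is_derive (fun s => Im (g s)) t (Im l).
Proof.
  intros H. apply (deriv_scal _ _ (- Ci)%C) in H. apply rder_Re in H.
  replace (Im l) with (Re (- Ci * l)%C) by (destruct l; simpl; ring).
  eapply is_derive_ext; [|exact H]. intros s. simpl. destruct (g s). simpl. ring.
Qed.

Lemma rder_of_real (g : R -> R) t l : is_derive g t l -> rder (fun s => RtoC (g s)) t (RtoC l).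
Proof.
  intros H eps He. rewrite is_derive_R_eps in H. destruct (H eps He) as [d [Hd H']].
  exists d. split; [exact Hd|]. intros y. rewrite RtoC_dist. intros Hy.
  replace (RtoC (g y) - RtoC (g t) - RtoC l * (RtoC y - RtoC t))%C with
    (RtoC (g y - g t - l * (y - t))).
  - rewrite Cmod_R. now apply H'.
  - now rewrite !RtoC_minus, RtoC_mult, RtoC_minus.
Qed.

Lemma is_derive_cont_pt (f : R -> R) x l : is_derive f x l -> continuity_pt f x.
Proof.
  intros H. apply continuity_pt_filterlim. apply (ex_derive_continuous f x). now exists l.
Qed.

Lemma MVT_real (f df : R -> R) a b : a < b ->
  (forall t, a <= t <= b -> is_derive f t (df t)) ->
  exists c, a < c < b /\ f b - f a = df c * (b - a).
Proof.
  intros Hab H.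
  destruct (MVT_cor2 f df a b Hab) as [c [E Hc]].
  - intros t Ht. apply is_derive_Reals. now apply H.
  - exists c. now split.
Qed.

(** The real mean value theorem is applied to the component of [g] in the direction of its total
    increment [e]; the increment of that component is [|e|^2]. *)
Lemma MVT_rder (g g1 : R -> C) a b K : a <= b ->
  (forall t, a <= t <= b -> rder g t (g1 t)) ->
  (forall t, a <= t <= b -> Cmod (g1 t) <= K) -> Cmod (g b - g a)%C <= K * (b - a).
Proof.
  intros Hab Hd HK. destruct (Rle_lt_or_eq_dec _ _ Hab) as [L|L].
  2:{ subst b. replace (g a - g a)%C with (RtoC 0) by ring. rewrite Cmod_0. lra. }
  set (e := (g b - g a)%C).
  destruct (MVT_real (fun t => Re (Cconj e * g t)%C) (fun t => Re (Cconj e * g1 t)%C) a b L)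
    as [c [Hc E]].
  { intros t Ht. apply rder_Re, deriv_scal, Hd, Ht. }
  assert (E2 : Re (Cconj e * g b)%C - Re (Cconj e * g a)%C = Cmod e ^ 2).
  { rewrite Cmod2_alt. unfold e. destruct (g a), (g b). simpl. ring. }
  rewrite E2 in E.
  assert (H1 : Re (Cconj e * g1 c)%C <= Cmod e * K).
  { eapply Rle_trans; [apply Rle_abs|]. eapply Rle_trans; [apply re_le_Cmod|].
    rewrite Cmod_mult, Cmod_conj. apply Rmult_le_compat_l; [apply Cmod_ge_0|]. apply HK. lra. }
  assert (He := Cmod_ge_0 e). destruct (Rle_lt_or_eq_dec _ _ He) as [L'|L'].
  - apply Rmult_le_reg_l with (Cmod e); [exact L'|]. nra.
  - rewrite <- L'. assert (0 <= K).
    { eapply Rle_trans; [apply Cmod_ge_0|]. apply (HK a). lra. }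
    nra.
Qed.

Definition seg (x y : C) (t : R) : C := (x + (y - x) * RtoC t)%C.

Lemma seg_dist x y t p r : 0 <= t <= 1 -> Cmod (x - p)%C < r -> Cmod (y - p)%C < r ->
  Cmod (seg x y t - p)%C < r.
Proof.
  intros Ht Hx Hy. unfold seg.
  replace (x + (y - x) * RtoC t - p)%C with (RtoC (1 - t) * (x - p) + RtoC t * (y - p))%C
    by (rewrite RtoC_minus; ring).
  eapply Rle_lt_trans; [apply Cmod_triangle|]. rewrite !Cmod_mult, !Cmod_R, !Rabs_pos_eq by lra.
  destruct (Req_dec t 0) as [->|]; [lra|]. nra.
Qed.

(** Subtracting the linear term [l * z] first lets one inequality give both increment bounds, with
    [l = 0], and first order remainders, with [l] a frozen derivative. *)
Lemma MVT_cder (f f1 : C -> C) x y l K :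
  (forall t, 0 <= t <= 1 -> cder f (seg x y t) (f1 (seg x y t))) ->
  (forall t, 0 <= t <= 1 -> Cmod (f1 (seg x y t) - l)%C <= K) ->
  Cmod (f y - f x - l * (y - x))%C <= K * Cmod (y - x)%C.
Proof.
  intros Hd HK.
  assert (H := MVT_rder (fun t => f (seg x y t) - l * seg x y t)%C
    (fun t => (f1 (seg x y t) - l) * (y - x))%C 0 1 (K * Cmod (y - x)%C)).
  assert (E0 : seg x y 0 = x) by (unfold seg; ring).
  assert (E1 : seg x y 1 = y) by (unfold seg; ring).
  cbv beta in H. rewrite E0, E1 in H.
  replace (f y - f x - l * (y - x))%C with (f y - l * y - (f x - l * x))%C by ring.
  replace (K * Cmod (y - x)%C) with (K * Cmod (y - x)%C * (1 - 0)) by ring.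
  apply H; [lra| |].
  - intros t Ht.
    apply (cder_rder (fun z => f z - l * z)%C x (y - x)%C t (f1 (seg x y t) - l)%C).
    apply deriv_minus; [now apply Hd|apply cder_scal].
  - intros t Ht. rewrite Cmod_mult. apply Rmult_le_compat_r; [apply Cmod_ge_0|]. now apply HK.
Qed.

(** * Polynomials and local inverses *)

Lemma csum_shift (f : nat -> C) n : csum f (S n) = (f O + csum (fun k => f (S k)) n)%C.
Proof.
  induction n as [|n IH]; [simpl; ring|].
  change (csum f (S (S n))) with (csum f (S n) + f (S n))%C. rewrite IH. simpl. ring.
Qed.

Lemma csum_ext (f g : nat -> C) n : (forall k, (k < n)%nat -> f k = g k) -> csum f n = csum g n.
Proof. induction n as [|n IH]; intros H; simpl; [easy|]. rewrite IH, H; auto. Qed.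

Lemma csum_scal (a : C) f n : csum (fun k => a * f k)%C n = (a * csum f n)%C.
Proof. induction n as [|n IH]; simpl; [ring|]. rewrite IH. ring. Qed.

Lemma peval_S c m x : peval c (S m) x = (c O + x * peval (fun k => c (S k)) m x)%C.
Proof.
  unfold peval. rewrite csum_shift, <- csum_scal. simpl cpow. f_equal; [ring|].
  apply csum_ext. intros k _. simpl. ring.
Qed.

Lemma cder_cpow n x : cder (fun z => cpow z (S n)) x (RtoC (INR (S n)) * cpow x n)%C.
Proof.
  induction n as [|n IH].
  - apply (deriv_eq _ _ _ 1%C); [|simpl; ring].
    eapply deriv_ext; [apply Rlt_0_1| |apply deriv_self]. intros y _. simpl. ring.
  - apply (deriv_eq _ _ _ (1 * cpow x (S n) + x * (RtoC (INR (S n)) * cpow x n))%C).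
    + apply (deriv_mult (fun z : C => z) (fun z => z) (fun z => cpow z (S n))); [apply deriv_self|exact IH].
    + rewrite (S_INR (S n)), RtoC_plus. simpl cpow. ring.
Qed.

Lemma deriv_csum {X} (i : X -> C) (f : nat -> X -> C) (l : nat -> C) x n :
  (forall k, (k < n)%nat -> deriv_via i (f k) x (l k)) ->
  deriv_via i (fun y => csum (fun k => f k y) n) x (csum l n).
Proof.
  induction n as [|n IH]; intros H; simpl; [apply deriv_const|].
  apply deriv_plus; [apply IH; auto|apply H; lia].
Qed.

Lemma cder_peval c m x : c (S m) = RtoC 0 -> cder (peval c m) x (peval (pderiv c) m x).
Proof.
  intros Hc.
  apply (deriv_eq _ _ _ (csum (fun k => match k with O => RtoC 0 | S j => pderiv c j * cpow x j end) (S m))%C).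
  - apply (deriv_csum (fun z : C => z) (fun k y => c k * cpow y k)%C). intros k _. destruct k as [|j].
    + apply (deriv_eq _ _ _ (c O * 0)%C); [|ring]. apply deriv_scal. exact (deriv_const _ (RtoC 1) x).
    + apply (deriv_eq _ _ _ (c (S j) * (RtoC (INR (S j)) * cpow x j))%C).
      * apply deriv_scal, cder_cpow.
      * unfold pderiv. ring.
  - unfold peval. rewrite csum_shift. simpl.
    replace (pderiv c m) with (RtoC 0) by (unfold pderiv; rewrite Hc; ring). ring.
Qed.

(** The hypothesis says that the degree is at most [m - j]. Keeping [(1 + |y|)^j] on the left
    records the decay gained by differentiating [j] times, or by cancelling leading terms, relative
    to degree [m]. *)
Lemma peval_bound c m j : (forall k, (m < k + j)%nat -> c k = RtoC 0) ->
  exists K, 0 <= K /\ forall y, Cmod (peval c m y) * (1 + Cmod y) ^ j <= K * (1 + Cmod y) ^ m.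
Proof.
  intros Hc. unfold peval.
  assert (Hmon : forall k y, Cmod (c k * cpow y k)%C * (1 + Cmod y) ^ j <= Cmod (c k) * (1 + Cmod y) ^ m).
  { intros k y. rewrite Cmod_mult. assert (Hy := Cmod_ge_0 y).
    destruct (le_lt_dec (k + j) m) as [L|L].
    2:{ rewrite Hc by lia. rewrite Cmod_0. lra. }
    assert (Hk : Cmod (cpow y k) <= (1 + Cmod y) ^ k).
    { clear L. induction k as [|k IH]; simpl.
      - rewrite Cmod_1. lra.
      - rewrite Cmod_mult. apply Rmult_le_compat; try apply Cmod_ge_0; auto. lra. }
    rewrite Rmult_assoc. apply Rmult_le_compat_l; [apply Cmod_ge_0|].
    apply Rle_trans with ((1 + Cmod y) ^ k * (1 + Cmod y) ^ j).
    - apply Rmult_le_compat_r; [apply pow_le; lra|exact Hk].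
    - rewrite <- pow_add. apply Rle_pow; [lra|exact L]. }
  generalize (S m). intros n. induction n as [|n [K [HK IH]]].
  - exists 0. split; [lra|]. intros y. simpl. rewrite Cmod_0. lra.
  - exists (K + Cmod (c n)). assert (H0 := Cmod_ge_0 (c n)). split; [lra|]. intros y. simpl.
    specialize (IH y). specialize (Hmon n y).
    assert (Ht := Cmod_triangle (csum (fun k => c k * cpow y k)%C n) (c n * cpow y n)%C).
    assert (Hp : 0 <= (1 + Cmod y) ^ j) by (apply pow_le; assert (A := Cmod_ge_0 y); lra).
    apply (Rmult_le_compat_r _ _ _ Hp) in Ht. lra.
Qed.

Lemma Cmod_cpow y k : Cmod (cpow y k) = Cmod y ^ k.
Proof. induction k as [|k IH]; simpl; [apply Cmod_1|]. now rewrite Cmod_mult, IH. Qed.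

Lemma poly_growth c m : is_poly_deg c m ->
  exists c1 R0, 0 < c1 /\ 0 < R0 /\ forall y, R0 <= Cmod y -> c1 * (1 + Cmod y) ^ m <= Cmod (peval c m y).
Proof.
  intros [Hm [Hcm Hc]].
  set (c' := fun k => if Nat.eqb k m then RtoC 0 else c k).
  destruct (peval_bound c' m 1) as [K [HK Hb]].
  { intros k Hk. unfold c'. destruct (Nat.eqb_spec k m); [easy|]. apply Hc. lia. }
  assert (Hsplit : forall y, peval c m y = (peval c' m y + c m * cpow y m)%C).
  { intros y. unfold peval. simpl. unfold c' at 2. rewrite Nat.eqb_refl.
    rewrite (csum_ext (fun k => c k * cpow y k)%C (fun k => c' k * cpow y k)%C m); [ring|].
    intros k Hk. unfold c'. destruct (Nat.eqb_spec k m); [lia|easy]. }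
  set (A := Cmod (c m)). assert (HA : 0 < A) by (apply Cmod_gt_0; exact Hcm).
  assert (H2 : 0 < 2 ^ m) by (apply pow_lt; lra).
  (* For [|y| >= 1] the leading term is at least [A ((1 + |y|) / 2)^m]; beyond the radius given here
     the lower terms cost at most half of that. *)
  exists (A / (2 * 2 ^ m)), (1 + K * (2 * 2 ^ m) / A).
  assert (HKA : 0 <= K * (2 * 2 ^ m) / A).
  { apply Rmult_le_pos; [nra|]. apply Rlt_le, Rinv_0_lt_compat, HA. }
  split; [apply Rdiv_lt_0_compat; lra|]. split; [lra|].
  intros y Hy. specialize (Hb y). rewrite pow_1 in Hb.
  set (Y := 1 + Cmod y) in *. assert (HY : 2 <= Y) by (unfold Y; lra).
  assert (HYm : 0 < Y ^ m) by (apply pow_lt; lra).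
  rewrite Hsplit.
  assert (T := Cmod_triangle_inv (c m * cpow y m)%C (- peval c' m y)%C).
  rewrite Cmod_opp in T.
  replace (c m * cpow y m - - peval c' m y)%C with (peval c' m y + c m * cpow y m)%C in T by ring.
  rewrite Cmod_mult, Cmod_cpow in T. fold A in T.
  assert (H3 : Y ^ m / 2 ^ m <= Cmod y ^ m).
  { unfold Rdiv. rewrite <- pow_inv, <- Rpow_mult_distr. apply pow_incr. unfold Y in *. lra. }
  assert (H4 : Cmod (peval c' m y) <= A / (2 * 2 ^ m) * Y ^ m).
  { apply Rmult_le_reg_r with Y; [lra|]. eapply Rle_trans; [exact Hb|].
    replace (A / (2 * 2 ^ m) * Y ^ m * Y) with (A / (2 * 2 ^ m) * Y * Y ^ m) by ring.
    apply Rmult_le_compat_r; [lra|].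
    apply Rmult_le_reg_l with (2 * 2 ^ m / A); [apply Rdiv_lt_0_compat; lra|].
    replace (2 * 2 ^ m / A * (A / (2 * 2 ^ m) * Y)) with Y by (field; lra).
    replace (2 * 2 ^ m / A * K) with (K * (2 * 2 ^ m) / A) by (field; lra). unfold Y. lra. }
  assert (H5 : A * (Y ^ m / 2 ^ m) <= A * Cmod y ^ m) by (apply Rmult_le_compat_l; lra).
  replace (A * (Y ^ m / 2 ^ m)) with (2 * (A / (2 * 2 ^ m) * Y ^ m)) in H5 by (field; lra). lra.
Qed.

Lemma peval_shift c m b : exists c', forall v, peval c m (b + v)%C = peval c' m v.
Proof.
  revert c. induction m as [|m IH]; intros c.
  - exists c. intros v. unfold peval. simpl. ring.
  - destruct (IH (fun k => c (S k))) as [d Hd].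
    assert (H : exists e, forall v, peval e (S m) v = ((b + v) * peval d m v)%C).
    { exists (fun k => ((if Nat.leb k m then b * d k else 0) + match k with O => 0 | S j => d j end)%C).
      intros v. unfold peval. rewrite Cmult_plus_distr_r.
      transitivity (csum (fun k => (if Nat.leb k m then b * d k else 0) * cpow v k)%C (S (S m)) +
        csum (fun k => match k with O => 0 | S j => d j end * cpow v k)%C (S (S m)))%C.
      { generalize (S (S m)). intros n. induction n as [|n IHn]; simpl; [ring|]. rewrite IHn. ring. }
      f_equal.
      - change (csum (fun k => (if Nat.leb k m then b * d k else 0) * cpow v k)%C (S (S m))) with
          (csum (fun k => (if Nat.leb k m then b * d k else 0) * cpow v k)%C (S m) +
            (if Nat.leb (S m) m then b * d (S m) else 0) * cpow v (S m))%C.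
        destruct (Nat.leb_spec (S m) m); [lia|]. rewrite <- csum_scal.
        rewrite (csum_ext _ (fun k => b * (d k * cpow v k))%C); [ring|].
        intros k Hk. destruct (Nat.leb_spec k m); [ring|lia].
      - rewrite csum_shift, <- csum_scal.
        rewrite (csum_ext _ (fun k => v * (d k * cpow v k))%C); [ring|]. intros k _. simpl. ring. }
    destruct H as [e He].
    exists (fun k => match k with O => (c O + e O)%C | S j => e (S j) end). intros v.
    rewrite peval_S, Hd, <- He, !peval_S. ring.
Qed.

(** Splits off the order of vanishing at 0, so that zeros of every multiplicity can be treated
    together: the cofactor has a local square root. *)
Lemma peval_factor c m : (exists x, peval c m x <> RtoC 0) ->
  exists k n c', c' O <> RtoC 0 /\ forall v, peval c m v = (cpow v k * peval c' n v)%C.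
Proof.
  revert c. induction m as [|m IH]; intros c [x Hx].
  - exists O, O, c. split.
    + intros E. apply Hx. unfold peval. simpl. rewrite E. ring.
    + intros v. simpl. ring.
  - destruct (classic (c O = RtoC 0)) as [E|E].
    + destruct (IH (fun k => c (S k))) as [k [n [c' [H0 H]]]].
      { exists x. intros E2. apply Hx. rewrite peval_S, E, E2. ring. }
      exists (S k), n, c'. split; [exact H0|]. intros v. rewrite peval_S, E, H. simpl. ring.
    + exists O, (S m), c. split; [exact E|]. intros v. simpl. ring.
Qed.

Lemma peval_0 c m : peval c m (RtoC 0) = c O.
Proof. destruct m; [unfold peval; simpl; ring|]. rewrite peval_S. ring. Qed.

Lemma poly_nonzero c m : is_poly_deg c m -> exists x, peval c m x <> RtoC 0.
Proof.
  intros H. destruct (poly_growth c m H) as [c1 [R0 [Hc1 [HR H']]]].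
  exists (RtoC R0). apply Cmod_gt_0. specialize (H' (RtoC R0)).
  rewrite Cmod_R, Rabs_pos_eq in H' by lra.
  assert (0 < (1 + R0) ^ m) by (apply pow_lt; lra). specialize (H' (Rle_refl _)). nra.
Qed.

(** Continuity of [psi] puts [psi y] where the remainder of [S] is small, which gives
    [|s| |psi y - psi zeta| <= 2 |y - zeta|]; the remainder of [S] divided by [s] is then the
    remainder of [psi]. *)
Lemma deriv_inverse (S psi : C -> C) zeta s d : s <> RtoC 0 -> 0 < d ->
  cder S (psi zeta) s -> ccont psi zeta ->
  (forall z, Cmod (z - zeta)%C < d -> S (psi z) = z) -> cder psi zeta (/ s)%C.
Proof.
  intros Hs Hd HS Hc Hinv eps He.
  assert (Hs' : 0 < Cmod s) by (apply Cmod_gt_0; exact Hs).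
  set (e := Rmin (Cmod s / 2) (eps * (Cmod s * Cmod s) / 2)).
  assert (He' : 0 < e).
  { apply Rmin_pos; [lra|]. apply Rdiv_lt_0_compat; [|lra]. repeat apply Rmult_lt_0_compat; lra. }
  destruct (HS e He') as [d1 [Hd1 H1]].
  destruct (Hc d1 Hd1) as [d2 [Hd2 H2]].
  exists (Rmin d d2). split; [now apply Rmin_pos|]. intros y Hy.
  assert (A1 := Rmin_l d d2). assert (A2 := Rmin_r d d2).
  specialize (H2 y ltac:(lra)). specialize (H1 (psi y) H2).
  rewrite (Hinv y) in H1 by lra. rewrite (Hinv zeta) in H1.
  2:{ replace (zeta - zeta)%C with (RtoC 0) by ring. rewrite Cmod_0. exact Hd. }
  set (D := (psi y - psi zeta)%C) in *. set (k := (y - zeta)%C) in *.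
  assert (E1 : e <= Cmod s / 2) by apply Rmin_l.
  assert (E2 : e <= eps * (Cmod s * Cmod s) / 2) by apply Rmin_r.
  assert (HD0 := Cmod_ge_0 D). assert (Hk0 := Cmod_ge_0 k).
  assert (HD : Cmod s * Cmod D <= 2 * Cmod k).
  { assert (T := Cmod_triangle_inv (s * D) k). rewrite Cmod_mult in T.
    rewrite (Cmod_sub_sym (s * D) k) in T. nra. }
  replace (D - / s * k)%C with (- ((k - s * D) / s))%C by (field; exact Hs).
  rewrite Cmod_opp, Cmod_div by exact Hs.
  apply Rmult_le_reg_r with (Cmod s * Cmod s); [nra|].
  replace (Cmod (k - s * D)%C / Cmod s * (Cmod s * Cmod s)) with (Cmod s * Cmod (k - s * D)%C) by (field; lra).
  apply Rle_trans with (Cmod s * (e * Cmod D)); [apply Rmult_le_compat_l; lra|].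
  apply Rle_trans with (e * (2 * Cmod k)); [nra|].
  apply Rle_trans with (eps * (Cmod s * Cmod s) / 2 * (2 * Cmod k)); [|right; field].
  apply Rmult_le_compat_r; lra.
Qed.

(** Newton's iteration with frozen slope [l]. *)
Lemma inverse_function (f f1 : C -> C) x0 r l : 0 < r -> l <> RtoC 0 ->
  (forall x, Cmod (x - x0)%C < r -> cder f x (f1 x)) ->
  (forall x, Cmod (x - x0)%C < r -> Cmod (f1 x - l)%C <= Cmod l / 2) ->
  exists rho g, 0 < rho /\ g (f x0) = x0 /\
    (forall z, Cmod (z - f x0)%C < rho ->
       Cmod (g z - x0)%C < r /\ f (g z) = z /\ cder g z (/ f1 (g z))%C) /\
    (forall x, Cmod (x - x0)%C < r -> Cmod (f x - f x0)%C < rho -> g (f x) = x).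
Proof.
  intros Hr Hl Hd H1.
  assert (Hl' : 0 < Cmod l) by (apply Cmod_gt_0; exact Hl).
  assert (Hx0 : Cmod (x0 - x0)%C < r).
  { replace (x0 - x0)%C with (RtoC 0) by ring. rewrite Cmod_0. exact Hr. }
  assert (Hlin : forall x y, Cmod (x - x0)%C < r -> Cmod (y - x0)%C < r ->
     Cmod (f y - f x - l * (y - x))%C <= Cmod l / 2 * Cmod (y - x)%C).
  { intros x y Hx Hy. apply MVT_cder with f1; intros t Ht; [apply Hd|apply H1]; apply seg_dist; auto. }
  assert (Hlow : forall x y, Cmod (x - x0)%C < r -> Cmod (y - x0)%C < r ->
     Cmod l / 2 * Cmod (y - x)%C <= Cmod (f y - f x)%C).
  { intros x y Hx Hy. assert (T := Cmod_triangle_inv (l * (y - x)) (l * (y - x) - (f y - f x))).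
    rewrite (Cmod_sub_sym (l * (y - x)) (f y - f x)), Cmod_mult in T.
    replace (l * (y - x) - (l * (y - x) - (f y - f x)))%C with (f y - f x)%C in T by ring.
    specialize (Hlin x y Hx Hy). lra. }
  assert (Hup : forall x y, Cmod (x - x0)%C < r -> Cmod (y - x0)%C < r ->
     Cmod (f y - f x)%C <= 2 * Cmod l * Cmod (y - x)%C).
  { intros x y Hx Hy. assert (T := Cmod_triangle (f y - f x - l * (y - x)) (l * (y - x))).
    replace (f y - f x - l * (y - x) + l * (y - x))%C with (f y - f x)%C in T by ring.
    rewrite Cmod_mult in T. specialize (Hlin x y Hx Hy). assert (A := Cmod_ge_0 (y - x)%C). nra. }
  set (rho := Cmod l * r / 4).
  assert (Hrho : 0 < rho) by (apply Rdiv_lt_0_compat; nra).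
  assert (Hsur : forall z, Cmod (z - f x0)%C < rho -> exists x, Cmod (x - x0)%C < r /\ f x = z).
  { intros z Hz. set (de := Cmod (z - f x0)%C / Cmod l).
    assert (Hde : 0 <= de) by (apply Rmult_le_pos; [apply Cmod_ge_0|apply Rlt_le, Rinv_0_lt_compat, Hl']).
    assert (Hder : de < r / 4).
    { unfold de. apply Rmult_lt_reg_r with (Cmod l); [exact Hl'|].
      replace (Cmod (z - f x0)%C / Cmod l * Cmod l) with (Cmod (z - f x0)%C) by (field; lra).
      unfold rho in Hz. lra. }
    set (step := fun x => (x - (f x - z) / l)%C).
    set (u := fun n => Nat.iter n step x0).
    (* The slope condition halves each correction, so the iterates stay within [2 de < r / 2] of
       [x0], inside the disc where the condition holds. *)
    assert (Hu : forall n, Cmod (u n - x0)%C <= 2 * de * (1 - (/ 2) ^ n) /\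
                 Cmod (u (S n) - u n)%C <= de * (/ 2) ^ n).
    { induction n as [|n [I1 I2]].
      - split; simpl.
        + replace (x0 - x0)%C with (RtoC 0) by ring. rewrite Cmod_0. lra.
        + unfold step. replace (x0 - (f x0 - z) / l - x0)%C with ((z - f x0) / l)%C by (field; exact Hl).
          rewrite Cmod_div by exact Hl. unfold de. lra.
      - assert (P : 0 < (/ 2) ^ n) by (apply pow_lt; lra).
        assert (J : Cmod (u (S n) - x0)%C <= 2 * de * (1 - (/ 2) ^ (S n))).
        { replace (u (S n) - x0)%C with ((u (S n) - u n) + (u n - x0))%C by ring.
          eapply Rle_trans; [apply Cmod_triangle|]. simpl pow. lra. }
        split; [exact J|].
        assert (P1 : 0 < (/ 2) ^ (S n)) by (apply pow_lt; lra).
        assert (B1 : Cmod (u n - x0)%C < r) by nra.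
        assert (B2 : Cmod (u (S n) - x0)%C < r) by nra.
        assert (E : (u (S (S n)) - u (S n) = - ((f (u (S n)) - f (u n) - l * (u (S n) - u n)) / l))%C).
        { change (u (S (S n))) with (step (u (S n))). unfold step at 1.
          assert (E2 : (f (u n) - z = - (l * (u (S n) - u n)))%C).
          { change (u (S n)) with (step (u n)). unfold step. field. exact Hl. }
          replace (f (u n)) with (f (u n) - z + z)%C by ring. rewrite E2. field. exact Hl. }
        rewrite E, Cmod_opp, Cmod_div by exact Hl.
        assert (L := Hlin _ _ B1 B2).
        apply Rle_trans with (Cmod l / 2 * Cmod (u (S n) - u n)%C / Cmod l).
        + apply Rmult_le_compat_r; [apply Rlt_le, Rinv_0_lt_compat, Hl'|exact L].
        + replace (Cmod l / 2 * Cmod (u (S n) - u n)%C / Cmod l) with (Cmod (u (S n) - u n)%C / 2) by (field; lra).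
          simpl pow in *. lra. }
    assert (Hub : forall n, Cmod (u n - x0)%C <= r / 2).
    { intros n. destruct (Hu n) as [I _]. assert (P : 0 < (/ 2) ^ n) by (apply pow_lt; lra). nra. }
    destruct (cluster_point u (Cmod x0 + r / 2)) as [p Hp].
    { intros n. replace (u n) with ((u n - x0) + x0)%C by ring.
      eapply Rle_trans; [apply Cmod_triangle|]. specialize (Hub n). lra. }
    assert (Hpr : Cmod (p - x0)%C < r).
    { destruct (Hp (r / 4) O ltac:(lra)) as [n [_ Hn]].
      assert (T := Cmod_sub_triangle p (u n) x0). rewrite (Cmod_sub_sym p (u n)) in T. specialize (Hub n). lra. }
    (* A cluster point of the iterates suffices: the residual [f (u n) - z] is [- l] times the next
       correction and tends to 0. *)
    exists p. split; [exact Hpr|]. apply Cmod_small_eq. intros e He.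
    destruct (pow_lt_1_zero (/ 2)) with (y := e / (2 * (Cmod l * (de + 1)))) as [N HN].
    { rewrite Rabs_pos_eq; lra. }
    { apply Rdiv_lt_0_compat; [lra|]. nra. }
    destruct (Hp (e / (4 * Cmod l)) N) as [n [Hn1 Hn2]]; [apply Rdiv_lt_0_compat; lra|].
    assert (Hun : Cmod (u n - x0)%C < r) by (specialize (Hub n); lra).
    assert (T := Cmod_sub_triangle (f p) (f (u n)) z).
    assert (A := Hup (u n) p Hun Hpr). rewrite (Cmod_sub_sym p) in A.
    assert (B : Cmod (f (u n) - z)%C <= e / 2).
    { assert (E2 : (f (u n) - z = - (l * (u (S n) - u n)))%C).
      { change (u (S n)) with (step (u n)). unfold step. field. exact Hl. }
      rewrite E2, Cmod_opp, Cmod_mult. destruct (Hu n) as [_ I].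
      specialize (HN n ltac:(lia)). rewrite Rabs_pos_eq in HN by (apply pow_le; lra).
      apply Rle_trans with (Cmod l * ((de + 1) * (e / (2 * (Cmod l * (de + 1)))))).
      - apply Rmult_le_compat_l; [lra|]. eapply Rle_trans; [exact I|].
        apply Rmult_le_compat; try lra. apply pow_le; lra.
      - right. field. lra. }
    assert (D : 2 * Cmod l * Cmod (u n - p)%C <= e / 2).
    { apply Rle_trans with (2 * Cmod l * (e / (4 * Cmod l))).
      - apply Rmult_le_compat_l; lra.
      - right. field. lra. }
    lra. }
  assert (Hinj : forall x y, Cmod (x - x0)%C < r -> Cmod (y - x0)%C < r -> f x = f y -> x = y).
  { intros x y Hx Hy E. specialize (Hlow y x Hy Hx). rewrite E in Hlow.
    replace (f y - f y)%C with (RtoC 0) in Hlow by ring. rewrite Cmod_0 in Hlow.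
    apply Cmod_small_eq. intros e He. assert (A := Cmod_ge_0 (x - y)%C). nra. }
  set (g := fun z => epsilon (inhabits (RtoC 0)) (fun x => Cmod (x - x0)%C < r /\ f x = z)).
  assert (Hg : forall z, Cmod (z - f x0)%C < rho -> Cmod (g z - x0)%C < r /\ f (g z) = z).
  { intros z Hz. apply (epsilon_spec (inhabits (RtoC 0)) (fun x => Cmod (x - x0)%C < r /\ f x = z)).
    now apply Hsur. }
  exists rho, g. split; [exact Hrho|]. split; [|split].
  - destruct (Hg (f x0)) as [G1 G2].
    { replace (f x0 - f x0)%C with (RtoC 0) by ring. rewrite Cmod_0. exact Hrho. }
    now apply Hinj.
  - intros z Hz. destruct (Hg z Hz) as [G1 G2]. split; [exact G1|]. split; [exact G2|].
    apply deriv_inverse with f (rho - Cmod (z - f x0)%C).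
    + intros E. specialize (H1 (g z) G1). rewrite E in H1.
      replace (0 - l)%C with (- l)%C in H1 by ring. rewrite Cmod_opp in H1. lra.
    + lra.
    + now apply Hd.
    + intros e He. exists (Rmin (rho - Cmod (z - f x0)%C) (Cmod l / 2 * e)). split.
      { apply Rmin_pos; nra. }
      intros y Hy. assert (A1 := Rmin_l (rho - Cmod (z - f x0)%C) (Cmod l / 2 * e)).
      assert (A2 := Rmin_r (rho - Cmod (z - f x0)%C) (Cmod l / 2 * e)).
      assert (Hy' : Cmod (y - f x0)%C < rho).
      { assert (T := Cmod_sub_triangle y z (f x0)). lra. }
      destruct (Hg y Hy') as [Y1 Y2]. specialize (Hlow (g z) (g y) G1 Y1). rewrite G2, Y2 in Hlow.
      apply Rmult_lt_reg_l with (Cmod l / 2); lra.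
    + intros y Hy. apply Hg. assert (T := Cmod_sub_triangle y z (f x0)). lra.
  - intros x Hx Hfx. destruct (Hg (f x) Hfx) as [G1 G2]. now apply Hinj.
Qed.

Lemma inverse_function_cont (f f1 : C -> C) x0 r : 0 < r ->
  (forall x, Cmod (x - x0)%C < r -> cder f x (f1 x)) -> ccont f1 x0 -> f1 x0 <> RtoC 0 ->
  exists r' rho g, 0 < r' <= r /\ 0 < rho /\ g (f x0) = x0 /\
    (forall x, Cmod (x - x0)%C < r' -> f1 x <> RtoC 0) /\
    (forall z, Cmod (z - f x0)%C < rho ->
       Cmod (g z - x0)%C < r' /\ f (g z) = z /\ cder g z (/ f1 (g z))%C) /\
    (forall x, Cmod (x - x0)%C < r' -> Cmod (f x - f x0)%C < rho -> g (f x) = x).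
Proof.
  intros Hr Hd Hc H0. assert (H0' : 0 < Cmod (f1 x0)) by (apply Cmod_gt_0; exact H0).
  destruct (Hc (Cmod (f1 x0) / 2)) as [d [Hdp H]]; [lra|].
  assert (Hm := Rmin_l r d). assert (Hm' := Rmin_r r d).
  assert (Hmp : 0 < Rmin r d) by now apply Rmin_pos.
  destruct (inverse_function f f1 x0 (Rmin r d) (f1 x0)) as [rho [g [G1 [G2 [G3 G4]]]]]; auto.
  - intros x Hx. apply Hd. lra.
  - intros x Hx. apply Rlt_le, H. lra.
  - exists (Rmin r d), rho, g. repeat split; try lra; try assumption; try apply G3; auto.
    intros x Hx E. specialize (H x ltac:(lra)). rewrite E in H.
    replace (0 - f1 x0)%C with (- f1 x0)%C in H by ring. rewrite Cmod_opp in H. lra.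
Qed.

(** * Complex exponential and roots *)

Lemma cexp_add z w : cexp (z + w)%C = (cexp z * cexp w)%C.
Proof.
  unfold cexp. destruct z as [a b], w as [u v]. simpl.
  rewrite exp_plus, cos_plus, sin_plus. apply C_ext; simpl; ring.
Qed.

Lemma cpow_cexp z n : cpow (cexp z) n = cexp (RtoC (INR n) * z)%C.
Proof.
  induction n as [|n IH].
  - simpl. unfold cexp. destruct z. simpl. rewrite !Rmult_0_l, Rminus_0_r, Rplus_0_r, exp_0, cos_0, sin_0.
    apply C_ext; simpl; ring.
  - simpl cpow. rewrite IH, <- cexp_add. f_equal. rewrite S_INR, RtoC_plus. ring.
Qed.

Lemma clog_exists z : z <> RtoC 0 -> exists l, cexp l = z.
Proof.
  intros Hz. assert (H : 0 < Cmod z) by (apply Cmod_gt_0; exact Hz).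
  set (rho := Cmod z) in *. set (x := Re z / rho).
  assert (Hx : -1 <= x <= 1).
  { apply Rabs_le_between. unfold x, Rdiv. rewrite Rabs_mult, (Rabs_pos_eq (/ rho)).
    - apply Rmult_le_reg_r with rho; [exact H|]. rewrite Rmult_assoc, Rinv_l, Rmult_1_r, Rmult_1_l by lra.
      apply re_le_Cmod.
    - apply Rlt_le, Rinv_0_lt_compat, H. }
  assert (E : 1 - x * x = (Im z / rho) * (Im z / rho)).
  { assert (S := Cmod2_alt z). fold rho in S. unfold x.
    replace (1 - Re z / rho * (Re z / rho)) with ((rho ^ 2 - Re z ^ 2) / (rho * rho)) by (field; lra).
    rewrite S. field. lra. }
  assert (E2 : sqrt (1 - x²) = Rabs (Im z / rho)).
  { unfold Rsqr. rewrite E. apply sqrt_Rsqr_abs. }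
  assert (Hex : exists th, cos th = x /\ sin th = Im z / rho).
  { destruct (Rle_lt_dec 0 (Im z / rho)) as [L|L].
    - exists (acos x). rewrite cos_acos, sin_acos, E2 by lra. split; [easy|]. now apply Rabs_pos_eq.
    - exists (- acos x). rewrite cos_neg, sin_neg, cos_acos, sin_acos, E2 by lra. split; [easy|].
      rewrite Rabs_left by lra. ring. }
  destruct Hex as [th [H1 H2]]. exists (ln rho, th). unfold cexp. simpl.
  rewrite exp_ln, H1, H2 by exact H. unfold x. apply C_ext; simpl; field; lra.
Qed.

Lemma nth_root z n : (1 <= n)%nat -> exists d, cpow d n = z.
Proof.
  intros Hn. destruct (classic (z = RtoC 0)) as [->|Hz].
  - exists 0. destruct n; [lia|]. simpl. ring.
  - destruct (clog_exists z Hz) as [l Hl]. exists (cexp (l / RtoC (INR n)))%C.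
    rewrite cpow_cexp, <- Hl. f_equal. field. intros E. injection E. apply not_0_INR. lia.
Qed.

(** * Integrals of complex functions of a real variable, and primitives *)

Notation CInt := (@is_RInt C_R_NormedModule).

Lemma rcont_continuous (f : R -> C) t : rcont f t <-> @continuous R_UniformSpace C_R_NormedModule f t.
Proof.
  unfold continuous. rewrite filterlim_locally. split.
  - intros H eps. destruct (H eps (cond_pos eps)) as [d [Hd H']]. exists (mkposreal d Hd).
    intros y Hy. specialize (H' y). rewrite RtoC_dist in H'. specialize (H' Hy).
    assert (A := re_le_Cmod (f y - f t)%C). assert (B := im_le_Cmod (f y - f t)%C).
    split.
    + change (Rabs (Re (f y) - Re (f t)) < eps).
      replace (Re (f y) - Re (f t)) with (Re (f y - f t)%C) by (destruct (f y), (f t); reflexivity). lra.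
    + change (Rabs (Im (f y) - Im (f t)) < eps).
      replace (Im (f y) - Im (f t)) with (Im (f y - f t)%C) by (destruct (f y), (f t); reflexivity). lra.
  - intros H eps He. assert (He2 : 0 < eps / 2) by lra.
    destruct (H (mkposreal _ He2)) as [d H']. exists d. split; [apply cond_pos|]. intros y.
    rewrite RtoC_dist. intros Hy. destruct (H' y Hy) as [H1 H2].
    change (Rabs (Re (f y) - Re (f t)) < eps / 2) in H1.
    change (Rabs (Im (f y) - Im (f t)) < eps / 2) in H2.
    eapply Rle_lt_trans; [apply Cmod_le_Re_Im|].
    replace (Re (f y - f t)%C) with (Re (f y) - Re (f t)) by (destruct (f y), (f t); reflexivity).
    replace (Im (f y - f t)%C) with (Im (f y) - Im (f t)) by (destruct (f y), (f t); reflexivity). lra.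
Qed.

Lemma CInt_plus f g a b l m : CInt f a b l -> CInt g a b m -> CInt (fun t => f t + g t)%C a b (l + m)%C.
Proof. intros Hf Hg. exact (is_RInt_plus f g a b l m Hf Hg). Qed.

Lemma CInt_minus f g a b l m : CInt f a b l -> CInt g a b m -> CInt (fun t => f t - g t)%C a b (l - m)%C.
Proof. intros Hf Hg. exact (is_RInt_minus f g a b l m Hf Hg). Qed.

(** [C_R_NormedModule] is a space over the reals, so a complex factor is distributed over the real
    and imaginary components. *)
Lemma CInt_scal f a b (k l : C) : CInt f a b l -> CInt (fun t => k * f t)%C a b (k * l)%C.
Proof.
  intros H. assert (H1 := is_RInt_fct_extend_fst _ _ _ _ H). assert (H2 := is_RInt_fct_extend_snd _ _ _ _ H).
  destruct k as [u v]. destruct l as [x y].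
  apply (is_RInt_fct_extend_pair (U := R_NormedModule) (V := R_NormedModule)).
  - exact (is_RInt_minus _ _ _ _ _ _ (is_RInt_scal _ _ _ u _ H1) (is_RInt_scal _ _ _ v _ H2)).
  - exact (is_RInt_plus _ _ _ _ _ _ (is_RInt_scal _ _ _ u _ H2) (is_RInt_scal _ _ _ v _ H1)).
Qed.

Lemma CInt_unique f a b l m : CInt f a b l -> CInt f a b m -> l = m.
Proof.
  intros H1 H2. apply (is_RInt_unique (V := C_R_CompleteNormedModule)) in H1.
  apply (is_RInt_unique (V := C_R_CompleteNormedModule)) in H2. now rewrite <- H1, <- H2.
Qed.

Lemma CInt_exists f a b : a <= b -> (forall t, a <= t <= b -> rcont f t) -> exists l, CInt f a b l.
Proof.
  intros Hab H. destruct (ex_RInt_continuous (V := C_R_CompleteNormedModule) f a b) as [l Hl].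
  - intros t Ht. rewrite Rmin_left, Rmax_right in Ht by exact Hab. now apply rcont_continuous, H.
  - now exists l.
Qed.

Lemma CInt_norm f g a b l I : a <= b -> (forall t, a <= t <= b -> Cmod (f t) <= g t) ->
  CInt f a b l -> is_RInt g a b I -> Cmod l <= I.
Proof.
  intros Hab H Hf Hg. rewrite <- C_R_norm_Cmod. apply (norm_RInt_le f g a b l I Hab); auto.
  intros t Ht. rewrite C_R_norm_Cmod. now apply H.
Qed.

Lemma CInt_norm_01 f l K : (forall t, 0 <= t <= 1 -> Cmod (f t) <= K) -> CInt f 0 1 l -> Cmod l <= K.
Proof.
  intros H Hf. replace K with (scal (1 - 0) K) by (unfold scal; simpl; unfold mult; simpl; ring).
  apply (CInt_norm f (fun _ => K) 0 1); auto; [lra|]. apply (is_RInt_const (V := R_NormedModule)).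
Qed.

Lemma CInt_derive (F f : R -> C) a b : a <= b -> (forall t, a <= t <= b -> rder F t (f t)) ->
  (forall t, a <= t <= b -> rcont f t) -> CInt f a b (F b - F a)%C.
Proof.
  intros Hab Hd Hc. apply (is_RInt_derive (V := C_R_CompleteNormedModule)); intros t Ht;
  rewrite Rmin_left, Rmax_right in Ht by exact Hab.
  - apply (rderiv_is_rder F t (f t)). now apply Hd.
  - now apply rcont_continuous, Hc.
Qed.

Lemma CInt_ext f g a b l : a <= b -> (forall t, a < t < b -> f t = g t) -> CInt f a b l -> CInt g a b l.
Proof.
  intros Hab H. apply is_RInt_ext. intros t Ht. rewrite Rmin_left, Rmax_right in Ht by exact Hab. now apply H.
Qed.

(** Two mean value inequalities, the first on every initial piece of the segment. They yield the
    constant [K] in place of Taylor's [K / 2], and no integral. The same shape of bound defines the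
    norm [nrm] later. *)
Lemma quadratic_remainder (f f1 f2 : C -> C) v w K :
  (forall t, 0 <= t <= 1 -> cder f (seg v w t) (f1 (seg v w t))) ->
  (forall t, 0 <= t <= 1 -> cder f1 (seg v w t) (f2 (seg v w t))) ->
  (forall t, 0 <= t <= 1 -> Cmod (f2 (seg v w t)) <= K) ->
  Cmod (f1 w - f1 v)%C <= K * Cmod (w - v)%C /\
  Cmod (f w - f v - f1 v * (w - v))%C <= K * (Cmod (w - v)%C * Cmod (w - v)%C).
Proof.
  intros H1 H2 HK.
  assert (Hseg : forall s, 0 <= s <= 1 -> Cmod (f1 (seg v w s) - f1 v)%C <= K * Cmod (w - v)%C).
  { intros s Hs.
    assert (E : forall t, seg v (seg v w s) t = seg v w (s * t)).
    { intros t. unfold seg. rewrite RtoC_mult. ring. }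
    assert (M := MVT_cder f1 f2 v (seg v w s) 0 K).
    replace (f1 (seg v w s) - f1 v)%C with (f1 (seg v w s) - f1 v - 0 * (seg v w s - v))%C by ring.
    eapply Rle_trans; [apply M|].
    - intros t Ht. rewrite E. apply H2. nra.
    - intros t Ht. rewrite E. replace (f2 (seg v w (s * t)) - 0)%C with (f2 (seg v w (s * t))) by ring.
      apply HK. nra.
    - assert (0 <= K) by (eapply Rle_trans; [apply Cmod_ge_0|apply (HK 0); lra]).
      apply Rmult_le_compat_l; [assumption|]. unfold seg.
      replace (v + (w - v) * RtoC s - v)%C with ((w - v) * RtoC s)%C by ring.
      rewrite Cmod_mult, Cmod_R, Rabs_pos_eq by lra. assert (A := Cmod_ge_0 (w - v)%C). nra. }
  split.
  - specialize (Hseg 1 ltac:(lra)). replace (seg v w 1) with w in Hseg by (unfold seg; ring). exact Hseg.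
  - rewrite <- Rmult_assoc. apply (MVT_cder f f1); [exact H1|]. exact Hseg.
Qed.

(** With [E v] the integral of [t^(k+1) f (t^2 v)] over [0, 1], the derivative of
    [t^(k+2) f (t^2 v)] integrates to the Euler identity below; the substitution [t^2]
    keeps the exponents integral when [k] is odd. *)
Lemma euler_primitive (f f1 f2 : C -> C) r K k :
  (forall v, Cmod v < r -> cder f v (f1 v)) -> (forall v, Cmod v < r -> cder f1 v (f2 v)) ->
  (forall v, Cmod v < r -> Cmod (f2 v) <= K) ->
  exists E E1 : C -> C, forall v, Cmod v < r ->
    cder E v (E1 v) /\ ccont E1 v /\ (RtoC (INR (S (S k))) * E v + 2 * v * E1 v = f v)%C.
Proof.
  intros H1 H2 HK.
  set (q := fun (v : C) (t : R) => (RtoC t * RtoC t * v)%C).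
  assert (Hq : forall v t, 0 <= t <= 1 -> Cmod (q v t) <= Cmod v).
  { intros v t Ht. unfold q. rewrite !Cmod_mult, Cmod_R, Rabs_pos_eq by lra.
    assert (A := Cmod_ge_0 v). assert (t * t <= 1) by nra. nra. }
  assert (Hqd : forall v t, rder (q v) t (2 * RtoC t * v)%C).
  { intros v t. apply (deriv_eq _ _ _ ((1 * RtoC t + RtoC t * 1) * v + RtoC t * RtoC t * 0)%C).
    - apply (deriv_mult RtoC (fun t => RtoC t * RtoC t)%C (fun _ => v)); [|apply deriv_const].
      apply deriv_mult; apply deriv_self.
    - ring. }
  assert (Hpd : forall n t, rder (fun t => cpow (RtoC t) (S n)) t (RtoC (INR (S n)) * cpow (RtoC t) n)%C).
  { intros n t. apply (deriv_eq _ _ _ ((RtoC (INR (S n)) * cpow (RtoC t) n) * 1)%C); [|ring].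
    apply (deriv_comp RtoC RtoC (fun z => cpow z (S n))); [apply deriv_self|apply cder_cpow]. }
  assert (Hpc : forall n t, rcont (fun t => cpow (RtoC t) n) t).
  { intros [|n] t; [exact (cont_const RtoC (RtoC 1) t)|]. eapply deriv_cont, Hpd. }
  set (p := fun (n : nat) (t : R) => cpow (RtoC t) n) in *.
  assert (Hp1 : forall n t, 0 <= t <= 1 -> 0 <= Cmod (p n t) <= 1).
  { intros n t Ht. split; [apply Cmod_ge_0|]. unfold p. rewrite Cmod_cpow, Cmod_R, Rabs_pos_eq by lra.
    rewrite <- (pow1 n). apply pow_incr. lra. }
  assert (Hfc : forall v t, Cmod v < r -> 0 <= t <= 1 -> rcont (fun t => f (q v t)) t /\ rcont (fun t => f1 (q v t)) t).
  { intros v t Hv Ht. specialize (Hq v t Ht). split.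
    - apply (cont_comp RtoC (q v) f); [eapply deriv_cont, Hqd|]. eapply deriv_cont, H1. lra.
    - apply (cont_comp RtoC (q v) f1); [eapply deriv_cont, Hqd|]. eapply deriv_cont, H2. lra. }
  (* Differentiating [f (t^2 v)] in [v] brings out [t^2], whence the weight [t^(k+3)] in [J1]. The
     differentiation under the integral is justified by [Hquad], a second order remainder bound
     uniform in [t]. *)
  set (J := fun v => epsilon (inhabits (RtoC 0)) (fun l => CInt (fun t => p (S k) t * f (q v t))%C 0 1 l)).
  set (J1 := fun v => epsilon (inhabits (RtoC 0)) (fun l => CInt (fun t => p (S (S (S k))) t * f1 (q v t))%C 0 1 l)).
  assert (HJ : forall v, Cmod v < r -> CInt (fun t => p (S k) t * f (q v t))%C 0 1 (J v)).
  { intros v Hv. apply epsilon_spec. apply CInt_exists; [lra|]. intros t Ht.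
    apply cont_mult; [apply Hpc|]. now apply Hfc. }
  assert (HJ1 : forall v, Cmod v < r -> CInt (fun t => p (S (S (S k))) t * f1 (q v t))%C 0 1 (J1 v)).
  { intros v Hv. apply epsilon_spec. apply CInt_exists; [lra|]. intros t Ht.
    apply cont_mult; [apply Hpc|]. now apply Hfc. }
  assert (Hquad : forall v w t, 0 <= t <= 1 -> Cmod v < r -> Cmod w < r ->
    Cmod (f1 (q w t) - f1 (q v t))%C <= K * Cmod (w - v)%C /\
    Cmod (f (q w t) - f (q v t) - f1 (q v t) * (q w t - q v t))%C <= K * (Cmod (w - v)%C * Cmod (w - v)%C)).
  { intros v w t Ht Hv Hw.
    assert (HK0 : 0 <= K) by (eapply Rle_trans; [apply Cmod_ge_0|apply (HK v Hv)]).
    assert (Hs : forall s, 0 <= s <= 1 -> Cmod (seg (q v t) (q w t) s) < r).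
    { intros s Hs. replace (seg (q v t) (q w t) s) with (seg (q v t) (q w t) s - 0)%C by ring.
      assert (A := Hq v t Ht). assert (B := Hq w t Ht).
      apply seg_dist; [exact Hs| |]; unfold Cminus; rewrite Copp_0, Cplus_0_r; lra. }
    destruct (quadratic_remainder f f1 f2 (q v t) (q w t) K) as [A B].
    - intros s Hs'. apply H1, Hs, Hs'.
    - intros s Hs'. apply H2, Hs, Hs'.
    - intros s Hs'. apply HK, Hs, Hs'.
    - assert (D : Cmod (q w t - q v t)%C <= Cmod (w - v)%C).
      { replace (q w t - q v t)%C with (q (w - v)%C t) by (unfold q; ring). now apply Hq. }
      assert (D0 := Cmod_ge_0 (q w t - q v t)%C).
      split; [eapply Rle_trans; [exact A|]|eapply Rle_trans; [exact B|]].
      + apply Rmult_le_compat_l; assumption.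
      + apply Rmult_le_compat_l; [assumption|]. apply Rmult_le_compat; assumption. }
  exists J, J1. intros v Hv.
  assert (HK0 : 0 <= K) by (eapply Rle_trans; [apply Cmod_ge_0|apply (HK v Hv)]).
  assert (Hball : forall w, Cmod (w - v)%C < r - Cmod v -> Cmod w < r).
  { intros w Hw. replace w with ((w - v) + v)%C by ring. eapply Rle_lt_trans; [apply Cmod_triangle|]. lra. }
  split; [|split].
  - assert (Hrem : forall w, Cmod (w - v)%C < r - Cmod v ->
      Cmod (J w - J v - J1 v * (w - v))%C <= K * (Cmod (w - v)%C * Cmod (w - v)%C)).
    { intros w Hw. assert (Hw' := Hball w Hw).
      apply CInt_norm_01 with (fun t => p (S k) t * f (q w t) - p (S k) t * f (q v t) -
         (w - v) * (p (S (S (S k))) t * f1 (q v t)))%C.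
      - intros t Ht. destruct (Hquad v w t Ht Hv Hw') as [_ A].
        replace (p (S k) t * f (q w t) - p (S k) t * f (q v t) -
         (w - v) * (p (S (S (S k))) t * f1 (q v t)))%C with
         (p (S k) t * (f (q w t) - f (q v t) - f1 (q v t) * (q w t - q v t)))%C
         by (unfold p, q; simpl; ring).
        rewrite Cmod_mult. destruct (Hp1 (S k) t Ht) as [P0 P1].
        rewrite <- (Rmult_1_l (K * _)). apply Rmult_le_compat; try assumption. apply Cmod_ge_0.
      - replace (J1 v * (w - v))%C with ((w - v) * J1 v)%C by ring.
        apply CInt_minus; [apply CInt_minus; now apply HJ|apply CInt_scal; now apply HJ1]. }
    intros eps He. exists (Rmin (r - Cmod v) (eps / (K + 1))).
    split; [apply Rmin_pos; [lra|apply Rdiv_lt_0_compat; lra]|]. intros w Hw.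
    assert (A1 := Rmin_l (r - Cmod v) (eps / (K + 1))). assert (A2 := Rmin_r (r - Cmod v) (eps / (K + 1))).
    eapply Rle_trans; [apply Hrem; lra|]. rewrite <- Rmult_assoc.
    apply Rmult_le_compat_r; [apply Cmod_ge_0|].
    apply Rle_trans with ((K + 1) * (eps / (K + 1))); [|right; field; lra].
    apply Rmult_le_compat; try lra. apply Cmod_ge_0.
  - intros eps He. exists (Rmin (r - Cmod v) (eps / (K + 1))).
    split; [apply Rmin_pos; [lra|apply Rdiv_lt_0_compat; lra]|]. intros w Hw.
    assert (A1 := Rmin_l (r - Cmod v) (eps / (K + 1))). assert (A2 := Rmin_r (r - Cmod v) (eps / (K + 1))).
    assert (Hw' : Cmod w < r) by (apply Hball; lra).
    apply Rle_lt_trans with (K * Cmod (w - v)%C).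
    + apply CInt_norm_01 with (fun t => p (S (S (S k))) t * f1 (q w t) - p (S (S (S k))) t * f1 (q v t))%C.
      * intros t Ht. destruct (Hquad v w t Ht Hv Hw') as [A _].
        replace (p (S (S (S k))) t * f1 (q w t) - p (S (S (S k))) t * f1 (q v t))%C with
          (p (S (S (S k))) t * (f1 (q w t) - f1 (q v t)))%C by ring.
        rewrite Cmod_mult. destruct (Hp1 (S (S (S k))) t Ht) as [P0 P1].
        rewrite <- (Rmult_1_l (K * _)). apply Rmult_le_compat; try assumption. apply Cmod_ge_0.
      * apply CInt_minus; now apply HJ1.
    + apply Rle_lt_trans with (K * (eps / (K + 1))); [apply Rmult_le_compat_l; lra|].
      apply Rmult_lt_reg_r with (K + 1); [lra|].
      replace (K * (eps / (K + 1)) * (K + 1)) with (K * eps) by (field; lra). nra.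
  - apply CInt_unique with (fun t => RtoC (INR (S (S k))) * (p (S k) t * f (q v t)) +
      2 * v * (p (S (S (S k))) t * f1 (q v t)))%C 0 1.
    + apply CInt_plus; apply CInt_scal; [now apply HJ|now apply HJ1].
    + replace (f v) with (p (S (S k)) 1 * f (q v 1) - p (S (S k)) 0 * f (q v 0))%C.
      2:{ replace (q v 1) with v by (unfold q; ring). unfold p. simpl.
          assert (E1 : cpow (RtoC 1) k = 1).
          { clear. induction k as [|k IH]; simpl; [easy|]. rewrite IH. ring. }
          rewrite E1. ring. }
      apply (CInt_derive (fun t => p (S (S k)) t * f (q v t))%C); [lra| |].
      * intros t Ht. apply (deriv_eq _ _ _ ((RtoC (INR (S (S k))) * cpow (RtoC t) (S k)) * f (q v t) +
          p (S (S k)) t * (f1 (q v t) * (2 * RtoC t * v)))%C).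
        -- apply (deriv_mult RtoC (p (S (S k))) (fun t => f (q v t))); [apply Hpd|]. apply (deriv_comp RtoC (q v) f); [apply Hqd|].
           apply H1. specialize (Hq v t Ht). lra.
        -- unfold p. simpl cpow. ring.
      * intros t Ht. destruct (Hfc v t Hv Ht) as [F1 F2].
        apply cont_plus; apply cont_mult; try apply cont_const; apply cont_mult; try apply Hpc; assumption.
Qed.

(** [peval] reads the coefficients up to [m] only, so they may be cut off beyond [m]; then the
    coefficient of index [m + 1], which [cder_peval] wants to vanish, does. *)
Lemma peval_smooth c m : exists f1 f2, forall x,
  cder (peval c m) x (f1 x) /\ cder f1 x (f2 x) /\ ccont f2 x.
Proof.
  set (d := fun k => if Nat.leb k m then c k else RtoC 0).
  assert (Hd : forall k, (m < k)%nat -> d k = RtoC 0).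
  { intros k Hk. unfold d. destruct (Nat.leb_spec k m); [lia|easy]. }
  assert (E : forall x, peval d m x = peval c m x).
  { intros x. unfold peval. apply csum_ext. intros k Hk. unfold d. destruct (Nat.leb_spec k m); [easy|lia]. }
  assert (Hp : forall e k, e k = RtoC 0 -> e (S k) = RtoC 0 -> pderiv e k = RtoC 0).
  { intros e k _ He. unfold pderiv. rewrite He. ring. }
  exists (peval (pderiv d) m), (peval (pderiv (pderiv d)) m). intros x. split; [|split].
  - eapply deriv_ext; [apply Rlt_0_1| |apply cder_peval]; [intros y _; apply E|apply Hd; lia].
  - apply cder_peval. unfold pderiv. rewrite Hd by lia. ring.
  - eapply deriv_cont. apply cder_peval. unfold pderiv. rewrite Hd by lia. ring.
Qed.

(** The branch is the local inverse of the squaring map at [s0], composed with [Q]. The bound on the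
    second derivative is what [euler_primitive] asks for. *)
Lemma local_sqrt (Q Q1 Q2 : C -> C) (s0 : C) : (forall x, cder Q x (Q1 x)) -> (forall x, cder Q1 x (Q2 x)) ->
  (forall x, ccont Q2 x) -> (s0 * s0)%C = Q (RtoC 0) -> s0 <> RtoC 0 ->
  exists r f f1 f2 K, 0 < r /\ f (RtoC 0) = s0 /\ forall v, Cmod v < r ->
    (f v * f v)%C = Q v /\ f v <> RtoC 0 /\ cder f v (f1 v) /\ cder f1 v (f2 v) /\ Cmod (f2 v) <= K.
Proof.
  intros HQ HQ1 HQ2 Hs Hs0.
  destruct (inverse_function_cont (fun z => z * z)%C (fun z => 2 * z)%C s0 1)
    as [r' [rho [g [Hr' [Hrho [Hg0 [Hn [Hg _]]]]]]]].
  - lra.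
  - intros x _. apply cder_sqr.
  - eapply deriv_cont, cder_scal.
  - apply Cmult_neq_0; [|exact Hs0]. intros E. injection E. lra.
  - rewrite Hs in *.
    destruct (deriv_cont _ _ _ _ (HQ (RtoC 0)) rho Hrho) as [r1 [Hr1 Hball]].
    set (f := fun v => g (Q v)).
    set (f1 := fun v => (Q1 v * / (2 * f v))%C).
    set (f2 := fun v => (Q2 v * / (2 * f v) + Q1 v * - (2 * f1 v / (2 * f v * (2 * f v))))%C).
    assert (H : forall v, Cmod v < r1 -> (f v * f v)%C = Q v /\ f v <> RtoC 0 /\ cder f v (f1 v) /\ cder f1 v (f2 v)).
    { intros v Hv. assert (Hv0 : Cmod (v - 0)%C < r1) by (replace (v - 0)%C with v by ring; exact Hv).
      destruct (Hg (Q v) (Hball v Hv0)) as [G1 [G2 G3]].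
      assert (F0 : (2 * f v)%C <> RtoC 0) by (apply Hn; exact G1).
      assert (F1 : cder f v (f1 v)).
      { apply (deriv_eq _ _ _ (/ (2 * g (Q v)) * Q1 v)%C); [|unfold f1, f; ring].
        apply (deriv_comp _ Q g); [apply HQ|exact G3]. }
      split; [exact G2|]. split; [|split; [exact F1|]].
      - intros E. apply F0. rewrite E. ring.
      - apply (deriv_mult _ Q1 (fun v => / (2 * f v))%C); [apply HQ1|].
        apply (deriv_inv _ (fun v => 2 * f v)%C); [exact F0|]. now apply deriv_scal. }
    assert (Hc : ccont f2 0).
    { destruct (H (RtoC 0)) as [_ [F0 [F1 F2]]]; [rewrite Cmod_0; exact Hr1|].
      assert (N : (2 * f 0)%C <> RtoC 0).
      { apply Cmult_neq_0; [|exact F0]. intros E. injection E. lra. }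
      assert (Cf := deriv_cont _ _ _ _ F1). assert (Cf1 := deriv_cont _ _ _ _ F2).
      assert (C2f : ccont (fun v => 2 * f v)%C 0) by (apply cont_mult; [apply cont_const|exact Cf]).
      apply cont_plus.
      - apply cont_mult; [apply HQ2|]. now apply cont_inv.
      - apply cont_mult; [exact (deriv_cont _ _ _ _ (HQ1 0))|].
        apply (cont_ext _ (fun v => (- (1)) * (2 * f1 v * / (2 * f v * (2 * f v))))%C _ _ 1); [lra| |].
        { intros y _. unfold Cdiv. ring. }
        apply cont_mult; [apply cont_const|]. apply cont_mult.
        + apply cont_mult; [apply cont_const|exact Cf1].
        + apply (cont_inv _ (fun v => 2 * f v * (2 * f v))%C); [now apply Cmult_neq_0|]. now apply cont_mult. }
    destruct (Hc 1 Rlt_0_1) as [r2 [Hr2 Hb]].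
    exists (Rmin r1 r2), f, f1, f2, (Cmod (f2 0) + 1). split; [now apply Rmin_pos|]. split.
    + unfold f. rewrite <- Hg0. reflexivity.
    + intros v Hv. assert (A1 := Rmin_l r1 r2). assert (A2 := Rmin_r r1 r2).
      destruct (H v ltac:(lra)) as [B1 [B2 [B3 B4]]]. repeat (split; [assumption|]).
      specialize (Hb v). replace (v - 0)%C with v in Hb by ring. specialize (Hb ltac:(lra)).
      assert (T := Cmod_triangle_inv (f2 v) (f2 0)). lra.
Qed.

(** The natural parameter of the quadratic differential [Q dy^2] at a regular point [w]: [f] is the
    branch of [sqrt Q] with value [s0], [T] its primitive vanishing at [w], and [psi] the inverse of
    [T] on a disc of radius [rho]. In the coordinate [T] trajectories are horizontal segments. *)
Record chart (Q : C -> C) (w s0 : C) (f T psi : C -> C) (r rho : R) : Prop := {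
  chart_r : 0 < r;
  chart_rho : 0 < rho;
  chart_f0 : f w = s0;
  chart_T0 : T w = RtoC 0;
  chart_psi0 : psi (RtoC 0) = w;
  chart_f : forall y, Cmod (y - w)%C < r ->
    (f y * f y)%C = Q y /\ f y <> RtoC 0 /\ ccont f y /\ cder T y (f y);
  chart_psi : forall z, Cmod z < rho ->
    Cmod (psi z - w)%C < r /\ T (psi z) = z /\ cder psi z (/ f (psi z))%C;
  chart_inv : forall y, Cmod (y - w)%C < r -> Cmod (T y) < rho -> psi (T y) = y }.

Lemma chart_exists c m w s0 e : (s0 * s0)%C = peval c m w -> s0 <> RtoC 0 -> 0 < e ->
  exists f T psi r rho, chart (peval c m) w s0 f T psi r rho /\ r <= e.
Proof.
  intros Hs Hs0 He. destruct (peval_shift c m w) as [c' Hc'].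
  destruct (peval_smooth c' m) as [Q1 [Q2 HQ]].
  destruct (local_sqrt (peval c' m) Q1 Q2 s0) as [r [f [f1 [f2 [K [Hr [Hf0 Hf]]]]]]];
    try (intros x; apply HQ); auto.
  { rewrite <- Hc', Cplus_0_r. exact Hs. }
  destruct (euler_primitive f f1 f2 r K 0) as [E [E1 HE]]; try (intros v Hv; apply Hf, Hv).
  (* With [k = 0] the Euler identity reads [2 E + 2 v E' = f], that is, [2 v E] is a primitive of
     [f]. *)
  set (T := fun v => (2 * v * E v)%C).
  assert (HT : forall v, Cmod v < r -> cder T v (f v)).
  { intros v Hv. destruct (HE v Hv) as [A [_ B]].
    apply (deriv_eq _ _ _ (2 * E v + 2 * v * E1 v)%C); [|rewrite <- B; replace (INR 2) with 2 by (simpl; ring); ring].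
    apply (deriv_mult _ (fun v => 2 * v)%C); [apply cder_scal|exact A]. }
  assert (Hm1 := Rmin_l r e). assert (Hm2 := Rmin_r r e). assert (Hmp : 0 < Rmin r e) by now apply Rmin_pos.
  destruct (inverse_function_cont T f 0 (Rmin r e)) as [r' [rho [g [Hr' [Hrho [Hg0 [Hn [Hg Hgi]]]]]]]]; auto.
  - intros x Hx. apply HT. replace (x - 0)%C with x in Hx by ring. lra.
  - eapply deriv_cont. apply Hf. rewrite Cmod_0. exact Hr.
  - rewrite Hf0. exact Hs0.
  - assert (T0 : T 0 = RtoC 0) by (unfold T; ring). rewrite T0 in *.
    exists (fun y => f (y - w)%C), (fun y => T (y - w)%C), (fun z => w + g z)%C, r', rho. split; [|lra].
    assert (Hcut : forall y, (y - 0)%C = y) by (intros; ring).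
    split; try lra.
    + replace (w - w)%C with (RtoC 0) by ring. exact Hf0.
    + replace (w - w)%C with (RtoC 0) by ring. exact T0.
    + rewrite Hg0. ring.
    + intros y Hy. assert (Hy' : Cmod (y - w)%C < r) by lra.
      destruct (Hf _ Hy') as [F1 [F2 [F3 _]]]. split; [|split; [exact F2|]].
      * rewrite F1, <- Hc'. f_equal. ring.
      * assert (Hsub : cder (fun y => y - w)%C y 1).
        { apply (deriv_eq _ _ _ (1 - 0)%C); [|ring]. apply deriv_minus; [apply deriv_self|apply deriv_const]. }
        split.
        -- apply (cont_comp _ (fun y => y - w)%C f); [eapply deriv_cont, Hsub|eapply deriv_cont, F3].
        -- apply (deriv_eq _ _ _ (f (y - w)%C * 1)%C); [|ring].
           apply (deriv_comp _ (fun y => y - w)%C T); [exact Hsub|]. now apply HT.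
    + intros z Hz. rewrite <- (Hcut z) in Hz. destruct (Hg z Hz) as [G1 [G2 G3]]. rewrite Hcut in G1.
      replace (w + g z - w)%C with (g z) by ring. split; [exact G1|]. split; [exact G2|].
      apply (deriv_eq _ _ _ (0 + / f (g z))%C); [|ring]. apply deriv_plus; [apply deriv_const|exact G3].
    + intros y Hy HTy. rewrite Hgi; [ring| |]; rewrite Hcut; assumption.
Qed.

(** * Stokes arcs at the zeros of the polynomial *)

Lemma deriv_unique {X} (i f : X -> C) x l m :
  (forall d, 0 < d -> exists y, 0 < Cmod (i y - i x)%C < d) ->
  deriv_via i f x l -> deriv_via i f x m -> l = m.
Proof.
  intros Hacc Hl Hm. apply Cmod_small_eq. intros e He.
  destruct (Hl (e / 2) ltac:(lra)) as [d1 [Hd1 H1]]. destruct (Hm (e / 2) ltac:(lra)) as [d2 [Hd2 H2]].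
  destruct (Hacc (Rmin d1 d2)) as [y [Hy Hy']]; [now apply Rmin_pos|].
  assert (A1 := Rmin_l d1 d2). assert (A2 := Rmin_r d1 d2).
  specialize (H1 y ltac:(lra)). specialize (H2 y ltac:(lra)).
  apply Rmult_le_reg_r with (Cmod (i y - i x)%C); [exact Hy|]. rewrite <- Cmod_mult.
  replace ((l - m) * (i y - i x))%C with
    ((f y - f x - m * (i y - i x)) - (f y - f x - l * (i y - i x)))%C by ring.
  eapply Rle_trans; [apply Cmod_sub_le|]. lra.
Qed.

Lemma rder_unique g t l m : rder g t l -> rder g t m -> l = m.
Proof.
  apply deriv_unique. intros d Hd. exists (t + d / 2). rewrite RtoC_dist, Rabs_pos_eq; lra.
Qed.

Lemma filterlim_at_right_eps (g : R -> C) (b : C) : filterlim g (at_right 0) (locally b) <->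
  forall e, 0 < e -> exists d, 0 < d /\ forall t, 0 < t < d -> Cmod (g t - b)%C < e.
Proof.
  rewrite filterlim_locally. split.
  - intros H e He. assert (He2 : 0 < e / 2) by lra. destruct (H (mkposreal _ He2)) as [d Hd].
    exists d. split; [apply cond_pos|]. intros t Ht.
    assert (Hb : ball 0 d t) by (change (Rabs (t - 0) < d); rewrite Rabs_pos_eq; lra).
    destruct (Hd t Hb (proj1 Ht)) as [H1 H2].
    change (Rabs (Re (g t) - Re b) < e / 2) in H1. change (Rabs (Im (g t) - Im b) < e / 2) in H2.
    eapply Rle_lt_trans; [apply Cmod_le_Re_Im|].
    replace (Re (g t - b)%C) with (Re (g t) - Re b) by (destruct (g t), b; reflexivity).
    replace (Im (g t - b)%C) with (Im (g t) - Im b) by (destruct (g t), b; reflexivity). lra.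
  - intros H eps. destruct (H eps (cond_pos eps)) as [d [Hd H']]. exists (mkposreal d Hd).
    intros t Hb Ht. change (Rabs (t - 0) < d) in Hb. rewrite Rabs_pos_eq in Hb by lra.
    specialize (H' t ltac:(lra)).
    assert (A := re_le_Cmod (g t - b)%C). assert (B := im_le_Cmod (g t - b)%C). split.
    + change (Rabs (Re (g t) - Re b) < eps).
      replace (Re (g t) - Re b) with (Re (g t - b)%C) by (destruct (g t), b; reflexivity). lra.
    + change (Rabs (Im (g t) - Im b) < eps).
      replace (Im (g t) - Im b) with (Im (g t - b)%C) by (destruct (g t), b; reflexivity). lra.
Qed.

Lemma cpow_mult x y n : cpow (x * y)%C n = (cpow x n * cpow y n)%C.
Proof. induction n as [|n IH]; simpl; [ring|]. rewrite IH. ring. Qed.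


Lemma cpow_neq_0 x n : x <> RtoC 0 -> cpow x n <> RtoC 0.
Proof.
  intros H. induction n as [|n IH]; simpl; [intros E; injection E; lra|]. now apply Cmult_neq_0.
Qed.

Lemma cpow_RtoC s n : cpow (RtoC s) n = RtoC (s ^ n).
Proof. induction n as [|n IH]; simpl; [easy|]. now rewrite IH, RtoC_mult. Qed.

Lemma Cmod_cut (x : C) : Cmod (x - 0)%C = Cmod x.
Proof. f_equal. ring. Qed.

Lemma RtoC_neq_0 r : r <> 0 -> RtoC r <> RtoC 0.
Proof. intros H E. injection E. exact H. Qed.

(** In the coordinate [u = v (E/E(0))^(2/(k+2))] one has [S_b^2 = E(0)^2 u^(k+2)], so a suitable ray
    in the [u]-plane is a Stokes arc. *)
Lemma stokes_arc_exists c m b : is_poly_deg c m -> peval c m b = RtoC 0 ->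
  exists gam T, stokes_arc c m b gam T.
Proof.
  intros Hp Hb. destruct (peval_shift c m b) as [c' Hc'].
  destruct (peval_factor c' m) as [k [n [c2 [Hc2 Hfac]]]].
  { destruct (poly_nonzero c m Hp) as [x Hx]. exists (x - b)%C. rewrite <- Hc'.
    replace (b + (x - b))%C with x by ring. exact Hx. }
  destruct (peval_smooth c2 n) as [R1 [R2 HR]].
  destruct (nth_root (c2 O) 2) as [s0 Hs0]; [lia|].
  assert (Hs : (s0 * s0)%C = c2 O) by (rewrite <- Hs0; simpl; ring).
  assert (Hs0' : s0 <> RtoC 0) by (intros E; apply Hc2; rewrite <- Hs, E; ring).
  destruct (local_sqrt (peval c2 n) R1 R2 s0) as [r [f [f1 [f2 [K [Hr [Hf0 Hf]]]]]]];
    try (intros x; apply HR); auto.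
  { rewrite peval_0. exact Hs. }
  destruct (euler_primitive f f1 f2 r K k) as [E [E1 HE]]; try (intros v Hv; apply Hf, Hv).
  assert (H0r : Cmod 0 < r) by (rewrite Cmod_0; exact Hr).
  set (N := S (S k)).
  assert (HN : RtoC (INR N) <> RtoC 0) by (apply RtoC_neq_0, not_0_INR; unfold N; lia).
  assert (HE0 : E 0 <> RtoC 0).
  { intros Z. destruct (HE 0 H0r) as [_ [_ EQ]]. rewrite Z, Hf0 in EQ. apply Hs0'. rewrite <- EQ. ring. }
  set (P := fun v => (E v * E v * / (E 0 * E 0))%C).
  set (P1 := fun v => (2 * E v * E1 v * / (E 0 * E 0))%C).
  assert (HEE : (E 0 * E 0)%C <> RtoC 0) by now apply Cmult_neq_0.
  assert (HP : forall v, Cmod v < r -> cder P v (P1 v)).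
  { intros v Hv. destruct (HE v Hv) as [A _].
    apply (deriv_eq _ _ _ ((E1 v * E v + E v * E1 v) * / (E 0 * E 0) + E v * E v * 0)%C); [|unfold P1; ring].
    apply (deriv_mult _ (fun v => E v * E v)%C (fun _ => / (E 0 * E 0))%C); [now apply deriv_mult|apply deriv_const]. }
  assert (HP0 : P 0 = RtoC 1) by (unfold P; field; exact HE0).
  (* [g] is the branch of the [N]-th root near 1. With it [T v = v * g (P v)] is the new coordinate,
     and [T^N = v^N E^2 / E(0)^2] holds without fractional powers. *)
  destruct (inverse_function_cont (fun z => cpow z N) (fun z => RtoC (INR N) * cpow z (S k))%C 1 1)
    as [r1 [rho1 [g [Hr1 [Hrho1 [Hg1 [Hgn [Hg _]]]]]]]].
  { lra. }
  { intros x _. apply cder_cpow. }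
  { apply cont_mult; [apply cont_const|]. eapply deriv_cont, cder_cpow. }
  { apply Cmult_neq_0; [exact HN|]. apply cpow_neq_0, RtoC_neq_0. lra. }
  assert (H11 : forall j, cpow 1 j = RtoC 1) by (intros j; rewrite cpow_RtoC, pow1; easy).
  rewrite H11 in *.
  assert (HPc : ccont P 0) by (eapply deriv_cont, HP, H0r).
  destruct (HPc rho1 Hrho1) as [r2 [Hr2 HPb]]. rewrite HP0 in HPb.
  set (rr := Rmin r r2). assert (Hrr : 0 < rr) by now apply Rmin_pos.
  assert (Hrr1 : rr <= r) by apply Rmin_l. assert (Hrr2 : rr <= r2) by apply Rmin_r.
  set (T1 := fun v => (g (P v) + v * (/ (RtoC (INR N) * cpow (g (P v)) (S k)) * P1 v))%C).
  set (T := fun v => (v * g (P v))%C).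
  assert (Hgd : forall v, Cmod v < rr -> cder (fun v => g (P v)) v (/ (RtoC (INR N) * cpow (g (P v)) (S k)) * P1 v)%C).
  { intros v Hv. apply (deriv_comp _ P g); [apply HP; lra|]. apply Hg, HPb. rewrite Cmod_cut. lra. }
  assert (HT : forall v, Cmod v < rr -> cder T v (T1 v)).
  { intros v Hv. apply (deriv_eq _ _ _ (1 * g (P v) + v * (/ (RtoC (INR N) * cpow (g (P v)) (S k)) * P1 v))%C);
      [|unfold T1; ring].
    apply (deriv_mult _ (fun v => v) (fun v => g (P v))); [apply deriv_self|now apply Hgd]. }
  assert (HgP0 : g (P 0) = RtoC 1) by (rewrite HP0; exact Hg1).
  assert (H0rr : Cmod 0 < rr) by (rewrite Cmod_0; exact Hrr).
  assert (HT1c : ccont T1 0).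
  { assert (Cg := deriv_cont _ _ _ _ (Hgd 0 H0rr)).
    apply cont_plus; [exact Cg|]. apply cont_mult; [eapply deriv_cont, deriv_self|].
    apply cont_mult.
    - apply (cont_inv _ (fun v => RtoC (INR N) * cpow (g (P v)) (S k))%C).
      + rewrite HgP0, H11. apply Cmult_neq_0; [exact HN|]. apply RtoC_neq_0. lra.
      + apply cont_mult; [apply cont_const|].
        apply (cont_comp _ (fun v => g (P v)) (fun z => cpow z (S k))); [exact Cg|]. eapply deriv_cont, cder_cpow.
    - destruct (HE 0 H0r) as [A1 [A2 _]].
      apply cont_mult; [|apply cont_const]. apply cont_mult; [|exact A2].
      apply cont_mult; [apply cont_const|eapply deriv_cont, A1]. }
  assert (HT10 : T1 0 = RtoC 1) by (unfold T1; rewrite HgP0; ring).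
  assert (HT0 : T 0 = RtoC 0) by (unfold T; ring).
  destruct (inverse_function_cont T T1 0 rr) as [r3 [rho [G [Hr3 [Hrho [HG0 [HGn [HG _]]]]]]]]; auto.
  { intros x Hx. rewrite Cmod_cut in Hx. now apply HT. }
  { rewrite HT10. apply RtoC_neq_0. lra. }
  rewrite HT0 in *.
  (* The direction of the ray: with this [d] the number [E(0)^2 d^N] equals [kap > 0], so [v^N E^2]
     takes the positive value [kap s^N] on the ray. *)
  destruct (nth_root (Cconj (E 0 * E 0)) N) as [d Hd]; [unfold N; lia|].
  set (kap := Cmod (E 0 * E 0)%C ^ 2).
  assert (Hkap : 0 < kap).
  { apply pow_lt. apply Cmod_gt_0. exact HEE. }
  assert (Hdk : (E 0 * E 0 * cpow d N)%C = RtoC kap).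
  { rewrite Hd. unfold kap. rewrite Cmod2_conj. reflexivity. }
  assert (Hd0 : d <> RtoC 0).
  { intros Z. rewrite Z in Hdk. simpl in Hdk.
    assert (Z2 : RtoC kap = RtoC 0) by (rewrite <- Hdk; ring). injection Z2. lra. }
  assert (Hdm : 0 < Cmod d) by (apply Cmod_gt_0; exact Hd0).
  exists (fun s => b + G (RtoC s * d))%C, (rho / Cmod d).
  assert (HTp : 0 < rho / Cmod d) by (apply Rdiv_lt_0_compat; lra).
  assert (Hin : forall s, 0 <= s < rho / Cmod d -> Cmod (RtoC s * d - 0)%C < rho).
  { intros s Hs1. rewrite Cmod_cut, Cmod_mult, Cmod_R, Rabs_pos_eq by lra.
    apply Rlt_le_trans with (rho / Cmod d * Cmod d); [apply Rmult_lt_compat_r; lra|right; field; lra]. }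
  assert (Hlin : forall s, rder (fun s => RtoC s * d)%C s d).
  { intros s. apply (deriv_eq _ _ _ (1 * d + RtoC s * 0)%C); [|ring].
    apply (deriv_mult RtoC RtoC (fun _ => d)); [apply deriv_self|apply deriv_const]. }
  assert (HGd : forall s, 0 <= s < rho / Cmod d -> rder (fun s => G (RtoC s * d)%C) s (/ T1 (G (RtoC s * d)%C) * d)%C).
  { intros s Hs1. apply (deriv_comp RtoC (fun s => RtoC s * d)%C G); [apply Hlin|]. apply HG. now apply Hin. }
  assert (HgR : forall s, 0 <= s < rho / Cmod d ->
     rder (fun s => b + G (RtoC s * d))%C s (/ T1 (G (RtoC s * d)%C) * d)%C).
  { intros s Hs1. apply (deriv_eq _ _ _ (0 + / T1 (G (RtoC s * d)%C) * d)%C); [|ring].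
    apply deriv_plus; [apply deriv_const|]. now apply HGd. }
  split; [exact Hb|]. split; [exact HTp|]. split; [|split].
  - replace (RtoC 0 * d)%C with (RtoC 0) by ring. rewrite HG0. ring.
  - apply filterlim_at_right_eps. intros e He.
    assert (H00 : 0 <= 0 < rho / Cmod d) by lra.
    destruct (deriv_cont _ _ _ _ (HgR 0 H00) e He) as [de [Hde H]].
    exists de. split; [exact Hde|]. intros t Ht. specialize (H t). cbv beta in H.
    replace (b + G (RtoC 0 * d))%C with b in H by (replace (RtoC 0 * d)%C with (RtoC 0) by ring; rewrite HG0; ring).
    apply H. rewrite RtoC_dist, Rabs_pos_eq; lra.
  - intros s Hs1 Hs2. simpl in Hs2.
    assert (Hs3 : 0 <= s < rho / Cmod d) by lra.
    set (v := G (RtoC s * d)%C). set (e := (/ T1 v * d)%C).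
    exists e. split; [apply rderiv_is_rder, HgR; exact Hs3|].
    destruct (HG _ (Hin s Hs3)) as [Hv1 [Hv2 _]]. fold v in Hv1, Hv2. rewrite Cmod_cut in Hv1.
    assert (Hvr : Cmod v < r) by lra.
    (* v^N E^2 = E(0)^2 T^N *)
    assert (HF : forall w, Cmod w < rr -> (cpow w N * (E w * E w))%C = (E 0 * E 0 * cpow (T w) N)%C).
    { intros w Hw. unfold T. rewrite cpow_mult.
      destruct (Hg (P w)) as [_ [Hgw _]]; [apply HPb; rewrite Cmod_cut; lra|].
      cbv beta in Hgw. rewrite Hgw. unfold P. field. exact HE0. }
    destruct (HE v Hvr) as [A1 [_ A3]].
    (* The derivative of [v^N E^2] along the arc is computed by the chain rule and from the value
       [kap s^N]. Equating the squares and dividing by [kap s^N] gives [Q e^2 = kap N^2 s^k], real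
       and positive as an arc requires. *)
    assert (L1 : rder (fun s => cpow (G (RtoC s * d)%C) N * (E (G (RtoC s * d)%C) * E (G (RtoC s * d)%C)))%C s
       (cpow v (S k) * E v * f v * e)%C).
    { apply (deriv_eq _ _ _ ((RtoC (INR N) * cpow v (S k) * (E v * E v) + cpow v N * (E1 v * E v + E v * E1 v)) * e)%C).
      - apply (deriv_comp RtoC (fun s => G (RtoC s * d)%C) (fun w => cpow w N * (E w * E w))%C).
        + apply HGd. exact Hs3.
        + apply (deriv_mult _ (fun w => cpow w N) (fun w => E w * E w)%C); [apply cder_cpow|].
          now apply deriv_mult.
      - rewrite <- A3. unfold N. simpl cpow. ring. }
    assert (L2 : rder (fun s => cpow (G (RtoC s * d)%C) N * (E (G (RtoC s * d)%C) * E (G (RtoC s * d)%C)))%C s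
       (RtoC (kap * (INR N * s ^ (S k))))).
    { apply (deriv_ext RtoC (fun s => RtoC kap * cpow (RtoC s) N)%C _ _ _ (Rmin s (rho / Cmod d - s))).
      - apply Rmin_pos; lra.
      - intros y Hy. rewrite RtoC_dist in Hy.
        assert (B1 := Rmin_l s (rho / Cmod d - s)). assert (B2 := Rmin_r s (rho / Cmod d - s)).
        assert (Hy' : - (Rmin s (rho / Cmod d - s)) < y - s < Rmin s (rho / Cmod d - s)) by now apply Rabs_def2 in Hy.
        destruct (HG (RtoC y * d)%C) as [C1 [C2 _]]; [apply Hin; lra|]. rewrite Cmod_cut in C1.
        rewrite HF, C2, cpow_mult by lra. rewrite <- Hdk. ring.
      - apply (deriv_eq _ _ _ (RtoC kap * (RtoC (INR N) * cpow (RtoC s) (S k) * 1))%C).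
        + apply deriv_scal. apply (deriv_comp RtoC RtoC (fun z => cpow z N)); [apply deriv_self|apply cder_cpow].
        + rewrite cpow_RtoC, !RtoC_mult. ring. }
    assert (EQ := rder_unique _ _ _ _ L1 L2).
    destruct (Hf v Hvr) as [Ff _].
    assert (HQ : (peval c m (b + v) * (e * e))%C = RtoC (kap * INR N ^ 2 * s ^ k)).
    { assert (Sk : s ^ k <> 0) by (apply pow_nonzero; lra).
      assert (Z : RtoC (kap * s ^ N) <> RtoC 0).
      { apply RtoC_neq_0. apply Rmult_integral_contrapositive. split; [lra|]. apply pow_nonzero. lra. }
      assert (HFv : (cpow v N * (E v * E v))%C = RtoC (kap * s ^ N)).
      { rewrite HF, Hv2, cpow_mult, cpow_RtoC by lra. rewrite RtoC_mult, <- Hdk. ring. }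
      assert (M : (RtoC (kap * s ^ N) * (peval c m (b + v) * (e * e)))%C =
        (RtoC (kap * s ^ N) * RtoC (kap * INR N ^ 2 * s ^ k))%C).
      { transitivity ((cpow v (S k) * E v * f v * e) * (cpow v (S k) * E v * f v * e))%C.
        - rewrite <- HFv, Hc', Hfac, <- Ff. unfold N. simpl cpow. ring.
        - rewrite EQ, <- !RtoC_mult. f_equal. change (s ^ N) with (s * (s * s ^ k)).
          change (s ^ S k) with (s * s ^ k). generalize (INR N). intros I. ring. }
      apply (f_equal (fun z => / RtoC (kap * s ^ N) * z)%C) in M.
      rewrite !Cmult_assoc, Cinv_l, !Cmult_1_l in M by exact Z. rewrite <- Cmult_assoc in M. exact M. }
    fold v. rewrite HQ. split; [reflexivity|]. change (0 < kap * INR N ^ 2 * s ^ k).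
    apply Rmult_lt_0_compat; [|apply pow_lt; exact Hs1].
    apply Rmult_lt_0_compat; [exact Hkap|].
    apply pow_lt, lt_0_INR. unfold N. lia.
Qed.

(** The constant parameter 0 of the arc suffices. This is what keeps the zeros of [Q] out of Stokes
    domains, see [sheet_neq_0]. *)
Lemma zero_on_stokes c m b : is_poly_deg c m -> peval c m b = RtoC 0 -> on_stokes c m b.
Proof.
  intros Hp Hb. destruct (stokes_arc_exists c m b Hp Hb) as [gam [T H]].
  exists b, gam, T, 0. split; [exact H|]. split; [lra|]. split; apply H.
Qed.

(** * Trajectories of the quadratic differential *)

Lemma clopen (P J : R -> Prop) :
  (forall r s t, J r -> J t -> r <= s <= t -> J s) ->
  (forall t, J t -> P t -> exists d, 0 < d /\ forall s, J s -> Rabs (s - t) < d -> P s) ->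
  (forall t, J t -> ~ P t -> exists d, 0 < d /\ forall s, J s -> Rabs (s - t) < d -> ~ P s) ->
  forall u v, J u -> J v -> P u -> P v.
Proof.
  intros Hc Ho Hcl. apply locally_const; [|exact Hc]. intros t0 Ht0.
  destruct (classic (P t0)) as [H|H].
  - destruct (Ho t0 Ht0 H) as [d [Hd H']]. exists d. split; [exact Hd|]. intros s t _ Ht _ B _. now apply H'.
  - destruct (Hcl t0 Ht0 H) as [d [Hd H']]. exists d. split; [exact Hd|].
    intros s t Hs _ A _ Ps. destruct (H' s Hs A Ps).
Qed.

Lemma cont_neq {X} (i f g : X -> C) x : cont_via i f x -> cont_via i g x -> f x <> g x ->
  exists d, 0 < d /\ forall y, Cmod (i y - i x)%C < d -> f y <> g y.
Proof.
  intros Hf Hg Hn. set (e := Cmod (f x - g x)%C).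
  assert (He : 0 < e).
  { apply Cmod_gt_0. intros E. apply Hn. replace (f x) with (f x - g x + g x)%C by ring. rewrite E. ring. }
  destruct (Hf (e / 2) ltac:(lra)) as [d1 [Hd1 H1]]. destruct (Hg (e / 2) ltac:(lra)) as [d2 [Hd2 H2]].
  exists (Rmin d1 d2). split; [now apply Rmin_pos|]. intros y Hy E.
  assert (A1 := Rmin_l d1 d2). assert (A2 := Rmin_r d1 d2).
  specialize (H1 y ltac:(lra)). specialize (H2 y ltac:(lra)). rewrite E in H1.
  assert (T := Cmod_sub_triangle (f x) (g y) (g x)). rewrite (Cmod_sub_sym (f x) (g y)) in T. fold e in T. lra.
Qed.

Lemma Cinv_neq_0 x : x <> RtoC 0 -> (/ x)%C <> RtoC 0.
Proof.
  intros Hx E. assert (H := Cinv_r x Hx). rewrite E in H.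
  replace (x * 0)%C with (RtoC 0) in H by ring. injection H. lra.
Qed.

Lemma Cinv_inv x : (/ / x)%C = x.
Proof.
  destruct (classic (x = RtoC 0)) as [->|Hx].
  - apply C_ext; simpl; unfold Rdiv; ring.
  - field. exact Hx.
Qed.

(** Open intervals as predicates, bounded or not, so that a maximal interval of existence can be
    formed as a union. *)
Definition oint (J : R -> Prop) : Prop :=
  (forall t, J t -> exists d, 0 < d /\ forall s, Rabs (s - t) < d -> J s) /\
  (forall r s t, J r -> J t -> r <= s <= t -> J s).

(** Horizontal trajectories of [Q dy^2], parametrised by length; [v] is the velocity. *)
Definition traj (Q : C -> C) (J : R -> Prop) (y v : R -> C) : Prop :=
  forall t, J t -> rder y t (v t) /\ rcont v t /\ (v t * v t * Q (y t))%C = RtoC 1.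

Lemma oint_ball a r : oint (fun t => Rabs (t - a) < r).
Proof.
  split.
  - intros t Ht. exists (r - Rabs (t - a)). split; [lra|]. intros s Hs.
    replace (s - a) with ((s - t) + (t - a)) by ring. eapply Rle_lt_trans; [apply Rabs_triang|]. lra.
  - intros u s t Hu Ht Hs. apply Rabs_def2 in Hu. apply Rabs_def2 in Ht. apply Rabs_def1; lra.
Qed.

Lemma oint_inter J K : oint J -> oint K -> oint (fun t => J t /\ K t).
Proof.
  intros [J1 J2] [K1 K2]. split.
  - intros t [Ht Kt]. destruct (J1 t Ht) as [d [Hd H]]. destruct (K1 t Kt) as [e [He H']].
    exists (Rmin d e). split; [now apply Rmin_pos|]. intros s Hs.
    assert (A := Rmin_l d e). assert (B := Rmin_r d e). split; [apply H|apply H']; lra.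
  - intros r s t [A B] [A' B'] Hs. split; [apply (J2 r s t)|apply (K2 r s t)]; auto.
Qed.

Lemma traj_sub Q (J K : R -> Prop) y v : (forall t, K t -> J t) -> traj Q J y v -> traj Q K y v.
Proof. intros H HT t Ht. apply HT, H, Ht. Qed.

Lemma chart_opp Q w s0 f T psi r rho : chart Q w s0 f T psi r rho ->
  chart Q w (- s0)%C (fun y => - f y)%C (fun y => - T y)%C (fun z => psi (- z)%C) r rho.
Proof.
  intros HC. split.
  - apply HC.
  - apply HC.
  - now rewrite (chart_f0 _ _ _ _ _ _ _ _ HC).
  - rewrite (chart_T0 _ _ _ _ _ _ _ _ HC). ring.
  - rewrite <- (chart_psi0 _ _ _ _ _ _ _ _ HC). f_equal. ring.
  - intros y Hy. destruct (chart_f _ _ _ _ _ _ _ _ HC y Hy) as [A [B [D E]]]. split; [|split; [|split]].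
    + rewrite <- A. ring.
    + intros Z. apply B. replace (f y) with (- - f y)%C by ring. rewrite Z. ring.
    + apply (cont_ext _ (fun y => (-(1)) * f y)%C _ _ 1); [lra|intros; ring|].
      apply cont_mult; [apply cont_const|exact D].
    + now apply deriv_opp.
  - intros z Hz. rewrite <- Cmod_opp in Hz. destruct (chart_psi _ _ _ _ _ _ _ _ HC _ Hz) as [A [B D]].
    split; [exact A|]. split; [rewrite B; ring|].
    apply (deriv_eq _ _ _ (/ f (psi (- z)%C) * - (1))%C).
    + apply (deriv_comp _ (fun z => - z)%C psi); [|exact D]. apply deriv_opp, deriv_self.
    + field. apply (chart_f _ _ _ _ _ _ _ _ HC). exact A.
  - intros y Hy. rewrite Cmod_opp. intros HT. replace (- - T y)%C with (T y) by ring.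
    now apply (chart_inv _ _ _ _ _ _ _ _ HC).
Qed.

Lemma sqr_one x : (x * x)%C = RtoC 1 -> x = RtoC 1 \/ x = (- (1))%C.
Proof.
  intros H. assert (E : ((x - 1) * (x + 1))%C = RtoC 0).
  { replace ((x - 1) * (x + 1))%C with (x * x - 1)%C by ring. rewrite H. ring. }
  destruct (classic (x - 1 = 0)%C) as [Z|Z].
  - left. replace x with (x - 1 + 1)%C by ring. rewrite Z. ring.
  - right. apply (f_equal (fun u => / (x - 1) * u)%C) in E. rewrite Cmult_assoc, Cinv_l, Cmult_1_l in E by exact Z.
    replace x with (x + 1 - 1)%C by ring. rewrite E. ring.
Qed.

Lemma one_neq_opp : RtoC 1 <> (- (1))%C.
Proof. intros E. injection E. lra. Qed.

Lemma cont_sign {X} (i g : X -> C) x : cont_via i g x -> g x = RtoC 1 ->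
  exists d, 0 < d /\ forall y, Cmod (i y - i x)%C < d -> (g y * g y)%C = RtoC 1 -> g y = RtoC 1.
Proof.
  intros Hg H1. destruct (cont_neq i g (fun _ => (- (1))%C) x) as [d [Hd H]].
  - exact Hg.
  - apply cont_const.
  - rewrite H1. exact one_neq_opp.
  - exists d. split; [exact Hd|]. intros y Hy E. destruct (sqr_one _ E) as [A|A]; [exact A|].
    destruct (H y Hy A).
Qed.

(** The product [f (y t) * v t] squares to 1, so by continuity it keeps the value 1; hence
    [T (y t) - t] is constant and the trajectory is a horizontal translation in the chart. *)
Lemma traj_chart Q w s0 f T psi r rho J y v t0 z0 : chart Q w s0 f T psi r rho ->
  oint J -> traj Q J y v -> J t0 -> Cmod z0 < rho -> y t0 = psi z0 -> v t0 = (/ f (psi z0))%C ->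
  exists d, 0 < d /\ forall t, Rabs (t - t0) < d -> J t /\ Cmod (z0 + RtoC (t - t0))%C < rho /\
    y t = psi (z0 + RtoC (t - t0))%C /\ v t = (/ f (y t))%C.
Proof.
  intros HC [Ho Hcv] Htr Ht0 Hz0 Hy0 Hv0.
  destruct (chart_psi _ _ _ _ _ _ _ _ HC z0 Hz0) as [P1 [P2 _]].
  destruct (chart_f _ _ _ _ _ _ _ _ HC _ P1) as [F1 [F2 [F3 _]]].
  destruct (Ho t0 Ht0) as [d0 [Hd0 HJ]].
  destruct (Htr t0 Ht0) as [D1 [D2 D3]].
  assert (Hyc := deriv_cont _ _ _ _ D1).
  destruct (Hyc (r - Cmod (psi z0 - w)%C)) as [d1 [Hd1 H1]]; [lra|].
  assert (Hg : rcont (fun t => f (y t) * v t)%C t0).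
  { apply cont_mult; [|exact D2]. apply (cont_comp RtoC y f); [exact Hyc|]. now rewrite Hy0. }
  destruct (cont_sign RtoC _ t0 Hg) as [d2 [Hd2 H2]].
  { cbv beta. rewrite Hy0, Hv0. field. exact F2. }
  set (d := Rmin (Rmin d0 d1) (Rmin d2 (rho - Cmod z0))).
  assert (Hd : 0 < d) by (repeat apply Rmin_pos; lra).
  assert (B1 : d <= Rmin d0 d1) by apply Rmin_l. assert (B2 : d <= Rmin d2 (rho - Cmod z0)) by apply Rmin_r.
  assert (B3 := Rmin_l d0 d1). assert (B4 := Rmin_r d0 d1).
  assert (B5 := Rmin_l d2 (rho - Cmod z0)). assert (B6 := Rmin_r d2 (rho - Cmod z0)).
  assert (K : forall t, Rabs (t - t0) < d -> J t /\ Cmod (y t - w)%C < r /\ (f (y t) * v t)%C = RtoC 1).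
  { intros t Ht. assert (Jt : J t) by (apply HJ; lra).
    assert (Hr : Cmod (y t - w)%C < r).
    { specialize (H1 t). rewrite RtoC_dist in H1. specialize (H1 ltac:(lra)). rewrite Hy0 in H1.
      assert (A := Cmod_sub_triangle (y t) (psi z0) w). lra. }
    split; [exact Jt|]. split; [exact Hr|]. apply H2; [rewrite RtoC_dist; lra|].
    destruct (Htr t Jt) as [_ [_ E3]]. destruct (chart_f _ _ _ _ _ _ _ _ HC _ Hr) as [G1 _].
    rewrite <- E3, <- G1. ring. }
  assert (Hz : forall t, Rabs (t - t0) < d -> Cmod (z0 + RtoC (t - t0))%C < rho).
  { intros t Ht. eapply Rle_lt_trans; [apply Cmod_triangle|]. rewrite Cmod_R. lra. }
  assert (HTl : forall t, Rabs (t - t0) < d -> T (y t) = (z0 + RtoC (t - t0))%C).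
  { intros t Ht.
    assert (Hder : forall s, Rabs (s - t0) < d -> rder (fun s => T (y s) - RtoC s)%C s 0).
    { intros s Hs. destruct (K s Hs) as [K1 [K2 K3]]. destruct (Htr s K1) as [E1 _].
      apply (deriv_eq _ _ _ (f (y s) * v s - 1)%C); [|rewrite K3; ring].
      apply deriv_minus; [|apply deriv_self]. apply (deriv_comp RtoC y T); [exact E1|].
      now apply (chart_f _ _ _ _ _ _ _ _ HC). }
    assert (Heq : (T (y t) - RtoC t)%C = (T (y t0) - RtoC t0)%C).
    { destruct (Rle_lt_dec t t0) as [L|L].
      - symmetry. apply Cmod_small_eq. intros e He. apply Rle_trans with (0 * (t0 - t)); [|lra].
        apply (MVT_rder (fun s => T (y s) - RtoC s)%C (fun _ => 0)); [exact L| |intros; rewrite Cmod_0; lra].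
        intros s Hs. apply Hder. apply Rabs_def2 in Ht. apply Rabs_def1; lra.
      - apply Cmod_small_eq. intros e He. apply Rle_trans with (0 * (t - t0)); [|lra].
        apply (MVT_rder (fun s => T (y s) - RtoC s)%C (fun _ => 0)); [lra| |intros; rewrite Cmod_0; lra].
        intros s Hs. apply Hder. apply Rabs_def2 in Ht. apply Rabs_def1; lra. }
    rewrite Hy0, P2 in Heq. replace (T (y t)) with (T (y t) - RtoC t + RtoC t)%C by ring. rewrite Heq.
    rewrite RtoC_minus. ring. }
  exists d. split; [exact Hd|]. intros t Ht. destruct (K t Ht) as [K1 [K2 K3]].
  split; [exact K1|]. split; [now apply Hz|]. split.
  - rewrite <- (HTl t Ht). symmetry. apply (chart_inv _ _ _ _ _ _ _ _ HC); [exact K2|]. rewrite (HTl t Ht). now apply Hz.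
  - destruct (chart_f _ _ _ _ _ _ _ _ HC _ K2) as [_ [G2 _]].
    replace (v t) with (/ f (y t) * (f (y t) * v t))%C by (field; exact G2). rewrite K3. ring.
Qed.

Lemma traj_at_chart c m J y v t : traj (peval c m) J y v -> J t -> forall e, 0 < e ->
  exists f T psi r rho, chart (peval c m) (y t) (/ v t)%C f T psi r rho /\ r <= e.
Proof.
  intros H Ht e He. destruct (H t Ht) as [_ [_ E]].
  assert (V : v t <> RtoC 0).
  { intros Z. rewrite Z in E. replace (0 * 0 * peval c m (y t))%C with (RtoC 0) in E by ring. injection E. lra. }
  apply chart_exists; [|now apply Cinv_neq_0|exact He].
  replace (peval c m (y t)) with (/ v t * / v t * (v t * v t * peval c m (y t)))%C by (field; exact V).
  rewrite E. ring.
Qed.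

(** The set of agreement of points and velocities is closed by continuity, and open because
    [traj_chart] expresses both trajectories by the same translation in one chart. *)
Lemma traj_unique c m J y1 v1 y2 v2 t0 : oint J ->
  traj (peval c m) J y1 v1 -> traj (peval c m) J y2 v2 -> J t0 -> y1 t0 = y2 t0 -> v1 t0 = v2 t0 ->
  forall t, J t -> y1 t = y2 t /\ v1 t = v2 t.
Proof.
  intros HJ H1 H2 Ht0 Hy Hv t Ht.
  apply (clopen (fun t => y1 t = y2 t /\ v1 t = v2 t) J) with t0; auto; [apply HJ| |].
  - clear - HJ H1 H2. intros t Jt [Ey Ev].
    destruct (traj_at_chart c m J y1 v1 t H1 Jt 1 Rlt_0_1) as [f [T [psi [r [rho [HC _]]]]]].
    assert (P0 := chart_psi0 _ _ _ _ _ _ _ _ HC). assert (R0 := chart_rho _ _ _ _ _ _ _ _ HC).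
    assert (F0 := chart_f0 _ _ _ _ _ _ _ _ HC).
    assert (V : v1 t = (/ f (psi 0))%C).
    { rewrite P0, F0, Cinv_inv; reflexivity. }
    destruct (traj_chart _ _ _ _ _ _ _ _ J y1 v1 t 0 HC HJ H1 Jt) as [d1 [Hd1 K1]]; auto.
    { now rewrite Cmod_0. }
    destruct (traj_chart _ _ _ _ _ _ _ _ J y2 v2 t 0 HC HJ H2 Jt) as [d2 [Hd2 K2]].
    { now rewrite Cmod_0. } { now rewrite <- Ey. } { now rewrite <- Ev. }
    exists (Rmin d1 d2). split; [now apply Rmin_pos|]. intros s _ Hs.
    assert (A := Rmin_l d1 d2). assert (B := Rmin_r d1 d2).
    destruct (K1 s ltac:(lra)) as [_ [_ [A1 A2]]]. destruct (K2 s ltac:(lra)) as [_ [_ [B1 B2]]].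
    assert (E : y1 s = y2 s) by (rewrite A1, B1; reflexivity). split; [exact E|]. rewrite A2, B2, E. reflexivity.
  - clear - HJ H1 H2. intros t Jt Hn.
    destruct (H1 t Jt) as [D1 [C1 _]]. destruct (H2 t Jt) as [D2 [C2 _]].
    destruct (classic (y1 t = y2 t)) as [E|E].
    + destruct (cont_neq RtoC v1 v2 t C1 C2) as [d [Hd H]]; [intros E2; apply Hn; now split|].
      exists d. split; [exact Hd|]. intros s _ Hs [_ Z]. apply (H s); [rewrite RtoC_dist; exact Hs|exact Z].
    + destruct (cont_neq RtoC y1 y2 t) as [d [Hd H]]; auto; try (eapply deriv_cont; eassumption).
      exists d. split; [exact Hd|]. intros s _ Hs [Z _]. apply (H s); [rewrite RtoC_dist; exact Hs|exact Z].
Qed.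

Lemma oint_union J K t : oint J -> oint K -> J t -> K t -> oint (fun s => J s \/ K s).
Proof.
  intros [J1 J2] [K1 K2] Jt Kt. split.
  - intros s [H|H]; [destruct (J1 s H) as [d [Hd H']]|destruct (K1 s H) as [d [Hd H']]];
    exists d; (split; [exact Hd|]); intros u Hu; [left|right]; auto.
  - intros a s b Ha Hb Hs. destruct (Rle_lt_dec s t) as [L|L].
    + destruct Ha as [Ha|Ha]; [left; apply (J2 a s t)|right; apply (K2 a s t)]; auto; lra.
    + destruct Hb as [Hb|Hb]; [left; apply (J2 t s b)|right; apply (K2 t s b)]; auto; lra.
Qed.

Lemma traj_glue c m J K y1 v1 y2 v2 t0 : oint J -> oint K ->
  traj (peval c m) J y1 v1 -> traj (peval c m) K y2 v2 -> J t0 -> K t0 -> y1 t0 = y2 t0 -> v1 t0 = v2 t0 ->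
  exists y v, traj (peval c m) (fun s => J s \/ K s) y v /\
    (forall s, J s -> y s = y1 s /\ v s = v1 s) /\ (forall s, K s -> y s = y2 s /\ v s = v2 s).
Proof.
  intros HJ HK T1 T2 Jt Kt Ey Ev.
  set (y := fun s => if excluded_middle_informative (J s) then y1 s else y2 s).
  set (v := fun s => if excluded_middle_informative (J s) then v1 s else v2 s).
  assert (HJ1 : forall s, J s -> y s = y1 s /\ v s = v1 s).
  { intros s Hs. unfold y, v. now destruct (excluded_middle_informative (J s)). }
  assert (HK1 : forall s, K s -> y s = y2 s /\ v s = v2 s).
  { intros s Hs. unfold y, v. destruct (excluded_middle_informative (J s)) as [H|H]; [|easy].
    apply (traj_unique c m (fun t => J t /\ K t) y1 v1 y2 v2 t0); auto.
    - now apply oint_inter.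
    - now apply (traj_sub _ J).
    - now apply (traj_sub _ K). }
  exists y, v. split; [|now split].
  assert (Hgen : forall (L : R -> Prop) z w, oint L -> traj (peval c m) L z w ->
     (forall s, L s -> y s = z s /\ v s = w s) -> traj (peval c m) L y v).
  { intros L z w [Lo _] TL HL s Ls. destruct (Lo s Ls) as [d [Hd H]]. destruct (TL s Ls) as [A [B D]].
    destruct (HL s Ls) as [E1 E2]. split; [|split].
    - rewrite E2. apply (deriv_ext RtoC z y _ _ d); auto. intros u Hu. rewrite RtoC_dist in Hu.
      symmetry. now apply HL, H.
    - apply (cont_ext RtoC w v _ d); auto. intros u Hu. rewrite RtoC_dist in Hu. symmetry. now apply HL, H.
    - now rewrite E1, E2. }
  intros s [Hs|Hs]; [apply (Hgen J y1 v1)|apply (Hgen K y2 v2)]; auto.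
Qed.

(** * Maximal trajectories *)

Definition maxJ (Q : C -> C) (x v0 : C) (t : R) : Prop :=
  exists J y v, oint J /\ J 0 /\ J t /\ traj Q J y v /\ y 0 = x /\ v 0 = v0.

Definition maxtraj (Q : C -> C) (x v0 : C) (t : R) : C * C :=
  epsilon (inhabits (RtoC 0, RtoC 0)) (fun p => exists J y v,
    oint J /\ J 0 /\ J t /\ traj Q J y v /\ y 0 = x /\ v 0 = v0 /\ p = (y t, v t)).

Notation maxY Q x v0 := (fun t => fst (maxtraj Q x v0 t)).
Notation maxV Q x v0 := (fun t => snd (maxtraj Q x v0 t)).

Lemma maxtraj_eq c m x v0 J y v t : oint J -> J 0 -> J t -> traj (peval c m) J y v -> y 0 = x -> v 0 = v0 ->
  maxtraj (peval c m) x v0 t = (y t, v t).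
Proof.
  intros HJ J0 Jt HT Hy Hv. unfold maxtraj.
  match goal with |- epsilon ?i ?P = _ => assert (H : P (epsilon i P)) end.
  { apply epsilon_spec. exists (y t, v t), J, y, v. repeat (split; [assumption|]). reflexivity. }
  cbv beta in H. destruct H as [K [z [w [HK [K0 [Kt [HT' [Hz [Hw E]]]]]]]]]. rewrite E.
  destruct (traj_unique c m (fun t => J t /\ K t) y v z w 0) with (t := t) as [A B]; auto; try congruence.
  - now apply oint_inter.
  - now apply (traj_sub _ J).
  - now apply (traj_sub _ K).
Qed.

Lemma oint_maxJ Q x v0 : oint (maxJ Q x v0).
Proof.
  split.
  - intros t [J [y [v [HJ [J0 [Jt H]]]]]]. destruct (proj1 HJ t Jt) as [d [Hd H']]. exists d. split; [exact Hd|].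
    intros s Hs. exists J, y, v. repeat (split; auto).
  - intros r s t [J [y [v [HJ [J0 [Jt H]]]]]] [K [y' [v' [HK [K0 [Kt H']]]]]] Hs.
    destruct (Rle_lt_dec s 0) as [L|L].
    + exists J, y, v. split; [exact HJ|]. split; [exact J0|]. split; [|exact H]. apply (proj2 HJ r s 0); auto; lra.
    + exists K, y', v'. split; [exact HK|]. split; [exact K0|]. split; [|exact H']. apply (proj2 HK 0 s t); auto; lra.
Qed.

Lemma maxtraj_traj c m x v0 :
  traj (peval c m) (maxJ (peval c m) x v0) (maxY (peval c m) x v0) (maxV (peval c m) x v0).
Proof.
  intros t [J [y [v [HJ [J0 [Jt [HT [Hy Hv]]]]]]]].
  destruct (proj1 HJ t Jt) as [d [Hd H]]. destruct (HT t Jt) as [A [B D]].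
  assert (E : forall s, J s -> maxtraj (peval c m) x v0 s = (y s, v s)).
  { intros s Hs. now apply (maxtraj_eq c m x v0 J). }
  rewrite (E t Jt). simpl. split; [|split].
  - apply (deriv_ext RtoC y _ _ _ d); auto. intros s Hs. rewrite RtoC_dist in Hs. rewrite E; auto.
  - apply (cont_ext RtoC v _ _ d); auto. intros s Hs. rewrite RtoC_dist in Hs. rewrite E; auto.
  - exact D.
Qed.

Lemma chart_traj Q w s0 f T psi r rho z0 e : chart Q w s0 f T psi r rho -> Cmod z0 + e <= rho ->
  traj Q (fun t => Rabs t < e) (fun t => psi (z0 + RtoC t)%C) (fun t => / f (psi (z0 + RtoC t)%C))%C.
Proof.
  intros HC He t Ht.
  assert (Hz : Cmod (z0 + RtoC t)%C < rho).
  { eapply Rle_lt_trans; [apply Cmod_triangle|]. rewrite Cmod_R. lra. }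
  destruct (chart_psi _ _ _ _ _ _ _ _ HC _ Hz) as [A [_ D]].
  destruct (chart_f _ _ _ _ _ _ _ _ HC _ A) as [F1 [F2 [F3 _]]].
  assert (Hd : rder (fun t => psi (z0 + RtoC t)%C) t (/ f (psi (z0 + RtoC t)%C))%C).
  { apply (deriv_eq _ _ _ (/ f (psi (z0 + RtoC t)%C) * (0 + 1))%C); [|ring].
    apply (deriv_comp RtoC (fun t => z0 + RtoC t)%C psi); [|exact D].
    apply deriv_plus; [apply deriv_const|apply deriv_self]. }
  split; [exact Hd|]. split.
  - apply (cont_inv RtoC (fun t => f (psi (z0 + RtoC t)%C))); [exact F2|].
    apply (cont_comp RtoC (fun t => psi (z0 + RtoC t)%C) f); [eapply deriv_cont, Hd|exact F3].
  - rewrite <- F1. field. exact F2.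
Qed.

Lemma maxJ_0 c m x v0 : (v0 * v0 * peval c m x)%C = RtoC 1 -> maxJ (peval c m) x v0 0.
Proof.
  intros E.
  assert (V : v0 <> RtoC 0).
  { intros Z. rewrite Z in E. replace (0 * 0 * peval c m x)%C with (RtoC 0) in E by ring. injection E. lra. }
  destruct (chart_exists c m x (/ v0)%C 1) as [f [T [psi [r [rho [HC _]]]]]].
  - replace (peval c m x) with (/ v0 * / v0 * (v0 * v0 * peval c m x))%C by (field; exact V). rewrite E. ring.
  - now apply Cinv_neq_0.
  - lra.
  - assert (R0 := chart_rho _ _ _ _ _ _ _ _ HC). assert (P0 := chart_psi0 _ _ _ _ _ _ _ _ HC).
    assert (F0 := chart_f0 _ _ _ _ _ _ _ _ HC).
    exists (fun t => Rabs t < rho), (fun t => psi (0 + RtoC t)%C), (fun t => / f (psi (0 + RtoC t)%C))%C.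
    assert (O := oint_ball 0 rho). assert (E0 : forall t, t - 0 = t) by (intros; ring).
    split; [|split; [|split; [|split; [|split]]]].
    + destruct O as [O1 O2]. split.
      * intros t Ht. rewrite <- (E0 t) in Ht. destruct (O1 t Ht) as [d [Hd H]]. exists d. split; [exact Hd|].
        intros s Hs. rewrite <- (E0 s). now apply H.
      * intros a s b. specialize (O2 a s b). now rewrite !E0 in O2.
    + now rewrite Rabs_R0.
    + now rewrite Rabs_R0.
    + apply (chart_traj _ _ _ _ _ _ _ _ _ _ HC). rewrite Cmod_0. lra.
    + rewrite Cplus_0_r. exact P0.
    + rewrite Cplus_0_r, P0, F0, Cinv_inv. reflexivity.
Qed.

Lemma maxtraj_0 c m x v0 : (v0 * v0 * peval c m x)%C = RtoC 1 -> maxtraj (peval c m) x v0 0 = (x, v0).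
Proof.
  intros E. destruct (maxJ_0 c m x v0 E) as [J [y [v [HJ [J0 [_ [HT [Hy Hv]]]]]]]].
  rewrite (maxtraj_eq c m x v0 J y v 0); auto. now rewrite Hy, Hv.
Qed.

(** The chart at the regular point [p] has a fixed radius [rho], so a trajectory that comes close to
    [p] at a time close to [tau] can be continued in this chart past [tau]. It is enough that [p] is
    a cluster value, which compactness supplies. *)
Lemma maxtraj_extend c m x v0 p tau : (v0 * v0 * peval c m x)%C = RtoC 1 -> peval c m p <> RtoC 0 ->
  (forall e, 0 < e -> exists t, maxJ (peval c m) x v0 t /\ Rabs (t - tau) < e /\
     Cmod (maxY (peval c m) x v0 t - p)%C < e) -> maxJ (peval c m) x v0 tau.
Proof.
  intros E Hp Hcl. set (Q := peval c m) in *.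
  destruct (nth_root (Q p) 2) as [s0 Hs0]; [lia|].
  assert (Hs : (s0 * s0)%C = Q p) by (rewrite <- Hs0; simpl; ring).
  assert (Hs' : s0 <> RtoC 0) by (intros Z; apply Hp; rewrite <- Hs, Z; ring).
  destruct (chart_exists c m p s0 1 Hs Hs' Rlt_0_1) as [f [T [psi [r [rho [HC _]]]]]].
  assert (R0 := chart_rho _ _ _ _ _ _ _ _ HC). assert (r0 := chart_r _ _ _ _ _ _ _ _ HC).
  assert (Hpp : Cmod (p - p)%C < r) by (replace (p - p)%C with (RtoC 0) by ring; now rewrite Cmod_0).
  destruct (chart_f _ _ _ _ _ _ _ _ HC p Hpp) as [_ [_ [_ HTd]]].
  destruct (deriv_cont _ _ _ _ HTd (rho / 2)) as [d [Hd HT]]; [lra|].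
  rewrite (chart_T0 _ _ _ _ _ _ _ _ HC) in HT.
  destruct (Hcl (Rmin (rho / 2) (Rmin d r))) as [t [Jt [Ht Hy]]]; [repeat apply Rmin_pos; lra|].
  assert (B1 := Rmin_l (rho / 2) (Rmin d r)). assert (B2 := Rmin_r (rho / 2) (Rmin d r)).
  assert (B3 := Rmin_l d r). assert (B4 := Rmin_r d r).
  assert (HTR := maxtraj_traj c m x v0). fold Q in HTR.
  destruct (HTR t Jt) as [_ [_ E3]]. cbv beta in *.
  set (yt := fst (maxtraj Q x v0 t)) in *. set (vt := snd (maxtraj Q x v0 t)) in *.
  (* The velocity singles out one of the two branches of [sqrt Q] at [p]; if it is not the one
     chosen above, the opposite chart is taken. *)
  assert (Hchart : exists s0 f T psi, chart Q p s0 f T psi r rho /\ Cmod (T yt) < rho / 2 /\ vt = (/ f yt)%C).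
  { destruct (chart_f _ _ _ _ _ _ _ _ HC yt ltac:(lra)) as [F1 [F2 _]].
    specialize (HT yt ltac:(lra)). replace (T yt - 0)%C with (T yt) in HT by ring.
    destruct (sqr_one (f yt * vt)%C) as [S|S].
    - transitivity (vt * vt * (f yt * f yt))%C; [ring|]. rewrite F1. exact E3.
    - exists s0, f, T, psi. split; [exact HC|]. split; [exact HT|].
      replace vt with (/ f yt * (f yt * vt))%C by (field; exact F2). rewrite S. ring.
    - exists (- s0)%C, (fun y => - f y)%C, (fun y => - T y)%C, (fun z => psi (- z)%C).
      split; [now apply chart_opp|]. rewrite Cmod_opp. split; [exact HT|].
      replace vt with (/ f yt * (f yt * vt))%C by (field; exact F2). rewrite S. field. exact F2. }
  clear s0 Hs0 Hs Hs' f T psi HC HTd HT. destruct Hchart as [s0 [f [T [psi [HC [HT Hv]]]]]].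
  assert (Hps : psi (T yt) = yt) by (apply (chart_inv _ _ _ _ _ _ _ _ HC); lra).
  assert (K := chart_traj _ _ _ _ _ _ _ _ (T yt) (rho / 2) HC ltac:(lra)).
  assert (K2 : traj Q (fun s => Rabs (s - t) < rho / 2) (fun s => psi (T yt + RtoC (s - t))%C)
     (fun s => / f (psi (T yt + RtoC (s - t))%C))%C).
  { intros s Hs. destruct (K (s - t) Hs) as [K1 [K2 K3]].
    assert (Hsh : rder (fun s => RtoC (s - t)) s 1).
    { apply (deriv_eq _ _ _ (1 - 0)%C); [|ring].
      apply (deriv_ext RtoC (fun s => RtoC s - RtoC t)%C _ _ _ 1); [lra|intros; now rewrite RtoC_minus|].
      apply deriv_minus; [apply deriv_self|apply deriv_const]. }
    destruct (chart_psi _ _ _ _ _ _ _ _ HC (T yt + RtoC (s - t))%C) as [P1 [_ P3]].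
    { eapply Rle_lt_trans; [apply Cmod_triangle|]. rewrite Cmod_R. lra. }
    destruct (chart_f _ _ _ _ _ _ _ _ HC _ P1) as [_ [F2 [F3 _]]].
    assert (D : rder (fun s => psi (T yt + RtoC (s - t))%C) s (/ f (psi (T yt + RtoC (s - t))%C))%C).
    { apply (deriv_eq _ _ _ (/ f (psi (T yt + RtoC (s - t))%C) * (0 + 1))%C); [|ring].
      apply (deriv_comp RtoC (fun s => T yt + RtoC (s - t))%C psi); [|exact P3].
      apply deriv_plus; [apply deriv_const|exact Hsh]. }
    split; [exact D|]. split; [|exact K3].
    apply (cont_inv RtoC (fun s => f (psi (T yt + RtoC (s - t))%C))); [exact F2|].
    apply (cont_comp RtoC (fun s => psi (T yt + RtoC (s - t))%C) f); [eapply deriv_cont, D|exact F3]. }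
  assert (H0 : Rabs (t - t) < rho / 2) by (rewrite Rminus_diag, Rabs_R0; lra).
  assert (J0 := maxJ_0 c m x v0 E). fold Q in J0.
  destruct (traj_glue c m _ _ _ _ _ _ t (oint_maxJ Q x v0) (oint_ball t (rho / 2)) HTR K2 Jt H0)
    as [y [v [G1 [G2 G3]]]].
  { rewrite Rminus_diag. replace (T yt + RtoC 0)%C with (T yt) by ring. now rewrite Hps. }
  { rewrite Rminus_diag. replace (T yt + RtoC 0)%C with (T yt) by ring. now rewrite Hps. }
  exists (fun s => maxJ Q x v0 s \/ Rabs (s - t) < rho / 2), y, v.
  split; [apply (oint_union _ _ t); auto; [apply oint_maxJ|apply oint_ball]|].
  split; [left; exact J0|]. split; [right; rewrite Rabs_minus_sym; lra|]. split; [exact G1|].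
  destruct (G2 0 J0) as [A B]. rewrite A, B. unfold Q. now rewrite maxtraj_0.
Qed.

Lemma rder_glue (g1 g2 : R -> C) t l : rder g1 t l -> rder g2 t l -> g1 t = g2 t ->
  rder (fun s => if Rle_dec s t then g1 s else g2 s) t l.
Proof.
  intros H1 H2 E eps He. destruct (H1 eps He) as [d1 [Hd1 K1]]. destruct (H2 eps He) as [d2 [Hd2 K2]].
  exists (Rmin d1 d2). split; [now apply Rmin_pos|]. intros y Hy.
  assert (A := Rmin_l d1 d2). assert (B := Rmin_r d1 d2).
  destruct (Rle_dec t t) as [_|N]; [|lra]. destruct (Rle_dec y t) as [L|L].
  - apply K1. lra.
  - rewrite E. apply K2. lra.
Qed.


Lemma rcont_Cmod_pt (g : R -> C) t : rcont g t -> continuity_pt (fun s => Cmod (g s)) t.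
Proof.
  intros H e He. destruct (H e He) as [d [Hd H']]. exists d. split; [exact Hd|].
  intros y [_ Hy]. specialize (H' y). rewrite RtoC_dist in H'. specialize (H' Hy).
  unfold dist; simpl. unfold Rdist. eapply Rle_lt_trans; [|exact H'].
  apply Rabs_le. assert (A := Cmod_triangle_inv (g y) (g t)). assert (B := Cmod_triangle_inv (g t) (g y)).
  rewrite (Cmod_sub_sym (g t) (g y)) in B. lra.
Qed.

Lemma ivt_between (f : R -> R) a b y : a <= b -> (forall t, a <= t <= b -> continuity_pt f t) ->
  f a <= y <= f b \/ f b <= y <= f a -> exists t, a <= t <= b /\ f t = y.
Proof.
  intros Hab Hc Hy.
  destruct (Req_dec (f a) y) as [E|Na]; [exists a; split; [lra|exact E]|].
  destruct (Req_dec (f b) y) as [E|Nb]; [exists b; split; [lra|exact E]|].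
  assert (Hlt : a < b) by (destruct (Req_dec a b) as [-> | ]; [exfalso; lra|lra]).
  destruct Hy as [Hy|Hy].
  - destruct (IVT_interv (fun t => f t - y) a b) as [t [Ht Et]]; try lra.
    + intros t Ht. apply continuity_pt_minus; [now apply Hc|]. apply continuity_pt_const. now intros ? ?.
    + exists t. split; [exact Ht|lra].
  - destruct (IVT_interv (fun t => y - f t) a b) as [t [Ht Et]]; try lra.
    + intros t Ht. apply continuity_pt_minus; [|now apply Hc]. apply continuity_pt_const. now intros ? ?.
    + exists t. split; [exact Ht|lra].
Qed.

Lemma sqr_pos_real a : Im (a * a)%C = 0 -> 0 < Re (a * a)%C -> Im a = 0 /\ Re a <> 0.
Proof.
  destruct a as [x y]. simpl. intros H1 H2. assert (x * y = 0) by lra.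
  apply Rmult_integral in H. destruct H as [-> | ->]; [exfalso; nra|]. split; [easy|]. intros ->. lra.
Qed.

Lemma cluster_at (Y : R -> C) tau M (S : R -> Prop) :
  (forall d, 0 < d -> exists t, S t /\ Rabs (t - tau) < d) -> (forall t, S t -> Cmod (Y t) <= M) ->
  exists p, forall e, 0 < e -> exists t, S t /\ Rabs (t - tau) < e /\ Cmod (Y t - p)%C < e.
Proof.
  intros H HM.
  assert (H' : forall n : nat, exists t, S t /\ Rabs (t - tau) < / (INR n + 1)).
  { intros n. apply H. apply Rinv_0_lt_compat. assert (A := pos_INR n). lra. }
  set (u := fun n => proj1_sig (constructive_indefinite_description _ (H' n))).
  assert (Hu : forall n, S (u n) /\ Rabs (u n - tau) < / (INR n + 1)).
  { intros n. unfold u. apply proj2_sig. }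
  destruct (cluster_point (fun n => Y (u n)) M) as [p Hp].
  { intros n. apply HM, Hu. }
  exists p. intros e He. destruct (INR_unbounded (/ e)) as [N HN].
  destruct (Hp e N He) as [n [Hn Hn']]. exists (u n). destruct (Hu n) as [U1 U2].
  split; [exact U1|]. split; [|exact Hn'].
  apply Rlt_trans with (/ (INR n + 1)); [exact U2|]. rewrite <- (Rinv_inv e).
  apply Rinv_lt_contravar.
  - apply Rmult_lt_0_compat; [now apply Rinv_0_lt_compat|]. assert (A := pos_INR n). lra.
  - apply le_INR in Hn. lra.
Qed.

(** Concatenation when the arc runs towards [psi h2]; when it runs away from it, following the arc
    backwards it would stay on the chord and never reach its starting zero. *)
Lemma on_stokes_chord c m w s0 f T psi r rho h1 h2 : chart (peval c m) w s0 f T psi r rho ->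
  - rho < h1 -> h1 < h2 -> h2 < rho -> on_stokes c m (psi (RtoC h1)) -> on_stokes c m (psi (RtoC h2)).
Proof.
  intros HC L1 L12 L2 [b [gam [Tg [s1 [Harc [Hs1 [Hs1T Hg1]]]]]]].
  destruct Harc as [Hb [HTg [Hg0 [Hglim Hgd]]]].
  assert (Hr : forall h, -rho < h < rho -> Cmod (RtoC h) < rho) by (intros h Hh; rewrite Cmod_R; apply Rabs_def1; lra).
  assert (Hpsi : forall h, -rho < h < rho -> Cmod (psi (RtoC h) - w)%C < r /\ T (psi (RtoC h)) = RtoC h /\
     rder (fun h => psi (RtoC h)) h (/ f (psi (RtoC h)))%C /\ f (psi (RtoC h)) <> RtoC 0 /\
     (f (psi (RtoC h)) * f (psi (RtoC h)))%C = peval c m (psi (RtoC h))).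
  { intros h Hh. destruct (chart_psi _ _ _ _ _ _ _ _ HC _ (Hr h Hh)) as [A [B D]].
    destruct (chart_f _ _ _ _ _ _ _ _ HC _ A) as [F1 [F2 _]].
    split; [exact A|]. split; [exact B|]. split; [|now split].
    apply (deriv_eq _ _ _ (/ f (psi (RtoC h)) * 1)%C); [|ring].
    apply (deriv_comp RtoC RtoC psi); [apply deriv_self|exact D]. }
  assert (HQ0 : forall h, -rho < h < rho -> psi (RtoC h) <> b).
  { intros h Hh E. destruct (Hpsi h Hh) as [_ [_ [_ [N E2]]]]. rewrite E, Hb in E2.
    assert (f b <> RtoC 0) by (rewrite <- E; exact N). apply (Cmult_neq_0 _ _ H H E2). }
  assert (Hs1' : 0 < s1).
  { destruct Hs1 as [L|L]; [exact L|]. exfalso. apply (HQ0 h1); [lra|]. now rewrite <- Hg1, <- L. }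
  assert (Haux : forall s, 0 < s -> Rbar_lt s Tg -> Cmod (gam s - w)%C < r -> exists d,
     rder gam s d /\ Im (peval c m (gam s) * (d * d))%C = 0 /\ 0 < Re (peval c m (gam s) * (d * d))%C /\
     Im (f (gam s) * d)%C = 0 /\ Re (f (gam s) * d)%C <> 0 /\
     rder (fun s => T (gam s)) s (f (gam s) * d)%C).
  { intros s Hs HsT Hsr. destruct (Hgd s Hs HsT) as [d [D1 [D2 D3]]]. apply rderiv_is_rder in D1.
    destruct (chart_f _ _ _ _ _ _ _ _ HC _ Hsr) as [F1 [_ [_ F4]]].
    exists d. split; [exact D1|]. split; [exact D2|]. split; [exact D3|].
    assert (E : (f (gam s) * d * (f (gam s) * d))%C = (peval c m (gam s) * (d * d))%C) by (rewrite <- F1; ring).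
    destruct (sqr_pos_real (f (gam s) * d)%C) as [A B]; [now rewrite E|now rewrite E|].
    split; [exact A|]. split; [exact B|]. now apply (deriv_comp RtoC gam T). }
  assert (Hr1 : Cmod (gam s1 - w)%C < r) by (rewrite Hg1; apply Hpsi; lra).
  destruct (Haux s1 Hs1' Hs1T Hr1) as [d1 [D1 [DI [DR [D2 [D3 D4]]]]]].
  assert (Ha : (f (gam s1) * d1)%C = RtoC (Re (f (gam s1) * d1)%C)) by (apply C_ext; simpl; auto).
  set (lam := Re (f (gam s1) * d1)%C) in *.
  destruct (Rlt_le_dec 0 lam) as [Hl|Hl].
  - set (line := fun s => psi (RtoC (h1 + lam * (s - s1)))).
    exists b, (fun s => if Rle_dec s s1 then gam s else line s), (s1 + (rho - h1) / lam), (s1 + (h2 - h1) / lam).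
    assert (Hline : forall s, -rho < h1 + lam * (s - s1) < rho -> rder line s (/ f (line s) * RtoC lam)%C).
    { intros s Hs. destruct (Hpsi _ Hs) as [_ [_ [H _]]].
      apply (deriv_eq _ _ _ (/ f (line s) * (1 * RtoC lam))%C); [|ring].
      apply (deriv_comp RtoC (fun s => RtoC (h1 + lam * (s - s1))) psi).
      - apply (deriv_eq _ _ _ (0 + RtoC lam * (1 - 0))%C); [|ring].
        apply (deriv_ext RtoC (fun s => RtoC h1 + RtoC lam * (RtoC s - RtoC s1))%C _ _ _ 1); [lra| |].
        { intros y _. now rewrite RtoC_plus, RtoC_mult, RtoC_minus. }
        apply deriv_plus; [apply deriv_const|]. apply deriv_scal.
        apply deriv_minus; [apply deriv_self|apply deriv_const].
      - destruct (chart_psi _ _ _ _ _ _ _ _ HC _ (Hr _ Hs)) as [A [B D]].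
        apply (deriv_eq _ _ _ (/ f (line s))%C); [exact D|ring]. }
    assert (P1 : 0 < (rho - h1) / lam) by (apply Rdiv_lt_0_compat; lra).
    assert (P2 : 0 < (h2 - h1) / lam) by (apply Rdiv_lt_0_compat; lra).
    split; [split; [exact Hb|split; [|split; [|split]]]|split; [lra|split]].
    + simpl. lra.
    + destruct (Rle_dec 0 s1); [exact Hg0|lra].
    + rewrite filterlim_at_right_eps in *. intros e He. destruct (Hglim e He) as [d [Hd H]].
      exists (Rmin d s1). split; [now apply Rmin_pos|]. intros t Ht.
      assert (A := Rmin_l d s1). assert (B := Rmin_r d s1).
      destruct (Rle_dec t s1); [apply H; lra|lra].
    + intros s Hs HsT. simpl in HsT.
      destruct (Rtotal_order s s1) as [L | [-> | L]].
      * assert (HsT' : Rbar_lt s Tg) by (apply (Rbar_lt_trans s s1); [exact L|exact Hs1T]).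
        destruct (Hgd s Hs HsT') as [d [K1 K2]]. exists d. destruct (Rle_dec s s1); [|lra]. split; [|exact K2].
        apply rderiv_is_rder. apply rderiv_is_rder in K1.
        apply (deriv_ext RtoC gam _ _ _ (s1 - s)); [lra| |exact K1]. intros y Hy. rewrite RtoC_dist in Hy.
        apply Rabs_def2 in Hy. destruct (Rle_dec y s1); [easy|lra].
      * exists d1. assert (Els : line s1 = gam s1).
        { unfold line. rewrite Hg1, Rminus_diag, Rmult_0_r, Rplus_0_r. reflexivity. }
        split.
        -- apply rderiv_is_rder. apply rder_glue; [exact D1| |now rewrite Els].
           apply (deriv_eq _ _ _ (/ f (line s1) * RtoC lam)%C).
           { apply Hline. rewrite Rminus_diag. lra. }
           rewrite Els, <- Ha. field. rewrite Hg1. apply Hpsi. lra.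
        -- destruct (Rle_dec s1 s1); [|lra]. now split.
      * assert (Hb' : -rho < h1 + lam * (s - s1) < rho).
        { split; [nra|]. apply Rmult_lt_reg_r with (/ lam); [now apply Rinv_0_lt_compat|].
          apply Rplus_lt_reg_r with (- (h1 / lam)). apply Rplus_lt_reg_r with s1.
          replace ((h1 + lam * (s - s1)) * / lam + - (h1 / lam) + s1) with s by (field; lra).
          replace (rho * / lam + - (h1 / lam) + s1) with (s1 + (rho - h1) / lam) by (field; lra). exact HsT. }
        exists (/ f (line s) * RtoC lam)%C. destruct (Rle_dec s s1); [lra|]. split.
        -- apply rderiv_is_rder. apply (deriv_ext RtoC line _ _ _ (s - s1)); [lra| |now apply Hline].
           intros y Hy. rewrite RtoC_dist in Hy. apply Rabs_def2 in Hy. destruct (Rle_dec y s1); [lra|easy].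
        -- destruct (Hpsi _ Hb') as [_ [_ [_ [F2 F1]]]]. fold (line s) in F1, F2.
           replace (peval c m (line s) * (/ f (line s) * RtoC lam * (/ f (line s) * RtoC lam)))%C with (RtoC (lam * lam)).
           { simpl. split; [easy|nra]. }
           rewrite <- F1, RtoC_mult. field. exact F2.
    + simpl. apply Rplus_lt_compat_l. apply Rmult_lt_compat_r; [now apply Rinv_0_lt_compat|lra].
    + destruct (Rle_dec (s1 + (h2 - h1) / lam) s1) as [L|L]; [lra|]. unfold line.
      do 2 f_equal. field. lra.
  - assert (Hl' : lam < 0) by lra. apply NNPP. intros Hn2.
    assert (Hgc : forall u, 0 <= u < s1 -> rcont gam (s1 - u)).
    { intros u Hu. assert (HsT' : Rbar_lt (s1 - u) Tg).
      { apply (Rbar_le_lt_trans _ s1); [simpl; lra|exact Hs1T]. }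
      destruct (Hgd (s1 - u) ltac:(lra) HsT') as [d [K1 _]]. apply rderiv_is_rder in K1.
      eapply deriv_cont, K1. }
    (* Followed backwards, the arc stays at chord points with [h1 <= h < h2]. It cannot reach [h2]
       by [Hn2], and it cannot return to [h1] by Rolle, because the derivative of [Re (T (gam s))]
       vanishes nowhere. *)
    assert (HP : forall u, 0 <= u <= s1 -> exists h, h1 <= h < h2 /\ gam (s1 - u) = psi (RtoC h)).
    { apply real_induction.
      - lra.
      - exists h1. rewrite Rminus_0_r. split; [lra|exact Hg1].
      - intros u Hu Hprev. destruct (Hprev u) as [h [Hh Eh]]; [lra|].
        assert (Hh' : -rho < h < rho) by lra.
        destruct (Hpsi h Hh') as [A1 [A2 _]].
        destruct (Hgc u Hu (r - Cmod (psi (RtoC h) - w)%C)) as [e1 [He1 K1]]; [lra|].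
        set (e2 := Rmin e1 (s1 - u)). assert (He2 : 0 < e2) by (apply Rmin_pos; lra).
        assert (M1 : e2 <= e1) by apply Rmin_l. assert (M2 : e2 <= s1 - u) by apply Rmin_r.
        assert (Hnear : forall s, s1 - u - e2 < s <= s1 - u -> 0 < s /\ Rbar_lt s Tg /\ Cmod (gam s - w)%C < r).
        { intros s Hs. split; [lra|]. split; [apply (Rbar_le_lt_trans _ s1); [simpl; lra|exact Hs1T]|].
          specialize (K1 s). rewrite RtoC_dist, Rabs_left1 in K1 by lra. specialize (K1 ltac:(lra)).
          rewrite Eh in K1. assert (Tr := Cmod_sub_triangle (gam s) (psi (RtoC h)) w). lra. }
        assert (Hreal : forall s, s1 - u - e2 < s <= s1 - u -> Im (T (gam s)) = 0).
        { intros s Hs. destruct (Req_dec s (s1 - u)) as [-> | Hne]; [rewrite Eh, A2; reflexivity|].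
          set (dd := fun t => epsilon (inhabits (RtoC 0)) (fun d => rder (fun s => T (gam s)) t d /\ Im d = 0)).
          assert (Hdd : forall t, s1 - u - e2 < t <= s1 - u -> rder (fun s => T (gam s)) t (dd t) /\ Im (dd t) = 0).
          { intros t Ht. destruct (Hnear t Ht) as [N1 [N2 N3]].
            destruct (Haux t N1 N2 N3) as [d [_ [_ [_ [B1 [_ B2]]]]]].
            apply (epsilon_spec (inhabits (RtoC 0)) (fun d => rder (fun s => T (gam s)) t d /\ Im d = 0)).
            exists (f (gam t) * d)%C. now split. }
          destruct (MVT_real (fun t => Im (T (gam t))) (fun t => Im (dd t)) s (s1 - u)) as [x [Hx Ex]]; [lra| |].
          { intros t Ht. apply rder_Im. apply Hdd. lra. }
          rewrite (proj2 (Hdd x ltac:(lra))), Eh, A2 in Ex. simpl in Ex. lra. }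
        destruct (Hnear (s1 - u) ltac:(lra)) as [N1 [N2 N3]].
        destruct (Haux (s1 - u) N1 N2 N3) as [d [_ [_ [_ [B1 [B2 B3]]]]]].
        assert (HTc := deriv_cont _ _ _ _ B3).
        assert (Hstep : forall e3, 0 < e3 -> exists d3, 0 < d3 /\ forall s, s1 - u - d3 < s < s1 - u ->
          s1 - u - e2 < s /\ Rabs (Re (T (gam s)) - h) < e3 /\ Cmod (T (gam s)) < rho /\
          gam s = psi (RtoC (Re (T (gam s))))).
        { intros e3 He3. destruct (HTc (Rmin e3 (rho - Rabs h))) as [d3 [Hd3 K3]].
          { apply Rmin_pos; [exact He3|]. assert (Rabs h < rho) by (apply Rabs_def1; lra). lra. }
          exists (Rmin d3 e2). split; [now apply Rmin_pos|]. intros s Hs.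
          assert (Q1 := Rmin_l d3 e2). assert (Q2 := Rmin_r d3 e2).
          assert (Q3 := Rmin_l e3 (rho - Rabs h)). assert (Q4 := Rmin_r e3 (rho - Rabs h)).
          specialize (K3 s). rewrite RtoC_dist, Rabs_left1 in K3 by lra. specialize (K3 ltac:(lra)).
          cbv beta in K3. rewrite Eh, A2 in K3.
          assert (Cl : Cmod (T (gam s)) < rho).
          { assert (Tr := Cmod_triangle_inv (T (gam s)) (RtoC h)). rewrite Cmod_R in Tr. lra. }
          split; [lra|]. split; [|split; [exact Cl|]].
          - assert (Q5 := re_le_Cmod (T (gam s) - RtoC h)%C).
            replace (Re (T (gam s) - RtoC h)%C) with (Re (T (gam s)) - h) in Q5 by (destruct (T (gam s)); reflexivity). lra.
          - assert (EQ : T (gam s) = RtoC (Re (T (gam s)))).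
            { apply C_ext; simpl; [easy|]. apply Hreal. lra. }
            rewrite <- EQ. symmetry. apply (chart_inv _ _ _ _ _ _ _ _ HC); [|exact Cl]. apply Hnear. lra. }
        destruct (Req_dec h h1) as [Eh1|Nh1].
        + destruct (Req_dec u 0) as [Eu|Nu].
          * subst u h. rewrite Rminus_0_r in *.
            destruct (D4 (- lam / 2)) as [d4 [Hd4 K4]]; [lra|].
            destruct (Hstep (h2 - h1)) as [d3 [Hd3 K3]]; [lra|].
            exists (Rmin d3 d4). split; [now apply Rmin_pos|]. intros t Ht _.
            assert (Q1 := Rmin_l d3 d4). assert (Q2 := Rmin_r d3 d4).
            destruct (K3 (s1 - t)) as [_ [R1 [_ R2]]]; [lra|].
            exists (Re (T (gam (s1 - t)))). split; [|exact R2].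
            apply Rabs_def2 in R1. split; [|lra].
            specialize (K4 (s1 - t)). rewrite RtoC_dist in K4.
            replace (s1 - t - s1) with (- t) in K4 by ring. rewrite Rabs_Ropp, Rabs_pos_eq in K4 by lra.
            specialize (K4 ltac:(lra)). assert (Q3 := re_le_Cmod (T (gam (s1 - t)%R) - T (gam s1) - f (gam s1) * d1 * (RtoC (s1 - t)%R - RtoC s1))%C).
            rewrite Ha in K4, Q3. rewrite Eh, A2 in K4, Q3.
            replace (Re (T (gam (s1 - t)%R) - RtoC h1 - RtoC lam * (RtoC (s1 - t)%R - RtoC s1))%C) with
              (Re (T (gam (s1 - t))) - h1 - lam * (- t)) in Q3 by (destruct (T (gam (s1 - t))); simpl; ring).
            assert (Q5 : Rabs (Re (T (gam (s1 - t))) - h1 - lam * (- t)) <= - lam / 2 * t) by lra.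
            apply Rabs_le_between in Q5. nra.
          * exfalso.
            set (dd := fun t => epsilon (inhabits (RtoC 0)) (fun d => rder (fun s => T (gam s)) t d /\ Re d <> 0)).
            assert (Hdd : forall t, s1 - u <= t <= s1 -> rder (fun s => T (gam s)) t (dd t) /\ Re (dd t) <> 0).
            { intros t Ht. destruct (Hprev (s1 - t)) as [h' [Hh1 Eh']]; [lra|].
              replace (s1 - (s1 - t)) with t in Eh' by ring.
              destruct (Haux t) as [d' [_ [_ [_ [_ [C2 C3]]]]]]; [lra| |rewrite Eh'; apply Hpsi; lra|].
              - apply (Rbar_le_lt_trans _ s1); [simpl; lra|exact Hs1T].
              - apply (epsilon_spec (inhabits (RtoC 0)) (fun d => rder (fun s => T (gam s)) t d /\ Re d <> 0)).
                exists (f (gam t) * d')%C. now split. }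
            destruct (MVT_real (fun t => Re (T (gam t))) (fun t => Re (dd t)) (s1 - u) s1) as [x [Hx Ex]]; [lra| |].
            { intros t Ht. apply rder_Re. now apply Hdd. }
            rewrite Eh, A2, Hg1 in Ex. rewrite (proj1 (proj2 (Hpsi h1 ltac:(lra)))) in Ex. rewrite Eh1 in Ex.
            assert (Hx2 := proj2 (Hdd x ltac:(lra))). apply Hx2.
            apply Rmult_eq_reg_r with (s1 - (s1 - u)); [|lra]. simpl in Ex. lra.
        + destruct (Hstep (Rmin (h - h1) (h2 - h))) as [d3 [Hd3 K3]]; [apply Rmin_pos; lra|].
          exists d3. split; [exact Hd3|]. intros t Ht _. destruct (K3 (s1 - t)) as [_ [R1 [_ R2]]]; [lra|].
          exists (Re (T (gam (s1 - t)))). split; [|exact R2].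
          assert (Q1 := Rmin_l (h - h1) (h2 - h)). assert (Q2 := Rmin_r (h - h1) (h2 - h)).
          apply Rabs_def2 in R1. lra.
      - intros u Hu Hprev.
        assert (Hlim : forall e, 0 < e -> exists d, 0 < d /\ forall t, u - d < t < u -> 0 <= t -> Cmod (gam (s1 - t)%R - gam (s1 - u)%R)%C < e).
        { intros e He. destruct (Req_dec u s1) as [Eu|Nu].
          - rewrite Eu, Rminus_diag, Hg0. rewrite filterlim_at_right_eps in Hglim.
            destruct (Hglim e He) as [d [Hd H]]. exists d. split; [exact Hd|]. intros t Ht _. apply H. lra.
          - destruct (Hgc u ltac:(lra) e He) as [d [Hd H]]. exists d. split; [exact Hd|]. intros t Ht _.
            apply H. rewrite RtoC_dist, Rabs_pos_eq; lra. }
        set (hh := fun t => epsilon (inhabits 0) (fun h => h1 <= h < h2 /\ gam (s1 - t) = psi (RtoC h))).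
        assert (Hhh : forall t, 0 <= t < u -> h1 <= hh t < h2 /\ gam (s1 - t) = psi (RtoC (hh t))).
        { intros t Ht. apply (epsilon_spec (inhabits 0) (fun h => h1 <= h < h2 /\ gam (s1 - t) = psi (RtoC h))).
          now apply Hprev. }
        destruct (cluster_at (fun t => RtoC (hh t)) u (Rabs h1 + Rabs h2) (fun t => 0 <= t < u)) as [p Hp].
        { intros d Hd. exists (Rmax 0 (u - d / 2)). assert (Q1 := Rmax_l 0 (u - d / 2)). assert (Q2 := Rmax_r 0 (u - d / 2)).
          assert (Rmax 0 (u - d / 2) < u) by (apply Rmax_lub_lt; lra). split; [lra|].
          rewrite Rabs_left; lra. }
        { intros t Ht. destruct (Hhh t Ht) as [Q1 _]. rewrite Cmod_R.
          assert (A := Rle_abs h2). assert (B := Rle_abs (- h1)). rewrite Rabs_Ropp in B.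
          assert (A' := Rabs_pos h2). assert (B' := Rabs_pos h1). apply Rabs_le. lra. }
        assert (Hpim : Im p = 0).
        { apply Rabs_eq_0. apply Rle_antisym; [|apply Rabs_pos]. apply Rnot_lt_le. intros L.
          destruct (Hp _ L) as [t [_ [_ Q]]]. assert (Q2 := im_le_Cmod (RtoC (hh t) - p)%C).
          replace (Im (RtoC (hh t) - p)%C) with (- Im p) in Q2 by (destruct p; simpl; ring).
          rewrite Rabs_Ropp in Q2. lra. }
        assert (Hpre : h1 <= Re p <= h2).
        { assert (Q : forall e, 0 < e -> h1 - e <= Re p <= h2 + e).
          { intros e He. destruct (Hp e He) as [t [Ht [_ Q]]]. assert (Q2 := re_le_Cmod (RtoC (hh t) - p)%C).
            replace (Re (RtoC (hh t) - p)%C) with (hh t - Re p) in Q2 by (destruct p; simpl; ring).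
            destruct (Hhh t Ht) as [Q3 _]. assert (Q4 : Rabs (hh t - Re p) < e) by lra.
            apply Rabs_def2 in Q4. lra. }
          split; apply Rnot_lt_le; intros L.
          - destruct (Q ((h1 - Re p) / 2)); lra.
          - destruct (Q ((Re p - h2) / 2)); lra. }
        assert (Ep : p = RtoC (Re p)) by (apply C_ext; simpl; auto).
        assert (Hlimit : gam (s1 - u) = psi (RtoC (Re p))).
        { apply Cmod_small_eq. intros e He.
          destruct (Hpsi (Re p)) as [_ [_ [D _]]]; [lra|].
          destruct (chart_psi _ _ _ _ _ _ _ _ HC (RtoC (Re p))) as [_ [_ Dp]]; [apply Hr; lra|].
          destruct (deriv_cont _ _ _ _ Dp (e / 2)) as [d1' [Hd1' K1]]; [lra|].
          destruct (Hlim (e / 2)) as [d2 [Hd2 K2]]; [lra|].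
          destruct (Hp (Rmin d1' d2)) as [t [Ht [Q1 Q2]]]; [now apply Rmin_pos|].
          assert (Q3 := Rmin_l d1' d2). assert (Q4 := Rmin_r d1' d2).
          destruct (Hhh t Ht) as [_ Q5]. rewrite Ep in Q2. specialize (K1 (RtoC (hh t)) ltac:(lra)).
          apply Rabs_def2 in Q1. specialize (K2 t ltac:(lra) ltac:(lra)). rewrite Q5 in K2.
          assert (Tr := Cmod_sub_triangle (gam (s1 - u)) (psi (RtoC (hh t))) (psi (RtoC (Re p)))).
          rewrite (Cmod_sub_sym (gam (s1 - u)) (psi (RtoC (hh t)))) in Tr. lra. }
        exists (Re p). split; [|exact Hlimit]. split; [lra|].
        destruct (Req_dec (Re p) h2) as [E2|N2]; [|lra]. exfalso. apply Hn2. rewrite <- E2, <- Hlimit.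
        exists b, gam, Tg, (s1 - u). split; [now repeat split|]. split; [lra|]. split; [|reflexivity].
        apply (Rbar_le_lt_trans _ s1); [simpl; lra|exact Hs1T]. }
    (* At [u = s1] the arc is at its starting zero [b], whereas every chord point is regular. *)
    destruct (HP s1) as [h [Hh Eh]]; [lra|]. rewrite Rminus_diag, Hg0 in Eh. apply (HQ0 h); [lra|easy].
Qed.

(** Membership passes along chords of charts in both directions, the second one by [chart_opp], so
    it is locally constant in the parameter. A trajectory therefore meets the Stokes curves entirely
    or not at all. *)
Lemma on_stokes_traj c m J y v s t : oint J -> traj (peval c m) J y v -> J s -> J t ->
  on_stokes c m (y s) -> on_stokes c m (y t).
Proof.
  intros HJ HT Js Jt Hs.
  apply (locally_const (fun t => on_stokes c m (y t)) J) with s; auto; [|apply HJ].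
  clear s t Js Jt Hs. intros t0 Jt0.
  destruct (traj_at_chart c m J y v t0 HT Jt0 1 Rlt_0_1) as [f [T [psi [r [rho [HC _]]]]]].
  assert (P0 := chart_psi0 _ _ _ _ _ _ _ _ HC). assert (R0 := chart_rho _ _ _ _ _ _ _ _ HC).
  assert (F0 := chart_f0 _ _ _ _ _ _ _ _ HC).
  destruct (traj_chart _ _ _ _ _ _ _ _ J y v t0 0 HC HJ HT Jt0) as [d [Hd K]].
  { now rewrite Cmod_0. } { easy. } { now rewrite P0, F0, Cinv_inv. }
  exists d. split; [exact Hd|]. intros s t _ _ Hs Ht Hst.
  destruct (K s Hs) as [_ [Ks [Es _]]]. destruct (K t Ht) as [_ [Kt [Et _]]].
  rewrite Cplus_0_l in Es, Et, Ks, Kt. rewrite Cmod_R in Ks, Kt.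
  apply Rabs_def2 in Ks. apply Rabs_def2 in Kt. rewrite Es in Hst. rewrite Et.
  destruct (Rtotal_order (s - t0) (t - t0)) as [L | [L | L]].
  - apply (on_stokes_chord _ _ _ _ _ _ _ _ _ (s - t0) (t - t0) HC); auto; lra.
  - now rewrite <- L.
  - apply chart_opp in HC.
    assert (H := on_stokes_chord _ _ _ _ _ _ _ _ _ (- (s - t0)) (- (t - t0)) HC). cbv beta in H.
    rewrite <- !RtoC_opp, !Ropp_involutive in H. apply H; auto; lra.
Qed.

(** * Completeness of the trajectories off the Stokes curves *)

Lemma isolated_zero c m b : is_poly_deg c m ->
  exists r, 0 < r /\ forall y, 0 < Cmod (y - b)%C < r -> peval c m y <> RtoC 0.
Proof.
  intros Hp. destruct (peval_shift c m b) as [c' Hc'].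
  destruct (peval_factor c' m) as [k [n [c2 [Hc2 Hfac]]]].
  { destruct (poly_nonzero c m Hp) as [x Hx]. exists (x - b)%C. rewrite <- Hc'.
    replace (b + (x - b))%C with x by ring. exact Hx. }
  destruct (peval_smooth c2 n) as [R1 [R2 HR]].
  destruct (HR (RtoC 0)) as [D _].
  destruct (cont_neq (fun z : C => z) (peval c2 n) (fun _ => RtoC 0) 0) as [d [Hd H]].
  - eapply deriv_cont, D.
  - apply cont_const.
  - rewrite peval_0. exact Hc2.
  - exists d. split; [exact Hd|]. intros y [Hy1 Hy2].
    replace y with (b + (y - b))%C by ring. rewrite Hc', Hfac. apply Cmult_neq_0.
    + apply cpow_neq_0. apply Cmod_gt_0. exact Hy1.
    + apply H. rewrite Cmod_cut. exact Hy2.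
Qed.

Lemma traj_speed Q J y v t : traj Q J y v -> J t -> Cmod (v t) * Cmod (v t) * Cmod (Q (y t)) = 1.
Proof. intros H Jt. destruct (H t Jt) as [_ [_ E]]. rewrite <- !Cmod_mult, E. apply Cmod_1. Qed.

(** The speed is [|Q|^(-1/2)], which is bounded outside a disc, so a trajectory cannot escape to
    infinity in finite time. *)
Lemma traj_bounded c m J y v tau : is_poly_deg c m -> traj (peval c m) J y v ->
  0 < tau -> (forall t, 0 <= t < tau -> J t) -> exists M, forall t, 0 <= t < tau -> Cmod (y t) <= M.
Proof.
  intros Hp HT Htau HJ. destruct (poly_growth c m Hp) as [c1 [R0 [Hc1 [HR0 Hg]]]].
  (* A bound for [c1^(-1/2)] that spares the square root. *)
  set (K := 1 + / c1). assert (Hic : 0 < / c1) by now apply Rinv_0_lt_compat.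
  assert (Hsp : forall t, J t -> R0 <= Cmod (y t) -> Cmod (v t) <= K).
  { intros t Jt Ht. assert (E := traj_speed _ _ _ _ _ HT Jt). specialize (Hg _ Ht).
    assert (H1 : 1 <= (1 + Cmod (y t)) ^ m) by (apply pow_R1_Rle; assert (A := Cmod_ge_0 (y t)); lra).
    assert (Hq : c1 <= Cmod (peval c m (y t))) by nra.
    assert (Hv := Cmod_ge_0 (v t)). apply Rnot_lt_le. intros L. unfold K in L.
    assert (1 < Cmod (v t)) by lra.
    assert (1 / c1 < Cmod (v t) * Cmod (v t)) by nra.
    assert (c1 * (1 / c1) = 1) by (field; lra). nra. }
  set (R1 := Rmax R0 (Cmod (y 0))). assert (A1 : R0 <= R1) by apply Rmax_l. assert (A2 : Cmod (y 0) <= R1) by apply Rmax_r.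
  exists (R1 + 1 + K * tau). intros t Ht.
  assert (H : forall s, 0 <= s <= t -> Cmod (y s) <= R1 + 1 + K * s).
  { apply real_induction.
    - lra.
    - lra.
    - intros s Hs Hprev. specialize (Hprev s ltac:(lra)).
      assert (Js : J s) by (apply HJ; lra). destruct (HT s Js) as [D _].
      assert (Hc := deriv_cont _ _ _ _ D).
      destruct (Rlt_le_dec (Cmod (y s)) (R1 + 1)) as [L|L].
      + destruct (Hc (R1 + 1 - Cmod (y s))) as [d [Hd H]]; [lra|]. exists d. split; [exact Hd|].
        intros u Hu _. specialize (H u). rewrite RtoC_dist, Rabs_pos_eq in H by lra. specialize (H ltac:(lra)).
        assert (T := Cmod_triangle_inv (y u) (y s)). unfold K. nra.
      + destruct (Hc 1 Rlt_0_1) as [d [Hd H]]. exists d. split; [exact Hd|].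
        intros u Hu Hut. assert (M : Cmod (y u - y s)%C <= K * (u - s)).
        { apply MVT_rder with v; [lra| |].
          - intros x Hx. apply HT, HJ. lra.
          - intros x Hx. apply Hsp; [apply HJ; lra|]. specialize (H x). rewrite RtoC_dist, Rabs_pos_eq in H by lra.
            specialize (H ltac:(lra)). assert (T := Cmod_triangle_inv (y s) (y x)).
            rewrite Cmod_sub_sym in T. lra. }
        assert (T := Cmod_triangle_inv (y u) (y s)). lra.
    - intros s Hs Hprev. apply Rnot_lt_le. intros L.
      destruct (HT s (HJ s ltac:(lra))) as [D _].
      destruct (deriv_cont _ _ _ _ D (Cmod (y s) - (R1 + 1 + K * s))) as [d [Hd H]]; [lra|].
      set (u := Rmax 0 (s - d / 2)). assert (U1 : 0 <= u) by apply Rmax_l. assert (U2 : s - d / 2 <= u) by apply Rmax_r.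
      assert (U3 : u < s) by (apply Rmax_lub_lt; lra).
      specialize (H u). rewrite RtoC_dist, Rabs_left in H by lra. specialize (H ltac:(lra)).
      specialize (Hprev u ltac:(lra)). assert (T := Cmod_triangle_inv (y s) (y u)).
      rewrite (Cmod_sub_sym (y s) (y u)) in T. unfold K in *. nra. }
  specialize (H t ltac:(lra)). unfold K in *. nra.
Qed.

(** Cluster values at [tau] are zeros of [Q] by [maxtraj_extend]. If the trajectory did not converge
    to one of them, [b], it would cross a small circle about [b] at times accumulating at [tau], and
    the circle would contain another zero; but zeros are isolated. *)
Lemma maxtraj_escape c m x v0 tau : is_poly_deg c m -> (v0 * v0 * peval c m x)%C = RtoC 1 -> 0 < tau ->
  (forall t, 0 <= t < tau -> maxJ (peval c m) x v0 t) -> ~ maxJ (peval c m) x v0 tau ->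
  exists b, peval c m b = RtoC 0 /\ forall e, 0 < e -> exists d, 0 < d /\
    forall t, tau - d < t < tau -> 0 <= t -> Cmod (maxY (peval c m) x v0 t - b)%C < e.
Proof.
  intros Hp E Htau HJ Hn. set (Y := maxY (peval c m) x v0).
  assert (HT := maxtraj_traj c m x v0). fold Y in HT.
  destruct (traj_bounded c m _ _ _ tau Hp HT Htau HJ) as [M HM].
  assert (Hzero : forall (S : R -> Prop), (forall t, S t -> 0 <= t < tau) ->
     (forall d, 0 < d -> exists t, S t /\ Rabs (t - tau) < d) ->
     exists p, peval c m p = RtoC 0 /\ forall e, 0 < e -> exists t, S t /\ Rabs (t - tau) < e /\ Cmod (Y t - p)%C < e).
  { intros S HS1 HS2. destruct (cluster_at Y tau M S HS2) as [p Hpc].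
    { intros t Ht. apply HM, HS1, Ht. }
    exists p. split; [|exact Hpc]. apply NNPP. intros Hq. apply Hn.
    apply (maxtraj_extend c m x v0 p tau E Hq). intros e He. destruct (Hpc e He) as [t [Ht [B1 B2]]].
    exists t. split; [apply HJ, HS1, Ht|]. now split. }
  destruct (Hzero (fun t => 0 <= t < tau)) as [b [Hb Hbc]]; [auto| |].
  { intros d Hd. exists (Rmax 0 (tau - d / 2)). assert (U1 := Rmax_l 0 (tau - d / 2)). assert (U2 := Rmax_r 0 (tau - d / 2)).
    assert (U3 : Rmax 0 (tau - d / 2) < tau) by (apply Rmax_lub_lt; lra). split; [lra|]. rewrite Rabs_left; lra. }
  exists b. split; [exact Hb|]. intros e He. apply NNPP. intros Hno.
  destruct (isolated_zero c m b Hp) as [r [Hr Hiso]].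
  set (e' := Rmin e r / 2). assert (M1 := Rmin_l e r). assert (M2 := Rmin_r e r).
  assert (M3 : 0 < Rmin e r) by now apply Rmin_pos. assert (He' : 0 < e') by (unfold e'; lra).
  destruct (Hzero (fun t => 0 <= t < tau /\ Cmod (Y t - b)%C = e')) as [p [Hp0 Hpc]]; [tauto| |].
  - intros d Hd.
    assert (Hfar : exists t1, tau - Rmin d tau < t1 < tau /\ 0 <= t1 /\ e <= Cmod (Y t1 - b)%C).
    { apply NNPP. intros H. apply Hno. exists (Rmin d tau). split; [now apply Rmin_pos|].
      intros t Ht Ht0. apply Rnot_le_lt. intros L. apply H. exists t. now split. }
    destruct Hfar as [t1 [Ht1 [Ht10 Hf1]]].
    destruct (Hbc (Rmin (Rmin d tau) e')) as [t2 [Ht2 [Hd2 Hc2]]]; [repeat apply Rmin_pos; lra|].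
    assert (N1 := Rmin_l (Rmin d tau) e'). assert (N2 := Rmin_r (Rmin d tau) e').
    assert (N3 := Rmin_l d tau). apply Rabs_def2 in Hd2.
    destruct (ivt_between (fun t => Cmod (Y t - b)%C) (Rmin t1 t2) (Rmax t1 t2) e') as [t [Ht Et]].
    + apply Rle_trans with t1; [apply Rmin_l|apply Rmax_l].
    + intros t Ht. assert (Jt : 0 <= t < tau).
      { split; [apply Rle_trans with (Rmin t1 t2); [apply Rmin_glb; lra|lra]|].
        apply Rle_lt_trans with (Rmax t1 t2); [lra|apply Rmax_lub_lt; lra]. }
      apply (rcont_Cmod_pt (fun t => Y t - b)%C). destruct (HT t (HJ t Jt)) as [D _].
      eapply deriv_cont. apply (deriv_minus RtoC Y (fun _ => b)); [exact D|apply deriv_const].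
    + unfold e' in *. destruct (Rle_dec t1 t2) as [L|L].
      * rewrite Rmin_left, Rmax_right by lra. right. lra.
      * rewrite Rmin_right, Rmax_left by lra. left. lra.
    + exists t. assert (B1 : Rmin t1 t2 <= t <= Rmax t1 t2) by exact Ht.
      assert (B2 : tau - Rmin d tau < t < tau).
      { split; [apply Rlt_le_trans with (Rmin t1 t2); [apply Rmin_glb_lt; lra|lra]|].
        apply Rle_lt_trans with (Rmax t1 t2); [lra|apply Rmax_lub_lt; lra]. }
      assert (N4 := Rmin_r d tau).
      split; [split; [lra|exact Et]|]. rewrite Rabs_left; lra.
  - assert (Hpb : Cmod (p - b)%C = e').
    { apply Rle_antisym; apply Rnot_lt_le; intros L.
      - destruct (Hpc (Cmod (p - b)%C - e')) as [t [[_ Et] [_ D]]]; [lra|].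
        assert (T := Cmod_sub_triangle p (Y t) b). rewrite (Cmod_sub_sym p (Y t)) in T. lra.
      - destruct (Hpc (e' - Cmod (p - b)%C)) as [t [[_ Et] [_ D]]]; [lra|].
        assert (T := Cmod_sub_triangle (Y t) p b). lra. }
    apply (Hiso p); [unfold e' in *; lra|exact Hp0].
Qed.

(** A trajectory that stops in finite time runs into a zero; read backwards from there it is a
    Stokes arc, and [on_stokes_traj] puts [x] on a Stokes curve. *)
Lemma maxJ_forward c m x v0 : is_poly_deg c m -> (v0 * v0 * peval c m x)%C = RtoC 1 ->
  ~ on_stokes c m x -> forall t, 0 <= t -> maxJ (peval c m) x v0 t.
Proof.
  intros Hp E Hns t Ht. apply (real_induction (maxJ (peval c m) x v0) 0 t); try lra.
  - now apply maxJ_0.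
  - intros s Hs Hprev. destruct (proj1 (oint_maxJ (peval c m) x v0) s) as [d [Hd H]]; [apply Hprev; lra|].
    exists d. split; [exact Hd|]. intros u Hu _. apply H. rewrite Rabs_pos_eq; lra.
  - intros s Hs Hprev. apply NNPP. intros Hn. apply Hns.
    destruct (maxtraj_escape c m x v0 s Hp E ltac:(lra) Hprev Hn) as [b [Hb Hlim]].
    set (Y := maxY (peval c m) x v0) in *. assert (HT := maxtraj_traj c m x v0). fold Y in HT.
    assert (Hx : Y 0 = x) by (unfold Y; now rewrite maxtraj_0).
    rewrite <- Hx. apply (on_stokes_traj c m _ _ _ (s / 2) 0 (oint_maxJ _ _ _) HT); try (apply Hprev; lra).
    exists b, (fun u => if Rle_dec u 0 then b else Y (s - u)), s, (s / 2).
    split; [|split; [lra|split; [simpl; lra|]]].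
    2:{ destruct (Rle_dec (s / 2) 0); [lra|]. f_equal. field. }
    split; [exact Hb|]. split; [simpl; lra|]. split; [destruct (Rle_dec 0 0); [easy|lra]|]. split.
    + apply filterlim_at_right_eps. intros e He. destruct (Hlim e He) as [d [Hd H]].
      exists (Rmin d s). split; [apply Rmin_pos; lra|]. intros u Hu.
      assert (A1 := Rmin_l d s). assert (A2 := Rmin_r d s).
      destruct (Rle_dec u 0); [lra|]. apply H; lra.
    + intros u Hu Hus. simpl in Hus. destruct (HT (s - u)) as [D [_ EQ]]; [apply Hprev; lra|].
      exists (maxV (peval c m) x v0 (s - u)%R * - (1))%C. destruct (Rle_dec u 0); [lra|]. split.
      * apply rderiv_is_rder.
        assert (D2 : rder (fun u => Y (s - u)%R) u (maxV (peval c m) x v0 (s - u)%R * - (1))%C).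
        { intros eps He. destruct (D eps He) as [d [Hd K]]. exists d. split; [exact Hd|].
          intros z Hz. specialize (K (s - z)). rewrite !RtoC_dist in *.
          replace (s - z - (s - u)) with (- (z - u)) in K by ring. rewrite Rabs_Ropp in K.
          replace (RtoC (s - z)%R - RtoC (s - u)%R)%C with (- (1) * (RtoC z - RtoC u))%C in K by (rewrite !RtoC_minus; ring).
          rewrite Cmult_assoc in K. exact (K Hz). }
        apply (deriv_ext RtoC (fun u => Y (s - u)%R) _ _ _ u); [lra| |exact D2].
        intros z Hz. rewrite RtoC_dist in Hz. apply Rabs_def2 in Hz. destruct (Rle_dec z 0); [lra|easy].
      * replace (peval c m (Y (s - u)%R) * (maxV (peval c m) x v0 (s - u)%R * - (1) * (maxV (peval c m) x v0 (s - u)%R * - (1))))%C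
          with (RtoC 1) by (symmetry; etransitivity; [|exact EQ]; ring). simpl. split; [easy|lra].
Qed.

Lemma maxtraj_reverse c m x v0 t : maxJ (peval c m) x v0 t -> maxJ (peval c m) x (- v0)%C (- t).
Proof.
  intros [J [y [v [HJ [J0 [Jt [HT [Hy Hv]]]]]]]].
  exists (fun s => J (- s)), (fun s => y (- s)), (fun s => - v (- s)%R)%C.
  split; [|split; [|split; [|split; [|split]]]].
  - destruct HJ as [O1 O2]. split.
    + intros s Hs. destruct (O1 _ Hs) as [d [Hd H]]. exists d. split; [exact Hd|]. intros u Hu. apply H.
      replace (- u - - s) with (- (u - s)) by ring. now rewrite Rabs_Ropp.
    + intros a s b Ha Hb Hs. apply (O2 (- b) (- s) (- a)); auto; lra.
  - now rewrite Ropp_0.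
  - now rewrite Ropp_involutive.
  - intros s Hs. destruct (HT (- s) Hs) as [D [Cv E]].
    split; [|split].
    + intros eps He. destruct (D eps He) as [d [Hd K]]. exists d. split; [exact Hd|].
      intros z Hz. specialize (K (- z)). rewrite !RtoC_dist in *.
      replace (- z - - s) with (- (z - s)) in K by ring. rewrite Rabs_Ropp in K.
      replace (v (- s)%R * (RtoC (- z)%R - RtoC (- s)%R))%C with (- v (- s)%R * (RtoC z - RtoC s))%C in K by (rewrite !RtoC_opp; ring).
      exact (K Hz).
    + intros eps He. destruct (Cv eps He) as [d [Hd K]]. exists d. split; [exact Hd|].
      intros z Hz. specialize (K (- z)). rewrite !RtoC_dist in *.
      replace (- z - - s) with (- (z - s)) in K by ring. rewrite Rabs_Ropp in K. specialize (K Hz).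
      replace (- v (- z)%R - - v (- s)%R)%C with (- (v (- z)%R - v (- s)%R))%C by ring. now rewrite Cmod_opp.
    + rewrite <- E. ring.
  - now rewrite Ropp_0.
  - now rewrite Ropp_0, Hv.
Qed.

Lemma maxJ_all c m x v0 : is_poly_deg c m -> (v0 * v0 * peval c m x)%C = RtoC 1 ->
  ~ on_stokes c m x -> forall t, maxJ (peval c m) x v0 t.
Proof.
  intros Hp E Hns t. destruct (Rle_lt_dec 0 t) as [L|L]; [now apply maxJ_forward|].
  rewrite <- (Ropp_involutive t). replace v0 with (- - v0)%C by ring.
  apply maxtraj_reverse, maxJ_forward; auto; [rewrite <- E; ring|lra].
Qed.

(** * The primitive on a Stokes domain *)

Definition rpath (A : C -> Prop) (x y : C) : Prop :=
  exists p : R -> C, p 0 = x /\ p 1 = y /\ forall t, 0 <= t <= 1 -> A (p t) /\ rcont p t.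

Lemma path_in_rpath A x y : path_in A x y <-> rpath A x y.
Proof.
  split; intros [p [H0 [H1 H]]]; exists p; (split; [exact H0|]; split; [exact H1|]); intros t Ht;
  destruct (H t Ht) as [A1 A2]; (split; [exact A1|]); apply rcont_continuous; exact A2.
Qed.

Lemma rcont_affine (p : R -> C) a b t : rcont p (a * t + b) -> rcont (fun s => p (a * s + b)) t.
Proof.
  intros H e He. destruct (H e He) as [d [Hd K]].
  assert (Ha := Rabs_pos a). exists (d / (Rabs a + 1)). split; [apply Rdiv_lt_0_compat; lra|].
  intros s Hs. apply K. rewrite RtoC_dist in *.
  replace (a * s + b - (a * t + b)) with (a * (s - t)) by ring. rewrite Rabs_mult.
  assert (A := Rabs_pos (s - t)).
  apply Rmult_lt_compat_r with (r := Rabs a + 1) in Hs; [|lra].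
  replace (d / (Rabs a + 1) * (Rabs a + 1)) with d in Hs by (field; lra). nra.
Qed.

Lemma rcont_glue (g1 g2 : R -> C) t : rcont g1 t -> rcont g2 t -> g1 t = g2 t ->
  rcont (fun s => if Rle_dec s t then g1 s else g2 s) t.
Proof.
  intros H1 H2 E e He. destruct (H1 e He) as [d1 [Hd1 K1]]. destruct (H2 e He) as [d2 [Hd2 K2]].
  exists (Rmin d1 d2). split; [now apply Rmin_pos|]. intros y Hy.
  assert (A := Rmin_l d1 d2). assert (B := Rmin_r d1 d2).
  destruct (Rle_dec t t) as [_|N]; [|lra]. destruct (Rle_dec y t) as [L|L].
  - apply K1. lra.
  - rewrite E. apply K2. lra.
Qed.

Lemma rpath_rev A x y : rpath A x y -> rpath A y x.
Proof.
  intros [p [H0 [H1 H]]]. exists (fun t => p (- (1) * t + 1)).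
  split; [now rewrite Rmult_0_r, Rplus_0_l|]. split; [rewrite <- H0; f_equal; ring|].
  intros t Ht. destruct (H (- (1) * t + 1)) as [A1 A2]; [lra|]. split; [exact A1|]. now apply rcont_affine.
Qed.

Lemma rpath_sub A x y (p : R -> C) s : p 0 = x -> p s = y -> 0 <= s -> (forall t, 0 <= t <= s -> A (p t) /\ rcont p t) ->
  rpath A x y.
Proof.
  intros H0 H1 Hs H. exists (fun t => p (s * t + 0)).
  split; [rewrite <- H0; f_equal; ring|]. split; [rewrite <- H1; f_equal; ring|].
  intros t Ht. destruct (H (s * t + 0)) as [A1 A2]; [nra|]. split; [exact A1|]. now apply rcont_affine.
Qed.

Lemma rpath_trans A x y z : rpath A x y -> rpath A y z -> rpath A x z.
Proof.
  intros [p [P0 [P1 P]]] [q [Q0 [Q1 Q]]].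
  exists (fun t => if Rle_dec t (1 / 2) then p (2 * t + 0) else q (2 * t + - (1))).
  split; [destruct (Rle_dec 0 (1 / 2)); [rewrite <- P0; f_equal; ring|lra]|].
  split; [destruct (Rle_dec 1 (1 / 2)); [lra|rewrite <- Q1; f_equal; ring]|].
  intros t Ht. destruct (Rtotal_order t (1 / 2)) as [L | [L | L]].
  - destruct (P (2 * t + 0)) as [A1 A2]; [lra|]. split; [destruct (Rle_dec t (1 / 2)); [exact A1|lra]|].
    apply (cont_ext RtoC (fun t => p (2 * t + 0)) _ _ (1 / 2 - t)); [lra| |now apply rcont_affine].
    intros s Hs. rewrite RtoC_dist in Hs. apply Rabs_def2 in Hs. destruct (Rle_dec s (1 / 2)); [easy|lra].
  - subst t. destruct (P (2 * (1 / 2) + 0)) as [A1 A2]; [lra|]. destruct (Q (2 * (1 / 2) + - (1))) as [B1 B2]; [lra|].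
    split; [destruct (Rle_dec (1 / 2) (1 / 2)); [exact A1|lra]|].
    apply rcont_glue; [now apply (rcont_affine p)|now apply (rcont_affine q)|].
    replace (2 * (1 / 2) + 0) with 1 by field. replace (2 * (1 / 2) + - (1)) with 0 by field. now rewrite P1, Q0.
  - destruct (Q (2 * t + - (1))) as [A1 A2]; [lra|]. split; [destruct (Rle_dec t (1 / 2)); [lra|exact A1]|].
    apply (cont_ext RtoC (fun t => q (2 * t + - (1))) _ _ (t - 1 / 2)); [lra| |now apply rcont_affine].
    intros s Hs. rewrite RtoC_dist in Hs. apply Rabs_def2 in Hs. destruct (Rle_dec s (1 / 2)); [lra|easy].
Qed.

(** One Stokes domain with its branch and primitive. No sign of [Im S] is recorded, so that the
    record applies to [Om] and, with [sq] and [S] negated, to [Om']. *)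
Record sheet (c : nat -> C) (m : nat) (Om : C -> Prop) (S sq : C -> C) : Prop := {
  sh_deg : is_poly_deg c m;
  sh_dom : stokes_domain c m Om;
  sh_sq : forall x, Om x -> (sq x * sq x)%C = peval c m x;
  sh_cont : forall x, Om x -> ccont sq x;
  sh_S : forall x, Om x -> cder S x (sq x) }.

Lemma domain_path c m Om x y : stokes_domain c m Om -> Om x ->
  (Om y <-> rpath (fun z => ~ on_stokes c m z) x y).
Proof.
  intros [x0 [H0 H]] Hx. rewrite H, path_in_rpath in *. split; intros Hy.
  - apply rpath_trans with x0; [now apply rpath_rev|exact Hy].
  - now apply rpath_trans with x.
Qed.

Lemma domain_not_stokes c m Om x : stokes_domain c m Om -> Om x -> ~ on_stokes c m x.
Proof.
  intros [x0 [H0 H]] Hx. rewrite H in Hx. destruct Hx as [p [P0 [P1 P]]].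
  rewrite <- P1. apply (P 1). lra.
Qed.

Lemma domain_connected c m Om x y : stokes_domain c m Om -> Om x -> Om y -> rpath Om x y.
Proof.
  intros HD Hx Hy. assert (Hp := proj1 (domain_path c m Om x y HD Hx) Hy).
  destruct Hp as [p [P0 [P1 P]]]. exists p. split; [exact P0|]. split; [exact P1|].
  intros t Ht. split; [|now apply P]. apply (domain_path c m Om x _ HD Hx).
  apply (rpath_sub _ _ _ p t P0 eq_refl); [lra|]. intros s Hs. apply P. lra.
Qed.

Lemma domain_traj c m Om J y v s t : stokes_domain c m Om -> oint J -> traj (peval c m) J y v -> J s -> J t ->
  Om (y s) -> Om (y t).
Proof.
  intros HD HJ HT Js Jt Hs. apply (domain_path c m Om (y s) _ HD Hs).
  assert (Hn := domain_not_stokes c m Om _ HD Hs).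
  exists (fun u => y ((t - s) * u + s)).
  split; [f_equal; ring|]. split; [f_equal; ring|]. intros u Hu.
  assert (Ju : J ((t - s) * u + s)).
  { destruct (Rle_lt_dec s t) as [L|L].
    - apply (proj2 HJ s _ t); auto. nra.
    - apply (proj2 HJ t _ s); auto. nra. }
  split.
  - intros H. apply Hn. now apply (on_stokes_traj c m J y v ((t - s) * u + s)).
  - apply rcont_affine. destruct (HT _ Ju) as [D _]. eapply deriv_cont, D.
Qed.

Lemma sheet_neq_0 c m Om S sq x : sheet c m Om S sq -> Om x -> peval c m x <> RtoC 0 /\ sq x <> RtoC 0.
Proof.
  intros HS Hx. assert (HQ : peval c m x <> RtoC 0).
  { intros E. apply (domain_not_stokes c m Om x (sh_dom _ _ _ _ _ HS) Hx). apply zero_on_stokes; [apply HS|exact E]. }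
  split; [exact HQ|]. intros E. apply HQ. rewrite <- (sh_sq _ _ _ _ _ HS x Hx), E. ring.
Qed.

(** * The horizontal flow *)

Definition flow (c : nat -> C) (m : nat) (sq : C -> C) (x : C) (t : R) : C :=
  maxY (peval c m) x (/ sq x)%C t.

(** Trajectories from points of the domain exist for all times by [maxJ_all] and cannot meet a
    Stokes curve, so they stay in the domain. The velocity remains on the branch [1 / sq] because
    [sq * v] is continuous and squares to 1. *)
Lemma flow_traj c m Om S sq x : sheet c m Om S sq -> Om x ->
  exists v, traj (peval c m) (fun _ => True) (flow c m sq x) v /\ flow c m sq x 0 = x /\
   forall t, Om (flow c m sq x t) /\ v t = (/ sq (flow c m sq x t))%C.
Proof.
  intros HS Hx. destruct (sheet_neq_0 _ _ _ _ _ _ HS Hx) as [HQ Hs].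
  assert (HD := sh_dom _ _ _ _ _ HS).
  assert (E : (/ sq x * / sq x * peval c m x)%C = RtoC 1).
  { rewrite <- (sh_sq _ _ _ _ _ HS x Hx). field. exact Hs. }
  assert (HJ := maxJ_all c m x _ (sh_deg _ _ _ _ _ HS) E (domain_not_stokes _ _ _ _ HD Hx)).
  assert (HT := maxtraj_traj c m x (/ sq x)%C).
  set (v := maxV (peval c m) x (/ sq x)%C) in *.
  assert (H0 := maxtraj_0 c m x _ E).
  assert (Hy0 : flow c m sq x 0 = x) by (unfold flow; now rewrite H0).
  assert (HTa : traj (peval c m) (fun _ => True) (flow c m sq x) v) by (intros t _; now apply HT).
  assert (HO : forall t, Om (flow c m sq x t)).
  { intros t. apply (domain_traj c m Om (fun _ => True) (flow c m sq x) v 0 t); auto.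
    - split; [|auto]. intros s _. exists 1. split; [lra|auto].
    - now rewrite Hy0. }
  exists v. split; [exact HTa|]. split; [exact Hy0|]. intros t. split; [apply HO|].
  assert (Hprod : (sq (flow c m sq x t) * v t)%C = RtoC 1).
  { apply (clopen (fun t => (sq (flow c m sq x t) * v t)%C = RtoC 1) (fun _ => True)) with 0; auto.
    - intros s _ Es. destruct (HTa s I) as [D [Cv _]].
      destruct (cont_sign RtoC (fun t => sq (flow c m sq x t) * v t)%C s) as [d [Hd H]]; auto.
      { apply cont_mult; [|exact Cv]. apply (cont_comp RtoC (flow c m sq x) sq); [eapply deriv_cont, D|].
        apply (sh_cont _ _ _ _ _ HS), HO. }
      exists d. split; [exact Hd|]. intros u _ Hu. apply H; [rewrite RtoC_dist; exact Hu|].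
      destruct (HTa u I) as [_ [_ E2]]. rewrite <- (sh_sq _ _ _ _ _ HS _ (HO u)) in E2. rewrite <- E2. ring.
    - intros s _ Es. destruct (HTa s I) as [D [Cv _]].
      destruct (cont_neq RtoC (fun t => sq (flow c m sq x t) * v t)%C (fun _ => RtoC 1) s) as [d [Hd H]]; auto.
      { apply cont_mult; [|exact Cv]. apply (cont_comp RtoC (flow c m sq x) sq); [eapply deriv_cont, D|].
        apply (sh_cont _ _ _ _ _ HS), HO. }
      { apply cont_const. }
      exists d. split; [exact Hd|]. intros u _ Hu. apply H. rewrite RtoC_dist. exact Hu.
    - rewrite Hy0. unfold v. rewrite H0. simpl. field. exact Hs. }
  destruct (sheet_neq_0 _ _ _ _ _ _ HS (HO t)) as [_ N].
  replace (v t) with (/ sq (flow c m sq x t) * (sq (flow c m sq x t) * v t))%C by (field; exact N).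
  rewrite Hprod. ring.
Qed.

Lemma oint_all : oint (fun _ => True).
Proof. split; [|auto]. intros s _. exists 1. split; [lra|auto]. Qed.

Lemma flow_props c m Om S sq x t : sheet c m Om S sq -> Om x ->
  Om (flow c m sq x t) /\ rder (flow c m sq x) t (/ sq (flow c m sq x t))%C /\
  S (flow c m sq x t) = (S x + RtoC t)%C /\ flow c m sq x 0 = x.
Proof.
  intros HS Hx. destruct (flow_traj c m Om S sq x HS Hx) as [v [HT [H0 Hv]]].
  assert (HD : forall s, rder (flow c m sq x) s (/ sq (flow c m sq x s))%C).
  { intros s. destruct (HT s I) as [D _]. now rewrite (proj2 (Hv s)) in D. }
  split; [apply Hv|]. split; [apply HD|]. split; [|exact H0].
  assert (Hd : forall s, rder (fun s => S (flow c m sq x s) - RtoC s)%C s 0).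
  { intros s. apply (deriv_eq _ _ _ (sq (flow c m sq x s) * / sq (flow c m sq x s) - 1)%C).
    - apply deriv_minus; [|apply deriv_self]. apply (deriv_comp RtoC (flow c m sq x) S); [apply HD|].
      apply (sh_S _ _ _ _ _ HS), Hv.
    - field. apply (sheet_neq_0 _ _ _ _ _ _ HS (proj1 (Hv s))). }
  assert (E : (S (flow c m sq x t) - RtoC t)%C = (S (flow c m sq x 0) - RtoC 0)%C).
  { destruct (Rle_lt_dec 0 t) as [L|L].
    - apply Cmod_small_eq. intros e He. apply Rle_trans with (0 * (t - 0)); [|lra].
      apply (MVT_rder (fun s => S (flow c m sq x s) - RtoC s)%C (fun _ => 0)); [exact L|auto|intros; rewrite Cmod_0; lra].
    - symmetry. apply Cmod_small_eq. intros e He. apply Rle_trans with (0 * (0 - t)); [|lra].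
      apply (MVT_rder (fun s => S (flow c m sq x s) - RtoC s)%C (fun _ => 0)); [lra|auto|intros; rewrite Cmod_0; lra]. }
  rewrite H0 in E. replace (S (flow c m sq x t)) with (S (flow c m sq x t) - RtoC t + RtoC t)%C by ring.
  rewrite E. ring.
Qed.

Lemma traj_shift Q J y v a : traj Q J y v -> traj Q (fun t => J (t + a)) (fun t => y (t + a)) (fun t => v (t + a)).
Proof.
  intros HT t Jt. destruct (HT _ Jt) as [D [Cv E]].
  assert (Ed : forall s, (RtoC (s + a) - RtoC (t + a) = RtoC s - RtoC t)%C) by (intros; rewrite !RtoC_plus; ring).
  split; [|split; [|exact E]]; intros eps He.
  - destruct (D eps He) as [d [Hd K]]. exists d. split; [exact Hd|]. intros s Hs.
    specialize (K (s + a)). rewrite Ed in K. now apply K.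
  - destruct (Cv eps He) as [d [Hd K]]. exists d. split; [exact Hd|]. intros s Hs.
    specialize (K (s + a)). rewrite Ed in K. now apply K.
Qed.

Lemma flow_follow c m Om S sq x K z w t : sheet c m Om S sq -> Om x -> oint K -> K 0 -> K t ->
  traj (peval c m) K z w -> z 0 = x -> w 0 = (/ sq x)%C ->
  flow c m sq x t = z t /\ w t = (/ sq (z t))%C.
Proof.
  intros HS Hx HK K0 Kt HT Hz Hw. destruct (flow_traj c m Om S sq x HS Hx) as [v [HTv [H0 Hv]]].
  destruct (traj_unique c m K (flow c m sq x) v z w 0 HK) with (t := t) as [E1 E2]; auto.
  - intros s Hs. now apply HTv.
  - now rewrite H0.
  - now rewrite (proj2 (Hv 0)), H0, Hw.
  - split; [exact E1|]. rewrite <- E2, <- E1. apply Hv.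
Qed.

Lemma flow_add c m Om S sq x s t : sheet c m Om S sq -> Om x ->
  flow c m sq (flow c m sq x s) t = flow c m sq x (t + s).
Proof.
  intros HS Hx. destruct (flow_traj c m Om S sq x HS Hx) as [v [HTv [H0 Hv]]].
  apply (flow_follow c m Om S sq (flow c m sq x s) (fun _ => True) (fun t => flow c m sq x (t + s)) (fun t => v (t + s))); auto.
  - apply Hv.
  - apply oint_all.
  - exact (traj_shift _ _ _ _ s HTv).
  - f_equal. ring.
  - rewrite Rplus_0_l. apply Hv.
Qed.

Lemma chart_line_traj Q w s0 f T psi r rho z0 : chart Q w s0 f T psi r rho ->
  oint (fun t => Cmod (z0 + RtoC t)%C < rho) /\
  traj Q (fun t => Cmod (z0 + RtoC t)%C < rho) (fun t => psi (z0 + RtoC t)%C) (fun t => / f (psi (z0 + RtoC t)%C))%C.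
Proof.
  intros HC. split; [split|].
  - intros t Ht. exists (rho - Cmod (z0 + RtoC t)%C). split; [lra|]. intros s Hs.
    replace (z0 + RtoC s)%C with ((z0 + RtoC t) + RtoC (s - t))%C by (rewrite RtoC_minus; ring).
    eapply Rle_lt_trans; [apply Cmod_triangle|]. rewrite Cmod_R. lra.
  - intros a s b Ha Hb Hs. destruct (Req_dec a b) as [E|N]; [replace s with a by lra; exact Ha|].
    rewrite <- Cmod_cut in *. set (u := (s - a) / (b - a)).
    assert (Hu : 0 <= u <= 1).
    { unfold u. split; [apply Rmult_le_pos; [lra|apply Rlt_le, Rinv_0_lt_compat; lra]|].
      apply Rmult_le_reg_r with (b - a); [lra|]. unfold Rdiv. rewrite Rmult_assoc, Rinv_l by lra. lra. }
    replace (z0 + RtoC s)%C with (seg (z0 + RtoC a)%C (z0 + RtoC b)%C u); [now apply seg_dist|].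
    unfold seg. replace s with (a + (b - a) * u) by (unfold u; field; lra).
    rewrite RtoC_plus, RtoC_mult, RtoC_minus. ring.
  - intros t Ht. assert (K := chart_traj _ _ _ _ _ _ _ _ (z0 + RtoC t)%C (rho - Cmod (z0 + RtoC t)%C) HC ltac:(lra)).
    apply (traj_shift _ _ _ _ (- t)) in K.
    destruct (K t) as [D [Cv E]]; [rewrite Rplus_opp_r, Rabs_R0; lra|].
    assert (Es : forall s, (z0 + RtoC t + RtoC (s + - t))%C = (z0 + RtoC s)%C) by (intros; rewrite RtoC_plus, RtoC_opp; ring).
    rewrite Es in D, E. split; [|split].
    + apply (deriv_ext RtoC (fun s => psi (z0 + RtoC t + RtoC (s + - t))%C) _ _ _ 1); [lra| |exact D].
      intros s _. now rewrite Es.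
    + apply (cont_ext RtoC (fun s => / f (psi (z0 + RtoC t + RtoC (s + - t))%C))%C _ _ 1); [lra| |exact Cv].
      intros s _. now rewrite Es.
    + exact E.
Qed.

Lemma domain_chord c m Om w s0 f T psi r rho z h : stokes_domain c m Om -> chart (peval c m) w s0 f T psi r rho ->
  Cmod z < rho -> Cmod (z + RtoC h)%C < rho -> Om (psi z) -> Om (psi (z + RtoC h)%C).
Proof.
  intros HD HC Hz Hzh Hom. destruct (chart_line_traj _ _ _ _ _ _ _ _ z HC) as [O L].
  apply (domain_traj c m Om _ _ _ 0 h HD O L); rewrite ?Cplus_0_r; auto.
Qed.

Lemma flow_chart c m Om S sq w s0 f T psi r rho z t : sheet c m Om S sq -> chart (peval c m) w s0 f T psi r rho ->
  Cmod z < rho -> Cmod (z + RtoC t)%C < rho -> Om (psi z) -> sq (psi z) = f (psi z) ->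
  flow c m sq (psi z) t = psi (z + RtoC t)%C /\ sq (psi (z + RtoC t)%C) = f (psi (z + RtoC t)%C).
Proof.
  intros HS HC Hz Hzt Hom Hsq. destruct (chart_line_traj _ _ _ _ _ _ _ _ z HC) as [O L].
  destruct (flow_follow c m Om S sq (psi z) (fun t => Cmod (z + RtoC t)%C < rho)
    (fun t => psi (z + RtoC t)%C) (fun t => / f (psi (z + RtoC t)%C))%C t HS Hom O) as [A B];
    rewrite ?Cplus_0_r; auto.
  - now rewrite Hsq.
  - split; [exact A|]. cbv beta in B.
    rewrite <- (Cinv_inv (f _)), B. now rewrite Cinv_inv.
Qed.

(** The chart brings its own branch [f]. By the sign argument it agrees with [sq] near [z], and this
    can be claimed only at points of [Om], where [sq] is known to square to [Q]. *)
Lemma sheet_chart c m Om S sq z : sheet c m Om S sq -> Om z ->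
  exists f T psi r rho, chart (peval c m) z (sq z) f T psi r rho /\
    exists r1, 0 < r1 <= r /\ forall y, Om y -> Cmod (y - z)%C < r1 -> sq y = f y.
Proof.
  intros HS Hz. destruct (sheet_neq_0 _ _ _ _ _ _ HS Hz) as [_ N].
  destruct (chart_exists c m z (sq z) 1 (sh_sq _ _ _ _ _ HS z Hz) N Rlt_0_1) as [f [T [psi [r [rho [HC _]]]]]].
  exists f, T, psi, r, rho. split; [exact HC|]. assert (Hr := chart_r _ _ _ _ _ _ _ _ HC).
  assert (Hzz : Cmod (z - z)%C < r) by (replace (z - z)%C with (RtoC 0) by ring; now rewrite Cmod_0).
  assert (F0 := chart_f0 _ _ _ _ _ _ _ _ HC).
  destruct (chart_f _ _ _ _ _ _ _ _ HC z Hzz) as [_ [Fz [Fc _]]].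
  destruct (cont_sign (fun y : C => y) (fun y => sq y * / f y)%C z) as [d [Hd H]].
  - apply cont_mult; [now apply (sh_cont _ _ _ _ _ HS)|now apply cont_inv].
  - rewrite F0. field. exact N.
  - exists (Rmin d r). split; [split; [now apply Rmin_pos|apply Rmin_r]|]. intros y Hy Hyz.
    assert (A := Rmin_l d r). assert (B := Rmin_r d r).
    destruct (chart_f _ _ _ _ _ _ _ _ HC y ltac:(lra)) as [F1 [F2 _]].
    specialize (H y ltac:(lra)). cbv beta in H.
    assert (E : (sq y * / f y)%C = RtoC 1).
    { apply H. replace (sq y * / f y * (sq y * / f y))%C with (sq y * sq y * / (f y * f y))%C by (field; exact F2).
      rewrite F1, (sh_sq _ _ _ _ _ HS y Hy). apply Cinv_r. rewrite <- F1. now apply Cmult_neq_0. }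
    replace (sq y) with (sq y * / f y * f y)%C by (field; exact F2). rewrite E. ring.
Qed.

(** Short time dependence on the initial point, seen in one chart. It is phrased as a step from time
    [T1] to time [T2] so that [flow_cont] can propagate it along a whole trajectory by
    [locally_const]. *)
Lemma flow_near c m Om S sq z : sheet c m Om S sq -> Om z ->
  exists eta, 0 < eta /\ forall T1 T2, Rabs T1 < eta -> Rabs T2 < eta -> forall e, 0 < e ->
    exists d, 0 < d /\ forall w t, Om w -> Cmod (w - flow c m sq z T1)%C < d -> Rabs (t - T2) < d ->
      Cmod (flow c m sq w (t - T1) - flow c m sq z T2)%C < e.
Proof.
  intros HS Hz. destruct (sheet_chart c m Om S sq z HS Hz) as [f [T [psi [r [rho [HC [r1 [Hr1 Hsg]]]]]]]].
  assert (Hrho := chart_rho _ _ _ _ _ _ _ _ HC). assert (P0 := chart_psi0 _ _ _ _ _ _ _ _ HC).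
  assert (R00 : Cmod 0 < rho) by (rewrite Cmod_0; exact Hrho).
  destruct (chart_psi _ _ _ _ _ _ _ _ HC 0 R00) as [_ [_ D0]].
  destruct (deriv_cont _ _ _ _ D0 r1) as [rho1 [Hrho1 Hball]]; [lra|].
  set (eta := Rmin (rho / 8) (rho1 / 8)).
  assert (He1 : eta <= rho / 8) by apply Rmin_l. assert (He2 : eta <= rho1 / 8) by apply Rmin_r.
  assert (He0 : 0 < eta) by (apply Rmin_pos; lra).
  exists eta. split; [exact He0|]. intros T1 T2 HT1 HT2 e He.
  assert (Hfl : forall t, Rabs t < eta -> flow c m sq z t = psi (RtoC t) /\ sq (psi (RtoC t)) = f (psi (RtoC t))).
  { intros t Ht. rewrite <- (Cplus_0_l (RtoC t)).
    destruct (flow_chart c m Om S sq _ _ _ _ _ _ _ 0 t HS HC R00) as [A B]; auto.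
    - rewrite Cplus_0_l, Cmod_R. lra.
    - now rewrite P0.
    - rewrite P0. symmetry. apply (chart_f0 _ _ _ _ _ _ _ _ HC).
    - split; [|exact B]. rewrite <- A. now rewrite P0. }
  destruct (Hfl T1 HT1) as [E1 S1]. destruct (Hfl T2 HT2) as [E2 _].
  assert (C1 : Cmod (RtoC T1) < rho) by (rewrite Cmod_R; lra).
  assert (C2 : Cmod (RtoC T2) < rho) by (rewrite Cmod_R; lra).
  destruct (chart_psi _ _ _ _ _ _ _ _ HC _ C1) as [A1 [A2 _]].
  destruct (chart_psi _ _ _ _ _ _ _ _ HC _ C2) as [_ [_ D2]].
  destruct (deriv_cont _ _ _ _ D2 e He) as [dp [Hdp Hpsi]].
  destruct (chart_f _ _ _ _ _ _ _ _ HC _ A1) as [_ [_ [_ DT]]].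
  assert (HA1' : Cmod (psi (RtoC T1) - z)%C < r1).
  { rewrite <- P0. apply Hball. rewrite Cmod_cut, Cmod_R. lra. }
  set (eT := Rmin (rho / 8) (dp / 2)). assert (HeT : 0 < eT) by (apply Rmin_pos; lra).
  destruct (deriv_cont _ _ _ _ DT eT HeT) as [dT [HdT KT]].
  exists (Rmin (Rmin dT (r1 - Cmod (psi (RtoC T1) - z)%C)) eT).
  split; [repeat apply Rmin_pos; lra|]. intros w t Hw Hwd Ht.
  assert (M1 := Rmin_l (Rmin dT (r1 - Cmod (psi (RtoC T1) - z)%C)) eT).
  assert (M2 := Rmin_r (Rmin dT (r1 - Cmod (psi (RtoC T1) - z)%C)) eT).
  assert (M3 := Rmin_l dT (r1 - Cmod (psi (RtoC T1) - z)%C)).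
  assert (M4 := Rmin_r dT (r1 - Cmod (psi (RtoC T1) - z)%C)).
  assert (M5 : eT <= rho / 8) by apply Rmin_l. assert (M6 : eT <= dp / 2) by apply Rmin_r.
  rewrite E1 in Hwd. specialize (KT w ltac:(lra)). rewrite A2 in KT.
  assert (Hwz : Cmod (w - z)%C < r1).
  { assert (Tr := Cmod_sub_triangle w (psi (RtoC T1)) z). lra. }
  assert (HTw : Cmod (T w) < rho).
  { assert (Tr := Cmod_triangle_inv (T w) (RtoC T1)). rewrite Cmod_R in Tr. lra. }
  assert (Epw : psi (T w) = w) by (apply (chart_inv _ _ _ _ _ _ _ _ HC); lra).
  assert (Hz2 : Cmod (T w + RtoC (t - T1) - RtoC T2)%C < dp).
  { replace (T w + RtoC (t - T1) - RtoC T2)%C with ((T w - RtoC T1) + RtoC (t - T2))%C by (rewrite !RtoC_minus; ring).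
    eapply Rle_lt_trans; [apply Cmod_triangle|]. rewrite Cmod_R. lra. }
  assert (Hz3 : Cmod (T w + RtoC (t - T1))%C < rho).
  { replace (T w + RtoC (t - T1))%C with ((T w - RtoC T1) + RtoC (t - T2) + RtoC T2)%C by (rewrite !RtoC_minus; ring).
    eapply Rle_lt_trans; [apply Cmod_triangle|]. assert (Tr := Cmod_triangle (T w - RtoC T1)%C (RtoC (t - T2))).
    rewrite !Cmod_R in *. lra. }
  destruct (flow_chart c m Om S sq _ _ _ _ _ _ _ (T w) (t - T1) HS HC HTw Hz3) as [Q1 _].
  - now rewrite Epw.
  - rewrite Epw. now apply Hsg.
  - rewrite Epw in Q1. rewrite Q1, E2. apply Hpsi. exact Hz2.
Qed.

Lemma flow_cont c m Om S sq x T : sheet c m Om S sq -> Om x -> forall e, 0 < e ->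
  exists d, 0 < d /\ forall x', Om x' -> Cmod (x' - x)%C < d -> Cmod (flow c m sq x' T - flow c m sq x T)%C < e.
Proof.
  intros HS Hx.
  apply (locally_const (fun T => forall e, 0 < e -> exists d, 0 < d /\ forall x', Om x' -> Cmod (x' - x)%C < d ->
     Cmod (flow c m sq x' T - flow c m sq x T)%C < e) (fun _ => True)) with 0; auto.
  - intros T0 _. assert (Hz : Om (flow c m sq x T0)) by now apply (flow_props c m Om S sq).
    destruct (flow_near c m Om S sq _ HS Hz) as [eta [Heta H]]. exists eta. split; [exact Heta|].
    intros T1 T2 _ _ HT1 HT2 HP e He. destruct (H _ _ HT1 HT2 e He) as [d [Hd K]].
    destruct (HP d Hd) as [d' [Hd' K']]. exists d'. split; [exact Hd'|]. intros x' Hx' Hxx.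
    specialize (K (flow c m sq x' T1) (T2 - T0)).
    rewrite (flow_add c m Om S sq x' _ _ HS Hx'), !(flow_add c m Om S sq x _ _ HS Hx) in K.
    replace (T2 - T0 - (T1 - T0) + T1) with T2 in K by ring.
    replace (T2 - T0 + T0) with T2 in K by ring. replace (T1 - T0 + T0) with T1 in K by ring.
    apply K.
    + now apply (flow_props c m Om S sq).
    + now apply K'.
    + now rewrite Rminus_diag, Rabs_R0.
  - intros e He. exists e. split; [exact He|]. intros x' Hx' Hxx.
    destruct (flow_props c m Om S sq x 0 HS Hx) as [_ [_ [_ E]]].
    destruct (flow_props c m Om S sq x' 0 HS Hx') as [_ [_ [_ E']]]. now rewrite E, E'.
Qed.

Lemma flow_joint c m Om S sq x T : sheet c m Om S sq -> Om x -> forall e, 0 < e ->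
  exists d, 0 < d /\ forall x' t, Om x' -> Cmod (x' - x)%C < d -> Rabs (t - T) < d ->
    Cmod (flow c m sq x' t - flow c m sq x T)%C < e.
Proof.
  intros HS Hx e He. assert (Hz : Om (flow c m sq x T)) by now apply (flow_props c m Om S sq).
  destruct (flow_near c m Om S sq _ HS Hz) as [eta [Heta H]].
  assert (R0 : Rabs 0 < eta) by now rewrite Rabs_R0.
  destruct (H 0 0 R0 R0 e He) as [d [Hd K]].
  destruct (flow_cont c m Om S sq x T HS Hx d Hd) as [d' [Hd' K']].
  exists (Rmin d d'). split; [now apply Rmin_pos|]. intros x' t Hx' Hxx Ht.
  assert (A := Rmin_l d d'). assert (B := Rmin_r d d').
  specialize (K (flow c m sq x' T) (t - T)).
  rewrite (flow_add c m Om S sq x' _ _ HS Hx'), !(flow_add c m Om S sq x _ _ HS Hx), Rplus_0_l in K.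
  replace (t - T - 0 + T) with t in K by ring.
  apply K.
  - now apply (flow_props c m Om S sq).
  - apply K'; [exact Hx'|lra].
  - rewrite Rminus_0_r. lra.
Qed.

(** * Vertical trajectories and injectivity of the primitive *)

Lemma chart_rot Q Q' w s0 f T psi r rho : (forall y, Q' y = - Q y)%C -> chart Q w s0 f T psi r rho ->
  chart Q' w (- Ci * s0)%C (fun y => - Ci * f y)%C (fun y => - Ci * T y)%C (fun z => psi (Ci * z)%C) r rho.
Proof.
  intros HQ HC. assert (I2 : (Ci * Ci)%C = (- (1))%C) by (apply C_ext; simpl; ring).
  assert (HI : (- Ci)%C <> RtoC 0) by (intros E; injection E; lra).
  assert (HI2 : Ci <> RtoC 0) by (intros E; injection E; lra).
  split.
  - apply HC.
  - apply HC.
  - now rewrite (chart_f0 _ _ _ _ _ _ _ _ HC).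
  - rewrite (chart_T0 _ _ _ _ _ _ _ _ HC). ring.
  - rewrite <- (chart_psi0 _ _ _ _ _ _ _ _ HC). f_equal. ring.
  - intros y Hy. destruct (chart_f _ _ _ _ _ _ _ _ HC y Hy) as [A [B [D E]]]. split; [|split; [|split]].
    + rewrite HQ, <- A. replace (- Ci * f y * (- Ci * f y))%C with (Ci * Ci * (f y * f y))%C by ring. rewrite I2. ring.
    + now apply Cmult_neq_0.
    + apply cont_mult; [apply cont_const|exact D].
    + now apply deriv_scal.
  - intros z Hz. assert (Hz' : Cmod (Ci * z)%C < rho) by (rewrite Cmod_mult, Cmod_Ci, Rmult_1_l; exact Hz).
    destruct (chart_psi _ _ _ _ _ _ _ _ HC _ Hz') as [A [B D]].
    split; [exact A|]. split.
    + rewrite B. replace (- Ci * (Ci * z))%C with (- (Ci * Ci) * z)%C by ring. rewrite I2. ring.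
    + apply (deriv_eq _ _ _ (/ f (psi (Ci * z)%C) * Ci)%C).
      * apply (deriv_comp _ (fun z => Ci * z)%C psi); [apply cder_scal|exact D].
      * destruct (chart_f _ _ _ _ _ _ _ _ HC _ A) as [_ [F2 _]].
        replace Ci with (/ (- Ci))%C at 2; [field; split; assumption|].
        replace (- Ci)%C with (/ Ci)%C by (rewrite Ci_inv; reflexivity). apply Cinv_inv.
  - intros y Hy. rewrite Cmod_mult, Cmod_opp, Cmod_Ci, Rmult_1_l. intros HT.
    replace (Ci * (- Ci * T y))%C with (- (Ci * Ci) * T y)%C by ring. rewrite I2.
    replace (- - (1) * T y)%C with (T y) by ring. now apply (chart_inv _ _ _ _ _ _ _ _ HC).
Qed.

Lemma maxtraj_follow c m x v0 t1 t2 K z w : (v0 * v0 * peval c m x)%C = RtoC 1 ->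
  maxJ (peval c m) x v0 t1 -> oint K -> K t1 -> K t2 -> traj (peval c m) K z w ->
  maxtraj (peval c m) x v0 t1 = (z t1, w t1) ->
  maxJ (peval c m) x v0 t2 /\ maxtraj (peval c m) x v0 t2 = (z t2, w t2).
Proof.
  intros E J1 HK K1 K2 HT Eq.
  assert (J0 := maxJ_0 c m x v0 E). assert (M0 := maxtraj_0 c m x v0 E).
  destruct (traj_glue c m _ K _ _ z w t1 (oint_maxJ _ x v0) HK (maxtraj_traj c m x v0) HT J1 K1) as [y [v [G1 [G2 G3]]]].
  { now rewrite Eq. } { now rewrite Eq. }
  assert (HO : oint (fun s => maxJ (peval c m) x v0 s \/ K s)).
  { apply (oint_union _ _ t1); auto. apply oint_maxJ. }
  destruct (G2 0 J0) as [Y0 V0]. rewrite M0 in Y0, V0. simpl in Y0, V0.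
  split.
  - exists (fun s => maxJ (peval c m) x v0 s \/ K s), y, v.
    split; [exact HO|]. split; [now left|]. split; [now right|]. split; [exact G1|]. now split.
  - rewrite (maxtraj_eq c m x v0 (fun s => maxJ (peval c m) x v0 s \/ K s) y v t2); auto.
    destruct (G3 t2 K2) as [-> ->]. reflexivity.
Qed.

Lemma rpath_total A x y : rpath A x y -> exists p : R -> C, p 0 = x /\ p 1 = y /\ forall t, A (p t) /\ rcont p t.
Proof.
  intros [p [P0 [P1 P]]]. set (cl := fun t => Rmax 0 (Rmin 1 t)).
  assert (Hcl : forall t, 0 <= cl t <= 1).
  { intros t. unfold cl. split; [apply Rmax_l|]. apply Rmax_lub; [lra|apply Rmin_l]. }
  assert (Hlip : forall s t, Rabs (cl s - cl t) <= Rabs (s - t)).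
  { intros s t. unfold cl, Rmax, Rmin.
    destruct (Rle_dec 1 s), (Rle_dec 1 t); repeat destruct Rle_dec; unfold Rabs; repeat destruct Rcase_abs; lra. }
  exists (fun t => p (cl t)). split; [|split].
  - unfold cl. rewrite Rmin_right, Rmax_left by lra. exact P0.
  - unfold cl. rewrite Rmin_left, Rmax_right by lra. exact P1.
  - intros t. destruct (P (cl t) (Hcl t)) as [A1 A2]. split; [exact A1|].
    intros e He. destruct (A2 e He) as [d [Hd K]]. exists d. split; [exact Hd|]. intros s Hs. apply K.
    rewrite RtoC_dist in *. specialize (Hlip s t). lra.
Qed.

Lemma C_shift_re (a b : C) : Im b = Im a -> (b + RtoC (Re a - Re b))%C = a.
Proof. destruct a, b. simpl. intros ->. apply C_ext; simpl; ring. Qed.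

(** Heights between those of two points of a path inside a chart are swept by the path, and with
    them whole chords; [Om] itself is not known to be open. *)
Lemma sheet_local c m Om S sq (q : R -> C) s0 f T psi r rho : sheet c m Om S sq ->
  (forall t, Om (q t) /\ rcont q t) -> chart (peval c m) (q s0) (sq (q s0)) f T psi r rho ->
  (exists r1, 0 < r1 <= r /\ forall y, Om y -> Cmod (y - q s0)%C < r1 -> sq y = f y) ->
  exists d, 0 < d /\ forall s, Rabs (s - s0) < d -> Cmod (S (q s) - S (q s0))%C < rho /\
    q s = psi (S (q s) - S (q s0))%C /\ sq (q s) = f (q s).
Proof.
  intros HS Hq HC [r1 [Hr1 Hsg]].
  assert (Hrho := chart_rho _ _ _ _ _ _ _ _ HC). assert (P0 := chart_psi0 _ _ _ _ _ _ _ _ HC).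
  assert (R00 : Cmod 0 < rho) by (rewrite Cmod_0; exact Hrho).
  destruct (chart_psi _ _ _ _ _ _ _ _ HC 0 R00) as [_ [_ D0]].
  destruct (deriv_cont _ _ _ _ D0 r1) as [rho1 [Hrho1 Hball]]; [lra|]. rewrite P0 in Hball.
  set (rho2 := Rmin rho rho1). assert (L1 : rho2 <= rho) by apply Rmin_l. assert (L2 : rho2 <= rho1) by apply Rmin_r.
  assert (Hrho2 : 0 < rho2) by now apply Rmin_pos.
  assert (Hww : Cmod (q s0 - q s0)%C < r).
  { replace (q s0 - q s0)%C with (RtoC 0) by ring. rewrite Cmod_0. lra. }
  destruct (chart_f _ _ _ _ _ _ _ _ HC _ Hww) as [_ [_ [_ DT]]].
  destruct (deriv_cont _ _ _ _ DT rho2 Hrho2) as [dT [HdT KT]]. rewrite (chart_T0 _ _ _ _ _ _ _ _ HC) in KT.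
  destruct (proj2 (Hq s0) (Rmin dT r1)) as [d [Hd Kq]]; [apply Rmin_pos; lra|].
  assert (M1 := Rmin_l dT r1). assert (M2 := Rmin_r dT r1).
  assert (Hin : forall s, Rabs (s - s0) < d -> Cmod (q s - q s0)%C < r1 /\ Cmod (T (q s)) < rho2 /\ psi (T (q s)) = q s).
  { intros s Hs. specialize (Kq s). rewrite RtoC_dist in Kq. specialize (Kq Hs).
    specialize (KT (q s) ltac:(lra)). rewrite Cmod_cut in KT. split; [lra|]. split; [exact KT|].
    apply (chart_inv _ _ _ _ _ _ _ _ HC); lra. }
  exists d. split; [exact Hd|]. intros s Hs. destruct (Hin s Hs) as [I1 [I2 I3]].
  set (z := T (q s)) in *.
  assert (Hseg : forall t, 0 <= t <= 1 -> Cmod (z * RtoC t)%C < rho2).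
  { intros t Ht. rewrite Cmod_mult, Cmod_R, Rabs_pos_eq by lra. assert (A := Cmod_ge_0 z). nra. }
  assert (Hband : forall t, 0 <= t <= 1 -> Om (psi (z * RtoC t)%C)).
  { intros t Ht.
    destruct (ivt_between (fun u => Im (T (q u))) (Rmin s0 s) (Rmax s0 s) (Im (z * RtoC t)%C)) as [u [Hu Eu]].
    - apply Rle_trans with s0; [apply Rmin_l|apply Rmax_l].
    - intros u Hu. assert (Hud : Rabs (u - s0) < d).
      { apply Rabs_def2 in Hs. apply Rabs_def1; unfold Rmin, Rmax in Hu; destruct (Rle_dec s0 s); lra. }
      destruct (Hin u Hud) as [U1 _].
      destruct (chart_f _ _ _ _ _ _ _ _ HC (q u) ltac:(lra)) as [_ [_ [_ DTu]]].
      assert (Hc : rcont (fun u => T (q u)) u).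
      { apply (cont_comp RtoC q T); [apply Hq|eapply deriv_cont, DTu]. }
      intros e He. destruct (Hc e He) as [d' [Hd' K]]. exists d'. split; [exact Hd'|].
      intros y [_ Hy]. specialize (K y). rewrite RtoC_dist in K. specialize (K Hy).
      unfold dist; simpl. unfold Rdist. eapply Rle_lt_trans; [|exact K].
      replace (Im (T (q y)) - Im (T (q u))) with (Im (T (q y) - T (q u))%C) by (destruct (T (q y)), (T (q u)); reflexivity).
      apply im_le_Cmod.
    - assert (E0 : Im (T (q s0)) = 0) by (rewrite (chart_T0 _ _ _ _ _ _ _ _ HC); reflexivity).
      assert (Ez : Im (z * RtoC t)%C = Im z * t) by (destruct z; simpl; ring).
      rewrite Ez. fold z. unfold Rmin, Rmax. destruct (Rle_dec s0 s); rewrite ?E0; fold z;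
      destruct (Rle_lt_dec 0 (Im z)); [left | right | right | left]; nra.
    - assert (Hud : Rabs (u - s0) < d).
      { apply Rabs_def2 in Hs. apply Rabs_def1; unfold Rmin, Rmax in Hu; destruct (Rle_dec s0 s); lra. }
      destruct (Hin u Hud) as [U1 [U2 U3]].
      rewrite <- (C_shift_re _ _ Eu).
      apply (domain_chord c m Om _ _ _ _ _ _ _ _ _ (sh_dom _ _ _ _ _ HS) HC); [lra| |rewrite U3; apply Hq].
      rewrite (C_shift_re _ _ Eu). specialize (Hseg t Ht). lra. }
  assert (Hsqf : forall t, 0 <= t <= 1 -> sq (psi (z * RtoC t)%C) = f (psi (z * RtoC t)%C)).
  { intros t Ht. apply Hsg; [now apply Hband|]. apply Hball. rewrite Cmod_cut. specialize (Hseg t Ht). lra. }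
  assert (HSz : (S (q s) - S (q s0))%C = z).
  { assert (E : Cmod ((S (psi (z * RtoC 1)%C) - z * RtoC 1) - (S (psi (z * RtoC 0)%C) - z * RtoC 0))%C <= 0 * (1 - 0)).
    { apply (MVT_rder (fun t => S (psi (z * RtoC t)%C) - z * RtoC t)%C (fun _ => 0)); [lra| |intros; rewrite Cmod_0; lra].
      intros t Ht.
      assert (Hsg' := Hseg t Ht). assert (Hzt : Cmod (z * RtoC t)%C < rho) by lra.
      destruct (chart_psi _ _ _ _ _ _ _ _ HC _ Hzt) as [A1 [A2 A3]].
      destruct (chart_f _ _ _ _ _ _ _ _ HC _ A1) as [_ [F2 _]].
      assert (Dl : rder (fun t => z * RtoC t)%C t z).
      { apply (deriv_eq _ _ _ (z * 1)%C); [|ring]. apply deriv_scal, deriv_self. }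
      apply (deriv_eq _ _ _ (sq (psi (z * RtoC t)%C) * (/ f (psi (z * RtoC t)%C) * z) - z)%C).
      - apply deriv_minus; [|exact Dl]. apply (deriv_comp RtoC (fun t => psi (z * RtoC t)%C) S).
        + now apply (deriv_comp RtoC (fun t => z * RtoC t)%C psi).
        + apply (sh_S _ _ _ _ _ HS). now apply Hband.
      - rewrite Hsqf by exact Ht. field. exact F2. }
    rewrite Cmult_1_r, I3, Cmult_0_r, P0 in E.
    assert (E2 : (S (q s) - z - (S (q s0) - 0))%C = RtoC 0).
    { apply Cmod_eq_0. apply Rle_antisym; [lra|apply Cmod_ge_0]. }
    replace (S (q s) - S (q s0))%C with (S (q s) - z - (S (q s0) - 0) + z)%C by ring. rewrite E2. ring. }
  rewrite HSz. split; [lra|]. split; [now rewrite I3|]. apply Hsg; [apply Hq|exact I1].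
Qed.

(** The point of the horizontal trajectory of [y] on the vertical [Re S = 0]. *)
Definition hat c m S sq (y : C) : C := flow c m sq y (- Re (S y)).

Lemma hat_props c m Om S sq y : sheet c m Om S sq -> Om y ->
  Om (hat c m S sq y) /\ S (hat c m S sq y) = (Ci * RtoC (Im (S y)))%C /\
  flow c m sq (hat c m S sq y) (Re (S y)) = y.
Proof.
  intros HS Hy. unfold hat. destruct (flow_props c m Om S sq y (- Re (S y)) HS Hy) as [A [_ [B E]]].
  split; [exact A|]. split.
  - rewrite B. apply C_ext; destruct (S y); simpl; ring.
  - rewrite (flow_add c m Om S sq _ _ _ HS Hy), Rplus_opp_r. exact E.
Qed.

(** The maximal vertical trajectory through [hat x] (a horizontal one for [-Q]). *)
Definition vert c m S sq (x : C) : R -> C * C :=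
  maxtraj (peval (fun k => - c k)%C m) (hat c m S sq x) (Ci * / sq (hat c m S sq x))%C.
Definition vertJ c m S sq (x : C) : R -> Prop :=
  maxJ (peval (fun k => - c k)%C m) (hat c m S sq x) (Ci * / sq (hat c m S sq x))%C.

Lemma peval_opp c m x : peval (fun k => - c k)%C m x = (- peval c m x)%C.
Proof.
  unfold peval. generalize (S m). intros n. induction n as [|n IH]; simpl; [ring|]. rewrite IH. ring.
Qed.

Lemma vert_init c m Om S sq x : sheet c m Om S sq -> Om x ->
  (Ci * / sq (hat c m S sq x) * (Ci * / sq (hat c m S sq x)) * peval (fun k => - c k)%C m (hat c m S sq x))%C = RtoC 1.
Proof.
  intros HS Hx. destruct (hat_props c m Om S sq x HS Hx) as [A _].
  rewrite peval_opp, <- (sh_sq _ _ _ _ _ HS _ A).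
  assert (I2 : (Ci * Ci)%C = (- (1))%C) by (apply C_ext; simpl; ring).
  destruct (sheet_neq_0 _ _ _ _ _ _ HS A) as [_ N].
  replace (Ci * / sq (hat c m S sq x) * (Ci * / sq (hat c m S sq x)) * - (sq (hat c m S sq x) * sq (hat c m S sq x)))%C
   with (- (Ci * Ci))%C by (field; exact N). rewrite I2. ring.
Qed.

(** Along a path from [x] to [y] inside [Om] the feet [hat] move on a single vertical trajectory, at
    a parameter equal to the difference of heights. So the foot of [y] is determined by the height
    of [S y] alone, whatever the path; injectivity of [S] rests on this. *)
Lemma vert_spec c m Om S sq x y : sheet c m Om S sq -> Om x -> Om y ->
  vertJ c m S sq x (Im (S y) - Im (S x)) /\
  vert c m S sq x (Im (S y) - Im (S x)) = (hat c m S sq y, (Ci * / sq (hat c m S sq y))%C).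
Proof.
  intros HS Hx Hy.
  destruct (rpath_total _ _ _ (domain_connected c m Om x y (sh_dom _ _ _ _ _ HS) Hx Hy)) as [p [P0 [P1 P]]].
  assert (Hini := vert_init c m Om S sq x HS Hx).
  set (q := fun s => hat c m S sq (p s)). set (e := fun s => Im (S (p s)) - Im (S x)).
  set (Pr := fun s => vertJ c m S sq x (e s) /\ vert c m S sq x (e s) = (q s, (Ci * / sq (q s))%C)).
  assert (Hgoal : Pr 1); [|unfold Pr, e, q in Hgoal; rewrite P1 in Hgoal; exact Hgoal].
  assert (Hq : forall s, Om (q s) /\ rcont q s).
  { intros s. split; [now apply (hat_props c m Om S sq), P|]. intros e' He'.
    destruct (flow_joint c m Om S sq (p s) (- Re (S (p s))) HS (proj1 (P s)) e' He') as [d [Hd K]].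
    assert (HSc : rcont (fun s => S (p s)) s).
    { apply (cont_comp RtoC p S); [apply P|]. eapply deriv_cont. apply (sh_S _ _ _ _ _ HS), P. }
    destruct (HSc d Hd) as [d1 [Hd1 K1]]. destruct (proj2 (P s) d Hd) as [d2 [Hd2 K2]].
    exists (Rmin d1 d2). split; [now apply Rmin_pos|]. intros t Ht.
    assert (A := Rmin_l d1 d2). assert (B := Rmin_r d1 d2). apply K; [apply P|apply K2; lra|].
    specialize (K1 t ltac:(lra)). assert (RL := re_le_Cmod (S (p t) - S (p s))%C).
    replace (- Re (S (p t)) - - Re (S (p s))) with (- Re (S (p t) - S (p s))%C) by (destruct (S (p t)), (S (p s)); simpl; ring).
    rewrite Rabs_Ropp. lra. }
  assert (HSq : forall s t, (S (q s) - S (q t))%C = (Ci * RtoC (e s - e t))%C).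
  { intros s t. unfold q. rewrite !(proj1 (proj2 (hat_props c m Om S sq _ HS (proj1 (P _))))).
    unfold e. rewrite !RtoC_minus. ring. }
  apply (locally_const Pr (fun _ => True)) with 0; auto.
  2:{ unfold Pr, e, q, vert, vertJ. rewrite P0, Rminus_diag. split; [now apply maxJ_0|now apply maxtraj_0]. }
  intros s0 _. destruct (sheet_chart c m Om S sq (q s0) HS (proj1 (Hq s0))) as [f [T [psi [r [rho [HC Hsg]]]]]].
  destruct (sheet_local c m Om S sq q s0 f T psi r rho HS Hq HC Hsg) as [d [Hd K]].
  (* In the rotated chart the vertical through [q s0] is a trajectory of [- Q], and [sheet_local]
     puts the nearby feet on it. *)
  assert (HC' := chart_rot _ (peval (fun k => - c k)%C m) _ _ _ _ _ _ _ (fun y => peval_opp c m y) HC).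
  assert (HT := chart_traj _ _ _ _ _ _ _ _ 0 rho HC' ltac:(rewrite Cmod_0; lra)).
  apply (traj_shift _ _ _ _ (- e s0)) in HT. cbv beta in HT.
  assert (Hlink : forall s, Rabs (s - s0) < d -> Rabs (e s + - e s0) < rho /\
    (psi (Ci * (0 + RtoC (e s + - e s0))), / (- Ci * f (psi (Ci * (0 + RtoC (e s + - e s0))))))%C = (q s, (Ci * / sq (q s))%C)).
  { intros s Hs. destruct (K s Hs) as [K1 [K2 K3]]. rewrite HSq in K1, K2.
    change (e s + - e s0) with (e s - e s0). rewrite Cplus_0_l, <- K2, <- K3.
    rewrite Cmod_mult, Cmod_Ci, Rmult_1_l, Cmod_R in K1. split; [exact K1|]. f_equal.
    destruct (sheet_neq_0 _ _ _ _ _ _ HS (proj1 (Hq s))) as [_ N].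
    assert (HI : Ci <> RtoC 0) by (intros E; injection E; lra).
    replace (- Ci)%C with (/ Ci)%C by apply Ci_inv. field. split; assumption. }
  exists d. split; [exact Hd|]. intros s t _ _ Hs Ht [J1 E1].
  destruct (Hlink s Hs) as [Ls Es]. destruct (Hlink t Ht) as [Lt Et].
  unshelve epose proof (maxtraj_follow _ _ _ _ (e s) (e t) _ _ _ Hini J1 _ _ _ HT _) as [A B].
  - destruct (oint_ball (e s0) rho) as [O1 O2]. split; [exact O1|exact O2].
  - exact Ls.
  - exact Lt.
  - refine (eq_trans E1 _). symmetry. exact Es.
  - split; [exact A|]. exact (eq_trans B Et).
Qed.

(** Equal heights give equal feet by [vert_spec], and equal real parts give equal flow times from
    the foot. *)
Lemma sheet_inj c m Om S sq x y : sheet c m Om S sq -> Om x -> Om y -> S x = S y -> x = y.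
Proof.
  intros HS Hx Hy E.
  destruct (vert_spec c m Om S sq x y HS Hx Hy) as [_ A]. destruct (vert_spec c m Om S sq x x HS Hx Hx) as [_ B].
  rewrite E in A, B. rewrite A in B. assert (Eh : hat c m S sq y = hat c m S sq x) by exact (f_equal fst B).
  destruct (hat_props c m Om S sq x HS Hx) as [_ [_ Fx]]. destruct (hat_props c m Om S sq y HS Hy) as [_ [_ Fy]].
  transitivity (flow c m sq (hat c m S sq x) (Re (S x))); [now rewrite Fx|]. rewrite <- Eh, E. exact Fy.
Qed.

Definition sinv (Om : C -> Prop) (S : C -> C) (z : C) : C :=
  epsilon (inhabits (RtoC 0)) (fun x => Om x /\ S x = z).

(** The height of [z] is attained on a path from [y1] to [y2] by intermediate values, and the flow
    adjusts the real part freely. *)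
Lemma sheet_surj c m Om S sq y1 y2 z : sheet c m Om S sq -> Om y1 -> Om y2 ->
  Im (S y1) <= Im z <= Im (S y2) -> Om (sinv Om S z) /\ S (sinv Om S z) = z.
Proof.
  intros HS H1 H2 Hz. apply (epsilon_spec (inhabits (RtoC 0)) (fun x => Om x /\ S x = z)).
  destruct (rpath_total _ _ _ (domain_connected c m Om y1 y2 (sh_dom _ _ _ _ _ HS) H1 H2)) as [p [P0 [P1 P]]].
  destruct (ivt_between (fun s => Im (S (p s))) 0 1 (Im z)) as [s [_ Es]]; [lra| |left; now rewrite P0, P1|].
  - intros s _. assert (HSc : rcont (fun s => S (p s)) s).
    { apply (cont_comp RtoC p S); [apply P|]. eapply deriv_cont. apply (sh_S _ _ _ _ _ HS), P. }
    intros e He. destruct (HSc e He) as [d' [Hd' K]]. exists d'. split; [exact Hd'|].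
    intros y [_ Hy]. specialize (K y). rewrite RtoC_dist in K. specialize (K Hy).
    unfold dist; simpl. unfold Rdist. eapply Rle_lt_trans; [|exact K].
    replace (Im (S (p y)) - Im (S (p s))) with (Im (S (p y) - S (p s))%C) by (destruct (S (p y)), (S (p s)); reflexivity).
    apply im_le_Cmod.
  - exists (flow c m sq (p s) (Re z - Re (S (p s)))).
    destruct (flow_props c m Om S sq (p s) (Re z - Re (S (p s))) HS (proj1 (P s))) as [A [_ [B _]]].
    split; [exact A|]. rewrite B. destruct (S (p s)) as [u v], z as [u' v']. simpl in *. apply C_ext; simpl; lra.
Qed.

Lemma sinv_S c m Om S sq x : sheet c m Om S sq -> Om x -> sinv Om S (S x) = x.
Proof.
  intros HS Hx. destruct (sheet_surj c m Om S sq x x (S x) HS Hx Hx) as [A B]; [lra|].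
  now apply (sheet_inj c m Om S sq).
Qed.

(** Only continuity has to be shown, by [deriv_inverse]. The foot moves continuously with the height
    along the vertical trajectory, and the flow is jointly continuous in point and time. *)
Lemma sinv_cder c m Om S sq y1 y2 z : sheet c m Om S sq -> Om y1 -> Om y2 ->
  Im (S y1) < Im z < Im (S y2) -> cder (sinv Om S) z (/ sq (sinv Om S z))%C.
Proof.
  intros HS H1 H2 Hz.
  set (dd := Rmin (Im z - Im (S y1)) (Im (S y2) - Im z)).
  assert (Hdd : 0 < dd) by (apply Rmin_pos; lra).
  assert (L1 : dd <= Im z - Im (S y1)) by apply Rmin_l. assert (L2 : dd <= Im (S y2) - Im z) by apply Rmin_r.
  assert (Hheight : forall z', Cmod (z' - z)%C < dd -> Om (sinv Om S z') /\ S (sinv Om S z') = z').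
  { intros z' Hz'. apply (sheet_surj c m Om S sq y1 y2); auto. assert (A := im_le_Cmod (z' - z)%C).
    replace (Im (z' - z)%C) with (Im z' - Im z) in A by (destruct z', z; reflexivity).
    assert (A' : Rabs (Im z' - Im z) < dd) by lra. apply Rabs_def2 in A'. lra. }
  destruct (Hheight z) as [Hx Sx].
  { replace (z - z)%C with (RtoC 0) by ring. now rewrite Cmod_0. }
  set (x := sinv Om S z) in *.
  apply deriv_inverse with S dd; auto.
  - apply (sheet_neq_0 _ _ _ _ _ _ HS Hx).
  - now apply (sh_S _ _ _ _ _ HS).
  - intros e He.
    destruct (hat_props c m Om S sq x HS Hx) as [Hh [_ Fx]].
    destruct (flow_joint c m Om S sq (hat c m S sq x) (Re z) HS Hh e He) as [d1 [Hd1 K1]].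
    destruct (vert_spec c m Om S sq x x HS Hx Hx) as [J0 V0]. rewrite Rminus_diag in J0, V0.
    assert (HT := maxtraj_traj (fun k => - c k)%C m (hat c m S sq x) (Ci * / sq (hat c m S sq x))%C).
    destruct (HT 0 J0) as [D0 _]. destruct (deriv_cont _ _ _ _ D0 d1 Hd1) as [d2 [Hd2 K2]].
    exists (Rmin dd (Rmin d1 d2)). split; [repeat apply Rmin_pos; lra|]. intros z' Hz'.
    assert (M1 := Rmin_l dd (Rmin d1 d2)). assert (M2 := Rmin_r dd (Rmin d1 d2)).
    assert (M3 := Rmin_l d1 d2). assert (M4 := Rmin_r d1 d2).
    destruct (Hheight z' ltac:(lra)) as [Hx' Sx']. set (x' := sinv Om S z') in *.
    destruct (hat_props c m Om S sq x' HS Hx') as [Hh' [_ Fx']].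
    destruct (vert_spec c m Om S sq x x' HS Hx Hx') as [_ V'].
    assert (A := im_le_Cmod (z' - z)%C). assert (B := re_le_Cmod (z' - z)%C).
    replace (Im (z' - z)%C) with (Im z' - Im z) in A by (destruct z', z; reflexivity).
    replace (Re (z' - z)%C) with (Re z' - Re z) in B by (destruct z', z; reflexivity).
    rewrite Sx in V', Fx. rewrite Sx' in V', Fx'. change (Cmod (x' - x)%C < e).
    assert (Hgo : Cmod (flow c m sq (hat c m S sq x') (Re z') - flow c m sq (hat c m S sq x) (Re z))%C < e); [|now rewrite Fx', Fx in Hgo].
    apply K1; [exact Hh'| |lra].
    specialize (K2 (Im z' - Im z)). rewrite RtoC_dist, Rminus_0_r in K2. specialize (K2 ltac:(lra)).
    unfold vert in V', V0. rewrite V', V0 in K2. exact K2.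
  - intros z' Hz'. now apply Hheight.
Qed.

(** Both sides are trajectories of [-Q]. *)
Lemma sinv_vertical c m Om S sq w s0 f T psi r rho y1 y2 z t : sheet c m Om S sq ->
  chart (peval c m) w s0 f T psi r rho -> Om y1 -> Om y2 -> Om (psi z) -> sq (psi z) = f (psi z) ->
  Cmod z < rho -> Cmod (z + Ci * RtoC t)%C < rho ->
  Im (S y1) < Im (S (psi z)) < Im (S y2) -> Im (S y1) < Im (S (psi z)) + t < Im (S y2) ->
  Om (psi (z + Ci * RtoC t)%C) /\ S (psi (z + Ci * RtoC t)%C) = (S (psi z) + Ci * RtoC t)%C.
Proof.
  intros HS HC H1 H2 Hom Hsq Hz Hzt Ha Hb.
  assert (I2 : (Ci * Ci)%C = (- (1))%C) by (apply C_ext; simpl; ring).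
  assert (HI : Ci <> RtoC 0) by (intros E; injection E; lra).
  set (s := S (psi z)) in *.
  assert (Ims : forall u, Im (s + Ci * RtoC u)%C = Im s + u) by (intros u; destruct s; simpl; ring).
  assert (HC' := chart_rot _ (peval (fun k => - c k)%C m) _ _ _ _ _ _ _ (fun y => peval_opp c m y) HC).
  destruct (chart_line_traj _ _ _ _ _ _ _ _ (- Ci * z)%C HC') as [O1 L1].
  assert (Er : forall u, (Ci * (- Ci * z + RtoC u))%C = (z + Ci * RtoC u)%C).
  { intros u. replace (Ci * (- Ci * z + RtoC u))%C with (- (Ci * Ci) * z + Ci * RtoC u)%C by ring. rewrite I2. ring. }
  assert (Em : forall u, Cmod (- Ci * z + RtoC u)%C = Cmod (z + Ci * RtoC u)%C).
  { intros u. rewrite <- Er, Cmod_mult, Cmod_Ci. ring. }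
  set (K := fun u => Cmod (- Ci * z + RtoC u)%C < rho /\ Im (S y1) < Im s + u < Im (S y2)).
  assert (OK : oint K).
  { apply oint_inter; [exact O1|]. split.
    - intros u Hu. exists (Rmin (Im s + u - Im (S y1)) (Im (S y2) - (Im s + u))).
      split; [apply Rmin_pos; lra|]. intros v Hv. apply Rabs_def2 in Hv.
      assert (A := Rmin_l (Im s + u - Im (S y1)) (Im (S y2) - (Im s + u))).
      assert (B := Rmin_r (Im s + u - Im (S y1)) (Im (S y2) - (Im s + u))). lra.
    - intros. lra. }
  set (g := fun u => sinv Om S (s + Ci * RtoC u)%C).
  assert (Hg : forall u, Im (S y1) < Im s + u < Im (S y2) ->
     Om (g u) /\ S (g u) = (s + Ci * RtoC u)%C /\ rder g u (Ci * / sq (g u))%C).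
  { intros u Hu. destruct (sheet_surj c m Om S sq y1 y2 (s + Ci * RtoC u)%C HS H1 H2) as [A B]; [rewrite Ims; lra|].
    split; [exact A|]. split; [exact B|].
    apply (deriv_eq _ _ _ (/ sq (g u) * Ci)%C); [|ring].
    apply (deriv_comp RtoC (fun u => s + Ci * RtoC u)%C (sinv Om S)).
    - apply (deriv_eq _ _ _ (0 + Ci * 1)%C); [|ring]. apply deriv_plus; [apply deriv_const|]. apply deriv_scal, deriv_self.
    - apply (sinv_cder c m Om S sq y1 y2); auto. rewrite Ims. lra. }
  assert (L2 : traj (peval (fun k => - c k)%C m) K g (fun u => Ci * / sq (g u))%C).
  { intros u [_ Hu]. destruct (Hg u Hu) as [A [_ D]]. destruct (sheet_neq_0 _ _ _ _ _ _ HS A) as [_ N].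
    split; [exact D|]. split.
    - apply cont_mult; [apply cont_const|]. apply (cont_inv RtoC (fun u => sq (g u))); [exact N|].
      apply (cont_comp RtoC g sq); [eapply deriv_cont, D|]. now apply (sh_cont _ _ _ _ _ HS).
    - rewrite peval_opp, <- (sh_sq _ _ _ _ _ HS _ A).
      replace (Ci * / sq (g u) * (Ci * / sq (g u)) * - (sq (g u) * sq (g u)))%C with (- (Ci * Ci))%C by (field; exact N).
      rewrite I2. ring. }
  assert (K0 : K 0). { split; [rewrite Em, Cmult_0_r, Cplus_0_r; exact Hz|lra]. }
  assert (Kt : K t). { split; [rewrite Em; exact Hzt|lra]. }
  assert (G0 : g 0 = psi z).
  { unfold g. rewrite Cmult_0_r, Cplus_0_r. unfold s. now apply (sinv_S c m Om S sq). }
  destruct (traj_unique _ _ K _ _ _ _ 0 OK (traj_sub _ _ K _ _ (fun u H => proj1 H) L1) L2 K0) with (t := t) as [E _]; auto.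
  - rewrite Er, Cmult_0_r, Cplus_0_r. now rewrite G0.
  - rewrite Er, Cmult_0_r, Cplus_0_r, G0, Hsq.
    destruct (sheet_neq_0 _ _ _ _ _ _ HS Hom) as [_ N]. rewrite Hsq in N.
    replace (- Ci)%C with (/ Ci)%C by apply Ci_inv. field. split; assumption.
  - cbv beta in E. rewrite Er in E. rewrite E. destruct (Hg t Hb) as [A [B _]]. now split.
Qed.

(** Near a boundary point at height 0, a point of [Om] has height equal to its height in the chart:
    it cannot be larger (going down would reach [w] inside [Om]), and if it were smaller, injectivity
    of [S] would identify points of different heights in the chart. *)
Lemma half_chart c m Om S sq w f T psi r rho : sheet c m Om S sq -> (forall x, Om x -> 0 < Im (S x)) ->
  closure_of Om w -> ~ Om w -> chart (peval c m) w (sq w) f T psi r rho -> ccont sq w -> ccont S w ->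
  Im (S w) = 0 ->
  exists rho', 0 < rho' <= rho /\ forall z, Cmod z < rho' -> 0 < Im z ->
    Om (psi z) /\ S (psi z) = (S w + z)%C.
Proof.
  intros HS Hpos Hcl Hnw HC Hsqc HSc HSw.
  assert (Hrho := chart_rho _ _ _ _ _ _ _ _ HC). assert (Hr := chart_r _ _ _ _ _ _ _ _ HC).
  assert (P0 := chart_psi0 _ _ _ _ _ _ _ _ HC). assert (F0 := chart_f0 _ _ _ _ _ _ _ _ HC).
  assert (Hww : Cmod (w - w)%C < r) by (replace (w - w)%C with (RtoC 0) by ring; now rewrite Cmod_0).
  destruct (chart_f _ _ _ _ _ _ _ _ HC w Hww) as [_ [Fw [Fc DT]]].
  assert (Hsg : exists r1, 0 < r1 <= r /\ forall y, Om y -> Cmod (y - w)%C < r1 -> sq y = f y).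
  { destruct (cont_sign (fun y : C => y) (fun y => sq y * / f y)%C w) as [d [Hd H]].
    - apply cont_mult; [exact Hsqc|now apply cont_inv].
    - rewrite F0. apply Cinv_r. now rewrite <- F0.
    - exists (Rmin d r). split; [split; [now apply Rmin_pos|apply Rmin_r]|]. intros y Hy Hyz.
      assert (A := Rmin_l d r). assert (B := Rmin_r d r).
      destruct (chart_f _ _ _ _ _ _ _ _ HC y ltac:(lra)) as [F1 [F2 _]].
      specialize (H y ltac:(lra)). cbv beta in H.
      assert (E : (sq y * / f y)%C = RtoC 1).
      { apply H. replace (sq y * / f y * (sq y * / f y))%C with (sq y * sq y * / (f y * f y))%C by (field; exact F2).
        rewrite F1, (sh_sq _ _ _ _ _ HS y Hy). apply Cinv_r. rewrite <- F1. now apply Cmult_neq_0. }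
      replace (sq y) with (sq y * / f y * f y)%C by (field; exact F2). rewrite E. ring. }
  destruct Hsg as [r1 [Hr1 Hsg]].
  assert (R00 : Cmod 0 < rho) by (rewrite Cmod_0; exact Hrho).
  destruct (chart_psi _ _ _ _ _ _ _ _ HC 0 R00) as [_ [_ D0]].
  destruct (deriv_cont _ _ _ _ D0 r1) as [rho0 [Hrho0 Hball]]; [lra|]. rewrite P0 in Hball.
  set (rho1 := Rmin rho rho0). assert (L1 : rho1 <= rho) by apply Rmin_l. assert (L2 : rho1 <= rho0) by apply Rmin_r.
  assert (Hrho1 : 0 < rho1) by now apply Rmin_pos.
  assert (Hsq1 : forall z, Cmod z < rho1 -> Om (psi z) -> sq (psi z) = f (psi z)).
  { intros z Hz Ho. apply Hsg; [exact Ho|]. apply Hball. rewrite Cmod_cut. lra. }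
  assert (Hinj : forall z z', Cmod z < rho1 -> Cmod z' < rho1 -> psi z = psi z' -> z = z').
  { intros z z' Hz Hz' E. destruct (chart_psi _ _ _ _ _ _ _ _ HC z ltac:(lra)) as [_ [A _]].
    destruct (chart_psi _ _ _ _ _ _ _ _ HC z' ltac:(lra)) as [_ [B _]]. now rewrite <- A, <- B, E. }
  assert (Hchord : forall z h, Cmod z < rho1 -> Cmod (z + RtoC h)%C < rho1 -> Om (psi z) ->
     Om (psi (z + RtoC h)%C) /\ S (psi (z + RtoC h)%C) = (S (psi z) + RtoC h)%C).
  { intros z h Hz Hzh Ho.
    destruct (flow_chart c m Om S sq _ _ _ _ _ _ _ z h HS HC ltac:(lra) ltac:(lra) Ho (Hsq1 z Hz Ho)) as [A _].
    destruct (flow_props c m Om S sq (psi z) h HS Ho) as [B [_ [D _]]]. rewrite A in B, D. now split. }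
  (* points of Om arbitrarily near w, in the chart and with small S-value *)
  assert (Hnear : forall e, 0 < e -> exists d, 0 < d /\ forall x, Cmod (x - w)%C < d ->
     Cmod (T x) < e /\ Cmod (T x) < rho1 /\ psi (T x) = x /\ Cmod (S x - S w)%C < e).
  { intros e He. destruct (deriv_cont _ _ _ _ DT (Rmin e rho1)) as [d1 [Hd1 K1]]; [now apply Rmin_pos|].
    destruct (HSc e He) as [d2 [Hd2 K2]]. rewrite (chart_T0 _ _ _ _ _ _ _ _ HC) in K1.
    exists (Rmin (Rmin d1 d2) r). split; [repeat apply Rmin_pos; lra|]. intros x Hx.
    assert (M1 := Rmin_l (Rmin d1 d2) r). assert (M2 := Rmin_r (Rmin d1 d2) r).
    assert (M3 := Rmin_l d1 d2). assert (M4 := Rmin_r d1 d2).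
    assert (M5 := Rmin_l e rho1). assert (M6 := Rmin_r e rho1).
    specialize (K1 x ltac:(lra)). rewrite Cmod_cut in K1.
    split; [lra|]. split; [lra|]. split; [|apply K2; lra]. apply (chart_inv _ _ _ _ _ _ _ _ HC); lra. }
  assert (Hpts : forall e, 0 < e -> exists x, Om x /\ Cmod (T x) < e /\ Cmod (T x) < rho1 /\ psi (T x) = x /\
     Cmod (S x - S w)%C < e).
  { intros e He. destruct (Hnear e He) as [d [Hd K]]. destruct (Hcl d Hd) as [x [Hx Hxd]]. exists x.
    split; [exact Hx|]. now apply K. }
  assert (Him : forall x e, Cmod (S x - S w)%C < e -> Rabs (Im (S x)) < e).
  { intros x e H. assert (A := im_le_Cmod (S x - S w)%C).
    replace (Im (S x - S w)%C) with (Im (S x)) in A; [lra|]. destruct (S x), (S w). simpl in *. lra. }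
  assert (Hlow : forall s, 0 < s -> exists y, Om y /\ Im (S y) < s).
  { intros s Hs. destruct (Hpts s Hs) as [x [Hx [_ [_ [_ H]]]]]. exists x. split; [exact Hx|].
    apply Him in H. apply Rabs_def2 in H. lra. }
  destruct (Hpts 1 Rlt_0_1) as [y2 [Hy2 _]]. assert (Hh2 := Hpos y2 Hy2). set (h2 := Im (S y2)) in *.
  set (rho2 := Rmin (rho1 / 8) (h2 / 8)). assert (N1 : rho2 <= rho1 / 8) by apply Rmin_l.
  assert (N2 : rho2 <= h2 / 8) by apply Rmin_r. assert (Hrho2 : 0 < rho2) by (apply Rmin_pos; lra).
  assert (HCi : forall t, Cmod (Ci * RtoC t)%C = Rabs t) by (intros t; rewrite Cmod_mult, Cmod_Ci, Cmod_R; ring).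
  (* recentring on the vertical through w *)
  assert (Hcen : forall x, Om x -> Cmod (T x) < rho2 -> psi (T x) = x ->
     Om (psi (Ci * RtoC (Im (T x)))%C) /\ S (psi (Ci * RtoC (Im (T x)))%C) = (S x - RtoC (Re (T x)))%C /\
     Rabs (Im (T x)) < rho2).
  { intros x Hx HT Hp. assert (A := im_le_Cmod (T x)).
    assert (E : (T x + RtoC (- Re (T x)))%C = (Ci * RtoC (Im (T x)))%C) by (destruct (T x); apply C_ext; simpl; ring).
    destruct (Hchord (T x) (- Re (T x))) as [B D]; [lra|rewrite E, HCi; lra|now rewrite Hp|].
    rewrite E, Hp in *. split; [exact B|]. split; [|lra]. rewrite D, RtoC_opp. ring. }
  assert (Hvert : forall eta t, Rabs eta < rho1 -> Rabs (eta + t) < rho1 -> Om (psi (Ci * RtoC eta)%C) ->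
     Im (S (psi (Ci * RtoC eta)%C)) < h2 -> 0 < Im (S (psi (Ci * RtoC eta)%C)) + t < h2 ->
     Om (psi (Ci * RtoC (eta + t))%C) /\ S (psi (Ci * RtoC (eta + t))%C) = (S (psi (Ci * RtoC eta)%C) + Ci * RtoC t)%C).
  { intros eta t He Het Ho Hs1 Hs2. assert (Hs0 := Hpos _ Ho).
    destruct (Hlow (Rmin (Im (S (psi (Ci * RtoC eta)%C))) (Im (S (psi (Ci * RtoC eta)%C)) + t))) as [y1 [Hy1 Hy1s]];
      [apply Rmin_pos; lra|].
    assert (Q1 := Rmin_l (Im (S (psi (Ci * RtoC eta)%C))) (Im (S (psi (Ci * RtoC eta)%C)) + t)).
    assert (Q2 := Rmin_r (Im (S (psi (Ci * RtoC eta)%C))) (Im (S (psi (Ci * RtoC eta)%C)) + t)).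
    replace (Ci * RtoC (eta + t))%C with (Ci * RtoC eta + Ci * RtoC t)%C by (rewrite RtoC_plus; ring).
    apply (sinv_vertical c m Om S sq w (sq w) f T psi r rho y1 y2); auto; fold h2; try lra.
    - apply Hsq1; [rewrite HCi; exact He|exact Ho].
    - rewrite HCi. lra.
    - replace (Ci * RtoC eta + Ci * RtoC t)%C with (Ci * RtoC (eta + t))%C by (rewrite RtoC_plus; ring).
      rewrite HCi. lra. }
  assert (Hle : forall x, Om x -> Cmod (T x) < rho2 -> psi (T x) = x -> Cmod (S x - S w)%C < rho2 ->
     0 < Im (T x) /\ Im (S x) <= Im (T x)).
  { intros x Hx HT Hp HSx. destruct (Hcen x Hx HT Hp) as [A [B D]].
    set (eta := Im (T x)) in *. set (s := Im (S x)).
    assert (Es : Im (S (psi (Ci * RtoC eta)%C)) = s) by (rewrite B; unfold s; destruct (S x); simpl; ring).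
    assert (Hs0 : 0 < s) by (now apply Hpos). assert (Hs2 := Him x rho2 HSx). fold s in Hs2. apply Rabs_def2 in Hs2.
    assert (Hzero : ~ (0 < s - eta < h2)).
    { intros Hse. destruct (Hvert eta (- eta)) as [X _]; rewrite ?Es; try lra.
      - rewrite Rplus_opp_r, Rabs_R0. lra.
      - exact A.
      - rewrite Rplus_opp_r, Cmult_0_r, P0 in X. now apply Hnw. }
    apply Rabs_def2 in D. split.
    - apply Rnot_le_lt. intros L. apply Hzero. lra.
    - apply Rnot_lt_le. intros L. apply Hzero. lra. }
  assert (Heq : forall x, Om x -> Cmod (T x) < rho2 -> psi (T x) = x -> Cmod (S x - S w)%C < rho2 ->
     Im (S x) = Im (T x)).
  { intros x Hx HT Hp HSx. destruct (Hle x Hx HT Hp HSx) as [Heta Hse]. apply Rle_antisym; [exact Hse|].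
    apply Rnot_lt_le. intros Hlt. assert (Hs0 := Hpos x Hx).
    destruct (Hpts (Rmin rho2 (Rmin (Im (T x) - Im (S x)) (Im (S x))))) as [x' [Hx' [HT' [_ [Hp' HSx']]]]];
      [repeat apply Rmin_pos; lra|].
    assert (M1 := Rmin_l rho2 (Rmin (Im (T x) - Im (S x)) (Im (S x)))).
    assert (M2 := Rmin_r rho2 (Rmin (Im (T x) - Im (S x)) (Im (S x)))).
    assert (M3 := Rmin_l (Im (T x) - Im (S x)) (Im (S x))). assert (M4 := Rmin_r (Im (T x) - Im (S x)) (Im (S x))).
    destruct (Hcen x Hx HT Hp) as [A [B D]]. destruct (Hcen x' Hx' ltac:(lra) Hp') as [A' [B' D']].
    destruct (Hle x' Hx' ltac:(lra) Hp' ltac:(lra)) as [Heta' Hse'].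
    assert (Hs' := Him x' _ HSx'). assert (Hs0' := Hpos x' Hx'). apply Rabs_def2 in Hs'.
    set (eta := Im (T x)) in *. set (eta' := Im (T x')) in *. set (s := Im (S x)) in *. set (s' := Im (S x')) in *.
    assert (Heta'' : eta' < eta - s).
    { assert (X := im_le_Cmod (T x')). fold eta' in X. rewrite Rabs_pos_eq in X by lra. lra. }
    assert (Es : Im (S (psi (Ci * RtoC eta)%C)) = s) by (rewrite B; unfold s; destruct (S x); simpl; ring).
    apply Rabs_def2 in D. apply Rabs_def2 in D'.
    assert (Hsb := Him x rho2 HSx). fold s in Hsb. apply Rabs_def2 in Hsb.
    destruct (Hvert eta (s' - s)) as [X Y]; rewrite ?Es; try lra; auto.
    { apply Rabs_def1; lra. } { apply Rabs_def1; lra. }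
    (* A vertical move by [s' - s] and the horizontal shift [de] bring the foot of [x] to the
       [S]-value of the recentred [x']. Its height in the chart is then [eta + s' - s], which
       exceeds [eta'], against injectivity of [S]. *)
    set (de := Re (S x' - S x)%C - Re (T x') + Re (T x)).
    assert (Hde : Rabs de < 4 * rho2).
    { unfold de. assert (X1 := re_le_Cmod (S x' - S x)%C). assert (X2 := Cmod_sub_triangle (S x') (S w) (S x)).
      rewrite (Cmod_sub_sym (S w) (S x)) in X2. assert (X3 := re_le_Cmod (T x')). assert (X4 := re_le_Cmod (T x)).
      assert (X5 : Rabs (Re (S x' - S x)%C) < 2 * rho2) by lra. apply Rabs_def2 in X5.
      assert (X6 : Rabs (Re (T x')) < rho2) by lra. apply Rabs_def2 in X6.
      assert (X7 : Rabs (Re (T x)) < rho2) by lra. apply Rabs_def2 in X7. apply Rabs_def1; lra. }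
    assert (Hc1 : Cmod (Ci * RtoC (eta + (s' - s)))%C < rho2) by (rewrite HCi; apply Rabs_def1; lra).
    assert (Hc2 : Cmod (Ci * RtoC (eta + (s' - s)) + RtoC de)%C < rho1).
    { eapply Rle_lt_trans; [apply Cmod_triangle|]. rewrite Cmod_R. lra. }
    destruct (Hchord (Ci * RtoC (eta + (s' - s)))%C de ltac:(lra) Hc2 X) as [U V].
    assert (EQ : psi (Ci * RtoC (eta + (s' - s)) + RtoC de)%C = psi (Ci * RtoC eta')%C).
    { apply (sheet_inj c m Om S sq); auto. rewrite V, Y, B, B'. unfold de, s, s'.
      destruct (S x) as [p q], (S x') as [p' q'], (T x), (T x'). apply C_ext; simpl; ring. }
    apply Hinj in EQ; [|exact Hc2|rewrite HCi; apply Rabs_def1; lra].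
    apply (f_equal Im) in EQ. simpl in EQ. lra. }
  destruct (Hpts rho2 Hrho2) as [x [Hx [HT [_ [Hp HSx]]]]].
  destruct (Hcen x Hx HT Hp) as [A [B D]]. destruct (Hle x Hx HT Hp HSx) as [Heta _].
  assert (Hs := Heq x Hx HT Hp HSx). set (eta := Im (T x)) in *.
  assert (Es : Im (S (psi (Ci * RtoC eta)%C)) = eta) by (rewrite B, <- Hs; destruct (S x); simpl; ring).
  apply Rabs_def2 in D.
  assert (Hseg : forall t, 0 < t <= eta -> Om (psi (Ci * RtoC t)%C) /\
     S (psi (Ci * RtoC t)%C) = (S (psi (Ci * RtoC eta)%C) + Ci * RtoC (t - eta))%C).
  { intros t Ht. replace t with (eta + (t - eta)) at 1 2 by ring. apply Hvert; rewrite ?Es; try lra; auto; apply Rabs_def1; lra. }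
  (* Along the vertical, [S] and the chart coordinate differ by a constant; letting the point tend
     to [w] identifies it as [S w]. *)
  assert (Hre : (S (psi (Ci * RtoC eta)%C) - Ci * RtoC eta)%C = S w).
  { apply Cmod_small_eq. intros e He. destruct (HSc (e / 2)) as [d1 [Hd1 K1]]; [lra|].
    destruct (deriv_cont _ _ _ _ D0 d1 Hd1) as [d2 [Hd2 K2]]. rewrite P0 in K2.
    set (t := Rmin (Rmin (e / 2) (d2 / 2)) eta). assert (Ht0 : 0 < t) by (repeat apply Rmin_pos; lra).
    assert (Q1 : t <= Rmin (e / 2) (d2 / 2)) by apply Rmin_l. assert (Q2 : t <= eta) by apply Rmin_r.
    assert (Q3 := Rmin_l (e / 2) (d2 / 2)). assert (Q4 := Rmin_r (e / 2) (d2 / 2)).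
    destruct (Hseg t ltac:(lra)) as [_ E].
    specialize (K2 (Ci * RtoC t)%C). rewrite Cmod_cut, HCi, Rabs_pos_eq in K2 by lra.
    specialize (K1 _ (K2 ltac:(lra))). rewrite E in K1.
    replace (S (psi (Ci * RtoC eta)) - Ci * RtoC eta - S w)%C with
      ((S (psi (Ci * RtoC eta)) + Ci * RtoC (t - eta) - S w) - Ci * RtoC t)%C by (rewrite RtoC_minus; ring).
    eapply Rle_trans; [apply Cmod_sub_le|]. rewrite HCi, Rabs_pos_eq by lra. lra. }
  exists (Rmin eta rho1). split; [split; [apply Rmin_pos; lra|apply Rle_trans with rho1; [apply Rmin_r|exact L1]]|].
  intros z Hz Hiz. assert (Q1 := Rmin_l eta rho1). assert (Q2 := Rmin_r eta rho1).
  assert (X := im_le_Cmod z). rewrite Rabs_pos_eq in X by lra.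
  destruct (Hseg (Im z) ltac:(lra)) as [U V].
  assert (Ez : (Ci * RtoC (Im z) + RtoC (Re z))%C = z) by (destruct z; apply C_ext; simpl; ring).
  destruct (Hchord (Ci * RtoC (Im z))%C (Re z)) as [U' V']; auto.
  - rewrite HCi, Rabs_pos_eq; lra.
  - rewrite Ez. lra.
  - rewrite Ez in U', V'. split; [exact U'|]. rewrite V', V, <- Hre, RtoC_minus.
    transitivity (S (psi (Ci * RtoC eta)) - Ci * RtoC eta + (Ci * RtoC (Im z) + RtoC (Re z)))%C; [ring|].
    now rewrite Ez.
Qed.

(** * The two adjoining domains *)

Definition on_curve (gam : R -> C) (x : C) : Prop := exists t, 0 <= t /\ gam t = x.
Definition tilde (Om Om' : C -> Prop) (a : C) (gam : R -> C) (x : C) : Prop :=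
  Om x \/ Om' x \/ (on_curve gam x /\ x <> a).

(** The hypotheses of the theorem with limits in epsilon form. They are symmetric under exchange of
    the domains together with a change of sign of [sq] and [S], which [setting_swap] uses to halve
    the work. *)
Record setting (c : nat -> C) (m : nat) (Om Om' : C -> Prop) (a : C) (gam : R -> C) (S sq : C -> C) : Prop := {
  st_deg : is_poly_deg c m;
  st_dom : stokes_domain c m Om;
  st_dom' : stokes_domain c m Om';
  st_arc : stokes_arc c m a gam p_infty;
  st_inf : forall M, exists t0, forall t, t0 < t -> M < Cmod (gam t);
  st_bd : forall x, (boundary Om x /\ boundary Om' x) <-> on_curve gam x;
  st_sq : forall x, tilde Om Om' a gam x -> (sq x * sq x)%C = peval c m x;
  st_cont : forall x, tilde Om Om' a gam x -> ccont sq x;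
  st_S : forall x, tilde Om Om' a gam x -> cder S x (sq x);
  st_a : forall e, 0 < e -> exists d, 0 < d /\ forall x, tilde Om Om' a gam x -> Cmod (x - a)%C < d -> Cmod (S x) < e;
  st_pos : forall x, Om x -> 0 < Im (S x);
  st_neg : forall x, Om' x -> Im (S x) < 0 }.

Lemma tilde_swap Om Om' a gam x : tilde Om' Om a gam x <-> tilde Om Om' a gam x.
Proof. unfold tilde. tauto. Qed.

Lemma setting_swap c m Om Om' a gam S sq : setting c m Om Om' a gam S sq ->
  setting c m Om' Om a gam (fun x => - S x)%C (fun x => - sq x)%C.
Proof.
  intros []. split; auto.
  - intros x. rewrite <- st_bd0. tauto.
  - intros x Hx. apply tilde_swap in Hx. rewrite <- st_sq0 by exact Hx. ring.
  - intros x Hx. apply tilde_swap in Hx.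
    apply (cont_ext _ (fun y => (-(1)) * sq y)%C _ _ 1); [lra|intros; ring|].
    apply cont_mult; [apply cont_const|now apply st_cont0].
  - intros x Hx. apply tilde_swap in Hx. now apply deriv_opp, st_S0.
  - intros e He. destruct (st_a0 e He) as [d [Hd K]]. exists d. split; [exact Hd|]. intros x Hx.
    apply tilde_swap in Hx. rewrite Cmod_opp. now apply K.
  - intros x Hx. specialize (st_neg0 x Hx). destruct (S x). simpl in *. lra.
  - intros x Hx. specialize (st_pos0 x Hx). destruct (S x). simpl in *. lra.
Qed.

Lemma setting_sheet c m Om Om' a gam S sq : setting c m Om Om' a gam S sq -> sheet c m Om S sq.
Proof.
  intros []. split; auto; intros x Hx.
  - apply st_sq0. now left.
  - apply st_cont0. now left.
  - apply st_S0. now left.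
Qed.

(** The curve has [Q gam'^2 > 0], hence carries no zero after [a]. The height vanishes at [w] since
    points of [Om], of positive height, and points of [Om'], of negative height, both accumulate
    there. *)
Lemma curve_facts c m Om Om' a gam S sq w : setting c m Om Om' a gam S sq -> on_curve gam w -> w <> a ->
  peval c m w <> RtoC 0 /\ sq w <> RtoC 0 /\ on_stokes c m w /\ closure_of Om w /\ closure_of Om' w /\
  Im (S w) = 0.
Proof.
  intros HS Hw Hwa. destruct Hw as [t [Ht Et]].
  assert (Htl : tilde Om Om' a gam w) by (right; right; split; [now exists t|exact Hwa]).
  assert (Harc := st_arc _ _ _ _ _ _ _ _ HS).
  assert (Hos : on_stokes c m w) by (exists a, gam, p_infty, t; exact (conj Harc (conj Ht (conj Logic.I Et)))).
  destruct Harc as [_ [_ [Hg0 [_ Hgd]]]].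
  assert (Ht0 : 0 < t) by (destruct Ht as [L | L]; [exact L|exfalso; apply Hwa; now rewrite <- Et, <- L]).
  assert (HQ : peval c m w <> RtoC 0).
  { intros E. destruct (Hgd t Ht0 Logic.I) as [d [_ [_ D]]]. rewrite Et, E in D.
    replace (0 * (d * d))%C with (RtoC 0) in D by ring. simpl in D. lra. }
  destruct (proj2 (st_bd _ _ _ _ _ _ _ _ HS w) (ex_intro _ t (conj Ht Et))) as [[C1 N1] [C2 N2]].
  split; [exact HQ|]. split; [|split; [exact Hos|split; [exact C1|split; [exact C2|]]]].
  - intros E. apply HQ. rewrite <- (st_sq _ _ _ _ _ _ _ _ HS w Htl), E. ring.
  - assert (HSc := deriv_cont _ _ _ _ (st_S _ _ _ _ _ _ _ _ HS w Htl)).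
    assert (Hd : forall x, Im (S x - S w)%C = Im (S x) - Im (S w)) by (intros; destruct (S x), (S w); reflexivity).
    destruct (Rtotal_order (Im (S w)) 0) as [L | [L | L]]; [|exact L|]; exfalso.
    + destruct (HSc (- Im (S w))) as [d [Hdp K]]; [lra|]. destruct (C1 d Hdp) as [y [Hy Hyd]].
      specialize (K y Hyd). assert (A := im_le_Cmod (S y - S w)%C). rewrite Hd in A.
      assert (P := st_pos _ _ _ _ _ _ _ _ HS y Hy). assert (Q := Rle_abs (Im (S y) - Im (S w))). lra.
    + destruct (HSc (Im (S w))) as [d [Hdp K]]; [lra|]. destruct (C2 d Hdp) as [y [Hy Hyd]].
      specialize (K y Hyd). assert (A := im_le_Cmod (S y - S w)%C). rewrite Hd in A.
      assert (P := st_neg _ _ _ _ _ _ _ _ HS y Hy). assert (Q := Rle_abs (- (Im (S y) - Im (S w)))).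
      rewrite Rabs_Ropp in Q. lra.
Qed.

(** By [half_chart] the upper half disc belongs to [Om] and the lower one to [Om']. A point of the
    diameter lies on the trajectory of [w], hence on a Stokes curve and in neither domain, and both
    domains accumulate at it; so the hypothesis on the common boundary puts it on the curve. Its
    value of [S] follows by continuity. *)
Lemma curve_chart c m Om Om' a gam S sq w : setting c m Om Om' a gam S sq -> on_curve gam w -> w <> a ->
  exists f T psi r rho, chart (peval c m) w (sq w) f T psi r rho /\ forall z, Cmod z < rho ->
    tilde Om Om' a gam (psi z) /\ S (psi z) = (S w + z)%C.
Proof.
  intros HS Hw Hwa. destruct (curve_facts _ _ _ _ _ _ _ _ _ HS Hw Hwa) as [HQ [Hsq [Hos [C1 [C2 HI]]]]].
  assert (Htl : tilde Om Om' a gam w) by (right; right; now split).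
  assert (HS' := setting_swap _ _ _ _ _ _ _ _ HS).
  assert (N1 : ~ Om w) by (intros X; exact (domain_not_stokes _ _ _ _ (st_dom _ _ _ _ _ _ _ _ HS) X Hos)).
  assert (N2 : ~ Om' w) by (intros X; exact (domain_not_stokes _ _ _ _ (st_dom' _ _ _ _ _ _ _ _ HS) X Hos)).
  destruct (chart_exists c m w (sq w) 1 (st_sq _ _ _ _ _ _ _ _ HS w Htl) Hsq Rlt_0_1) as [f [T [psi [r [rho [HC _]]]]]].
  assert (Hsc := st_cont _ _ _ _ _ _ _ _ HS w Htl).
  assert (HSc := deriv_cont _ _ _ _ (st_S _ _ _ _ _ _ _ _ HS w Htl)).
  assert (Htl' := proj2 (tilde_swap Om Om' a gam w) Htl).
  destruct (half_chart c m Om S sq w f T psi r rho) as [r1 [Hr1 H1]]; auto.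
  { now apply (setting_sheet _ _ _ _ _ _ _ _ HS). } { apply HS. }
  destruct (half_chart c m Om' (fun x => - S x)%C (fun x => - sq x)%C w (fun y => - f y)%C (fun y => - T y)%C
    (fun z => psi (- z)%C) r rho) as [r2 [Hr2 H2]]; auto.
  { exact (setting_sheet _ _ _ _ _ _ _ _ HS'). }
  { apply HS'. }
  { now apply chart_opp. }
  { exact (st_cont _ _ _ _ _ _ _ _ HS' w Htl'). }
  { exact (deriv_cont _ _ _ _ (st_S _ _ _ _ _ _ _ _ HS' w Htl')). }
  { destruct (S w). simpl in *. lra. }
  assert (L1 := Rmin_l r1 r2). assert (L2 := Rmin_r r1 r2).
  assert (Hm : 0 < Rmin r1 r2) by (apply Rmin_pos; lra).
  assert (Hup : forall z, Cmod z < Rmin r1 r2 -> 0 < Im z -> Om (psi z) /\ S (psi z) = (S w + z)%C).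
  { intros z Hz Hi. apply H1; lra. }
  assert (Hdn : forall z, Cmod z < Rmin r1 r2 -> Im z < 0 -> Om' (psi z) /\ S (psi z) = (S w + z)%C).
  { intros z Hz Hi. destruct (H2 (- z)%C) as [A B].
    - rewrite Cmod_opp. lra.
    - destruct z. simpl in *. lra.
    - replace (- - z)%C with z in * by ring. split; [exact A|].
      replace (S (psi z)) with (- - S (psi z))%C by ring. rewrite B. ring. }
  assert (Hall : forall z, Cmod z < Rmin r1 r2 -> tilde Om Om' a gam (psi z) /\ S (psi z) = (S w + z)%C).
  { intros z Hz. destruct (Rtotal_order (Im z) 0) as [L | [L | L]].
    - destruct (Hdn z Hz L). split; [right; now left|easy].
    - assert (Ez : z = RtoC (Re z)) by (apply C_ext; simpl; auto).
      assert (Hzr : Cmod z < rho) by lra.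
      destruct (chart_psi _ _ _ _ _ _ _ _ HC z Hzr) as [P1 [P2 P3]].
      destruct (chart_f _ _ _ _ _ _ _ _ HC _ P1) as [F1 [F2 _]].
      assert (Hst : on_stokes c m (psi z)).
      { destruct (chart_line_traj _ _ _ _ _ _ _ _ 0 HC) as [O Lt].
        assert (X := on_stokes_traj c m _ _ _ 0 (Re z) O Lt). cbv beta in X.
        rewrite !Cplus_0_l, <- Ez, (chart_psi0 _ _ _ _ _ _ _ _ HC) in X. apply X; auto.
        rewrite Cmod_0. apply HC. }
      assert (Hpc := deriv_cont _ _ _ _ P3).
      assert (HCi : forall t, Cmod (Ci * RtoC t)%C = Rabs t) by (intros t; rewrite Cmod_mult, Cmod_Ci, Cmod_R; ring).
      assert (Happ : forall e, 0 < e -> exists t, 0 < t < e /\ Cmod (z + Ci * RtoC t)%C < Rmin r1 r2 /\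
         Cmod (z + Ci * RtoC (- t))%C < Rmin r1 r2 /\ Cmod (psi (z + Ci * RtoC t) - psi z)%C < e /\
         Cmod (psi (z + Ci * RtoC (- t)) - psi z)%C < e).
      { intros e He. destruct (Hpc e He) as [d [Hd K]].
        set (t := Rmin (e / 2) (Rmin (d / 2) ((Rmin r1 r2 - Cmod z) / 2))).
        assert (Q1 : t <= e / 2) by apply Rmin_l. assert (Q2 : t <= Rmin (d / 2) ((Rmin r1 r2 - Cmod z) / 2)) by apply Rmin_r.
        assert (Q3 := Rmin_l (d / 2) ((Rmin r1 r2 - Cmod z) / 2)). assert (Q4 := Rmin_r (d / 2) ((Rmin r1 r2 - Cmod z) / 2)).
        assert (Ht : 0 < t) by (repeat apply Rmin_pos; lra). exists t.
        assert (A1 : Rabs t = t) by (apply Rabs_pos_eq; lra).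
        split; [lra|]. split; [|split; [|split]].
        - eapply Rle_lt_trans; [apply Cmod_triangle|]. rewrite HCi. lra.
        - eapply Rle_lt_trans; [apply Cmod_triangle|]. rewrite HCi, Rabs_Ropp. lra.
        - apply K. replace (z + Ci * RtoC t - z)%C with (Ci * RtoC t)%C by ring. rewrite HCi. lra.
        - apply K. replace (z + Ci * RtoC (- t) - z)%C with (Ci * RtoC (- t))%C by ring. rewrite HCi, Rabs_Ropp. lra. }
      assert (Hiu : forall t, Im (z + Ci * RtoC t)%C = t) by (intros t; destruct z; simpl in *; lra).
      assert (Hzt : tilde Om Om' a gam (psi z)).
      { right; right. split.
        - apply (st_bd _ _ _ _ _ _ _ _ HS). split; split.
          + intros e He. destruct (Happ e He) as [t [Ht [T1 [_ [T3 _]]]]]. exists (psi (z + Ci * RtoC t)%C).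
            split; [apply Hup; [exact T1|rewrite Hiu; lra]|exact T3].
          + intros X. exact (domain_not_stokes _ _ _ _ (st_dom _ _ _ _ _ _ _ _ HS) X Hst).
          + intros e He. destruct (Happ e He) as [t [Ht [_ [T2 [_ T4]]]]]. exists (psi (z + Ci * RtoC (- t))%C).
            split; [apply Hdn; [exact T2|rewrite Hiu; lra]|exact T4].
          + intros X. exact (domain_not_stokes _ _ _ _ (st_dom' _ _ _ _ _ _ _ _ HS) X Hst).
        - intros E. assert (Qa : peval c m a = RtoC 0) by apply (st_arc _ _ _ _ _ _ _ _ HS).
          rewrite E, Qa in F1. assert (Fa : f a <> RtoC 0) by (rewrite <- E; exact F2).
          apply (Cmult_neq_0 _ _ Fa Fa F1). }
      split; [exact Hzt|]. apply Cmod_small_eq. intros e He.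
      destruct (deriv_cont _ _ _ _ (st_S _ _ _ _ _ _ _ _ HS _ Hzt) (e / 2)) as [d [Hd K]]; [lra|].
      destruct (Happ (Rmin (e / 2) d)) as [t [Ht [T1 [_ [T3 _]]]]]; [apply Rmin_pos; lra|].
      assert (Q1 := Rmin_l (e / 2) d). assert (Q2 := Rmin_r (e / 2) d).
      destruct (Hup (z + Ci * RtoC t)%C T1) as [_ X]; [rewrite Hiu; lra|].
      specialize (K _ (Rlt_le_trans _ _ _ T3 Q2)). rewrite X in K. rewrite Cmod_sub_sym.
      replace (S w + z - S (psi z))%C with ((S w + (z + Ci * RtoC t) - S (psi z)) - Ci * RtoC t)%C by ring.
      eapply Rle_trans; [apply Cmod_sub_le|]. rewrite HCi, Rabs_pos_eq by lra. lra.
    - destruct (Hup z Hz L). split; [now left|easy]. }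
  exists f, T, psi, r, (Rmin r1 r2). split; [|exact Hall].
  split; try apply HC; try lra.
  - intros z Hz. apply (chart_psi _ _ _ _ _ _ _ _ HC). lra.
  - intros y Hy HT. apply (chart_inv _ _ _ _ _ _ _ _ HC); [exact Hy|lra].
Qed.

(** Cauchy's form of the mean value theorem, for [Re g] against [F]. *)
Lemma rder_Rle (g : R -> C) K a b (g1 : R -> C) F (F1 : R -> R) : a < b ->
  (forall t, a <= t <= b -> rder g t (g1 t)) -> (forall t, a <= t <= b -> is_derive F t (F1 t)) ->
  (forall t, a <= t <= b -> F1 t <> 0 /\ Cmod (g1 t) <= K * Rabs (F1 t)) ->
  Rabs (Re (g b) - Re (g a)) <= K * Rabs (F b - F a).
Proof.
  intros Hab Hg HF HK.
  destruct (MVT_real (fun t => Re (g t) * (F b - F a) - F t * (Re (g b) - Re (g a)))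
    (fun t => Re (g1 t) * (F b - F a) - F1 t * (Re (g b) - Re (g a))) a b Hab) as [x [Hx E]].
  - intros t Ht. apply (is_derive_minus (fun t => Re (g t) * (F b - F a)) (fun t => F t * (Re (g b) - Re (g a)))).
    + apply (is_derive_ext (fun t => scal (F b - F a) (Re (g t)))).
      { intros s. unfold scal; simpl; unfold mult; simpl. ring. }
      replace (Re (g1 t) * (F b - F a)) with (scal (F b - F a) (Re (g1 t))) by (unfold scal; simpl; unfold mult; simpl; ring).
      apply (is_derive_scal (fun t => Re (g t))). now apply rder_Re, Hg.
    + apply (is_derive_ext (fun t => scal (Re (g b) - Re (g a)) (F t))).
      { intros s. unfold scal; simpl; unfold mult; simpl. ring. }
      replace (F1 t * (Re (g b) - Re (g a))) with (scal (Re (g b) - Re (g a)) (F1 t)) by (unfold scal; simpl; unfold mult; simpl; ring).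
      apply (is_derive_scal F). now apply HF.
  - assert (E0 : Re (g1 x) * (F b - F a) = F1 x * (Re (g b) - Re (g a))).
    { apply Rminus_diag_uniq. apply Rmult_eq_reg_r with (b - a); [|lra]. rewrite <- E. ring. }
    destruct (HK x ltac:(lra)) as [N B]. assert (R1 := re_le_Cmod (g1 x)).
    apply (f_equal Rabs) in E0. rewrite !Rabs_mult in E0.
    assert (P : 0 < Rabs (F1 x)) by now apply Rabs_pos_lt.
    apply Rmult_le_reg_l with (Rabs (F1 x)); [exact P|]. rewrite <- E0.
    replace (Rabs (F1 x) * (K * Rabs (F b - F a))) with (K * Rabs (F1 x) * Rabs (F b - F a)) by ring.
    apply Rmult_le_compat_r; [apply Rabs_pos|lra].
Qed.

(** [|gam| -> oo] forces [S] to be unbounded on the curve since [|d gam| <= K |dS|] away from the zeros. *)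
Lemma curve_onto c m Om Om' a gam S sq s : setting c m Om Om' a gam S sq ->
  (forall x, on_curve gam x -> x <> a -> Re (S x) < 0) -> s < 0 ->
  exists x, on_curve gam x /\ x <> a /\ S x = RtoC s.
Proof.
  intros HS Hneg Hs. destruct (st_arc _ _ _ _ _ _ _ _ HS) as [Ha [_ [Hg0 [Hlim Hgd]]]].
  assert (Hga : forall t, 0 < t -> gam t <> a).
  { intros t Ht E. destruct (Hgd t Ht Logic.I) as [d [_ [_ D]]]. rewrite E, Ha in D.
    replace (0 * (d * d))%C with (RtoC 0) in D by ring. simpl in D. lra. }
  assert (Hoc : forall t, 0 < t -> on_curve gam (gam t)) by (intros t Ht; exists t; split; [lra|easy]).
  assert (Htl : forall t, 0 < t -> tilde Om Om' a gam (gam t)) by (intros t Ht; right; right; auto).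
  set (g1 := fun t => epsilon (inhabits (RtoC 0)) (fun d => rder gam t d /\
     Im (peval c m (gam t) * (d * d))%C = 0 /\ 0 < Re (peval c m (gam t) * (d * d))%C)).
  assert (Hg1 : forall t, 0 < t -> rder gam t (g1 t) /\ Im (peval c m (gam t) * (g1 t * g1 t))%C = 0 /\
     0 < Re (peval c m (gam t) * (g1 t * g1 t))%C).
  { intros t Ht. apply (epsilon_spec (inhabits (RtoC 0)) (fun d => rder gam t d /\
     Im (peval c m (gam t) * (d * d))%C = 0 /\ 0 < Re (peval c m (gam t) * (d * d))%C)).
    destruct (Hgd t Ht Logic.I) as [d [D1 D2]]. exists d. split; [now apply rderiv_is_rder|exact D2]. }
  set (F := fun t => Re (S (gam t))). set (F1 := fun t => Re (sq (gam t) * g1 t)%C).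
  assert (HSg : forall t, 0 < t -> rder (fun t => S (gam t)) t (sq (gam t) * g1 t)%C).
  { intros t Ht. apply (deriv_comp RtoC gam S); [now apply Hg1|]. apply (st_S _ _ _ _ _ _ _ _ HS). now apply Htl. }
  assert (HF : forall t, 0 < t -> is_derive F t (F1 t)) by (intros t Ht; now apply rder_Re, HSg).
  assert (HF1 : forall t, 0 < t -> F1 t <> 0 /\ Cmod (sq (gam t) * g1 t)%C = Rabs (F1 t)).
  { intros t Ht. destruct (Hg1 t Ht) as [_ [A B]].
    assert (E : (sq (gam t) * g1 t * (sq (gam t) * g1 t))%C = (peval c m (gam t) * (g1 t * g1 t))%C).
    { rewrite <- (st_sq _ _ _ _ _ _ _ _ HS _ (Htl t Ht)). ring. }
    destruct (sqr_pos_real (sq (gam t) * g1 t)%C) as [X Y]; [now rewrite E|now rewrite E|]. split; [exact Y|].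
    unfold F1. replace (sq (gam t) * g1 t)%C with (RtoC (Re (sq (gam t) * g1 t)%C)) at 1; [apply Cmod_R|].
    apply C_ext; simpl; auto. }
  assert (Hcp : forall t, 0 < t -> continuity_pt F t) by (intros t Ht; eapply is_derive_cont_pt, HF, Ht).
  assert (Hsmall : exists t, 0 < t /\ s < F t).
  { destruct (st_a _ _ _ _ _ _ _ _ HS (- s)) as [d [Hd K]]; [lra|].
    rewrite filterlim_at_right_eps in Hlim. destruct (Hlim d Hd) as [d' [Hd' K']].
    exists (d' / 2). split; [lra|]. specialize (K (gam (d' / 2)) (Htl (d' / 2) ltac:(lra)) (K' (d' / 2) ltac:(lra))).
    assert (A := re_le_Cmod (S (gam (d' / 2)))). assert (B := Rle_abs (- Re (S (gam (d' / 2))))).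
    rewrite Rabs_Ropp in B. unfold F. lra. }
  assert (Hbig : exists t, 0 < t /\ F t < s).
  { apply NNPP. intros Hno.
    assert (Hb : forall t, 0 < t -> s <= F t < 0).
    { intros t Ht. split; [|apply Hneg; auto]. apply Rnot_lt_le. intros L. apply Hno. now exists t. }
    destruct (poly_growth c m (st_deg _ _ _ _ _ _ _ _ HS)) as [c1 [R0 [Hc1 [HR0 Hgr]]]].
    destruct (st_inf _ _ _ _ _ _ _ _ HS R0) as [t0 Ht0].
    set (t1 := Rmax t0 0 + 1). assert (Q1 := Rmax_l t0 0). assert (Q2 := Rmax_r t0 0).
    (* As for [traj_bounded], this dominates [c1^(-1/2)], so that [|d gam| <= K |d F|] far out on
       the curve. *)
    set (K := 1 + / c1). assert (Hic : 0 < / c1) by now apply Rinv_0_lt_compat.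
    assert (HK : forall t, t1 <= t -> F1 t <> 0 /\ Cmod (g1 t) <= K * Rabs (F1 t)).
    { intros t Ht. unfold t1 in Ht. assert (Htp : 0 < t) by lra. destruct (HF1 t Htp) as [N E]. split; [exact N|].
      assert (Hq : R0 <= Cmod (gam t)) by (apply Rlt_le, Ht0; lra). specialize (Hgr _ Hq).
      assert (H1 : 1 <= (1 + Cmod (gam t)) ^ m) by (apply pow_R1_Rle; assert (A := Cmod_ge_0 (gam t)); lra).
      rewrite <- (st_sq _ _ _ _ _ _ _ _ HS _ (Htl t Htp)), Cmod_mult in Hgr. rewrite Cmod_mult in E.
      set (q := Cmod (sq (gam t))) in *. assert (Hq0 : 0 <= q) by apply Cmod_ge_0.
      assert (Hqq : c1 <= q * q) by nra.
      assert (Hqk : 1 <= K * q).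
      { apply Rnot_lt_le. intros L. assert (Cc : c1 * / c1 = 1) by (apply Rinv_r; lra).
        unfold K in L. assert (q < 1) by nra. assert (q * q <= q) by nra.
        assert (c1 * / c1 <= q * / c1) by (apply Rmult_le_compat_r; lra). nra. }
      rewrite <- E. assert (G := Cmod_ge_0 (g1 t)). nra. }
    assert (HB : forall t, t1 < t -> Cmod (gam t) <= Cmod (gam t1) + 2 * (K * - s)).
    { intros t Ht. assert (Ht1 : 0 < t1) by (unfold t1; lra).
      assert (HFF : Rabs (F t - F t1) <= - s).
      { assert (A := Hb t ltac:(lra)). assert (B := Hb t1 Ht1). apply Rabs_le. lra. }
      assert (HKp : 0 < K) by (unfold K; lra).
      assert (A1 := rder_Rle gam K t1 t g1 F F1 Ht (fun u Hu => proj1 (Hg1 u ltac:(lra)))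
        (fun u Hu => HF u ltac:(lra)) (fun u Hu => HK u ltac:(lra))).
      assert (A2 := rder_Rle (fun u => - Ci * gam u)%C K t1 t (fun u => - Ci * g1 u)%C F F1 Ht
        (fun u Hu => deriv_scal _ _ _ _ _ (proj1 (Hg1 u ltac:(lra)))) (fun u Hu => HF u ltac:(lra))).
      assert (Hc2 : forall u, Cmod (- Ci * g1 u)%C = Cmod (g1 u)) by (intros; rewrite Cmod_mult, Cmod_opp, Cmod_Ci; ring).
      assert (A3 : Rabs (Re (- Ci * gam t)%C - Re (- Ci * gam t1)%C) <= K * Rabs (F t - F t1)).
      { apply A2. intros u Hu. rewrite Hc2. apply HK. lra. }
      assert (Hr : Re (- Ci * gam t)%C - Re (- Ci * gam t1)%C = Im (gam t - gam t1)%C) by (destruct (gam t), (gam t1); simpl; ring).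
      assert (Hr' : Re (gam t) - Re (gam t1) = Re (gam t - gam t1)%C) by (destruct (gam t), (gam t1); simpl; ring).
      rewrite Hr in A3. rewrite Hr' in A1.
      assert (X := Cmod_le_Re_Im (gam t - gam t1)%C). assert (Y := Cmod_triangle_inv (gam t) (gam t1)).
      assert (K * Rabs (F t - F t1) <= K * - s) by (apply Rmult_le_compat_l; lra). lra. }
    destruct (st_inf _ _ _ _ _ _ _ _ HS (Cmod (gam t1) + 2 * (K * - s))) as [t2 Ht2].
    assert (M1 := Rmax_l t1 t2). assert (M2 := Rmax_r t1 t2).
    specialize (HB (Rmax t1 t2 + 1) ltac:(lra)). specialize (Ht2 (Rmax t1 t2 + 1) ltac:(lra)). lra. }
  destruct Hsmall as [u [Hu1 Hu2]]. destruct Hbig as [v [Hv1 Hv2]].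
  destruct (ivt_between F (Rmin u v) (Rmax u v) s) as [t [Ht Et]].
  - apply Rle_trans with u; [apply Rmin_l|apply Rmax_l].
  - intros t Ht. apply Hcp. apply Rlt_le_trans with (Rmin u v); [now apply Rmin_pos|lra].
  - unfold Rmin, Rmax. destruct (Rle_dec u v); lra.
  - assert (Ht0 : 0 < t) by (apply Rlt_le_trans with (Rmin u v); [now apply Rmin_pos|lra]).
    exists (gam t). split; [auto|]. split; [auto|].
    destruct (curve_facts _ _ _ _ _ _ _ _ _ HS (Hoc t Ht0) (Hga t Ht0)) as [_ [_ [_ [_ [_ HI]]]]].
    apply C_ext; simpl; [exact Et|exact HI].
Qed.

(** * The inverse of the primitive on the slit strip *)

Lemma Im_opp z : Im (- z)%C = - Im z.
Proof. now destruct z. Qed.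

(** The slit strip onto which [S] maps. *)
Definition zone (Om Om' : C -> Prop) (S : C -> C) (z : C) : Prop :=
  (exists y, Om y /\ Im z < Im (S y)) /\ (exists y, Om' y /\ Im (S y) < Im z) /\ (Im z = 0 -> Re z < 0).

(** The sign of the height tells which of the three pieces a point lies in. For two points of the
    curve, the points at a small height [t] above them lie in [Om] and have the same value of [S],
    so they coincide; they are as close to [x] and to [y] as desired. *)
Lemma tilde_inj c m Om Om' a gam S sq x y : setting c m Om Om' a gam S sq ->
  tilde Om Om' a gam x -> tilde Om Om' a gam y -> S x = S y -> x = y.
Proof.
  intros HS Hx Hy E.
  assert (H1 := setting_sheet _ _ _ _ _ _ _ _ HS).
  assert (H2 := setting_sheet _ _ _ _ _ _ _ _ (setting_swap _ _ _ _ _ _ _ _ HS)).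
  assert (Hsgn : forall u, tilde Om Om' a gam u -> (0 < Im (S u) /\ Om u) \/ (Im (S u) < 0 /\ Om' u) \/
     (Im (S u) = 0 /\ on_curve gam u /\ u <> a)).
  { intros u [Hu | [Hu | [Hu1 Hu2]]].
    - left. split; [now apply (st_pos _ _ _ _ _ _ _ _ HS)|exact Hu].
    - right; left. split; [now apply (st_neg _ _ _ _ _ _ _ _ HS)|exact Hu].
    - right; right. split; [|now split]. now apply (curve_facts _ _ _ _ _ _ _ _ _ HS Hu1 Hu2). }
  assert (EI : Im (S x) = Im (S y)) by now rewrite E.
  destruct (Hsgn x Hx) as [[A1 A2] | [[A1 A2] | [A1 [A2 A3]]]];
  destruct (Hsgn y Hy) as [[B1 B2] | [[B1 B2] | [B1 [B2 B3]]]]; try (exfalso; lra).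
  - now apply (sheet_inj _ _ _ _ _ _ _ H1).
  - apply (sheet_inj _ _ _ _ _ _ _ H2); auto. now rewrite E.
  - destruct (curve_chart _ _ _ _ _ _ _ _ _ HS A2 A3) as [f [T [psi [r [rho [HC HP]]]]]].
    destruct (curve_chart _ _ _ _ _ _ _ _ _ HS B2 B3) as [f' [T' [psi' [r' [rho' [HC' HP']]]]]].
    assert (R1 := chart_rho _ _ _ _ _ _ _ _ HC). assert (R2 := chart_rho _ _ _ _ _ _ _ _ HC').
    assert (P1 := chart_psi0 _ _ _ _ _ _ _ _ HC). assert (P2 := chart_psi0 _ _ _ _ _ _ _ _ HC').
    apply Cmod_small_eq. intros e He.
    destruct (chart_psi _ _ _ _ _ _ _ _ HC 0 ltac:(rewrite Cmod_0; exact R1)) as [_ [_ D1]].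
    destruct (chart_psi _ _ _ _ _ _ _ _ HC' 0 ltac:(rewrite Cmod_0; exact R2)) as [_ [_ D2]].
    destruct (deriv_cont _ _ _ _ D1 (e / 2)) as [d1 [Hd1 K1]]; [lra|].
    destruct (deriv_cont _ _ _ _ D2 (e / 2)) as [d2 [Hd2 K2]]; [lra|].
    set (t := Rmin (Rmin rho rho') (Rmin d1 d2) / 2).
    assert (Q1 := Rmin_l (Rmin rho rho') (Rmin d1 d2)). assert (Q2 := Rmin_r (Rmin rho rho') (Rmin d1 d2)).
    assert (Q3 := Rmin_l rho rho'). assert (Q4 := Rmin_r rho rho'). assert (Q5 := Rmin_l d1 d2). assert (Q6 := Rmin_r d1 d2).
    assert (Ht : 0 < Rmin (Rmin rho rho') (Rmin d1 d2)) by (repeat apply Rmin_pos; lra).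
    assert (Hz : Cmod (Ci * RtoC t)%C = t).
    { rewrite Cmod_mult, Cmod_Ci, Cmod_R, Rabs_pos_eq; unfold t; lra. }
    specialize (K1 (Ci * RtoC t)%C). specialize (K2 (Ci * RtoC t)%C). rewrite Cmod_cut, Hz in K1, K2.
    rewrite P1 in K1. rewrite P2 in K2.
    destruct (HP (Ci * RtoC t)%C) as [U1 V1]; [rewrite Hz; unfold t; lra|].
    destruct (HP' (Ci * RtoC t)%C) as [U2 V2]; [rewrite Hz; unfold t; lra|].
    assert (Hit : forall u, Im (S u) = 0 -> Im (S u + Ci * RtoC t)%C = t) by (intros u Hu; destruct (S u); simpl in *; lra).
    assert (EQ : psi (Ci * RtoC t)%C = psi' (Ci * RtoC t)%C).
    { destruct (Hsgn _ U1) as [[X1 X2] | [[X1 _] | [X1 _]]]; try (rewrite V1, Hit in X1 by assumption; unfold t in X1; lra).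
      destruct (Hsgn _ U2) as [[Y1 Y2] | [[Y1 _] | [Y1 _]]]; try (rewrite V2, Hit in Y1 by assumption; unfold t in Y1; lra).
      apply (sheet_inj _ _ _ _ _ _ _ H1); auto. now rewrite V1, V2, E. }
    specialize (K1 ltac:(unfold t; lra)). specialize (K2 ltac:(unfold t; lra)). rewrite EQ in K1.
    assert (Tr := Cmod_sub_triangle x (psi' (Ci * RtoC t)%C) y). rewrite (Cmod_sub_sym x (psi' (Ci * RtoC t)%C)) in Tr. lra.
Qed.

(** Values near the axis exist because both domains accumulate at the curve, values on it by
    [curve_onto]. Injectivity on the union makes [psi] agree locally with [sinv] of the relevant
    domain off the axis and with the chart of [curve_chart] on it, and its derivative is taken from
    there. *)
Lemma zone_inverse c m Om Om' a gam S sq : setting c m Om Om' a gam S sq ->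
  (forall x, on_curve gam x -> x <> a -> Re (S x) < 0) ->
  exists psi : C -> C,
    (forall z, zone Om Om' S z -> tilde Om Om' a gam (psi z) /\ S (psi z) = z /\ cder psi z (/ sq (psi z))%C) /\
    (forall x, tilde Om Om' a gam x -> psi (S x) = x).
Proof.
  intros HS Hneg.
  assert (H1 := setting_sheet _ _ _ _ _ _ _ _ HS).
  assert (H2 := setting_sheet _ _ _ _ _ _ _ _ (setting_swap _ _ _ _ _ _ _ _ HS)).
  assert (Hlow : forall s, 0 < s -> (exists y, Om y /\ Im (S y) < s) /\ (exists y, Om' y /\ - s < Im (S y))).
  { intros s Hs. destruct (curve_onto _ _ _ _ _ _ _ _ (-1) HS Hneg ltac:(lra)) as [x [Hx [Hxa Ex]]].
    destruct (curve_facts _ _ _ _ _ _ _ _ _ HS Hx Hxa) as [_ [_ [_ [C1 [C2 _]]]]].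
    assert (Htl : tilde Om Om' a gam x) by (right; right; now split).
    destruct (deriv_cont _ _ _ _ (st_S _ _ _ _ _ _ _ _ HS x Htl) s Hs) as [d [Hd K]].
    assert (Hi : forall y, Cmod (y - x)%C < d -> Rabs (Im (S y)) < s).
    { intros y Hy. specialize (K y Hy). rewrite Ex in K. assert (A := im_le_Cmod (S y - RtoC (-1))%C).
      replace (Im (S y - RtoC (-1))%C) with (Im (S y)) in A by (destruct (S y); simpl; ring). lra. }
    split; [destruct (C1 d Hd) as [y [Hy Hyd]]|destruct (C2 d Hd) as [y [Hy Hyd]]]; exists y; (split; [exact Hy|]);
    apply Hi in Hyd; apply Rabs_def2 in Hyd; lra. }
  set (psi := fun z => epsilon (inhabits (RtoC 0)) (fun x => tilde Om Om' a gam x /\ S x = z)).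
  assert (Hpsi : forall z, zone Om Om' S z -> tilde Om Om' a gam (psi z) /\ S (psi z) = z).
  { intros z [[y1 [Hy1 L1]] [[y2 [Hy2 L2]] L3]].
    apply (epsilon_spec (inhabits (RtoC 0)) (fun x => tilde Om Om' a gam x /\ S x = z)).
    destruct (Rtotal_order (Im z) 0) as [L | [L | L]].
    - destruct (Hlow (- Im z)) as [_ [y [Hy Ly]]]; [lra|].
      destruct (sheet_surj _ _ _ _ _ y y2 (- z)%C H2 Hy Hy2) as [A B]; [rewrite !Im_opp; lra|].
      exists (sinv Om' (fun x => - S x)%C (- z)%C). split; [right; now left|].
      set (u := sinv Om' (fun x => - S x)%C (- z)%C) in *.
      replace (S u) with (- - S u)%C by ring. rewrite B. ring.
    - destruct (curve_onto _ _ _ _ _ _ _ _ (Re z) HS Hneg (L3 L)) as [x [Hx [Hxa Ex]]].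
      exists x. split; [right; right; now split|]. rewrite Ex. apply C_ext; simpl; auto.
    - destruct (Hlow (Im z)) as [[y [Hy Ly]] _]; [lra|].
      destruct (sheet_surj _ _ _ _ _ y y1 z H1 Hy Hy1) as [A B]; [lra|].
      exists (sinv Om S z). split; [now left|exact B]. }
  assert (Hinv : forall x, tilde Om Om' a gam x -> psi (S x) = x).
  { intros x Hx.
    destruct (epsilon_spec (inhabits (RtoC 0)) (fun u => tilde Om Om' a gam u /\ S u = S x)) as [A B]; [now exists x|].
    now apply (tilde_inj _ _ _ _ _ _ _ _ _ _ HS). }
  exists psi. split; [|exact Hinv]. intros z Hz. destruct (Hpsi z Hz) as [P1 P2].
  split; [exact P1|]. split; [exact P2|].
  destruct Hz as [[y1 [Hy1 L1]] [[y2 [Hy2 L2]] L3]].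
  assert (Him : forall u, Rabs (Im u - Im z) <= Cmod (u - z)%C).
  { intros u. replace (Im u - Im z) with (Im (u - z)%C) by (destruct u, z; reflexivity). apply im_le_Cmod. }
  destruct (Rtotal_order (Im z) 0) as [L | [L | L]].
  - destruct (Hlow (- Im z)) as [_ [y [Hy Ly]]]; [lra|].
    assert (Eq : forall u, - Im (S y) < - Im u < - Im (S y2) -> Im u < 0 -> sinv Om' (fun x => - S x)%C (- u)%C = psi u).
    { intros u Hu _. destruct (sheet_surj _ _ _ _ _ y y2 (- u)%C H2 Hy Hy2) as [A B]; [rewrite !Im_opp; lra|].
      set (v := sinv Om' (fun x => - S x)%C (- u)%C) in *.
      rewrite <- (Hinv v) by (right; now left). f_equal. replace (S v) with (- - S v)%C by ring. rewrite B. ring. }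
    assert (D : cder (fun u => sinv Om' (fun x => - S x)%C (- u)%C) z (/ sq (psi z))%C).
    { rewrite <- (Eq z) by lra.
      apply (deriv_eq _ _ _ (/ - sq (sinv Om' (fun x => - S x)%C (- z)%C) * - (1))%C).
      - apply (deriv_comp _ (fun u => - u)%C (sinv Om' (fun x => - S x)%C)); [apply deriv_opp, deriv_self|].
        apply (sinv_cder _ _ _ _ _ y y2 _ H2); auto. rewrite !Im_opp. lra.
      - destruct (sheet_surj _ _ _ _ _ y y2 (- z)%C H2 Hy Hy2) as [A _]; [rewrite !Im_opp; lra|].
        destruct (sheet_neq_0 _ _ _ _ _ _ H2 A) as [_ N]. field. intros Z. apply N. rewrite Z. ring. }
    set (de := Rmin (- Im z) (Rmin (Im (S y) - Im z) (Im z - Im (S y2)))).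
    assert (Q1 : de <= - Im z) by apply Rmin_l. assert (Q2 : de <= Rmin (Im (S y) - Im z) (Im z - Im (S y2))) by apply Rmin_r.
    assert (Q3 := Rmin_l (Im (S y) - Im z) (Im z - Im (S y2))). assert (Q4 := Rmin_r (Im (S y) - Im z) (Im z - Im (S y2))).
    apply (deriv_ext _ _ psi _ _ de) in D; [exact D|repeat apply Rmin_pos; lra|].
    intros u Hu. specialize (Him u). assert (X : Rabs (Im u - Im z) < de) by lra. apply Rabs_def2 in X. apply Eq; lra.
  - assert (Hxc : on_curve gam (psi z) /\ psi z <> a).
    { destruct P1 as [X | [X | X]]; [| |exact X]; exfalso.
      - apply (st_pos _ _ _ _ _ _ _ _ HS) in X. rewrite P2 in X. lra.
      - apply (st_neg _ _ _ _ _ _ _ _ HS) in X. rewrite P2 in X. lra. }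
    destruct Hxc as [X1 X2]. destruct (curve_chart _ _ _ _ _ _ _ _ _ HS X1 X2) as [f [T [ps [r [rho [HC HP]]]]]].
    assert (R1 := chart_rho _ _ _ _ _ _ _ _ HC). assert (C0 := chart_psi0 _ _ _ _ _ _ _ _ HC).
    destruct (chart_psi _ _ _ _ _ _ _ _ HC 0 ltac:(rewrite Cmod_0; exact R1)) as [_ [_ D]].
    rewrite C0, (chart_f0 _ _ _ _ _ _ _ _ HC) in D.
    assert (D2 : cder (fun u => ps (u - z)%C) z (/ sq (psi z))%C).
    { apply (deriv_eq _ _ _ (/ sq (psi z) * (1 - 0))%C); [|ring].
      apply (deriv_comp _ (fun u => u - z)%C ps); [apply deriv_minus; [apply deriv_self|apply deriv_const]|].
      replace (z - z)%C with (RtoC 0) by ring. exact D. }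
    apply (deriv_ext _ _ psi _ _ rho) in D2; [exact D2|exact R1|].
    intros u Hu. destruct (HP _ Hu) as [A B]. rewrite <- (Hinv _ A). f_equal. rewrite B, P2. ring.
  - destruct (Hlow (Im z)) as [[y [Hy Ly]] _]; [lra|].
    assert (Eq : forall u, Im (S y) < Im u < Im (S y1) -> sinv Om S u = psi u).
    { intros u Hu. destruct (sheet_surj _ _ _ _ _ y y1 u H1 Hy Hy1) as [A B]; [lra|].
      rewrite <- (Hinv (sinv Om S u)) by (now left). now f_equal. }
    assert (D : cder (sinv Om S) z (/ sq (psi z))%C).
    { rewrite <- (Eq z) by lra. apply (sinv_cder _ _ _ _ _ y y1 _ H1); auto. }
    set (de := Rmin (Im z - Im (S y)) (Im (S y1) - Im z)).
    assert (Q1 : de <= Im z - Im (S y)) by apply Rmin_l. assert (Q2 : de <= Im (S y1) - Im z) by apply Rmin_r.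
    apply (deriv_ext _ _ psi _ _ de) in D; [exact D|apply Rmin_pos; lra|].
    intros u Hu. specialize (Him u). assert (X : Rabs (Im u - Im z) < de) by lra. apply Rabs_def2 in X. apply Eq; lra.
Qed.

(** * Growth along rays *)

(** Direction of integration: the ray is [z + dirn fwd * t], [t >= 0]. *)
Definition dirn (fwd : bool) : R := if fwd then 1 else -1.

(** All that the analysis keeps of the geometry: an inverse [psi] of [S] over a set [Z] that
    contains the ray from each of its points. The flag [fwd] lets one development serve both
    signs. *)
Record strip (c : nat -> C) (m : nat) (D : C -> Prop) (S sq psi : C -> C) (Z : C -> Prop) (fwd : bool) : Prop := {
  sp_deg : is_poly_deg c m;
  sp_sq : forall x, D x -> (sq x * sq x)%C = peval c m x /\ sq x <> RtoC 0;
  sp_cont : forall x, D x -> ccont sq x;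
  sp_S : forall x, D x -> cder S x (sq x);
  sp_psi : forall z, Z z -> D (psi z) /\ S (psi z) = z /\ cder psi z (/ sq (psi z))%C;
  sp_inv : forall x, D x -> psi (S x) = x;
  sp_ray : forall z t, Z z -> 0 <= t -> Z (z + RtoC (dirn fwd * t))%C }.

Definition deep (Z : C -> Prop) (r : R) (z : C) : Prop := forall k, Cmod k < r -> Z (z + k)%C.

Lemma deep_ray c m D S sq psi Z fwd r z t : strip c m D S sq psi Z fwd -> deep Z r z -> 0 <= t ->
  deep Z r (z + RtoC (dirn fwd * t))%C.
Proof.
  intros HS Hz Ht k Hk. replace (z + RtoC (dirn fwd * t) + k)%C with (z + k + RtoC (dirn fwd * t))%C by ring.
  apply (sp_ray _ _ _ _ _ _ _ _ HS); auto.
Qed.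

Lemma deep_center Z r z : 0 < r -> deep Z r z -> Z z.
Proof. intros Hr H. specialize (H 0). rewrite Cplus_0_r in H. apply H. now rewrite Cmod_0. Qed.

Lemma strip_sq_psi c m D S sq psi Z fwd z : strip c m D S sq psi Z fwd -> Z z ->
  (sq (psi z) * sq (psi z))%C = peval c m (psi z) /\ sq (psi z) <> RtoC 0 /\ peval c m (psi z) <> RtoC 0.
Proof.
  intros HS Hz. destruct (sp_psi _ _ _ _ _ _ _ _ HS z Hz) as [A _]. destruct (sp_sq _ _ _ _ _ _ _ _ HS _ A) as [B N].
  split; [exact B|]. split; [exact N|]. rewrite <- B. now apply Cmult_neq_0.
Qed.

(** The function [T (psi (z + k))] of [k] has derivative 1, so it equals [k]. Hence the values of
    [psi] fill a neighbourhood of [psi z], with [D] not assumed open. *)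
Lemma psi_local c m D S sq psi Z fwd z r0 : strip c m D S sq psi Z fwd -> deep Z r0 z -> 0 < r0 ->
  exists f T ps r rho, chart (peval c m) (psi z) (sq (psi z)) f T ps r rho /\
    exists eta, 0 < eta /\ forall y, Cmod (y - psi z)%C < r -> Cmod (T y) < eta -> psi (z + T y)%C = y.
Proof.
  intros HS Hz Hr0. assert (Zz := deep_center _ _ _ Hr0 Hz).
  destruct (sp_psi _ _ _ _ _ _ _ _ HS z Zz) as [A1 [A2 A3]].
  destruct (strip_sq_psi _ _ _ _ _ _ _ _ _ HS Zz) as [B1 [B2 _]]. set (w := psi z) in *.
  destruct (chart_exists c m w (sq w) 1 B1 B2 Rlt_0_1) as [f [T [ps [r [rho [HC _]]]]]].
  exists f, T, ps, r, rho. split; [exact HC|].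
  assert (Hrho := chart_rho _ _ _ _ _ _ _ _ HC). assert (Hr := chart_r _ _ _ _ _ _ _ _ HC).
  assert (F0 := chart_f0 _ _ _ _ _ _ _ _ HC).
  assert (Hww : Cmod (w - w)%C < r) by (replace (w - w)%C with (RtoC 0) by ring; now rewrite Cmod_0).
  destruct (chart_f _ _ _ _ _ _ _ _ HC w Hww) as [_ [Fw [Fc _]]].
  destruct (cont_sign (fun y : C => y) (fun y => sq y * / f y)%C w) as [d [Hd Hsg]].
  { apply cont_mult; [now apply (sp_cont _ _ _ _ _ _ _ _ HS)|now apply cont_inv]. }
  { rewrite F0. now apply Cinv_r. }
  destruct (deriv_cont _ _ _ _ A3 (Rmin d r)) as [e [He Kp]]; [apply Rmin_pos; lra|].
  assert (L1 := Rmin_l d r). assert (L2 := Rmin_r d r).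
  exists (Rmin (Rmin e r0) rho). split; [repeat apply Rmin_pos; lra|].
  assert (M1 := Rmin_l (Rmin e r0) rho). assert (M2 := Rmin_r (Rmin e r0) rho).
  assert (M3 := Rmin_l e r0). assert (M4 := Rmin_r e r0).
  assert (HT : forall ze, Cmod ze < Rmin (Rmin e r0) rho -> Cmod (psi (z + ze)%C - w)%C < r /\ T (psi (z + ze)%C) = ze).
  { intros ze Hze.
    assert (Hnear : forall k, Cmod k <= Cmod ze -> Z (z + k)%C /\ Cmod (psi (z + k)%C - w)%C < Rmin d r).
    { intros k Hk. split; [apply Hz; lra|]. apply Kp. replace (z + k - z)%C with k by ring. lra. }
    assert (Hder : forall k, Cmod k <= Cmod ze -> cder (fun k => T (psi (z + k)%C)) k 1).
    { intros k Hk. destruct (Hnear k Hk) as [Zk Nk].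
      destruct (sp_psi _ _ _ _ _ _ _ _ HS _ Zk) as [D1 [_ D3]].
      destruct (chart_f _ _ _ _ _ _ _ _ HC (psi (z + k)%C) ltac:(lra)) as [G1 [G2 [_ G4]]].
      destruct (strip_sq_psi _ _ _ _ _ _ _ _ _ HS Zk) as [E1 [E2 _]].
      assert (Eq : (sq (psi (z + k)) * / f (psi (z + k)))%C = RtoC 1).
      { apply Hsg; [lra|].
        replace (sq (psi (z + k)) * / f (psi (z + k)) * (sq (psi (z + k)) * / f (psi (z + k))))%C with
          (sq (psi (z + k)) * sq (psi (z + k)) * / (f (psi (z + k)) * f (psi (z + k))))%C by (field; exact G2).
        rewrite E1, G1. apply Cinv_r. rewrite <- G1. now apply Cmult_neq_0. }
      apply (deriv_eq _ _ _ (f (psi (z + k)%C) * (/ sq (psi (z + k)%C) * (0 + 1)))%C).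
      - apply (deriv_comp _ (fun k => psi (z + k)%C) T); [|exact G4].
        apply (deriv_comp _ (fun k => z + k)%C psi); [apply deriv_plus; [apply deriv_const|apply deriv_self]|exact D3].
      - replace (sq (psi (z + k)%C)) with (sq (psi (z + k)) * / f (psi (z + k)) * f (psi (z + k)))%C by (field; exact G2).
        rewrite Eq. field. exact G2. }
    destruct (Hnear ze (Rle_refl _)) as [_ N]. split; [lra|].
    assert (M := MVT_cder (fun k => T (psi (z + k)%C)) (fun _ => RtoC 1) 0 ze 1 0).
    assert (X : Cmod (T (psi (z + ze)) - T (psi (z + 0)) - 1 * (ze - 0))%C <= 0 * Cmod (ze - 0)%C).
    { apply M.
      - intros t Ht. apply Hder. unfold seg. replace (0 + (ze - 0) * RtoC t)%C with (ze * RtoC t)%C by ring.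
        rewrite Cmod_mult, Cmod_R, Rabs_pos_eq by lra. assert (Y := Cmod_ge_0 ze). nra.
      - intros t Ht. replace (1 - 1)%C with (RtoC 0) by ring. rewrite Cmod_0. lra. }
    rewrite Cplus_0_r in X. fold w in X. rewrite (chart_T0 _ _ _ _ _ _ _ _ HC) in X.
    assert (X0 : (T (psi (z + ze)) - 0 - 1 * (ze - 0))%C = RtoC 0).
    { apply Cmod_eq_0. apply Rle_antisym; [lra|apply Cmod_ge_0]. }
    replace (T (psi (z + ze)%C)) with (T (psi (z + ze)) - 0 - 1 * (ze - 0) + ze)%C by ring. rewrite X0. ring. }
  intros y Hy HTy. destruct (HT (T y) HTy) as [X1 X2].
  assert (Y1 := chart_inv _ _ _ _ _ _ _ _ HC y Hy ltac:(lra)).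
  assert (Y2 := chart_inv _ _ _ _ _ _ _ _ HC _ X1). rewrite X2 in Y2. rewrite <- Y1 at 2. symmetry. apply Y2. lra.
Qed.

(** Since [|dS| = |Q|^(1/2) |dy|], the lift of the segment from [psi z] to [y'] has length at most
    [M |y' - psi z| < r] and cannot leave the disc. The lift is continued by [psi_local], and its
    limit points are taken by compactness. *)
Lemma path_lift c m D S sq psi Z fwd z y' M r : strip c m D S sq psi Z fwd -> deep Z r z -> 0 <= M ->
  (forall t, 0 <= t <= 1 -> Cmod (peval c m (seg (psi z) y' t)) <= M * M) ->
  M * Cmod (y' - psi z)%C < r -> exists k, Cmod k < r /\ psi (z + k)%C = y'.
Proof.
  intros HS Hz HM HQ Hr. set (L := Cmod (y' - psi z)%C) in *. assert (HL : 0 <= L) by apply Cmod_ge_0.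
  assert (Hr0 : 0 < r) by nra. set (p := seg (psi z) y') in *.
  assert (Hpd : forall t, rder p t (y' - psi z)%C).
  { intros t. unfold p, seg. apply (deriv_eq _ _ _ (0 + (y' - psi z) * 1)%C); [|ring].
    apply deriv_plus; [apply deriv_const|apply deriv_scal, deriv_self]. }
  assert (HP : forall t, 0 <= t <= 1 -> exists k, Cmod k <= t * (M * L) /\ psi (z + k)%C = p t).
  { apply real_induction.
    - lra.
    - exists 0. split; [rewrite Cmod_0; lra|]. rewrite Cplus_0_r. unfold p, seg. ring.
    - intros s Hs Hprev. destruct (Hprev s ltac:(lra)) as [k [Hk Ek]].
      assert (HML : 0 <= M * L) by nra. assert (Hkr : Cmod k < r) by nra.
      assert (Hdk : deep Z (r - Cmod k) (z + k)%C).
      { intros j Hj. replace (z + k + j)%C with (z + (k + j))%C by ring. apply Hz.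
        eapply Rle_lt_trans; [apply Cmod_triangle|]. lra. }
      destruct (psi_local _ _ _ _ _ _ _ _ _ _ HS Hdk ltac:(lra)) as [f [T [ps [rr [rho [HC [eta [Heta Hloc]]]]]]]].
      rewrite Ek in HC, Hloc.
      assert (Hrr := chart_r _ _ _ _ _ _ _ _ HC).
      assert (Hpp : Cmod (p s - p s)%C < rr) by (replace (p s - p s)%C with (RtoC 0) by ring; now rewrite Cmod_0).
      destruct (chart_f _ _ _ _ _ _ _ _ HC _ Hpp) as [_ [_ [_ DT]]].
      destruct (deriv_cont _ _ _ _ DT eta Heta) as [d1 [Hd1 K1]]. rewrite (chart_T0 _ _ _ _ _ _ _ _ HC) in K1.
      destruct (deriv_cont _ _ _ _ (Hpd s) (Rmin d1 rr)) as [d [Hd K]]; [now apply Rmin_pos|].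
      assert (Q1 := Rmin_l d1 rr). assert (Q2 := Rmin_r d1 rr).
      exists d. split; [exact Hd|]. intros t Ht Ht1.
      assert (Hnear : forall u, s <= u <= t -> Cmod (p u - p s)%C < Rmin d1 rr).
      { intros u Hu. apply K. rewrite RtoC_dist, Rabs_pos_eq; lra. }
      assert (Nt := Hnear t ltac:(lra)). specialize (K1 (p t) ltac:(lra)). rewrite Cmod_cut in K1.
      exists (k + T (p t))%C. split.
      + assert (MV : Cmod (T (p t) - T (p s))%C <= M * L * (t - s)).
        { apply (MVT_rder (fun u => T (p u)) (fun u => f (p u) * (y' - psi z))%C); [lra| |].
          - intros u Hu. apply (deriv_comp RtoC p T); [apply Hpd|]. specialize (Hnear u Hu).
            apply (chart_f _ _ _ _ _ _ _ _ HC). lra.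
          - intros u Hu. specialize (Hnear u Hu). rewrite Cmod_mult. apply Rmult_le_compat_r; [exact HL|].
            destruct (chart_f _ _ _ _ _ _ _ _ HC (p u) ltac:(lra)) as [F1 _].
            specialize (HQ u ltac:(lra)). rewrite <- F1, Cmod_mult in HQ.
            assert (G := Cmod_ge_0 (f (p u))). nra. }
        rewrite (chart_T0 _ _ _ _ _ _ _ _ HC), Cmod_cut in MV.
        eapply Rle_trans; [apply Cmod_triangle|]. nra.
      + rewrite Cplus_assoc. apply Hloc; [lra|exact K1].
    - intros s Hs Hprev.
      set (kk := fun t => epsilon (inhabits (RtoC 0)) (fun k => Cmod k <= t * (M * L) /\ psi (z + k)%C = p t)).
      assert (Hkk : forall t, 0 <= t < s -> Cmod (kk t) <= t * (M * L) /\ psi (z + kk t)%C = p t).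
      { intros t Ht. apply (epsilon_spec (inhabits (RtoC 0)) (fun k => Cmod k <= t * (M * L) /\ psi (z + k)%C = p t)).
        now apply Hprev. }
      assert (HML : 0 <= M * L) by nra.
      destruct (cluster_at kk s (M * L) (fun t => 0 <= t < s)) as [q Hq].
      { intros d Hd. exists (Rmax 0 (s - d / 2)). assert (U1 := Rmax_l 0 (s - d / 2)). assert (U2 := Rmax_r 0 (s - d / 2)).
        assert (U3 : Rmax 0 (s - d / 2) < s) by (apply Rmax_lub_lt; lra). split; [lra|]. rewrite Rabs_left; lra. }
      { intros t Ht. destruct (Hkk t Ht) as [A _]. nra. }
      assert (Hqs : Cmod q <= s * (M * L)).
      { apply Rnot_lt_le. intros Lt. destruct (Hq (Cmod q - s * (M * L))) as [t [Ht [_ A]]]; [lra|].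
        destruct (Hkk t Ht) as [B _]. assert (Tr := Cmod_triangle_inv q (kk t)). rewrite Cmod_sub_sym in Tr. nra. }
      exists q. split; [exact Hqs|].
      assert (Zq : Z (z + q)%C) by (apply Hz; nra).
      destruct (sp_psi _ _ _ _ _ _ _ _ HS _ Zq) as [_ [_ Dq]].
      apply Cmod_small_eq. intros e He.
      destruct (deriv_cont _ _ _ _ Dq (e / 2)) as [d1 [Hd1 K1]]; [lra|].
      destruct (deriv_cont _ _ _ _ (Hpd s) (e / 2)) as [d2 [Hd2 K2]]; [lra|].
      destruct (Hq (Rmin d1 d2)) as [t [Ht [A1 A2]]]; [now apply Rmin_pos|].
      assert (Q1 := Rmin_l d1 d2). assert (Q2 := Rmin_r d1 d2).
      destruct (Hkk t Ht) as [_ E].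
      specialize (K1 (z + kk t)%C). replace (z + kk t - (z + q))%C with (kk t - q)%C in K1 by ring.
      specialize (K1 ltac:(lra)). specialize (K2 t). rewrite RtoC_dist in K2. specialize (K2 ltac:(lra)).
      rewrite E in K1. assert (Tr := Cmod_sub_triangle (psi (z + q)%C) (p t) (p s)).
      rewrite (Cmod_sub_sym (psi (z + q)%C) (p t)) in Tr. lra. }
  destruct (HP 1 ltac:(lra)) as [k [Hk Ek]]. exists k. split; [lra|]. rewrite Ek. unfold p, seg. ring.
Qed.

Lemma poly_bound_ball c m R0 : is_poly_deg c m -> 0 <= R0 -> exists M, 1 <= M /\
  forall y, Cmod y <= R0 -> Cmod (peval c m y) <= M * M.
Proof.
  intros [_ [_ Hc]] HR. destruct (peval_bound c m 0) as [K [HK Hb]]; [intros k Hk; apply Hc; lia|].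
  assert (P : 0 <= (1 + R0) ^ m) by (apply pow_le; lra).
  exists (1 + K * (1 + R0) ^ m). split; [nra|]. intros y Hy. specialize (Hb y). simpl in Hb. rewrite Rmult_1_r in Hb.
  assert (A := Cmod_ge_0 y).
  assert (Q : (1 + Cmod y) ^ m <= (1 + R0) ^ m) by (apply pow_incr; lra).
  assert (X : K * (1 + Cmod y) ^ m <= K * (1 + R0) ^ m) by (apply Rmult_le_compat_l; lra). nra.
Qed.

Lemma Cmod_seg x y t : 0 <= t <= 1 -> Cmod (seg x y t) <= Cmod x + Cmod (y - x)%C.
Proof.
  intros Ht. unfold seg. eapply Rle_trans; [apply Cmod_triangle|]. rewrite Cmod_mult, Cmod_R, Rabs_pos_eq by lra.
  assert (A := Cmod_ge_0 (y - x)%C). nra.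
Qed.

(** A zero of [Q] is no value of [psi] on [Z], so the uniform [d] is a lower bound for the distance
    of [psi z] from the zeros. In [ray_escapes] it separates the points of a ray. *)
Lemma strip_ball c m D S sq psi Z fwd r R0 : strip c m D S sq psi Z fwd -> 0 < r -> 0 <= R0 ->
  exists d, 0 < d /\ forall z y', deep Z r z -> Cmod (psi z) <= R0 -> Cmod (y' - psi z)%C < d ->
    exists k, Cmod k < r /\ psi (z + k)%C = y'.
Proof.
  intros HS Hr HR. destruct (poly_bound_ball c m (R0 + 1) (sp_deg _ _ _ _ _ _ _ _ HS) ltac:(lra)) as [M [HM HB]].
  exists (Rmin 1 (r / M)). assert (HrM : 0 < r / M) by (apply Rdiv_lt_0_compat; lra).
  split; [apply Rmin_pos; lra|]. intros z y' Hz Hy Hd.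
  assert (Q1 := Rmin_l 1 (r / M)). assert (Q2 := Rmin_r 1 (r / M)).
  apply (path_lift c m D S sq psi Z fwd z y' M r HS Hz); [lra| |].
  - intros t Ht. apply HB. assert (A := Cmod_seg (psi z) y' t Ht). lra.
  - apply Rlt_le_trans with (M * (r / M)); [apply Rmult_lt_compat_l; lra|right; field; lra].
Qed.

(** Points with ever smaller [|Q|] would accumulate at a zero of [Q], closer than [d] to one of
    them. *)
Lemma poly_lower_compact c m R0 d : is_poly_deg c m -> 0 < d -> exists q0, 0 < q0 /\
  forall y, Cmod y <= R0 -> (forall y', Cmod (y' - y)%C < d -> peval c m y' <> RtoC 0) -> q0 <= Cmod (peval c m y).
Proof.
  intros Hp Hd. apply NNPP. intros Hn.
  assert (H : forall n : nat, exists y, Cmod y <= R0 /\ (forall y', Cmod (y' - y)%C < d -> peval c m y' <> RtoC 0) /\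
     Cmod (peval c m y) < / (INR n + 1)).
  { intros n. apply NNPP. intros H. apply Hn. exists (/ (INR n + 1)).
    split; [apply Rinv_0_lt_compat; assert (A := pos_INR n); lra|]. intros y Hy Hy'.
    apply Rnot_lt_le. intros L. apply H. now exists y. }
  set (u := fun n => proj1_sig (constructive_indefinite_description _ (H n))).
  assert (Hu : forall n, Cmod (u n) <= R0 /\ (forall y', Cmod (y' - u n)%C < d -> peval c m y' <> RtoC 0) /\
     Cmod (peval c m (u n)) < / (INR n + 1)).
  { intros n. unfold u. apply proj2_sig. }
  destruct (cluster_point u R0) as [p Hpc]; [intros n; apply Hu|].
  destruct (Hpc d O Hd) as [n [_ Hn']]. destruct (Hu n) as [_ [Hz _]].
  apply (Hz p); [rewrite Cmod_sub_sym; exact Hn'|].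
  destruct (peval_smooth c m) as [f1 [f2 Hf]]. destruct (Hf p) as [Df _].
  replace (peval c m p) with (peval c m p - 0)%C by ring.
  assert (E : peval c m p = RtoC 0); [|rewrite E; ring].
  apply Cmod_small_eq. intros e He. destruct (deriv_cont _ _ _ _ Df (e / 2)) as [d1 [Hd1 K1]]; [lra|].
  destruct (INR_unbounded (2 / e)) as [N HN].
  destruct (Hpc d1 N Hd1) as [k [Hk Hk']]. specialize (K1 (u k) Hk'). destruct (Hu k) as [_ [_ Hs]].
  assert (X : / (INR k + 1) < e / 2).
  { apply le_INR in Hk. assert (He2 : 0 < 2 / e) by (apply Rdiv_lt_0_compat; lra).
    replace (e / 2) with (/ (2 / e)) by (field; lra). apply Rinv_lt_contravar; [|lra].
    apply Rmult_lt_0_compat; lra. }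
  assert (Tr := Cmod_sub_triangle (peval c m p) (peval c m (u k)) 0).
  rewrite (Cmod_sub_sym (peval c m p) (peval c m (u k))), (Cmod_cut (peval c m (u k))) in Tr. lra.
Qed.

Lemma strip_lower c m D S sq psi Z fwd r : strip c m D S sq psi Z fwd -> 0 < r ->
  exists c2, 0 < c2 <= 1 /\ forall z, deep Z r z -> c2 * (1 + Cmod (psi z)) ^ m <= Cmod (peval c m (psi z)).
Proof.
  intros HS Hr. assert (Hp := sp_deg _ _ _ _ _ _ _ _ HS).
  destruct (poly_growth c m Hp) as [c1 [R0 [Hc1 [HR0 Hg]]]].
  destruct (strip_ball _ _ _ _ _ _ _ _ r R0 HS Hr ltac:(lra)) as [d [Hd Hb]].
  destruct (poly_lower_compact c m R0 d Hp Hd) as [q0 [Hq0 Hq]].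
  assert (HP : 0 < (1 + R0) ^ m) by (apply pow_lt; lra).
  assert (Hx : 0 < q0 / (1 + R0) ^ m) by (apply Rdiv_lt_0_compat; lra).
  exists (Rmin 1 (Rmin c1 (q0 / (1 + R0) ^ m))).
  assert (Q1 := Rmin_l 1 (Rmin c1 (q0 / (1 + R0) ^ m))). assert (Q2 := Rmin_r 1 (Rmin c1 (q0 / (1 + R0) ^ m))).
  assert (Q3 := Rmin_l c1 (q0 / (1 + R0) ^ m)). assert (Q4 := Rmin_r c1 (q0 / (1 + R0) ^ m)).
  split; [split; [repeat apply Rmin_pos; lra|exact Q1]|]. intros z Hz.
  assert (A := Cmod_ge_0 (psi z)). assert (HY : 0 <= (1 + Cmod (psi z)) ^ m) by (apply pow_le; lra).
  destruct (Rle_lt_dec R0 (Cmod (psi z))) as [L|L].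
  - eapply Rle_trans; [|apply Hg; exact L]. apply Rmult_le_compat_r; lra.
  - apply Rle_trans with q0.
    + apply Rle_trans with (q0 / (1 + R0) ^ m * (1 + R0) ^ m); [|right; field; lra].
      apply Rmult_le_compat; try lra; [repeat apply Rmin_glb; lra|apply pow_incr; lra].
    + apply Hq; [lra|]. intros y' Hy'. destruct (Hb z y' Hz ltac:(lra) Hy') as [k [Hk Ek]].
      rewrite <- Ek. apply (strip_sq_psi _ _ _ _ _ _ _ _ _ HS). now apply Hz.
Qed.

(** [strip] records only continuity of [sq], and differentiability comes from here: divide
    [F y - F x = (g y - g x) (g y + g x)] by the second factor, which tends to [2 g x]. *)
Lemma deriv_sqrt {X} (i g F : X -> C) x l d : 0 < d -> cont_via i g x -> g x <> RtoC 0 ->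
  (forall y, Cmod (i y - i x)%C < d -> (g y * g y)%C = F y) -> deriv_via i F x l ->
  deriv_via i g x (l / (2 * g x))%C.
Proof.
  intros Hd Hc H0 Hsq HF eps He. assert (Hg : 0 < Cmod (g x)) by (apply Cmod_gt_0; exact H0).
  assert (Hl := Cmod_ge_0 l). set (a := Cmod (g x)) in *.
  destruct (HF (eps * a / 2)) as [d1 [Hd1 K1]]; [apply Rdiv_lt_0_compat; nra|].
  set (e2 := Rmin a (eps * (a * a) / (Cmod l + 1))).
  assert (He2 : 0 < e2).
  { apply Rmin_pos; [exact Hg|]. apply Rdiv_lt_0_compat; [|lra]. repeat apply Rmult_lt_0_compat; lra. }
  destruct (Hc e2 He2) as [d2 [Hd2 K2]].
  exists (Rmin d (Rmin d1 d2)). split; [repeat apply Rmin_pos; lra|]. intros y Hy.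
  assert (Q1 := Rmin_l d (Rmin d1 d2)). assert (Q2 := Rmin_r d (Rmin d1 d2)).
  assert (Q3 := Rmin_l d1 d2). assert (Q4 := Rmin_r d1 d2).
  specialize (K1 y ltac:(lra)). specialize (K2 y ltac:(lra)).
  assert (Ey := Hsq y ltac:(lra)). assert (Ex := Hsq x).
  replace (i x - i x)%C with (RtoC 0) in Ex by ring. rewrite Cmod_0 in Ex. specialize (Ex Hd).
  assert (E1 : e2 <= a) by apply Rmin_l. assert (E2 : e2 <= eps * (a * a) / (Cmod l + 1)) by apply Rmin_r.
  set (k := (i y - i x)%C) in *. assert (Hk := Cmod_ge_0 k).
  (* g y + g x = 2 g x + (g y - g x) stays away from 0 *)
  assert (Hsum : a <= Cmod (g y + g x)%C).
  { assert (T := Cmod_triangle_inv (2 * g x) (- (g y - g x))). rewrite Cmod_opp, Cmod_mult, Cmod_R, Rabs_pos_eq in T by lra.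
    replace (2 * g x - - (g y - g x))%C with (g y + g x)%C in T by ring. fold a in T. lra. }
  assert (Hs0 : (g y + g x)%C <> RtoC 0) by (apply Cmod_gt_0; lra).
  assert (H2 : (2 * g x)%C <> RtoC 0) by (apply Cmult_neq_0; [apply RtoC_neq_0; lra|exact H0]).
  replace (g y - g x - l / (2 * g x) * k)%C with
    ((F y - F x - l * k) / (g y + g x) - l * k * (g y - g x) / ((g y + g x) * (2 * g x)))%C.
  2:{ rewrite <- Ey, <- Ex. field. split; assumption. }
  eapply Rle_trans; [apply Cmod_sub_le|].
  rewrite !Cmod_div; [|now apply Cmult_neq_0|exact Hs0]. rewrite !Cmod_mult, Cmod_R, Rabs_pos_eq by lra. fold a.
  assert (B1 : Cmod (F y - F x - l * k)%C / Cmod (g y + g x)%C <= eps / 2 * Cmod k).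
  { apply Rle_trans with (eps * a / 2 * Cmod k / a); [|right; field; lra].
    apply Rmult_le_compat; [apply Cmod_ge_0|apply Rlt_le, Rinv_0_lt_compat; lra|exact K1|].
    apply Rinv_le_contravar; lra. }
  assert (B2 : Cmod l * Cmod k * Cmod (g y - g x)%C / (Cmod (g y + g x)%C * (2 * a)) <= eps / 2 * Cmod k).
  { apply Rle_trans with ((Cmod l + 1) * Cmod k * (eps * (a * a) / (Cmod l + 1)) / (a * (2 * a))); [|right; field; lra].
    apply Rmult_le_compat.
    - repeat apply Rmult_le_pos; try apply Cmod_ge_0; lra.
    - apply Rlt_le, Rinv_0_lt_compat. nra.
    - apply Rmult_le_compat; [apply Rmult_le_pos; [lra|exact Hk]|apply Cmod_ge_0| |lra].
      apply Rmult_le_compat_r; lra.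
    - apply Rinv_le_contravar; nra. }
  lra.
Qed.

Lemma sq_psi_cder c m D S sq psi Z fwd z r Q1 : strip c m D S sq psi Z fwd -> deep Z r z -> 0 < r ->
  cder (peval c m) (psi z) Q1 ->
  cder (fun z => sq (psi z)) z (Q1 / (2 * (sq (psi z) * sq (psi z))))%C.
Proof.
  intros HS Hz Hr HQ. assert (Zz := deep_center _ _ _ Hr Hz).
  destruct (sp_psi _ _ _ _ _ _ _ _ HS z Zz) as [A1 [_ A3]].
  destruct (strip_sq_psi _ _ _ _ _ _ _ _ _ HS Zz) as [_ [N _]].
  apply (deriv_eq _ _ _ ((Q1 * / sq (psi z)) / (2 * sq (psi z)))%C); [|field; exact N].
  apply (deriv_sqrt _ (fun z => sq (psi z)) (fun z => peval c m (psi z)) z _ r Hr).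
  - apply (cont_comp _ psi sq); [eapply deriv_cont, A3|]. now apply (sp_cont _ _ _ _ _ _ _ _ HS).
  - exact N.
  - intros y Hy. apply (strip_sq_psi _ _ _ _ _ _ _ _ _ HS). replace y with (z + (y - z))%C by ring. now apply Hz.
  - apply (deriv_comp _ psi (peval c m)); [exact A3|exact HQ].
Qed.

Lemma ray_rder c m D S sq psi Z fwd z r (g : C -> C) t l : strip c m D S sq psi Z fwd -> deep Z r z -> 0 < r -> 0 <= t ->
  cder g (z + RtoC (dirn fwd * t))%C l -> rder (fun t => g (z + RtoC (dirn fwd * t))%C) t (l * RtoC (dirn fwd))%C.
Proof.
  intros HS Hz Hr Ht Hg.
  apply (deriv_comp RtoC (fun t => z + RtoC (dirn fwd * t))%C g); [|exact Hg].
  apply (deriv_eq _ _ _ (0 + RtoC (dirn fwd) * 1)%C); [|ring].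
  apply deriv_plus; [apply deriv_const|].
  apply (deriv_ext RtoC (fun t => RtoC (dirn fwd) * RtoC t)%C _ _ _ 1); [lra|intros; now rewrite RtoC_mult|].
  apply deriv_scal, deriv_self.
Qed.

(** The points of a ray at distance at least [r] in the [S]-plane are separated, so a ray leaves
    every disc for good. *)
Lemma ray_escapes c m D S sq psi Z fwd z r R0 : strip c m D S sq psi Z fwd -> 0 < r -> deep Z r z -> 0 <= R0 ->
  exists T, 0 <= T /\ forall t, T <= t -> R0 <= Cmod (psi (z + RtoC (dirn fwd * t))%C).
Proof.
  intros HS Hr Hz HR. destruct (strip_ball _ _ _ _ _ _ _ _ r R0 HS Hr HR) as [d [Hd Hb]].
  set (y := fun t => psi (z + RtoC (dirn fwd * t))%C).
  assert (Hsep : forall t t', 0 <= t -> 0 <= t' -> Cmod (y t) <= R0 -> Cmod (y t' - y t)%C < d -> Rabs (t' - t) < r).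
  { intros t t' Ht Ht' Hy Hyy. destruct (Hb _ (y t') (deep_ray _ _ _ _ _ _ _ _ _ _ _ HS Hz Ht) Hy Hyy) as [k [Hk Ek]].
    assert (Z1 : Z (z + RtoC (dirn fwd * t) + k)%C) by (apply (deep_ray _ _ _ _ _ _ _ _ _ _ _ HS Hz Ht); exact Hk).
    assert (Z2 : Z (z + RtoC (dirn fwd * t'))%C) by (eapply deep_center; [exact Hr|]; now apply (deep_ray _ _ _ _ _ _ _ _ _ _ _ HS Hz)).
    apply (f_equal S) in Ek. rewrite (proj1 (proj2 (sp_psi _ _ _ _ _ _ _ _ HS _ Z1))) in Ek.
    unfold y in Ek. rewrite (proj1 (proj2 (sp_psi _ _ _ _ _ _ _ _ HS _ Z2))) in Ek.
    assert (Ek' : k = RtoC (dirn fwd * (t' - t))).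
    { replace k with (z + RtoC (dirn fwd * t) + k - z - RtoC (dirn fwd * t))%C by ring. rewrite Ek.
      rewrite !RtoC_mult, RtoC_minus. ring. }
    rewrite Ek', Cmod_R, Rabs_mult in Hk.
    replace (Rabs (dirn fwd)) with 1 in Hk by (destruct fwd; simpl; [rewrite Rabs_pos_eq|rewrite Rabs_left]; lra). lra. }
  apply NNPP. intros Hn.
  assert (H : forall n : nat, exists t, INR n <= t /\ Cmod (y t) < R0).
  { intros n. apply NNPP. intros H. apply Hn. exists (INR n). split; [apply pos_INR|]. intros t Ht.
    apply Rnot_lt_le. intros L. apply H. now exists t. }
  set (u := fun n => proj1_sig (constructive_indefinite_description _ (H n))).
  assert (Hu : forall n, INR n <= u n /\ Cmod (y (u n)) < R0) by (intros n; unfold u; apply proj2_sig).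
  assert (Hu0 : forall n, 0 <= u n) by (intros n; eapply Rle_trans; [apply pos_INR|apply Hu]).
  destruct (cluster_point (fun n => y (u n)) R0) as [p Hp]; [intros n; apply Rlt_le, Hu|].
  destruct (Hp (d / 2) O) as [n1 [_ H1]]; [lra|].
  destruct (INR_unbounded (u n1 + r)) as [N HN].
  destruct (Hp (d / 2) N) as [n2 [Hn2 H2]]; [lra|]. apply le_INR in Hn2.
  assert (X : Rabs (u n2 - u n1) < r).
  { apply Hsep; auto; [apply Rlt_le, Hu|].
    assert (Tr := Cmod_sub_triangle (y (u n2)) p (y (u n1))). rewrite (Cmod_sub_sym p (y (u n1))) in Tr. lra. }
  destruct (Hu n2) as [A _]. apply Rabs_def2 in X. lra.
Qed.

(** The coefficients of [y Q' - m Q] are [(k - m) c_k], so the leading one cancels; this is why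
    [y Q' / Q] tends to [m]. *)
Lemma euler_poly_bound c m : is_poly_deg c m -> exists K, 0 <= K /\ forall y,
  Cmod (y * peval (pderiv c) m y - RtoC (INR m) * peval c m y)%C * (1 + Cmod y) <= K * (1 + Cmod y) ^ m.
Proof.
  intros [Hm [Hcm Hc]]. set (e := fun k => (RtoC (INR k - INR m) * c k)%C).
  destruct (peval_bound e m 1) as [K [HK Hb]].
  { intros k Hk. unfold e. destruct (Nat.eq_dec k m) as [->|N].
    - rewrite Rminus_diag. ring.
    - rewrite Hc by lia. ring. }
  exists K. split; [exact HK|]. intros y. specialize (Hb y). rewrite pow_1 in Hb.
  replace (y * peval (pderiv c) m y - RtoC (INR m) * peval c m y)%C with (peval e m y); [exact Hb|].
  assert (E1 : (y * peval (pderiv c) m y)%C = peval (fun k => RtoC (INR k) * c k)%C m y).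
  { transitivity (peval (fun k => RtoC (INR k) * c k)%C (S m) y).
    - rewrite peval_S. change (fun k => RtoC (INR (S k)) * c (S k))%C with (pderiv c). change (INR 0) with 0. ring.
    - unfold peval. change (csum (fun k => RtoC (INR k) * c k * cpow y k)%C (S (S m))) with
        (csum (fun k => RtoC (INR k) * c k * cpow y k)%C (S m) + RtoC (INR (S m)) * c (S m) * cpow y (S m))%C.
      rewrite (Hc (S m)) by lia. ring. }
  rewrite E1. unfold peval, e. rewrite <- csum_scal. generalize (S m). intros n.
  induction n as [|n IH]; simpl csum; [ring|]. rewrite IH, RtoC_minus. ring.
Qed.

(** Along a ray [P = y sqrt(Q(y))] satisfies [P' = 1 + y Q'/(2Q) -> 1 + m/2], so [P] grows linearly. *)
Lemma ray_decay c m D S sq psi Z fwd z r : strip c m D S sq psi Z fwd -> 0 < r -> deep Z r z ->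
  exists K, 0 < K /\ forall t, 0 <= t ->
    (1 + t) * (1 + t) <= K * (1 + Cmod (psi (z + RtoC (dirn fwd * t))%C)) ^ (m + 2).
Proof.
  intros HS Hr Hz. assert (Hp := sp_deg _ _ _ _ _ _ _ _ HS).
  destruct (poly_growth c m Hp) as [c1 [R0 [Hc1 [HR0 Hg]]]].
  destruct (euler_poly_bound c m Hp) as [K1 [HK1 Hb1]].
  destruct (peval_bound c m 0) as [K0 [HK0 Hb0]]; [intros k Hk; apply Hp; lia|].
  assert (Hkc : 0 <= K1 / c1) by (apply Rmult_le_pos; [exact HK1|apply Rlt_le, Rinv_0_lt_compat, Hc1]).
  destruct (ray_escapes _ _ _ _ _ _ _ _ z r (R0 + K1 / c1) HS Hr Hz ltac:(lra)) as [T [HT HTe]].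
  set (s := dirn fwd). assert (Hs2 : s * s = 1) by (unfold s, dirn; destruct fwd; ring).
  set (y := fun t => psi (z + RtoC (s * t))%C).
  set (P := fun z => (psi z * sq (psi z))%C).
  set (Q1 := peval (pderiv c) m).
  assert (HQ1 : forall x, cder (peval c m) x (Q1 x)) by (intros x; apply cder_peval; apply Hp; lia).
  set (P1 := fun z => (1 + psi z * Q1 (psi z) / (2 * peval c m (psi z)))%C).
  assert (HP : forall t, 0 <= t -> cder P (z + RtoC (s * t))%C (P1 (z + RtoC (s * t))%C)).
  { intros t Ht. assert (Hd := deep_ray _ _ _ _ _ _ _ _ _ _ _ HS Hz Ht). fold s in Hd.
    set (zt := (z + RtoC (s * t))%C) in *. assert (Zt := deep_center _ _ _ Hr Hd).
    destruct (strip_sq_psi _ _ _ _ _ _ _ _ _ HS Zt) as [E [N _]].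
    assert (D2 := sq_psi_cder _ _ _ _ _ _ _ _ _ _ _ HS Hd Hr (HQ1 (psi zt))).
    apply (deriv_eq _ _ _ (/ sq (psi zt) * sq (psi zt) + psi zt * (Q1 (psi zt) / (2 * (sq (psi zt) * sq (psi zt)))))%C).
    - apply (deriv_mult _ psi (fun z => sq (psi z))); [apply (sp_psi _ _ _ _ _ _ _ _ HS _ Zt)|exact D2].
    - unfold P1. rewrite <- E. field. exact N. }
  (* Beyond [T] one has [P1 = 1 + (m + w) / 2] with [|w| <= 1 <= m]. *)
  assert (HRe : forall t, T <= t -> 1 <= Re (P1 (z + RtoC (s * t))%C)).
  { intros t Ht. assert (Hd := deep_ray _ _ _ _ _ _ _ _ _ _ t HS Hz ltac:(lra)). fold s in Hd.
    specialize (HTe t Ht). fold s in HTe. set (zt := (z + RtoC (s * t))%C) in *.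
    assert (Zt := deep_center _ _ _ Hr Hd). destruct (strip_sq_psi _ _ _ _ _ _ _ _ _ HS Zt) as [_ [_ N]].
    specialize (Hg (psi zt) ltac:(lra)). specialize (Hb1 (psi zt)). set (Y := 1 + Cmod (psi zt)) in *.
    assert (HY : 0 < Y ^ m) by (apply pow_lt; unfold Y; assert (A := Cmod_ge_0 (psi zt)); lra).
    assert (Hq : 0 < Cmod (peval c m (psi zt))) by nra.
    set (w := ((psi zt * Q1 (psi zt) - RtoC (INR m) * peval c m (psi zt)) / peval c m (psi zt))%C).
    assert (Hw : Cmod w <= 1).
    { unfold w. rewrite Cmod_div by exact N. apply Rmult_le_reg_r with (Cmod (peval c m (psi zt)) * Y); [unfold Y; assert (A := Cmod_ge_0 (psi zt)); nra|].
      fold Q1 in Hb1.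
      replace (Cmod (psi zt * Q1 (psi zt) - RtoC (INR m) * peval c m (psi zt)) / Cmod (peval c m (psi zt)) * (Cmod (peval c m (psi zt)) * Y))
        with (Cmod (psi zt * Q1 (psi zt) - RtoC (INR m) * peval c m (psi zt))%C * Y) by (field; lra).
      eapply Rle_trans; [exact Hb1|]. rewrite Rmult_1_l.
      assert (X : K1 / c1 <= Y) by (unfold Y; lra).
      apply Rle_trans with (c1 * Y ^ m * Y); [|apply Rmult_le_compat_r; [lra|exact Hg]].
      apply Rle_trans with (c1 * Y ^ m * (K1 / c1)); [right; field; lra|]. apply Rmult_le_compat_l; nra. }
    assert (E : P1 zt = (1 + RtoC (/ 2) * (RtoC (INR m) + w))%C).
    { unfold P1, w. rewrite RtoC_inv by lra. field. exact N. }
    rewrite E. assert (Hm : 1 <= INR m) by (apply (le_INR 1), Hp).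
    assert (Hre := re_le_Cmod w). assert (Rabs (Re w) <= 1) by lra. apply Rabs_le_between in H.
    destruct w as [wr wi]. simpl in *. lra. }
  assert (Hgrow : forall t, T <= t -> t - T - Cmod (P (z + RtoC (s * T))%C) <= Cmod (P (z + RtoC (s * t))%C)).
  { intros t Ht. destruct (Rle_lt_or_eq_dec _ _ Ht) as [L|L].
    2:{ subst t. assert (A := Cmod_ge_0 (P (z + RtoC (s * T))%C)). lra. }
    destruct (MVT_real (fun t => Re (RtoC s * P (z + RtoC (s * t)))%C) (fun t => Re (P1 (z + RtoC (s * t))%C)) T t L) as [x [Hx E]].
    { intros u Hu. replace (Re (P1 (z + RtoC (s * u))%C)) with (Re (RtoC s * (P1 (z + RtoC (s * u)) * RtoC s))%C).
      - apply rder_Re, deriv_scal. apply (ray_rder _ _ _ _ _ _ _ _ z r P u _ HS Hz Hr ltac:(lra)). apply HP. lra.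
      - replace (RtoC s * (P1 (z + RtoC (s * u)) * RtoC s))%C with (RtoC (s * s) * P1 (z + RtoC (s * u)))%C by (rewrite RtoC_mult; ring).
        rewrite Hs2. f_equal. ring. }
    assert (Hx1 := HRe x ltac:(lra)).
    assert (A1 := re_le_Cmod (RtoC s * P (z + RtoC (s * t)))%C). assert (A2 := re_le_Cmod (RtoC s * P (z + RtoC (s * T)))%C).
    assert (As : Rabs s = 1) by (unfold s, dirn; destruct fwd; [rewrite Rabs_pos_eq|rewrite Rabs_left]; lra).
    rewrite Cmod_mult, Cmod_R, As, Rmult_1_l in A1, A2. apply Rabs_le_between in A1. apply Rabs_le_between in A2.
    nra. }
  set (b := 1 + T + Cmod (P (z + RtoC (s * T))%C)). assert (Hb : 1 <= b) by (unfold b; assert (A := Cmod_ge_0 (P (z + RtoC (s * T))%C)); lra).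
  (* From [1 + t <= b + |P|] and [|P|^2 = |y|^2 |Q| <= K0 (1 + |y|)^(m+2)] by
     [(b + p)^2 <= 2 b^2 + 2 p^2]; the first summand also covers the times before [T]. *)
  exists (2 * (b * b) + 2 * K0). split; [nra|]. intros t Ht. fold s. set (zt := (z + RtoC (s * t))%C).
  assert (HY1 : 1 <= 1 + Cmod (psi zt)) by (assert (A := Cmod_ge_0 (psi zt)); lra).
  assert (HYm : 1 <= (1 + Cmod (psi zt)) ^ (m + 2)) by now apply pow_R1_Rle.
  destruct (Rle_lt_dec T t) as [L|L].
  - specialize (Hgrow t L). fold zt in Hgrow. specialize (Hb0 (psi zt)). simpl in Hb0. rewrite Rmult_1_r in Hb0.
    assert (Hd := deep_ray _ _ _ _ _ _ _ _ _ _ _ HS Hz Ht). fold s in Hd. fold zt in Hd.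
    destruct (strip_sq_psi _ _ _ _ _ _ _ _ _ HS (deep_center _ _ _ Hr Hd)) as [E _].
    assert (HPP : Cmod (P zt) * Cmod (P zt) <= K0 * (1 + Cmod (psi zt)) ^ (m + 2)).
    { rewrite <- Cmod_mult. unfold P. replace (psi zt * sq (psi zt) * (psi zt * sq (psi zt)))%C with (psi zt * psi zt * (sq (psi zt) * sq (psi zt)))%C by ring.
      rewrite E, !Cmod_mult, pow_add. assert (A := Cmod_ge_0 (psi zt)). assert (B := Cmod_ge_0 (peval c m (psi zt))).
      assert (X : Cmod (psi zt) * Cmod (psi zt) <= (1 + Cmod (psi zt)) ^ 2) by (simpl; nra).
      apply Rle_trans with ((1 + Cmod (psi zt)) ^ 2 * (K0 * (1 + Cmod (psi zt)) ^ m)); [|right; ring].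
      apply Rmult_le_compat; nra. }
    assert (H1 : 1 + t <= b + Cmod (P zt)) by (unfold b; lra).
    assert (A := Cmod_ge_0 (P zt)). set (p := Cmod (P zt)) in *. set (W := (1 + Cmod (psi zt)) ^ (m + 2)) in *.
    apply Rle_trans with ((b + p) * (b + p)); [apply Rmult_le_compat; lra|].
    apply Rle_trans with (2 * (b * b) + 2 * (p * p)); [assert (B := Rle_0_sqr (b - p)); unfold Rsqr in B; lra|].
    rewrite Rmult_plus_distr_r. apply Rplus_le_compat; [|lra].
    rewrite <- (Rmult_1_r (2 * (b * b))) at 1. apply Rmult_le_compat_l; nra.
  - assert (H1 : 1 + t <= b) by (unfold b; assert (A := Cmod_ge_0 (P (z + RtoC (s * T))%C)); lra).
    set (W := (1 + Cmod (psi zt)) ^ (m + 2)) in *.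
    apply Rle_trans with (b * b); [apply Rmult_le_compat; lra|].
    rewrite <- (Rmult_1_r (b * b)). apply Rmult_le_compat; nra.
Qed.

(** * Bounds on the potential *)

Definition qder (c : nat -> C) (m i : nat) : C -> C := peval (Nat.iter i pderiv c) m.

Lemma iter_pderiv_zero c m i k : is_poly_deg c m -> (m < k + i)%nat -> Nat.iter i pderiv c k = RtoC 0.
Proof.
  intros [_ [_ Hc]]. revert k. induction i as [|i IH]; intros k Hk; simpl.
  - apply Hc. lia.
  - unfold pderiv at 1. rewrite IH by lia. ring.
Qed.

Lemma qder_cder c m i x : is_poly_deg c m -> cder (qder c m i) x (qder c m (S i) x).
Proof. intros Hp. apply cder_peval. apply iter_pderiv_zero with m; [exact Hp|lia]. Qed.

Lemma qder_bound c m : is_poly_deg c m -> exists K, 1 <= K /\ forall i y, (i <= 4)%nat ->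
  Cmod (qder c m i y) * (1 + Cmod y) ^ i <= K * (1 + Cmod y) ^ m.
Proof.
  intros Hp.
  assert (H : forall n, exists K, 1 <= K /\ forall i y, (i <= n)%nat ->
    Cmod (qder c m i y) * (1 + Cmod y) ^ i <= K * (1 + Cmod y) ^ m).
  { assert (Hi : forall i, exists K, 0 <= K /\ forall y, Cmod (qder c m i y) * (1 + Cmod y) ^ i <= K * (1 + Cmod y) ^ m).
    { intros i. apply peval_bound. intros k Hk. now apply iter_pderiv_zero with m. }
    assert (Hm : forall y K K', K <= K' -> K * (1 + Cmod y) ^ m <= K' * (1 + Cmod y) ^ m).
    { intros y K K' L. apply Rmult_le_compat_r; [apply pow_le; assert (A := Cmod_ge_0 y); lra|exact L]. }
    induction n as [|n [K [HK IH]]].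
    - destruct (Hi O) as [K [HK Hb]]. exists (K + 1). split; [lra|]. intros i y Hi0.
      replace i with O by lia. eapply Rle_trans; [apply Hb|]. apply Hm. lra.
    - destruct (Hi (S n)) as [K' [HK' Hb]]. exists (K + K'). split; [lra|]. intros i y Hin.
      destruct (Nat.eq_dec i (S n)) as [->|N].
      + eapply Rle_trans; [apply Hb|]. apply Hm. lra.
      + eapply Rle_trans; [apply IH; lia|]. apply Hm. lra. }
  apply H.
Qed.

Lemma cpow_S x n : cpow x (S n) = (x * cpow x n)%C.
Proof. reflexivity. Qed.

(** With [u = 1 / sqrt Q] at [psi z] one has [psi' = u] and [u' = - Q' u^4 / 2], so polynomials in
    [psi] times powers of [u] are closed under differentiation. *)
Lemma term_cder c m D S sq psi Z fwd z r G G1 n : strip c m D S sq psi Z fwd -> deep Z r z -> 0 < r ->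
  cder G (psi z) G1 ->
  cder (fun z => G (psi z) * cpow (/ sq (psi z)) (Datatypes.S n))%C z
   (G1 * cpow (/ sq (psi z)) (Datatypes.S (Datatypes.S n)) -
    RtoC (INR (Datatypes.S n) / 2) * (G (psi z) * qder c m 1 (psi z) * cpow (/ sq (psi z)) (n + 4)))%C.
Proof.
  intros HS Hz Hr HG. assert (Zz := deep_center _ _ _ Hr Hz).
  destruct (sp_psi _ _ _ _ _ _ _ _ HS z Zz) as [_ [_ A3]].
  destruct (strip_sq_psi _ _ _ _ _ _ _ _ _ HS Zz) as [_ [N _]].
  assert (D1 := sq_psi_cder _ _ _ _ _ _ _ _ _ _ _ HS Hz Hr (qder_cder c m 0 (psi z) (sp_deg _ _ _ _ _ _ _ _ HS))).
  assert (D2 := deriv_inv _ (fun z => sq (psi z)) _ _ N D1).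
  assert (D3 := deriv_comp _ (fun z => / sq (psi z))%C (fun w => cpow w (Datatypes.S n)) _ _ _ D2 (cder_cpow n _)).
  assert (D4 := deriv_comp _ psi G _ _ _ A3 HG).
  eapply deriv_eq; [exact (deriv_mult _ _ _ _ _ _ D4 D3)|].
  replace (n + 4)%nat with (Datatypes.S (Datatypes.S (Datatypes.S (Datatypes.S n)))) by lia.
  unfold Rdiv. rewrite RtoC_mult, RtoC_inv by lra. rewrite !cpow_S. field. exact N.
Qed.

(** The exponent is the degree count of [C / Q]: at most [2 m - 2] in the numerator against [3 m] in
    the denominator. *)
Definition omega (m : nat) (psi : C -> C) (z : C) : R := / (1 + Cmod (psi z)) ^ (m + 2).

(** Degree count for one term: [Ym] and [Y2] stand for [(1 + |y|)^m] and [(1 + |y|)^2], [a] for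
    [|Q|^(-1/2)]. Of the [n] factors [a], [2 (j + 1)] absorb [Ym^(j+1)] through [a^2 Ym <= e], and
    each remaining one is at most [e]; [e^12] is a common bound since [n <= 12]. *)
Lemma weight_bound (G B Ym Y2 a e : R) (j n : nat) : 0 <= G -> 0 <= Y2 -> 0 <= B -> 0 <= Ym -> 1 <= e -> 0 <= a -> a <= e ->
  a * a * Ym <= e -> G * Y2 <= B * Ym ^ j -> (2 * (j + 1) <= n <= 12)%nat ->
  G * a ^ n * (Ym * Y2) <= B * e ^ 12.
Proof.
  intros HG HY2 HB HYm He Ha Hae Hae2 HGB Hn.
  replace (G * a ^ n * (Ym * Y2)) with (G * Y2 * (Ym * a ^ n)) by ring.
  apply Rle_trans with (B * Ym ^ j * (Ym * a ^ n)).
  { apply Rmult_le_compat_r; [apply Rmult_le_pos; [exact HYm|now apply pow_le]|exact HGB]. }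
  rewrite Rmult_assoc. apply Rmult_le_compat_l; [exact HB|].
  replace n with (2 * (j + 1) + (n - 2 * (j + 1)))%nat by lia.
  rewrite pow_add, pow_mult. replace (a ^ 2) with (a * a) by ring.
  replace (Ym ^ j * (Ym * ((a * a) ^ (j + 1) * a ^ (n - 2 * (j + 1))))) with
    ((a * a * Ym) ^ (j + 1) * a ^ (n - 2 * (j + 1))).
  2:{ rewrite Rpow_mult_distr, (Nat.add_comm j 1). simpl. ring. }
  apply Rle_trans with (e ^ (j + 1) * e ^ (n - 2 * (j + 1))).
  - apply Rmult_le_compat; try (apply pow_le); try nra; apply pow_incr; split; try assumption; nra.
  - rewrite <- pow_add. apply Rle_pow; [exact He|lia].
Qed.

Lemma potential_bounds c m D S sq psi Z fwd r : strip c m D S sq psi Z fwd -> 0 < r ->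
  exists (F1 : C -> C) M kap, 0 < M /\ 0 < kap <= 1 /\ kap <= r / 2 /\
  forall z, deep Z r z ->
    Cmod (Cfun c m (psi z) / peval c m (psi z))%C <= M * omega m psi z /\
    Cmod (F1 z) <= M * omega m psi z /\
    forall k, Cmod k < kap ->
     Cmod (Cfun c m (psi (z + k)) / peval c m (psi (z + k)) - Cfun c m (psi z) / peval c m (psi z) - k * F1 z)%C
       <= M * omega m psi z * (Cmod k * Cmod k).
Proof.
  intros HS Hr. assert (Hp := sp_deg _ _ _ _ _ _ _ _ HS).
  destruct (strip_lower _ _ _ _ _ _ _ _ (r / 2) HS ltac:(lra)) as [c2 [Hc2 Hlow]].
  destruct (qder_bound c m Hp) as [K [HK Hq]].
  set (q := qder c m). set (e := / c2).
  assert (He : 1 <= e) by (unfold e; rewrite <- Rinv_1; apply Rinv_le_contravar; lra).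
  (* [N] is the numerator of [C] divided by 16, so that [C / Q = N u^6]. [N1] and [N2] are its
     derivatives in [y], while [F1] and [F2] below are those of [N u^6] in the strip coordinate,
     obtained with [term_cder]. *)
  set (N := fun y => (RtoC (/ 16) * (4 * (q 0%nat y * q 2%nat y) - 5 * (q 1%nat y * q 1%nat y)))%C).
  set (N1 := fun y => (RtoC (/ 16) * (4 * (q 0%nat y * q 3%nat y) - 6 * (q 1%nat y * q 2%nat y)))%C).
  set (N2 := fun y => (RtoC (/ 16) * (4 * (q 0%nat y * q 4%nat y) - 2 * (q 1%nat y * q 3%nat y) - 6 * (q 2%nat y * q 2%nat y)))%C).
  assert (Hd : forall i y, cder (q i) y (q (Datatypes.S i) y)) by (intros; now apply qder_cder).
  assert (HdN : forall y, cder N y (N1 y)).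
  { intros y. eapply deriv_eq.
    - apply deriv_scal. apply deriv_minus; apply deriv_scal; apply deriv_mult; apply Hd.
    - unfold N1. ring. }
  assert (HdN1 : forall y, cder N1 y (N2 y)).
  { intros y. eapply deriv_eq.
    - apply deriv_scal. apply deriv_minus; apply deriv_scal; apply deriv_mult; apply Hd.
    - unfold N2. ring. }
  set (u := fun z => (/ sq (psi z))%C).
  set (F := fun z => (N (psi z) * cpow (u z) 6)%C).
  set (F1 := fun z => (N1 (psi z) * cpow (u z) 7 - 3 * (N (psi z) * q 1%nat (psi z) * cpow (u z) 9))%C).
  set (F2 := fun z => ((N2 (psi z) * cpow (u z) 8 - RtoC (7 / 2) * (N1 (psi z) * q 1%nat (psi z) * cpow (u z) 10)) -
     3 * ((N1 (psi z) * q 1%nat (psi z) + N (psi z) * q 2%nat (psi z)) * cpow (u z) 10 -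
       RtoC (9 / 2) * (N (psi z) * q 1%nat (psi z) * q 1%nat (psi z) * cpow (u z) 12)))%C).
  assert (Hr2 : 0 < r / 2) by lra.
  assert (HdF : forall z, deep Z (r / 2) z -> cder F z (F1 z)).
  { intros z Hz. eapply deriv_eq; [exact (term_cder _ _ _ _ _ _ _ _ _ _ N _ 5 HS Hz Hr2 (HdN _))|].
    unfold F1, u. replace (INR 6 / 2) with 3 by (simpl; field). reflexivity. }
  assert (HdF1 : forall z, deep Z (r / 2) z -> cder F1 z (F2 z)).
  { intros z Hz.
    assert (T1 := term_cder _ _ _ _ _ _ _ _ _ _ N1 _ 6 HS Hz Hr2 (HdN1 _)).
    assert (T2 := term_cder _ _ _ _ _ _ _ _ _ _ (fun y => N y * q 1%nat y)%C _ 8 HS Hz Hr2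
      (deriv_mult _ _ _ _ _ _ (HdN _) (Hd 1%nat _))).
    eapply deriv_eq; [exact (deriv_minus _ _ _ _ _ _ T1 (deriv_scal _ _ 3%C _ _ T2))|].
    unfold F2, u. replace (INR 7) with 7 by (simpl; ring). replace (INR 9) with 9 by (simpl; ring). reflexivity. }
  assert (HFeq : forall z, Z z -> F z = (Cfun c m (psi z) / peval c m (psi z))%C).
  { intros z Hz. destruct (strip_sq_psi _ _ _ _ _ _ _ _ _ HS Hz) as [E [Nz Nq]].
    unfold F, N, u, Cfun. unfold q, qder. simpl Nat.iter. rewrite <- E, RtoC_inv by lra. simpl cpow. field. exact Nz. }
  (* The sum of the coefficients of [F2], [1 + 13/2 + 3 + 27/2 = 24], which dominates those of [F]
     and [F1]. It is unrelated to the 24 in the smallness condition on [h]. *)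
  set (M0 := 24 * K ^ 4 * e ^ 12).
  assert (HK4 : K <= K ^ 4 /\ K * K <= K ^ 4 /\ K * K * K <= K ^ 4).
  { assert (K2 : 1 <= K * K) by nra. simpl. repeat split; nra. }
  assert (He12 : 1 <= e ^ 12) by now apply pow_R1_Rle.
  assert (Hb : forall z, deep Z (r / 2) z ->
     Cmod (F z) <= M0 * omega m psi z /\ Cmod (F1 z) <= M0 * omega m psi z /\ Cmod (F2 z) <= M0 * omega m psi z /\
     Cmod (u z) <= e).
  { intros z Hz. specialize (Hlow z Hz). destruct (strip_sq_psi _ _ _ _ _ _ _ _ _ HS (deep_center _ _ _ Hr2 Hz)) as [E [Nz _]].
    set (Y := 1 + Cmod (psi z)) in *. assert (HY : 1 <= Y) by (unfold Y; assert (A := Cmod_ge_0 (psi z)); lra).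
    set (a := Cmod (u z)). assert (Ha : 0 <= a) by apply Cmod_ge_0.
    set (Ym := Y ^ m) in *. assert (HYm : 1 <= Ym) by now apply pow_R1_Rle.
    assert (Hau : a * a * Cmod (peval c m (psi z)) = 1).
    { unfold a, u. rewrite <- E, <- !Cmod_mult. replace (/ sq (psi z) * / sq (psi z) * (sq (psi z) * sq (psi z)))%C with (RtoC 1) by (field; exact Nz).
      apply Cmod_1. }
    assert (Hae2 : a * a * Ym <= e).
    { apply Rmult_le_reg_l with c2; [lra|]. unfold e. rewrite Rinv_r by lra. rewrite <- Hau.
      replace (c2 * (a * a * Ym)) with (a * a * (c2 * Ym)) by ring. apply Rmult_le_compat_l; nra. }
    assert (Hae : a <= e) by nra.
    assert (Hqb : forall i j, (j <= i <= 4)%nat -> Cmod (q i (psi z)) * Y ^ j <= K * Ym).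
    { intros i j Hij. eapply Rle_trans; [|apply (Hq i (psi z)); lia]. fold Y. apply Rmult_le_compat_l; [apply Cmod_ge_0|].
      apply Rle_pow; [exact HY|lia]. }
    assert (Hpr : forall i j k l, (k <= i <= 4)%nat -> (l <= j <= 4)%nat -> (k + l = 2)%nat ->
       Cmod (q i (psi z) * q j (psi z))%C * (Y * Y) <= K * K * Ym ^ 2).
    { intros i j k l Hi Hj Hkl. rewrite Cmod_mult.
      replace (Y * Y) with (Y ^ k * Y ^ l) by (rewrite <- pow_add, Hkl; ring).
      replace (Cmod (q i (psi z)) * Cmod (q j (psi z)) * (Y ^ k * Y ^ l)) with
        ((Cmod (q i (psi z)) * Y ^ k) * (Cmod (q j (psi z)) * Y ^ l)) by ring.
      replace (K * K * Ym ^ 2) with ((K * Ym) * (K * Ym)) by ring.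
      apply Rmult_le_compat; try (apply Rmult_le_pos; [apply Cmod_ge_0|apply pow_le; lra]); now apply Hqb. }
    assert (Habs : forall x : R, 0 <= x -> Cmod (RtoC x) = x) by (intros x Hx; rewrite Cmod_R; now apply Rabs_pos_eq).
    assert (HYY : 0 <= Y * Y) by nra. assert (HKY : 0 <= K * K * Ym ^ 2) by (assert (0 <= Ym ^ 2) by (apply pow_le; lra); nra).
    assert (HN : Cmod (N (psi z)) * (Y * Y) <= K * K * Ym ^ 2).
    { assert (P1 := Hpr 0%nat 2%nat 0%nat 2%nat ltac:(lia) ltac:(lia) ltac:(lia)). assert (P2 := Hpr 1%nat 1%nat 1%nat 1%nat ltac:(lia) ltac:(lia) ltac:(lia)).
      unfold N. rewrite Cmod_mult, Habs by lra.
      assert (T := Cmod_sub_le (4 * (q 0%nat (psi z) * q 2%nat (psi z))) (5 * (q 1%nat (psi z) * q 1%nat (psi z)))).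
      rewrite (Cmod_mult 4), (Cmod_mult 5), !Habs in T by lra. apply (Rmult_le_compat_r _ _ _ HYY) in T. lra. }
    assert (HN1 : Cmod (N1 (psi z)) * (Y * Y) <= K * K * Ym ^ 2).
    { assert (P1 := Hpr 0%nat 3%nat 0%nat 2%nat ltac:(lia) ltac:(lia) ltac:(lia)). assert (P2 := Hpr 1%nat 2%nat 0%nat 2%nat ltac:(lia) ltac:(lia) ltac:(lia)).
      unfold N1. rewrite Cmod_mult, Habs by lra.
      assert (T := Cmod_sub_le (4 * (q 0%nat (psi z) * q 3%nat (psi z))) (6 * (q 1%nat (psi z) * q 2%nat (psi z)))).
      rewrite (Cmod_mult 4), (Cmod_mult 6), !Habs in T by lra. apply (Rmult_le_compat_r _ _ _ HYY) in T. lra. }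
    assert (HN2 : Cmod (N2 (psi z)) * (Y * Y) <= K * K * Ym ^ 2).
    { assert (P1 := Hpr 0%nat 4%nat 0%nat 2%nat ltac:(lia) ltac:(lia) ltac:(lia)). assert (P2 := Hpr 1%nat 3%nat 0%nat 2%nat ltac:(lia) ltac:(lia) ltac:(lia)).
      assert (P3 := Hpr 2%nat 2%nat 0%nat 2%nat ltac:(lia) ltac:(lia) ltac:(lia)).
      unfold N2. rewrite Cmod_mult, Habs by lra.
      assert (T := Cmod_sub_le (4 * (q 0%nat (psi z) * q 4%nat (psi z)) - 2 * (q 1%nat (psi z) * q 3%nat (psi z))) (6 * (q 2%nat (psi z) * q 2%nat (psi z)))).
      assert (T2 := Cmod_sub_le (4 * (q 0%nat (psi z) * q 4%nat (psi z))) (2 * (q 1%nat (psi z) * q 3%nat (psi z)))).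
      rewrite (Cmod_mult 6), !Habs in T by lra. rewrite (Cmod_mult 4), (Cmod_mult 2), !Habs in T2 by lra.
      apply (Rmult_le_compat_r _ _ _ HYY) in T. apply (Rmult_le_compat_r _ _ _ HYY) in T2. lra. }
    assert (Hq1 := Hqb 1%nat 0%nat ltac:(lia)). assert (Hq2 := Hqb 2%nat 0%nat ltac:(lia)). simpl pow in Hq1, Hq2. rewrite Rmult_1_r in Hq1, Hq2.
    assert (Hmore : forall G B (j : nat) H, 0 <= G -> 0 <= B -> G * (Y * Y) <= B * Ym ^ j -> 0 <= H -> H <= K * Ym ->
       G * H * (Y * Y) <= B * K * Ym ^ (Datatypes.S j)).
    { intros G B j H HG HB HGB HH HHK. replace (G * H * (Y * Y)) with (G * (Y * Y) * H) by ring.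
      replace (B * K * Ym ^ (Datatypes.S j)) with (B * Ym ^ j * (K * Ym)) by (simpl; ring).
      apply Rmult_le_compat; auto. apply Rmult_le_pos; auto. }
    assert (Hom : omega m psi z = / (Ym * (Y * Y))).
    { unfold omega. fold Y. rewrite pow_add. fold Ym. f_equal. simpl. ring. }
    assert (Hpos : 0 < Ym * (Y * Y)) by nra.
    assert (Hfin : forall v B, v * (Ym * (Y * Y)) <= B -> v <= B * omega m psi z).
    { intros v B Hv. rewrite Hom. apply Rmult_le_reg_r with (Ym * (Y * Y)); [exact Hpos|].
      rewrite Rmult_assoc, Rinv_l by lra. lra. }
    assert (KK : 0 <= K * K) by nra. assert (KKK : 0 <= K * K * K) by nra. assert (KKKK : 0 <= K * K * K * K) by nra.
    assert (Hw := fun G B j n HG HB HGB Hn => weight_bound G B Ym (Y * Y) a e j n HG HYY HB ltac:(lra) He Ha Hae Hae2 HGB Hn).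
    assert (Cg := fun w => Cmod_ge_0 w).
    assert (B6 := Hw _ _ 2%nat 6%nat (Cg _) KK HN ltac:(lia)).
    assert (B7 := Hw _ _ 2%nat 7%nat (Cg _) KK HN1 ltac:(lia)).
    assert (B8 := Hw _ _ 2%nat 8%nat (Cg _) KK HN2 ltac:(lia)).
    assert (Pos2 : forall v w, 0 <= Cmod v * Cmod w) by (intros; apply Rmult_le_pos; apply Cmod_ge_0).
    assert (E1 := Hmore _ _ _ _ (Cg _) KK HN (Cg (q 1%nat (psi z))) Hq1).
    assert (E2 := Hmore _ _ _ _ (Cg _) KK HN1 (Cg (q 1%nat (psi z))) Hq1).
    assert (E3 := Hmore _ _ _ _ (Cg _) KK HN (Cg (q 2%nat (psi z))) Hq2).
    assert (E4 := Hmore _ _ _ _ (Pos2 _ _) KKK E1 (Cg (q 1%nat (psi z))) Hq1).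
    assert (B9 := Hw _ _ _ 9%nat (Pos2 _ _) KKK E1 ltac:(lia)).
    assert (B10 := Hw _ _ _ 10%nat (Pos2 _ _) KKK E2 ltac:(lia)).
    assert (B11 := Hw _ _ _ 10%nat (Pos2 _ _) KKK E3 ltac:(lia)).
    assert (B12 := Hw _ _ _ 12%nat (Rmult_le_pos _ _ (Pos2 _ _) (Cg _)) KKKK E4 ltac:(lia)).
    assert (HeK : forall X, X <= K ^ 4 -> X * e ^ 12 <= K ^ 4 * e ^ 12) by (intros X HX; apply Rmult_le_compat_r; lra).
    assert (K2e := HeK _ (proj1 (proj2 HK4))). assert (K3e := HeK _ (proj2 (proj2 HK4))).
    assert (K4e : K * K * K * K * e ^ 12 = K ^ 4 * e ^ 12) by ring.
    assert (Pos := Rlt_le _ _ Hpos).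
    assert (Ke0 : 0 <= K ^ 4 * e ^ 12) by (apply Rmult_le_pos; apply pow_le; lra).
    split; [|split; [|split; [|exact Hae]]]; apply Hfin; unfold M0.
    - unfold F. rewrite Cmod_mult, Cmod_cpow. fold a. lra.
    - unfold F1.
      assert (T := Cmod_sub_le (N1 (psi z) * cpow (u z) 7) (3 * (N (psi z) * q 1%nat (psi z) * cpow (u z) 9))).
      rewrite !Cmod_mult, !Cmod_cpow, Habs in T by lra. fold a in T. apply (Rmult_le_compat_r _ _ _ Pos) in T.
      eapply Rle_trans; [exact T|]. lra.
    - unfold F2.
      set (t1 := (N2 (psi z) * cpow (u z) 8)%C). set (t2 := (N1 (psi z) * q 1%nat (psi z) * cpow (u z) 10)%C).
      set (t3 := (N (psi z) * q 1%nat (psi z) * q 1%nat (psi z) * cpow (u z) 12)%C).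
      set (t4 := (N (psi z) * q 2%nat (psi z) * cpow (u z) 10)%C).
      replace (t1 - RtoC (7 / 2) * t2 - 3 * ((N1 (psi z) * q 1%nat (psi z) + N (psi z) * q 2%nat (psi z)) * cpow (u z) 10 - RtoC (9 / 2) * t3))%C
        with (t1 - RtoC (13 / 2) * t2 - RtoC 3 * t4 + RtoC (27 / 2) * t3)%C.
      2:{ replace (13 / 2) with (7 / 2 + 3) by field. replace (27 / 2) with (3 * (9 / 2)) by field.
          rewrite RtoC_plus, (RtoC_mult 3). unfold t2, t4. ring. }
      assert (T1 := Cmod_triangle (t1 - RtoC (13 / 2) * t2 - RtoC 3 * t4) (RtoC (27 / 2) * t3)).
      assert (T2 := Cmod_sub_le (t1 - RtoC (13 / 2) * t2) (RtoC 3 * t4)).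
      assert (T3 := Cmod_sub_le t1 (RtoC (13 / 2) * t2)).
      rewrite (Cmod_mult (RtoC (27 / 2))), Habs in T1 by lra. rewrite (Cmod_mult (RtoC 3)), Habs in T2 by lra.
      rewrite (Cmod_mult (RtoC (13 / 2))), Habs in T3 by lra.
      assert (V1 : Cmod t1 * (Ym * (Y * Y)) <= K ^ 4 * e ^ 12) by (unfold t1; rewrite Cmod_mult, Cmod_cpow; fold a; lra).
      assert (V2 : Cmod t2 * (Ym * (Y * Y)) <= K ^ 4 * e ^ 12) by (unfold t2; rewrite !Cmod_mult, Cmod_cpow; fold a; lra).
      assert (V3 : Cmod t3 * (Ym * (Y * Y)) <= K ^ 4 * e ^ 12) by (unfold t3; rewrite !Cmod_mult, Cmod_cpow; fold a; lra).
      assert (V4 : Cmod t4 * (Ym * (Y * Y)) <= K ^ 4 * e ^ 12) by (unfold t4; rewrite !Cmod_mult, Cmod_cpow; fold a; lra).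
      assert (T4 : Cmod (t1 - RtoC (13 / 2) * t2 - RtoC 3 * t4 + RtoC (27 / 2) * t3)%C <= Cmod t1 + 13 / 2 * Cmod t2 + 3 * Cmod t4 + 27 / 2 * Cmod t3) by lra.
      apply (Rmult_le_compat_r _ _ _ Pos) in T4. eapply Rle_trans; [exact T4|]. lra. }
  assert (HM0 : 0 < M0) by (unfold M0; nra).
  assert (H2m : 1 <= 2 ^ (m + 2)) by (apply pow_R1_Rle; lra).
  (* Since [|psi'| <= e], an increment below [kap] moves [psi] by at most 1, so the weight changes
     at most by the factor [2^(m+2)]; [r / 2] keeps the segment inside the region of the bounds. *)
  set (kap := Rmin 1 (Rmin (r / 2) (/ e))). assert (Hie : 0 < / e) by (apply Rinv_0_lt_compat; lra).
  assert (Q1 : kap <= 1) by apply Rmin_l. assert (Q2 : kap <= Rmin (r / 2) (/ e)) by apply Rmin_r.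
  assert (Q3 := Rmin_l (r / 2) (/ e)). assert (Q4 := Rmin_r (r / 2) (/ e)).
  assert (Hkap : 0 < kap) by (repeat apply Rmin_pos; lra).
  exists F1, (M0 * 2 ^ (m + 2)), kap. split; [nra|]. split; [lra|]. split; [lra|].
  intros z Hz.
  assert (Hdz : forall k, Cmod k <= r / 2 -> deep Z (r / 2) (z + k)%C).
  { intros k Hk j Hj. rewrite <- Cplus_assoc. apply Hz. eapply Rle_lt_trans; [apply Cmod_triangle|]. lra. }
  assert (Hz0 : deep Z (r / 2) z) by (intros k Hk; apply Hz; lra).
  assert (HY : 1 <= 1 + Cmod (psi z)) by (assert (A := Cmod_ge_0 (psi z)); lra).
  assert (Hom0 : 0 < omega m psi z) by (apply Rinv_0_lt_compat, pow_lt; lra).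
  assert (Hlift : M0 * omega m psi z <= M0 * 2 ^ (m + 2) * omega m psi z).
  { apply Rmult_le_compat_r; [lra|]. rewrite <- (Rmult_1_r M0) at 1. apply Rmult_le_compat_l; lra. }
  destruct (Hb z Hz0) as [X1 [X2 _]].
  assert (Zz : Z z) by (apply (deep_center _ _ _ Hr Hz)).
  rewrite <- (HFeq z Zz). split; [lra|]. split; [lra|]. intros k Hk.
  rewrite <- (HFeq (z + k)%C) by (apply Hz; lra).
  assert (Hsg : forall t, 0 <= t <= 1 -> deep Z (r / 2) (seg z (z + k)%C t)).
  { intros t Ht. unfold seg. replace (z + (z + k - z) * RtoC t)%C with (z + k * RtoC t)%C by ring. apply Hdz.
    rewrite Cmod_mult, Cmod_R, Rabs_pos_eq by lra. assert (A := Cmod_ge_0 k). nra. }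
  destruct (quadratic_remainder F F1 F2 z (z + k)%C (M0 * 2 ^ (m + 2) * omega m psi z)) as [_ R].
  - intros t Ht. apply HdF, Hsg, Ht.
  - intros t Ht. apply HdF1, Hsg, Ht.
  - intros t Ht. set (w := seg z (z + k)%C t). destruct (Hb w (Hsg t Ht)) as [_ [_ [X3 _]]].
    eapply Rle_trans; [exact X3|]. rewrite Rmult_assoc. apply Rmult_le_compat_l; [lra|].
    assert (Hpp : Cmod (psi w - psi z)%C <= 1).
    { assert (MV := MVT_cder psi u z w 0 e).
      replace (psi w - psi z)%C with (psi w - psi z - 0 * (w - z))%C by ring.
      assert (Hseg2 : forall s, 0 <= s <= 1 -> deep Z (r / 2) (seg z w s)).
      { intros s Hs. unfold w, seg. replace (z + (z + (z + k - z) * RtoC t - z) * RtoC s)%C with (seg z (z + k)%C (t * s)) by (unfold seg; rewrite RtoC_mult; ring).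
        apply Hsg. nra. }
      eapply Rle_trans; [apply MV|].
      - intros s Hs. apply (sp_psi _ _ _ _ _ _ _ _ HS). apply (deep_center _ _ _ Hr2). now apply Hseg2.
      - intros s Hs. replace (u (seg z w s) - 0)%C with (u (seg z w s)) by ring. apply Hb. now apply Hseg2.
      - unfold w, seg. replace (z + (z + k - z) * RtoC t - z)%C with (k * RtoC t)%C by ring.
        rewrite Cmod_mult, Cmod_R, Rabs_pos_eq by lra. assert (A := Cmod_ge_0 k).
        assert (Hek : e * Cmod k <= 1).
        { apply Rle_trans with (e * / e); [apply Rmult_le_compat_l; lra|right; apply Rinv_r; lra]. }
        nra. }
    assert (Tr := Cmod_triangle_inv (psi z) (psi w)). rewrite (Cmod_sub_sym (psi z) (psi w)) in Tr.
    assert (A := Cmod_ge_0 (psi w)).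
    unfold omega. rewrite <- (Rinv_inv (2 ^ (m + 2))), <- Rinv_mult.
    apply Rinv_le_contravar.
    + apply Rmult_lt_0_compat; [apply Rinv_0_lt_compat|apply pow_lt]; lra.
    + apply Rmult_le_reg_l with (2 ^ (m + 2)); [lra|]. rewrite <- Rmult_assoc, Rinv_r by lra.
      rewrite Rmult_1_l, <- Rpow_mult_distr. apply pow_incr. lra.
  - replace (z + k - z)%C with k in R by ring.
    replace (k * F1 z)%C with (F1 z * k)%C by ring. exact R.
Qed.

(** * Integrals along rays *)

Lemma Cmod_add_cut (x y : C) : Cmod (x + y - x)%C = Cmod y.
Proof. f_equal. ring. Qed.

(** Improper integral over the half-line in epsilon form, common to both directions; [half_int_gen]
    turns it into the generalized integrals of the statement. *)
Definition half_int (k : R -> C) (l : C) : Prop := forall e, 0 < e -> exists M, 0 <= M /\ forall T, M < T ->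
  exists y, CInt k 0 T y /\ Cmod (y - l)%C < e.

Definition hint (k : R -> C) : C := epsilon (inhabits (RtoC 0)) (half_int k).


Lemma half_int_scal f k l : half_int f l -> half_int (fun u => k * f u)%C (k * l)%C.
Proof.
  intros H e He. assert (A := Cmod_ge_0 k). destruct (H (e / (Cmod k + 1))) as [M [HM K]]; [apply Rdiv_lt_0_compat; lra|].
  exists M. split; [exact HM|]. intros T HT. destruct (K T HT) as [y [I Y]]. exists (k * y)%C.
  split; [now apply CInt_scal|]. replace (k * y - k * l)%C with (k * (y - l))%C by ring. rewrite Cmod_mult.
  apply Rle_lt_trans with (Cmod k * (e / (Cmod k + 1))); [apply Rmult_le_compat_l; lra|].
  apply Rlt_le_trans with ((Cmod k + 1) * (e / (Cmod k + 1))); [|right; field; lra].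
  apply Rmult_lt_compat_r; [apply Rdiv_lt_0_compat|]; lra.
Qed.

Lemma half_int_minus f g l m : half_int f l -> half_int g m -> half_int (fun u => f u - g u)%C (l - m)%C.
Proof.
  intros H H' e He. destruct (H (e / 2)) as [M [HM K]]; [lra|]. destruct (H' (e / 2)) as [M' [HM' K']]; [lra|].
  exists (M + M'). split; [lra|]. intros T HT.
  destruct (K T) as [y [I Y]]; [lra|]. destruct (K' T) as [y' [I' Y']]; [lra|].
  exists (y - y')%C. split; [now apply CInt_minus|].
  replace (y - y' - (l - m))%C with ((y - l) - (y' - m))%C by ring.
  eapply Rle_lt_trans; [apply Cmod_sub_le|]. lra.
Qed.

Lemma half_int_ext f g l : (forall u, 0 <= u -> f u = g u) -> half_int f l -> half_int g l.
Proof.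
  intros E H e He. destruct (H e He) as [M [HM K]]. exists M. split; [exact HM|]. intros T HT.
  destruct (K T HT) as [y [I Y]]. exists y. split; [|exact Y]. apply (CInt_ext f g); auto; [lra|].
  intros t Ht. apply E. lra.
Qed.

(** [Bf] is the tail of a majorant [beta]: [Bf t = int_t^oo beta]. *)
Definition tail (beta Bf : R -> R) : Prop :=
  (forall u, 0 <= u -> is_derive Bf u (- beta u)) /\ (forall u, 0 <= u -> continuous beta u) /\
  (forall u, 0 <= u -> 0 <= Bf u) /\ (forall e, 0 < e -> exists M, 0 <= M /\ forall T, M < T -> Bf T < e).

Lemma tail_int beta Bf a b : tail beta Bf -> 0 <= a <= b -> is_RInt beta a b (Bf a - Bf b).
Proof.
  intros [Hd [Hc _]] Hab.
  replace (Bf a - Bf b) with (minus ((fun x => - Bf x) b) ((fun x => - Bf x) a)) by (unfold minus, plus, opp; simpl; ring).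
  apply (is_RInt_derive (V := R_CompleteNormedModule) (fun x => - Bf x)); intros x; rewrite Rmin_left, Rmax_right by lra; intros Hx.
  - replace (beta x) with (opp (- beta x)) by (unfold opp; simpl; ring). apply (is_derive_opp Bf). apply Hd. lra.
  - apply Hc. lra.
Qed.

Lemma half_int_bound k l beta Bf : tail beta Bf -> (forall u, 0 <= u -> Cmod (k u) <= beta u) ->
  half_int k l -> Cmod l <= Bf 0.
Proof.
  intros HT Hk H. apply Rnot_lt_le. intros L.
  destruct (H (Cmod l - Bf 0)) as [M [HM K]]; [lra|]. destruct (K (M + 1)) as [y [I Y]]; [lra|].
  assert (B := CInt_norm k beta 0 (M + 1) y _ ltac:(lra) ltac:(intros; apply Hk; lra) I (tail_int _ _ 0 (M + 1) HT ltac:(lra))).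
  assert (P := proj1 (proj2 (proj2 HT)) (M + 1) ltac:(lra)).
  assert (T := Cmod_triangle_inv l y). rewrite (Cmod_sub_sym l y) in T. lra.
Qed.

(** The increments of the partial integrals are bounded by those of [- Bf], which makes them Cauchy;
    the limit is a cluster point of their values at integers. *)
Lemma half_int_exists k beta Bf : tail beta Bf -> (forall u, 0 <= u -> rcont k u) ->
  (forall u, 0 <= u -> Cmod (k u) <= beta u) -> exists l, half_int k l.
Proof.
  intros HT Hc Hk. assert (HB := proj1 (proj2 (proj2 HT))). assert (Hlim := proj2 (proj2 (proj2 HT))).
  set (I := fun T => epsilon (inhabits (RtoC 0)) (fun y => CInt k 0 T y)).
  assert (HI : forall T, 0 <= T -> CInt k 0 T (I T)).
  { intros T HT0. apply epsilon_spec. apply CInt_exists; [exact HT0|]. intros t Ht. apply Hc. lra. }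
  assert (HC : forall T T', 0 <= T <= T' -> Cmod (I T' - I T)%C <= Bf T - Bf T').
  { intros T T' HTT. destruct (CInt_exists k T T') as [y Hy]; [lra|intros t Ht; apply Hc; lra|].
    assert (E := is_RInt_Chasles (V := C_R_NormedModule) k 0 T T' _ _ (HI T ltac:(lra)) Hy).
    rewrite (CInt_unique _ _ _ _ _ (HI T' ltac:(lra)) E).
    eapply Rle_trans; [right; exact (Cmod_add_cut (I T) y)|].
    apply (CInt_norm k beta T T' y); [lra| |exact Hy|apply (tail_int beta Bf T T' HT HTT)]. intros t Ht. apply Hk. lra. }
  destruct (cluster_point (fun n => I (INR n)) (Cmod (I 0) + Bf 0)) as [l Hl].
  { intros n. assert (A := HC 0 (INR n) (conj (Rle_refl 0) (pos_INR n))). assert (B := HB (INR n) (pos_INR n)).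
    assert (T := Cmod_triangle_inv (I (INR n)) (I 0)). lra. }
  exists l. intros e He. destruct (Hlim (e / 2)) as [M [HM K]]; [lra|]. exists M. split; [exact HM|]. intros T HMT.
  exists (I T). split; [apply HI; lra|].
  destruct (INR_unbounded T) as [N HN]. destruct (Hl (e / 2) N) as [n [Hn Hn']]; [lra|]. apply le_INR in Hn.
  assert (A := HC T (INR n) ltac:(lra)). assert (B := HB (INR n) (pos_INR n)). specialize (K T HMT).
  rewrite (Cmod_sub_sym (I (INR n)) (I T)) in A. assert (Tr := Cmod_sub_triangle (I T) (I (INR n)) l). lra.
Qed.

Lemma dirn_sqr fwd : dirn fwd * dirn fwd = 1.
Proof. destruct fwd; simpl; ring. Qed.

Lemma Copp_scal_invol (x : C) : (RtoC (-(1)) * (RtoC (-(1)) * x))%C = x.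
Proof. rewrite RtoC_opp. ring. Qed.

Lemma Copp_scal (x : C) : (RtoC (-(1)) * - x)%C = x.
Proof. rewrite RtoC_opp. ring. Qed.

(** [K_-] integrates from [+oo] down to 0 and [K_+] from [-oo] up to 0. With [t = dirn fwd * u] both
    become integrals over [u >= 0], and the orientation leaves the factor [- dirn fwd]. *)
Lemma half_int_gen fwd (g : R -> C) l :
  half_int (fun u => RtoC (- dirn fwd) * g (dirn fwd * u)%R)%C l ->
  @is_RInt_gen C_R_NormedModule g (Klow fwd) (at_point 0) l.
Proof.
  intros H P [eps HP]. destruct (H eps (cond_pos eps)) as [M [HM K]].
  assert (Hball : forall y : C, Cmod (y - l)%C < eps -> P y).
  { intros y Hy. apply HP. apply (norm_compat1 (V := C_R_NormedModule)). rewrite C_R_norm_Cmod. exact Hy. }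
  apply Filter_prod with (fun t => M < dirn fwd * t) (fun b => b = 0).
  - destruct fwd; [exists M|exists (- M)]; intros t Ht; simpl; lra.
  - reflexivity.
  - intros t b Ht ->. destruct (K _ Ht) as [y [I Y]]. exists y. split; [|now apply Hball].
    simpl fst; simpl snd. destruct fwd; simpl in I, Ht.
    + assert (I2 := is_RInt_swap _ _ _ _ (CInt_scal _ _ _ (RtoC (-(1))) _ I)).
      replace y with (opp (RtoC (-(1)) * y)%C : C_R_NormedModule).
      2:{ change (- (RtoC (-(1)) * y) = y)%C. rewrite RtoC_opp. ring. }
      rewrite Rmult_1_l in I2. revert I2. apply is_RInt_ext. intros x _.
      rewrite Rmult_1_l. apply Copp_scal_invol.
    + replace (-1 * t) with (- t) in I by ring. rewrite <- Ropp_0 in I.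
      apply is_RInt_swap in I. apply (is_RInt_comp_opp (V := C_R_NormedModule)) in I.
      apply (CInt_scal _ _ _ (RtoC (-(1)))) in I.
      replace y with (RtoC (-(1)) * (opp y : C_R_NormedModule))%C.
      2:{ change (RtoC (-(1)) * - y = y)%C. rewrite RtoC_opp. ring. }
      revert I. apply is_RInt_ext. intros x _. replace (-1 * - x) with x by ring.
      replace (- (-1)) with 1 by ring. rewrite <- (Cmult_1_l (g x)) at 2. apply Copp_scal.
Qed.


Lemma tail_exp a h : 0 <= a -> 0 < h -> tail (fun u => a * exp (-2 * u / h)) (fun u => a * (h / 2) * exp (-2 * u / h)).
Proof.
  intros Ha Hh. split; [|split; [|split]].
  - intros u _. auto_derive; [easy|]. unfold Rdiv. field. lra.
  - intros u _. apply (ex_derive_continuous (fun u => a * exp (-2 * u / h))). auto_derive. easy.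
  - intros u _. assert (E := exp_pos (-2 * u / h)). apply Rmult_le_pos; [apply Rmult_le_pos|]; lra.
  - intros e He. set (b := a * (h / 2)). assert (Hb : 0 <= b) by (apply Rmult_le_pos; lra).
    (* From [exp x > x] at [x = 2 T / h], the tail is below [b h / (2 T)]. *)
    exists (b * h / e). split; [apply Rmult_le_pos; [nra|apply Rlt_le, Rinv_0_lt_compat, He]|]. intros T HT.
    replace (-2 * T / h) with (- (2 * T / h)) by (field; lra). rewrite exp_Ropp.
    assert (HT0 : 0 < T).
    { eapply Rle_lt_trans; [|exact HT]. apply Rmult_le_pos; [nra|apply Rlt_le, Rinv_0_lt_compat, He]. }
    assert (X : 2 * T / h < exp (2 * T / h)).
    { assert (Y := exp_ineq1 (2 * T / h)). assert (0 < 2 * T / h) by (apply Rdiv_lt_0_compat; lra). lra. }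
    assert (P : 0 < 2 * T / h) by (apply Rdiv_lt_0_compat; lra).
    apply Rmult_lt_reg_r with (exp (2 * T / h)); [lra|]. rewrite Rmult_assoc, Rinv_l by lra. rewrite Rmult_1_r.
    apply Rle_lt_trans with (e * (2 * T / h)); [|now apply Rmult_lt_compat_l].
    replace (e * (2 * T / h)) with (e * T * 2 / h) by (field; lra).
    assert (Y : b * h < e * T).
    { apply Rmult_lt_reg_r with (/ e); [now apply Rinv_0_lt_compat|]. replace (e * T * / e) with T by (field; lra). exact HT. }
    apply Rmult_le_reg_r with h; [exact Hh|]. replace (e * T * 2 / h * h) with (e * T * 2) by (field; lra). nra.
Qed.

Lemma tail_sqr a : 0 <= a -> tail (fun u => a / ((1 + u) * (1 + u))) (fun u => a / (1 + u)).
Proof.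
  intros Ha. split; [|split; [|split]].
  - intros u Hu. auto_derive; [lra|]. field. lra.
  - intros u Hu. apply (ex_derive_continuous (fun u => a / ((1 + u) * (1 + u)))). auto_derive. nra.
  - intros u Hu. apply Rmult_le_pos; [exact Ha|]. apply Rlt_le, Rinv_0_lt_compat. lra.
  - intros e He. exists (a / e). split; [apply Rmult_le_pos; [exact Ha|apply Rlt_le, Rinv_0_lt_compat, He]|]. intros T HT.
    assert (X : a < e * T).
    { apply Rmult_lt_reg_r with (/ e); [now apply Rinv_0_lt_compat|]. replace (e * T * / e) with T by (field; lra). exact HT. }
    assert (HT0 : 0 <= T) by nra.
    apply Rmult_lt_reg_r with (1 + T); [lra|]. unfold Rdiv. rewrite Rmult_assoc, Rinv_l by lra. lra.
Qed.

(** What the norm estimates use of the strip: an open set containing its rays, a weight with values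
    in [[0, 1]], and a bound [kap <= 1] for the increments. The bounds by 1 let powers of [lam] and
    of [|k|] be dropped in products. *)
Record ray_env (Z : C -> Prop) (om : C -> R) (kap d : R) : Prop := {
  en_open : forall z, Z z -> exists r, 0 < r /\ forall k, Cmod k < r -> Z (z + k)%C;
  en_ray : forall z u, Z z -> 0 <= u -> Z (z + RtoC (d * u))%C;
  en_om : forall z, 0 <= om z <= 1;
  en_kap : 0 < kap <= 1;
  en_d : d * d = 1 }.

Definition ray_bd (om : C -> R) (d : R) (z : C) (lam : R) : Prop :=
  0 <= lam <= 1 /\ forall u, 0 <= u -> om (z + RtoC (d * u))%C <= lam.

(** Quantifying over all bounds [lam] of the weight on the ray from [z] makes the estimate stable
    under integration along rays and still records the decay of [F]; controlling second order
    remainders replaces differentiation under the integral sign. *)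
Definition nrm Z om kap d (F F1 : C -> C) (a : R) : Prop := 0 <= a /\ forall z lam, Z z -> ray_bd om d z lam ->
  Cmod (F z) <= a * lam /\ Cmod (F1 z) <= a * lam /\
  forall k, Cmod k < kap -> Z (z + k)%C -> Cmod (F (z + k) - F z - k * F1 z)%C <= a * lam * (Cmod k * Cmod k).

Lemma ray_bd_1 Z om kap d z : ray_env Z om kap d -> ray_bd om d z 1.
Proof. intros H. split; [lra|]. intros u _. apply (en_om _ _ _ _ H). Qed.

Lemma ray_bd_shift om d z lam u : ray_bd om d z lam -> 0 <= u -> ray_bd om d (z + RtoC (d * u))%C lam.
Proof.
  intros [H1 H2] Hu. split; [exact H1|]. intros v Hv.
  replace (z + RtoC (d * u) + RtoC (d * v))%C with (z + RtoC (d * (u + v)))%C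
    by (rewrite Rmult_plus_distr_l, RtoC_plus; ring).
  apply H2. lra.
Qed.

Lemma nrm_ext (Z : C -> Prop) om kap d F G F1 a : (forall z, Z z -> F z = G z) -> nrm Z om kap d F F1 a -> nrm Z om kap d G F1 a.
Proof.
  intros E [Ha H]. split; [exact Ha|]. intros z lam Hz Hl. destruct (H z lam Hz Hl) as [A1 [A2 A3]].
  rewrite <- E by exact Hz. split; [exact A1|]. split; [exact A2|]. intros k Hk Hzk.
  rewrite <- E by exact Hzk. now apply A3.
Qed.

Lemma nrm_le Z om kap d F F1 a b : a <= b -> nrm Z om kap d F F1 a -> nrm Z om kap d F F1 b.
Proof.
  intros E [Ha H]. split; [lra|]. intros z lam Hz Hl. destruct (H z lam Hz Hl) as [A1 [A2 A3]].
  assert (L : a * lam <= b * lam) by (apply Rmult_le_compat_r; [apply Hl|exact E]).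
  split; [lra|]. split; [lra|]. intros k Hk Hzk. eapply Rle_trans; [now apply A3|].
  apply Rmult_le_compat_r; [|exact L]. apply Rmult_le_pos; apply Cmod_ge_0.
Qed.

Lemma nrm_zero Z om kap d : nrm Z om kap d (fun _ => RtoC 0) (fun _ => RtoC 0) 0.
Proof.
  split; [lra|]. intros z lam _ _. rewrite Cmod_0. split; [lra|]. split; [lra|]. intros k _ _.
  replace (0 - 0 - k * 0)%C with (RtoC 0) by ring. rewrite Cmod_0. lra.
Qed.

Lemma nrm_plus Z om kap d F F1 G G1 a b : nrm Z om kap d F F1 a -> nrm Z om kap d G G1 b ->
  nrm Z om kap d (fun z => F z + G z)%C (fun z => F1 z + G1 z)%C (a + b).
Proof.
  intros [Ha H] [Hb H']. split; [lra|]. intros z lam Hz Hl.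
  destruct (H z lam Hz Hl) as [A1 [A2 A3]]. destruct (H' z lam Hz Hl) as [B1 [B2 B3]].
  split; [eapply Rle_trans; [apply Cmod_triangle|lra]|]. split; [eapply Rle_trans; [apply Cmod_triangle|lra]|].
  intros k Hk Hzk. specialize (A3 k Hk Hzk). specialize (B3 k Hk Hzk).
  replace (F (z + k) + G (z + k) - (F z + G z) - k * (F1 z + G1 z))%C with
    ((F (z + k) - F z - k * F1 z) + (G (z + k) - G z - k * G1 z))%C by ring.
  eapply Rle_trans; [apply Cmod_triangle|lra].
Qed.

Lemma nrm_opp Z om kap d F F1 a : nrm Z om kap d F F1 a -> nrm Z om kap d (fun z => - F z)%C (fun z => - F1 z)%C a.
Proof.
  intros [Ha H]. split; [lra|]. intros z lam Hz Hl. destruct (H z lam Hz Hl) as [A1 [A2 A3]].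
  rewrite !Cmod_opp. split; [exact A1|]. split; [exact A2|]. intros k Hk Hzk.
  replace (- F (z + k) - - F z - k * - F1 z)%C with (- (F (z + k) - F z - k * F1 z))%C by ring.
  rewrite Cmod_opp. now apply A3.
Qed.

Fixpoint rsum (f : nat -> R) (n : nat) : R := match n with O => 0 | S k => rsum f k + f k end.

Lemma nrm_csum Z om kap d (F F1 : nat -> C -> C) a n :
  (forall i, (i < n)%nat -> nrm Z om kap d (F i) (F1 i) (a i)) ->
  nrm Z om kap d (fun z => csum (fun i => F i z) n) (fun z => csum (fun i => F1 i z) n) (rsum a n).
Proof.
  induction n as [|n IH]; intros H; simpl; [apply nrm_zero|].
  apply nrm_plus; [apply IH; intros; apply H; lia|apply H; lia].
Qed.

(** The second order remainder of a product expands into six terms, each at most [a b lam |k|^2]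
    because [lam] and [|k|] are at most 1; hence the factor 6. *)
Lemma nrm_mult Z om kap d F F1 G G1 a b : ray_env Z om kap d -> nrm Z om kap d F F1 a -> nrm Z om kap d G G1 b ->
  nrm Z om kap d (fun z => F z * G z)%C (fun z => F1 z * G z + F z * G1 z)%C (6 * (a * b)).
Proof.
  intros He [Ha H] [Hb H']. assert (Hab : 0 <= a * b) by nra. split; [lra|]. intros z lam Hz Hl.
  destruct (H z lam Hz Hl) as [A1 [A2 A3]]. destruct (H' z lam Hz Hl) as [B1 [B2 B3]].
  destruct Hl as [Hlam _].
  assert (P : forall x y u v, 0 <= x -> 0 <= y -> x <= a * lam * u -> y <= b * lam * v -> 0 <= u -> 0 <= v ->
    x * y <= a * b * lam * (u * v)).
  { intros x y u v Hx Hy Hxu Hyv Hu Hv. apply Rle_trans with ((a * lam * u) * (b * lam * v)); [now apply Rmult_le_compat|].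
    replace (a * lam * u * (b * lam * v)) with (a * b * lam * (u * v) * lam) by ring.
    rewrite <- (Rmult_1_r (a * b * lam * (u * v))) at 2. apply Rmult_le_compat_l; [|lra].
    repeat apply Rmult_le_pos; lra. }
  assert (Ge := Cmod_ge_0). rewrite <- (Rmult_1_r (a * lam)) in A1, A2. rewrite <- (Rmult_1_r (b * lam)) in B1, B2.
  assert (U : 0 <= a * b * lam) by (apply Rmult_le_pos; lra).
  assert (P00 := P _ _ _ _ (Ge _) (Ge _) A1 B1 Rle_0_1 Rle_0_1). assert (P01 := P _ _ _ _ (Ge _) (Ge _) A1 B2 Rle_0_1 Rle_0_1).
  assert (P10 := P _ _ _ _ (Ge _) (Ge _) A2 B1 Rle_0_1 Rle_0_1). assert (P11 := P _ _ _ _ (Ge _) (Ge _) A2 B2 Rle_0_1 Rle_0_1).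
  split; [rewrite Cmod_mult; lra|]. split.
  { eapply Rle_trans; [apply Cmod_triangle|]. rewrite !Cmod_mult. lra. }
  intros k Hk Hzk. specialize (A3 k Hk Hzk). specialize (B3 k Hk Hzk).
  set (r := (F (z + k) - F z - k * F1 z)%C) in *. set (s := (G (z + k) - G z - k * G1 z)%C) in *.
  replace (F (z + k) * G (z + k) - F z * G z - k * (F1 z * G z + F z * G1 z))%C with
    (k * k * (F1 z * G1 z) + r * G z + F z * s + k * (r * G1 z) + k * (F1 z * s) + r * s)%C by (unfold r, s; ring).
  assert (Kp := Cmod_ge_0 k). set (q := Cmod k) in *. assert (Hq : q <= 1) by (assert (X := en_kap _ _ _ _ He); lra).
  assert (Hqq : 0 <= q * q) by nra.
  assert (Pr0 := P _ _ _ _ (Ge _) (Ge _) A3 B1 Hqq Rle_0_1). assert (Pr1 := P _ _ _ _ (Ge _) (Ge _) A3 B2 Hqq Rle_0_1).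
  assert (P0s := P _ _ _ _ (Ge _) (Ge _) A1 B3 Rle_0_1 Hqq). assert (P1s := P _ _ _ _ (Ge _) (Ge _) A2 B3 Rle_0_1 Hqq).
  assert (Prs := P _ _ _ _ (Ge _) (Ge _) A3 B3 Hqq Hqq).
  set (V := a * b * lam * (q * q)). assert (HV : 0 <= V) by (apply Rmult_le_pos; lra).
  assert (T1 := Cmod_triangle (k * k * (F1 z * G1 z) + r * G z + F z * s + k * (r * G1 z) + k * (F1 z * s)) (r * s)).
  assert (T2 := Cmod_triangle (k * k * (F1 z * G1 z) + r * G z + F z * s + k * (r * G1 z)) (k * (F1 z * s))).
  assert (T3 := Cmod_triangle (k * k * (F1 z * G1 z) + r * G z + F z * s) (k * (r * G1 z))).
  assert (T4 := Cmod_triangle (k * k * (F1 z * G1 z) + r * G z) (F z * s)).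
  assert (T5 := Cmod_triangle (k * k * (F1 z * G1 z)) (r * G z)).
  rewrite Cmod_mult in T1. rewrite (Cmod_mult k), (Cmod_mult (F1 z)) in T2. rewrite (Cmod_mult k), (Cmod_mult r) in T3.
  rewrite (Cmod_mult (F z)) in T4. rewrite (Cmod_mult (k * k)), (Cmod_mult k), (Cmod_mult (F1 z)), (Cmod_mult r) in T5. fold q in T2, T3, T5.
  assert (W1 : q * q * (Cmod (F1 z) * Cmod (G1 z)) <= V).
  { unfold V. rewrite (Rmult_comm (a * b * lam)). apply Rmult_le_compat_l; lra. }
  assert (Wq : forall x, 0 <= x -> x <= V -> q * x <= V) by (intros x H0 H1; nra).
  assert (W2 : q * (Cmod r * Cmod (G1 z)) <= V) by (apply Wq; [apply Rmult_le_pos; apply Ge|unfold V; lra]).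
  assert (W3 : q * (Cmod (F1 z) * Cmod s) <= V) by (apply Wq; [apply Rmult_le_pos; apply Ge|unfold V; lra]).
  assert (W4 : Cmod r * Cmod s <= V).
  { eapply Rle_trans; [exact Prs|]. unfold V. apply Rmult_le_compat_l; [exact U|]. assert (q * q <= 1) by nra. nra. }
  replace (6 * (a * b) * lam * (q * q)) with (6 * V) by (unfold V; ring). unfold V in *. lra.
Qed.

(** [F1] is Lipschitz: compare the Taylor expansions at both ends. *)
Lemma nrm_cont Z om kap d F F1 a z : ray_env Z om kap d -> nrm Z om kap d F F1 a -> Z z -> cder F z (F1 z) /\ ccont F1 z.
Proof.
  intros He [Ha H] Hz. assert (B := en_kap _ _ _ _ He).
  destruct (en_open _ _ _ _ He z Hz) as [r [Hr Ho]].
  destruct (H z 1 Hz (ray_bd_1 _ _ _ _ _ He)) as [_ [_ A3]]. rewrite Rmult_1_r in A3.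
  assert (Hd : forall e, 0 < e -> exists t, 0 < t /\ t <= r /\ t <= kap /\ 2 * a * t < e).
  { intros e Hee. exists (Rmin (Rmin r kap) (e / (2 * a + 1))).
    assert (Q1 := Rmin_l (Rmin r kap) (e / (2 * a + 1))). assert (Q2 := Rmin_r (Rmin r kap) (e / (2 * a + 1))).
    assert (Q3 := Rmin_l r kap). assert (Q4 := Rmin_r r kap).
    assert (P : 0 < e / (2 * a + 1)) by (apply Rdiv_lt_0_compat; lra).
    split; [repeat apply Rmin_pos; lra|]. split; [lra|]. split; [lra|].
    apply Rle_lt_trans with (2 * a * (e / (2 * a + 1))); [apply Rmult_le_compat_l; lra|].
    apply Rlt_le_trans with ((2 * a + 1) * (e / (2 * a + 1))); [nra|right; field; lra]. }
  split.
  - intros e Hee. destruct (Hd e Hee) as [t [Ht [Ht1 [Ht2 Ht3]]]]. exists t. split; [exact Ht|]. intros y Hy.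
    set (k := (y - z)%C) in *. replace y with (z + k)%C by (unfold k; ring).
    replace (F1 z * k)%C with (k * F1 z)%C by ring.
    eapply Rle_trans; [apply A3; [lra|apply Ho; lra]|]. rewrite <- Rmult_assoc.
    assert (K := Cmod_ge_0 k). apply Rmult_le_compat_r; [exact K|]. nra.
  - intros e Hee. destruct (Hd e Hee) as [t [Ht [Ht1 [Ht2 Ht3]]]]. exists t. split; [exact Ht|]. intros y Hy.
    set (k := (y - z)%C) in *. assert (Ey : y = (z + k)%C) by (unfold k; ring). rewrite Ey.
    assert (Zy : Z (z + k)%C) by (apply Ho; lra).
    destruct (Ceq_dec k 0) as [E0|N].
    { rewrite E0, Cplus_0_r. replace (F1 z - F1 z)%C with (RtoC 0) by ring. now rewrite Cmod_0. }
    apply Cmod_gt_0 in N.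
    destruct (H _ 1 Zy (ray_bd_1 _ _ _ _ _ He)) as [_ [_ B3]]. rewrite Rmult_1_r in B3.
    specialize (B3 (- k)%C). rewrite Cmod_opp in B3. replace (z + k + - k)%C with z in B3 by ring.
    specialize (B3 ltac:(lra) Hz). specialize (A3 k ltac:(lra) Zy).
    assert (X : Cmod (k * (F1 (z + k) - F1 z))%C <= 2 * a * (Cmod k * Cmod k)).
    { replace (k * (F1 (z + k) - F1 z))%C with ((F (z + k) - F z - k * F1 z) + (F z - F (z + k) - - k * F1 (z + k)))%C by ring.
      eapply Rle_trans; [apply Cmod_triangle|]. lra. }
    rewrite Cmod_mult in X. apply Rle_lt_trans with (2 * a * Cmod k); [|nra].
    apply Rmult_le_reg_l with (Cmod k); [exact N|]. lra.
Qed.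

Lemma ray_rcont (g : C -> C) z d u : ccont g (z + RtoC (d * u))%C -> rcont (fun u => g (z + RtoC (d * u))%C) u.
Proof.
  intros H. apply (cont_comp RtoC (fun u => z + RtoC (d * u))%C g); [|exact H].
  apply (cont_plus RtoC (fun _ => z) (fun u => RtoC (d * u))); [apply cont_const|].
  apply (cont_ext RtoC (fun u => RtoC d * RtoC u)%C _ u 1); [lra|intros; now rewrite RtoC_mult|].
  apply cont_mult; [apply cont_const|]. exact (deriv_cont _ _ _ _ (deriv_self RtoC u)).
Qed.

Lemma exp_rcont h u : rcont (fun u => RtoC (exp (-2 * u / h))) u.
Proof.
  assert (D : is_derive (fun u => exp (-2 * u / h)) u (-2 / h * exp (-2 * u / h))).
  { auto_derive; [easy|]. unfold Rdiv. ring. }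
  exact (deriv_cont _ _ _ _ (rder_of_real _ _ _ D)).
Qed.

(** The integrand of [K] transported to the half-line, see [half_int_gen]. *)
Definition expo (d h : R) (F : C -> C) (z : C) (u : R) : C :=
  (RtoC (- d) * (RtoC (exp (-2 * u / h)) * F (z + RtoC (d * u))))%C.

Lemma Cmod_dir d x : d * d = 1 -> Cmod (RtoC (- d) * x)%C = Cmod x.
Proof.
  intros H. rewrite Cmod_mult, Cmod_R, Rabs_Ropp. replace (Rabs d) with 1; [ring|].
  destruct (Rle_dec 0 d); [rewrite Rabs_pos_eq by lra|rewrite Rabs_left by lra]; nra.
Qed.

Lemma expo_bound d h F z a u : d * d = 1 -> Cmod (F (z + RtoC (d * u))%C) <= a -> Cmod (expo d h F z u) <= a * exp (-2 * u / h).
Proof.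
  intros Hd Ha. unfold expo. rewrite Cmod_dir, Cmod_mult, Cmod_R by exact Hd. assert (E := exp_pos (-2 * u / h)).
  rewrite Rabs_pos_eq, Rmult_comm by lra. apply Rmult_le_compat_r; lra.
Qed.

Lemma expo_rcont d h F z u : ccont F (z + RtoC (d * u))%C -> rcont (expo d h F z) u.
Proof.
  intros H. unfold expo. apply (cont_mult RtoC (fun _ => RtoC (- d))); [apply cont_const|].
  apply cont_mult; [apply exp_rcont|now apply ray_rcont].
Qed.

(** A bound [lam] of the weight on the ray from [z] is one on the ray from each later point, so
    value, derivative and remainder of [F] are at most [a lam] times the appropriate power of [|k|]
    along the whole ray. Integrating [exp (-2 u / h)] yields the factor [h / 2] for all three. *)
Lemma nrm_L Z om kap d F F1 a h : ray_env Z om kap d -> nrm Z om kap d F F1 a -> 0 < h ->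
  nrm Z om kap d (fun z => hint (expo d h F z)) (fun z => hint (expo d h F1 z)) (a * (h / 2)) /\
  forall z, Z z -> half_int (expo d h F z) (hint (expo d h F z)).
Proof.
  intros He Hn Hh. assert (Hn' := Hn). destruct Hn' as [Ha H]. assert (Hd := en_d _ _ _ _ He).
  assert (Hb : forall z lam u, Z z -> ray_bd om d z lam -> 0 <= u ->
     Cmod (F (z + RtoC (d * u))%C) <= a * lam /\ Cmod (F1 (z + RtoC (d * u))%C) <= a * lam).
  { intros z lam u Hz Hl Hu. destruct (H _ lam (en_ray _ _ _ _ He z u Hz Hu) (ray_bd_shift _ _ _ _ _ Hl Hu)) as [A1 [A2 _]]. now split. }
  assert (Hex : forall z, Z z -> half_int (expo d h F z) (hint (expo d h F z)) /\ half_int (expo d h F1 z) (hint (expo d h F1 z))).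
  { intros z Hz. assert (B1 := ray_bd_1 _ _ _ _ z He).
    assert (T := tail_exp (a * 1) h ltac:(lra) Hh).
    split; unfold hint; apply epsilon_spec; apply (half_int_exists _ _ _ T).
    - intros u Hu. apply expo_rcont. apply (deriv_cont _ _ _ _ (proj1 (nrm_cont _ _ _ _ _ _ _ _ He Hn (en_ray _ _ _ _ He z u Hz Hu)))).
    - intros u Hu. apply expo_bound; [exact Hd|]. now apply Hb.
    - intros u Hu. apply expo_rcont. apply (nrm_cont _ _ _ _ _ _ _ _ He Hn (en_ray _ _ _ _ He z u Hz Hu)).
    - intros u Hu. apply expo_bound; [exact Hd|]. now apply Hb. }
  split; [|intros z Hz; exact (proj1 (Hex z Hz))].
  split; [apply Rmult_le_pos; lra|]. intros z lam Hz Hl. assert (Hlam := proj1 Hl).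
  assert (T0 : forall l x, 0 <= x -> l <= x * (h / 2) * exp (-2 * 0 / h) -> l <= x * (h / 2)).
  { intros l x _. replace (-2 * 0 / h) with 0 by (field; lra). rewrite exp_0. lra. }
  assert (Hal : 0 <= a * lam) by nra.
  assert (T := tail_exp (a * lam) h Hal Hh).
  replace (a * (h / 2) * lam) with (a * lam * (h / 2)) by ring.
  destruct (Hex z Hz) as [X1 X2].
  split; [|split].
  - apply T0; [exact Hal|]. apply (half_int_bound _ _ _ _ T (fun u Hu => expo_bound _ _ _ _ _ _ Hd (proj1 (Hb z lam u Hz Hl Hu))) X1).
  - apply T0; [exact Hal|]. apply (half_int_bound _ _ _ _ T (fun u Hu => expo_bound _ _ _ _ _ _ Hd (proj2 (Hb z lam u Hz Hl Hu))) X2).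
  - intros k Hk Hzk. destruct (Hex _ Hzk) as [Y1 _].
    set (q := Cmod k * Cmod k). assert (Hq : 0 <= q) by (apply Rmult_le_pos; apply Cmod_ge_0).
    replace (a * lam * (h / 2) * q) with (a * lam * q * (h / 2)) by ring. apply T0; [now apply Rmult_le_pos|].
    assert (Tq := tail_exp (a * lam * q) h ltac:(now apply Rmult_le_pos) Hh).
    apply (half_int_bound (fun u => (expo d h F (z + k)%C u - expo d h F z u - k * expo d h F1 z u)%C) _ _ _ Tq).
    + intros u Hu. replace (expo d h F (z + k)%C u - expo d h F z u - k * expo d h F1 z u)%C with
        (expo d h (fun w => F (w + k) - F w - k * F1 w)%C z u).
      * apply expo_bound; [exact Hd|].
        apply (H _ lam (en_ray _ _ _ _ He z u Hz Hu) (ray_bd_shift _ _ _ _ _ Hl Hu)); [exact Hk|].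
        replace (z + RtoC (d * u) + k)%C with (z + k + RtoC (d * u))%C by ring. now apply (en_ray _ _ _ _ He).
      * unfold expo. replace (z + RtoC (d * u) + k)%C with (z + k + RtoC (d * u))%C by ring. ring.
    + apply half_int_minus; [apply half_int_minus; assumption|]. now apply half_int_scal.
Qed.

(** * The recursion *)

Lemma rsum_shift f n : rsum f (Datatypes.S n) = f O + rsum (fun i => f (Datatypes.S i)) n.
Proof. induction n as [|n IH]; simpl in *; [ring|]. rewrite IH. ring. Qed.

Lemma rsum_ext f g n : (forall i, (i < n)%nat -> f i = g i) -> rsum f n = rsum g n.
Proof. induction n as [|n IH]; intros H; simpl; [easy|]. rewrite IH, H; auto. Qed.

Lemma rsum_le f g n : (forall i, (i < n)%nat -> f i <= g i) -> rsum f n <= rsum g n.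
Proof.
  induction n as [|n IH]; intros H; simpl; [lra|].
  apply Rplus_le_compat; [apply IH; intros; apply H; lia|apply H; lia].
Qed.

Lemma rsum_lin f g a n : rsum (fun i => a * (f i + g i)) n = a * (rsum f n + rsum g n).
Proof. induction n as [|n IH]; simpl; [ring|]. rewrite IH. ring. Qed.

Lemma rsum_rev n : forall f, rsum (fun i => f (n - Datatypes.S i)%nat) n = rsum f n.
Proof.
  induction n as [|n IH]; intros f; [easy|]. rewrite rsum_shift.
  transitivity (f n + rsum f n); [|simpl; ring]. f_equal; [f_equal; lia|]. rewrite <- (IH f).
  apply rsum_ext. intros i _. f_equal; lia.
Qed.

Definition isq (n : nat) : R := / (INR n * INR n).

Lemma isq_sum n : rsum (fun i => isq (Datatypes.S i)) n <= 2.
Proof.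
  destruct n as [|n]; [simpl; lra|].
  (* The bound is strengthened to [2 - 1 / n] so that it telescopes with
     [1 / (x + 1)^2 <= 1 / x - 1 / (x + 1)]. *)
  assert (H : rsum (fun i => isq (Datatypes.S i)) (Datatypes.S n) <= 2 - / INR (Datatypes.S n)).
  { induction n as [|n IH]; [unfold isq; simpl; lra|]. set (m := Datatypes.S n) in *.
    change (rsum (fun i => isq (Datatypes.S i)) (Datatypes.S m)) with (rsum (fun i => isq (Datatypes.S i)) m + isq (Datatypes.S m)).
    assert (Hm : 0 < INR m) by (apply lt_0_INR; unfold m; lia). unfold isq at 2. rewrite S_INR. set (x := INR m) in *.
    assert (E : / ((x + 1) * (x + 1)) <= / x - / (x + 1)).
    { replace (/ x - / (x + 1)) with (/ (x * (x + 1))) by (field; lra). apply Rinv_le_contravar; nra. }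
    lra. }
  assert (P : 0 < / INR (Datatypes.S n)) by (apply Rinv_0_lt_compat, lt_0_INR; lia). lra.
Qed.

(** Majorant of the [n]-th iterate, up to a factor: stable under convolution. *)
Definition cf (n : nat) : R := (/ 2) ^ n * isq n.

Lemma cf_bounds n : (1 <= n)%nat -> 0 < cf n <= (/ 2) ^ n.
Proof.
  intros Hn. assert (P : 0 < (/ 2) ^ n) by (apply pow_lt; lra). assert (Q := le_INR 1 n Hn). simpl in Q.
  unfold cf, isq. assert (X : 1 <= INR n * INR n) by nra.
  assert (Y : 0 < / (INR n * INR n)) by (apply Rinv_0_lt_compat; lra).
  assert (W : / (INR n * INR n) <= 1) by (rewrite <- Rinv_1; apply Rinv_le_contravar; lra). nra.
Qed.

(** With denominators cleared this is [(i + j)^2 <= 2 (i^2 + j^2)]. *)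
Lemma isq_mult i j : (1 <= i)%nat -> (1 <= j)%nat -> isq i * isq j <= 2 * isq (i + j) * (isq i + isq j).
Proof.
  intros Hi Hj. apply le_INR in Hi, Hj. simpl in Hi, Hj. unfold isq. rewrite plus_INR.
  set (x := INR i) in *. set (y := INR j) in *.
  apply Rmult_le_reg_r with (x * x * (y * y) * ((x + y) * (x + y))); [repeat apply Rmult_lt_0_compat; lra|].
  replace (/ (x * x) * / (y * y) * (x * x * (y * y) * ((x + y) * (x + y)))) with ((x + y) * (x + y)) by (field; lra).
  replace (2 * / ((x + y) * (x + y)) * (/ (x * x) + / (y * y)) * (x * x * (y * y) * ((x + y) * (x + y)))) with (2 * (x * x + y * y)) by (field; lra).
  assert (A := Rle_0_sqr (x - y)). unfold Rsqr in A. lra.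
Qed.

(** The powers of 1/2 multiply exactly. [isq_mult] contributes a factor 2 and leaves two sums of
    inverse squares, one of them reversed, each at most 2: [2 (2 + 2) = 8]. *)
Lemma cf_conv p : rsum (fun i => cf (Datatypes.S i) * cf (Datatypes.S (Datatypes.S p) - Datatypes.S i)) (Datatypes.S p) <= 8 * cf (Datatypes.S (Datatypes.S p)).
Proof.
  set (n := Datatypes.S (Datatypes.S p)). set (N := Datatypes.S p).
  apply Rle_trans with (rsum (fun i => (2 * cf n) * (isq (Datatypes.S i) + isq (Datatypes.S (N - Datatypes.S i)))) N).
  - apply rsum_le. intros i Hi. replace (n - Datatypes.S i)%nat with (Datatypes.S (N - Datatypes.S i)) by (unfold n, N in *; lia).
    set (j := Datatypes.S (N - Datatypes.S i)). assert (X := isq_mult (Datatypes.S i) j ltac:(lia) ltac:(unfold j; lia)).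
    replace (Datatypes.S i + j)%nat with n in X by (unfold n, j, N in *; lia).
    assert (Ep : (/ 2) ^ n = (/ 2) ^ Datatypes.S i * (/ 2) ^ j) by (rewrite <- pow_add; f_equal; unfold n, j, N in *; lia).
    unfold cf. rewrite Ep. assert (P1 : 0 < (/ 2) ^ Datatypes.S i) by (apply pow_lt; lra). assert (P2 : 0 < (/ 2) ^ j) by (apply pow_lt; lra).
    set (u := (/ 2) ^ Datatypes.S i) in *. set (v := (/ 2) ^ j) in *.
    replace (u * isq (Datatypes.S i) * (v * isq j)) with (u * v * (isq (Datatypes.S i) * isq j)) by ring.
    replace (2 * (u * v * isq n) * (isq (Datatypes.S i) + isq j)) with (u * v * (2 * isq n * (isq (Datatypes.S i) + isq j))) by ring.
    apply Rmult_le_compat_l; [nra|exact X].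
  - rewrite rsum_lin. rewrite (rsum_rev N (fun j => isq (Datatypes.S j))).
    assert (A := isq_sum N). assert (B := cf_bounds n ltac:(unfold n; lia)). nra.
Qed.

Lemma Wupto_Wn c m sq D fwd n : forall k, (1 <= k <= n)%nat -> Wupto c m sq D fwd n k = Wn c m sq D fwd k.
Proof.
  induction n as [|n IH]; intros k Hk; [lia|]. destruct (Nat.eq_dec k (Datatypes.S n)) as [->|N]; [reflexivity|].
  simpl. destruct (Nat.leb_spec k n); [apply IH; lia|lia].
Qed.

Lemma Wn_1 c m sq D fwd : Wn c m sq D fwd 1 = Kop c m sq D fwd (fun x _ => Cfun c m x).
Proof. reflexivity. Qed.

Lemma Wn_S c m sq D fwd p x h : Wn c m sq D fwd (Datatypes.S (Datatypes.S p)) x h =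
  Copp (csum (fun i => Kop c m sq D fwd (fmul (Wn c m sq D fwd (Datatypes.S i)) (Wn c m sq D fwd (Datatypes.S (Datatypes.S p) - Datatypes.S i))) x h) (Datatypes.S p)).
Proof.
  unfold Wn at 1. set (N := Datatypes.S p). change (Wupto c m sq D fwd (Datatypes.S N) (Datatypes.S N)) with
    (if Nat.leb (Datatypes.S N) N then Wupto c m sq D fwd N (Datatypes.S N) else Wnext c m sq D fwd (Datatypes.S N) (Wupto c m sq D fwd N)).
  destruct (Nat.leb_spec (Datatypes.S N) N); [lia|].
  change (Wnext c m sq D fwd (Datatypes.S N) (Wupto c m sq D fwd N) x h) with
   (Copp (csum (fun i => Kop c m sq D fwd (fmul (Wupto c m sq D fwd N (Datatypes.S i)) (Wupto c m sq D fwd N (Datatypes.S N - Datatypes.S i)%nat)) x h) (Datatypes.S N - 1))).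
  replace (Datatypes.S N - 1)%nat with N by lia. f_equal. apply csum_ext. intros i Hi.
  rewrite !Wupto_Wn by lia. reflexivity.
Qed.

(** Any solution of the flow equation inside [D] satisfies [S (y t) = z + t], hence is
    [psi (z + t)]. So the choice made in the definition of [phi] is determined on the relevant
    half-line. *)
Lemma strip_flow c m D S sq psi Z fwd z : strip c m D S sq psi Z fwd -> Z z ->
  (exists y, flowP sq D fwd (psi z) y) /\
  forall y u, flowP sq D fwd (psi z) y -> 0 <= u -> y (dirn fwd * u) = psi (z + RtoC (dirn fwd * u))%C.
Proof.
  intros HS Hz. assert (Hray : forall u, 0 <= u -> Z (z + RtoC (dirn fwd * u))%C) by (intros u Hu; now apply (sp_ray _ _ _ _ _ _ _ _ HS)).
  assert (Hside : forall t, (if fwd then 0 <= t else t <= 0) -> exists u, 0 <= u /\ t = dirn fwd * u).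
  { intros t Ht. exists (dirn fwd * t). rewrite <- Rmult_assoc, dirn_sqr, Rmult_1_l. split; [|easy]. destruct fwd; simpl; lra. }
  split.
  - exists (fun t => psi (z + RtoC t)%C). split; [now rewrite Cplus_0_r|]. intros t Ht.
    destruct (Hside t Ht) as [u [Hu ->]]. destruct (sp_psi _ _ _ _ _ _ _ _ HS _ (Hray u Hu)) as [A1 [_ A3]].
    split; [exact A1|]. apply rderiv_is_rder. set (t := dirn fwd * u) in *.
    apply (deriv_eq _ _ _ (/ sq (psi (z + RtoC t)) * (0 + 1))%C); [|ring].
    apply (deriv_comp RtoC (fun t => z + RtoC t)%C psi); [|exact A3]. apply deriv_plus; [apply deriv_const|apply deriv_self].
  - intros y u [Hy0 Hy] Hu.
    assert (HyD : forall v, 0 <= v -> D (y (dirn fwd * v)) /\ rder y (dirn fwd * v) (/ sq (y (dirn fwd * v)%R))%C).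
    { intros v Hv. destruct (Hy (dirn fwd * v)) as [B1 B2]; [destruct fwd; simpl; lra|]. split; [exact B1|]. now apply rderiv_is_rder. }
    assert (Hc : Cmod ((S (y (dirn fwd * u)%R) - RtoC (dirn fwd * u)) - (S (y (dirn fwd * 0)%R) - RtoC (dirn fwd * 0)))%C <= 0 * (u - 0)).
    { apply (MVT_rder (fun v => S (y (dirn fwd * v)%R) - RtoC (dirn fwd * v))%C (fun _ => RtoC 0) 0 u 0 Hu).
      - intros v Hv. destruct (HyD v ltac:(lra)) as [B1 B2]. destruct (sp_sq _ _ _ _ _ _ _ _ HS _ B1) as [_ N].
        set (x := y (dirn fwd * v)) in *.
        assert (Dl : rder (fun v => RtoC (dirn fwd * v)) v (RtoC (dirn fwd))).
        { apply (deriv_ext RtoC (fun v => RtoC (dirn fwd) * RtoC v)%C _ _ _ 1); [lra|intros; now rewrite RtoC_mult|].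
          eapply deriv_eq; [apply deriv_scal, deriv_self|ring]. }
        assert (Dy : rder (fun v => y (dirn fwd * v)%R) v (/ sq x * RtoC (dirn fwd))%C).
        { intros e He. destruct (B2 e He) as [d [Hd K]]. exists d. split; [exact Hd|]. intros w Hw.
          assert (Ed : RtoC (dirn fwd * w) = (RtoC (dirn fwd) * RtoC w)%C) by apply RtoC_mult.
          assert (Ev : RtoC (dirn fwd * v) = (RtoC (dirn fwd) * RtoC v)%C) by apply RtoC_mult.
          assert (Em : Cmod (RtoC (dirn fwd * w) - RtoC (dirn fwd * v))%C = Cmod (RtoC w - RtoC v)%C).
          { rewrite Ed, Ev, <- (Cmod_dir (- dirn fwd) (RtoC w - RtoC v)) by (rewrite <- (dirn_sqr fwd); ring).
            rewrite Ropp_involutive. f_equal. ring. }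
          specialize (K (dirn fwd * w)). rewrite Em in K. specialize (K Hw).
          rewrite Ed, Ev in K. replace (/ sq x * RtoC (dirn fwd) * (RtoC w - RtoC v))%C with (/ sq x * (RtoC (dirn fwd) * RtoC w - RtoC (dirn fwd) * RtoC v))%C by ring.
          exact K. }
        apply (deriv_eq _ _ _ (sq x * (/ sq x * RtoC (dirn fwd)) - RtoC (dirn fwd))%C); [|field; exact N].
        apply deriv_minus; [|exact Dl]. apply (deriv_comp RtoC (fun v => y (dirn fwd * v)%R) S); [exact Dy|].
        now apply (sp_S _ _ _ _ _ _ _ _ HS).
      - intros v _. rewrite Cmod_0. lra. }
    rewrite Rmult_0_l, Rmult_0_r, Hy0 in Hc.
    destruct (HyD u Hu) as [B1 _]. rewrite <- (sp_inv _ _ _ _ _ _ _ _ HS _ B1). f_equal.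
    rewrite (proj1 (proj2 (sp_psi _ _ _ _ _ _ _ _ HS z Hz))) in Hc.
    assert (X : (S (y (dirn fwd * u)%R) - RtoC (dirn fwd * u) - (z - 0))%C = RtoC 0).
    { apply Cmod_eq_0. apply Rle_antisym; [exact Hc|apply Cmod_ge_0]. }
    replace (S (y (dirn fwd * u)%R)) with ((S (y (dirn fwd * u)%R) - RtoC (dirn fwd * u) - (z - 0)) + (z + RtoC (dirn fwd * u)))%C by ring.
    rewrite X. ring.
Qed.

Lemma strip_phi c m D S sq psi Z fwd z u : strip c m D S sq psi Z fwd -> Z z -> 0 <= u ->
  phi sq D fwd (dirn fwd * u) (psi z) = psi (z + RtoC (dirn fwd * u))%C.
Proof.
  intros HS Hz Hu. destruct (strip_flow _ _ _ _ _ _ _ _ _ HS Hz) as [Hex Hu'].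
  unfold phi. apply Hu'; [|exact Hu]. now apply epsilon_spec.
Qed.

Lemma gen_value fwd g l : half_int (fun u => RtoC (- dirn fwd) * g (dirn fwd * u)%R)%C l ->
  @ex_RInt_gen C_R_NormedModule g (Klow fwd) (at_point 0) /\
  @RInt_gen C_R_CompleteNormedModule g (Klow fwd) (at_point 0) = l.
Proof.
  intros H. apply half_int_gen in H. split; [now exists l|].
  destruct fwd; now apply (is_RInt_gen_unique (V := C_R_CompleteNormedModule)).
Qed.

(** In the strip, [K f / sqrt Q] is the integral of [f / Q] against the exponential along the ray.
    This is why the recursion is run for [W_n / sqrt Q]: the product of two such terms is exactly
    the [f / Q] of the next step. *)
Lemma strip_Kop c m D S sq psi Z fwd z h (f : C -> R -> C) l : strip c m D S sq psi Z fwd -> Z z ->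
  half_int (expo (dirn fwd) h (fun w => f (psi w) h / peval c m (psi w))%C z) l ->
  Kconv c m sq D fwd f (psi z) h /\ Kop c m sq D fwd f (psi z) h = (sq (psi z) * l)%C.
Proof.
  intros HS Hz H.
  assert (X : half_int (fun u => RtoC (- dirn fwd) * Kintegrand c m sq D fwd f (psi z) h (dirn fwd * u)%R)%C l).
  { revert H. apply half_int_ext. intros u Hu. unfold expo, Kintegrand. rewrite (strip_phi _ _ _ _ _ _ _ _ _ _ HS Hz Hu).
    replace ((if fwd then -2 else 2) * (dirn fwd * u) / h) with (-2 * u / h); [reflexivity|].
    destruct fwd; simpl; unfold Rdiv; ring. }
  destruct (gen_value _ _ _ X) as [E1 E2]. split; [exact E1|]. unfold Kop. now rewrite E2.
Qed.

(** * Convergence of the series *)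

Definition clim (f : nat -> C) (l : C) : Prop := forall e, 0 < e -> exists N, forall n, (N <= n)%nat -> Cmod (f n - l)%C < e.

Lemma clim_unique f l l' : clim f l -> clim f l' -> l = l'.
Proof.
  intros H H'. apply Cmod_small_eq. intros e He. destruct (H (e / 2)) as [N K]; [lra|]. destruct (H' (e / 2)) as [N' K']; [lra|].
  specialize (K (N + N')%nat ltac:(lia)). specialize (K' (N + N')%nat ltac:(lia)).
  assert (T := Cmod_sub_triangle l (f (N + N')%nat) l'). rewrite (Cmod_sub_sym l (f (N + N')%nat)) in T. lra.
Qed.

Lemma clim_minus f g l m : clim f l -> clim g m -> clim (fun n => f n - g n)%C (l - m)%C.
Proof.
  intros H H' e He. destruct (H (e / 2)) as [N K]; [lra|]. destruct (H' (e / 2)) as [N' K']; [lra|].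
  exists (N + N')%nat. intros n Hn. specialize (K n ltac:(lia)). specialize (K' n ltac:(lia)).
  replace (f n - g n - (l - m))%C with ((f n - l) - (g n - m))%C by ring. eapply Rle_lt_trans; [apply Cmod_sub_le|]. lra.
Qed.

Lemma clim_scal f k l : clim f l -> clim (fun n => k * f n)%C (k * l)%C.
Proof.
  intros H e He. assert (A := Cmod_ge_0 k). destruct (H (e / (Cmod k + 1))) as [N K]; [apply Rdiv_lt_0_compat; lra|].
  exists N. intros n Hn. specialize (K n Hn). replace (k * f n - k * l)%C with (k * (f n - l))%C by ring. rewrite Cmod_mult.
  apply Rle_lt_trans with (Cmod k * (e / (Cmod k + 1))); [apply Rmult_le_compat_l; lra|].
  apply Rlt_le_trans with ((Cmod k + 1) * (e / (Cmod k + 1))); [|right; field; lra].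
  apply Rmult_lt_compat_r; [apply Rdiv_lt_0_compat|]; lra.
Qed.

Lemma clim_bound f l K : clim f l -> (forall n, Cmod (f n) <= K) -> Cmod l <= K.
Proof.
  intros H HK. apply Rnot_lt_le. intros L. destruct (H (Cmod l - K)) as [N Hn]; [lra|].
  specialize (Hn N (le_n N)). specialize (HK N). assert (T := Cmod_triangle_inv l (f N)). rewrite (Cmod_sub_sym l (f N)) in T. lra.
Qed.

Lemma geometric_clim a A : 0 <= A -> (forall i, Cmod (a i) <= A * (/ 2) ^ i) -> exists l, clim (csum a) l.
Proof.
  intros HA Ha.
  assert (HC : forall p k, Cmod (csum a (p + k) - csum a k)%C <= 2 * A * ((/ 2) ^ k - (/ 2) ^ (p + k))).
  { induction p as [|p IH]; intros k; simpl.
    - replace (csum a k - csum a k)%C with (RtoC 0) by ring. rewrite Cmod_0. lra.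
    - replace (csum a (p + k) + a (p + k)%nat - csum a k)%C with ((csum a (p + k) - csum a k) + a (p + k)%nat)%C by ring.
      eapply Rle_trans; [apply Cmod_triangle|]. specialize (IH k). specialize (Ha (p + k)%nat). lra. }
  assert (Hp : forall k, 0 < (/ 2) ^ k) by (intros k; apply pow_lt; lra).
  destruct (cluster_point (csum a) (2 * A)) as [l Hl].
  { intros n. specialize (HC n O). rewrite Nat.add_0_r in HC. simpl in HC. replace (csum a n - 0)%C with (csum a n) in HC by ring.
    specialize (Hp n). nra. }
  exists l. intros e He.
  destruct (pow_lt_1_zero (/ 2) ltac:(rewrite Rabs_pos_eq; lra) (e / (4 * A + 1))) as [N HN]; [apply Rdiv_lt_0_compat; lra|].
  exists N. intros n Hn. specialize (HN n Hn). rewrite Rabs_pos_eq in HN by (apply Rlt_le, Hp).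
  destruct (Hl (e / 2) n) as [n' [Hn' X]]; [lra|]. specialize (HC (n' - n)%nat n). replace (n' - n + n)%nat with n' in HC by lia.
  assert (Y : 2 * A * ((/ 2) ^ n - (/ 2) ^ n') < e / 2).
  { apply Rle_lt_trans with (2 * A * (e / (4 * A + 1))); [apply Rmult_le_compat_l; [lra|]; specialize (Hp n'); lra|].
    apply Rmult_lt_reg_r with (4 * A + 1); [lra|]. replace (2 * A * (e / (4 * A + 1)) * (4 * A + 1)) with (2 * A * e) by (field; lra). lra. }
  assert (T := Cmod_sub_triangle (csum a n) (csum a n') l). rewrite (Cmod_sub_sym (csum a n) (csum a n')) in T. lra.
Qed.

Lemma sum_n_csum (a : nat -> C) n : @sum_n C_NormedModule a n = csum a (Datatypes.S n).
Proof.
  induction n as [|n IH].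
  - rewrite sum_O. simpl. symmetry. apply Cplus_0_l.
  - rewrite sum_Sn, IH. reflexivity.
Qed.

Lemma is_series_clim a l : @is_series C_AbsRing C_NormedModule a l <-> clim (csum a) l.
Proof.
  unfold is_series. rewrite (filterlim_locally_ball_norm (K := C_AbsRing) (U := C_NormedModule)). split.
  - intros H e He. destruct (H (mkposreal e He)) as [N HN]. exists (Datatypes.S N). intros n Hn.
    destruct n as [|n]; [lia|]. specialize (HN n ltac:(lia)). rewrite sum_n_csum in HN. exact HN.
  - intros H e. destruct (H e (cond_pos e)) as [N HN]. exists N. intros n Hn. unfold ball_norm. rewrite sum_n_csum.
    apply HN. lia.
Qed.

Lemma nrm_clim (Z : C -> Prop) om kap d (Fn F1n : nat -> C -> C) F F1 a : (forall n, nrm Z om kap d (Fn n) (F1n n) a) ->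
  (forall z, Z z -> clim (fun n => Fn n z) (F z) /\ clim (fun n => F1n n z) (F1 z)) -> nrm Z om kap d F F1 a.
Proof.
  intros H Hl. split; [apply (H O)|]. intros z lam Hz Hlam. destruct (Hl z Hz) as [L1 L2].
  split; [|split].
  - apply (clim_bound _ _ _ L1). intros n. now apply (H n).
  - apply (clim_bound _ _ _ L2). intros n. now apply (H n).
  - intros k Hk Hzk. destruct (Hl _ Hzk) as [L3 _].
    apply (clim_bound _ _ _ (clim_minus _ _ _ _ (clim_minus _ _ _ _ L3 L1) (clim_scal _ k _ L2))).
    intros n. now apply (H n).
Qed.

(** Unlike [deep Z r], always an open set. *)
Definition wide (Z : C -> Prop) (r : R) (z : C) : Prop := exists r', r < r' /\ deep Z r' z.

Lemma wide_deep Z r z : wide Z r z -> deep Z r z.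
Proof. intros [r' [L H]] k Hk. apply H. lra. Qed.

Lemma wide_env c m D S sq psi Z fwd r kap : strip c m D S sq psi Z fwd -> 0 < r -> 0 < kap <= 1 ->
  ray_env (wide Z r) (omega m psi) kap (dirn fwd).
Proof.
  intros HS Hr Hk. split; [| | |exact Hk|apply dirn_sqr].
  - intros z [r' [L H]]. exists ((r' - r) / 2). split; [lra|]. intros k Hkk. exists ((r' + r) / 2). split; [lra|].
    intros j Hj. rewrite <- Cplus_assoc. apply H. eapply Rle_lt_trans; [apply Cmod_triangle|]. lra.
  - intros z u [r' [L H]] Hu. exists r'. split; [exact L|]. now apply (deep_ray _ _ _ _ _ _ _ _ _ _ _ HS H).
  - intros z. assert (A := Cmod_ge_0 (psi z)). unfold omega.
    assert (P : 1 <= (1 + Cmod (psi z)) ^ (m + 2)) by (apply pow_R1_Rle; lra).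
    split; [apply Rlt_le, Rinv_0_lt_compat; lra|]. apply Rle_trans with (/ 1); [apply Rinv_le_contravar; lra|rewrite Rinv_1; lra].
Qed.

Lemma potential_nrm c m D S sq psi Z fwd r : strip c m D S sq psi Z fwd -> 0 < r ->
  exists F1 M kap, 0 < M /\ 0 < kap <= 1 /\
   nrm (wide Z r) (omega m psi) kap (dirn fwd) (fun z => Cfun c m (psi z) / peval c m (psi z))%C F1 M.
Proof.
  intros HS Hr. destruct (potential_bounds _ _ _ _ _ _ _ _ r HS Hr) as [F1 [M [kap [HM [Hk [Hk2 H]]]]]].
  exists F1, M, kap. split; [exact HM|]. split; [exact Hk|]. split; [lra|]. intros z lam Hz [Hl Hom].
  destruct (H z (wide_deep _ _ _ Hz)) as [A1 [A2 A3]].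
  assert (L : M * omega m psi z <= M * lam).
  { apply Rmult_le_compat_l; [lra|]. specialize (Hom 0 (Rle_refl 0)). now rewrite Rmult_0_r, Cplus_0_r in Hom. }
  split; [lra|]. split; [lra|]. intros k Hkk _. eapply Rle_trans; [now apply A3|].
  replace (M * lam * (Cmod k * Cmod k)) with (M * lam * (Cmod k ^ 2)) by ring.
  replace (Cmod k * Cmod k) with (Cmod k ^ 2) by ring.
  apply Rmult_le_compat_r; [apply pow_le, Cmod_ge_0|exact L].
Qed.

Lemma W_nrm c m D S sq psi Z fwd r kap F1 M h : strip c m D S sq psi Z fwd -> 0 < r ->
  ray_env (wide Z r) (omega m psi) kap (dirn fwd) ->
  nrm (wide Z r) (omega m psi) kap (dirn fwd) (fun z => Cfun c m (psi z) / peval c m (psi z))%C F1 M ->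
  0 < h -> 24 * M * (h * h) <= 1 -> forall n, (1 <= n)%nat ->
  (exists G1, nrm (wide Z r) (omega m psi) kap (dirn fwd) (fun z => Wn c m sq D fwd n (psi z) h / sq (psi z))%C G1 (/ (24 * h) * cf n)) /\
  forall z, wide Z r z -> Wn_defined c m sq D fwd n (psi z) h.
Proof.
  intros HS Hr He HC Hh Hsm. set (Bz := wide Z r) in *. set (om := omega m psi) in *. set (d := dirn fwd) in *.
  set (al := / (24 * h)). assert (Hal : 0 < al) by (apply Rinv_0_lt_compat; lra).
  set (G := fun n z => (Wn c m sq D fwd n (psi z) h / sq (psi z))%C).
  assert (HZ : forall z, Bz z -> Z z) by (intros z Hz; exact (deep_center _ _ _ Hr (wide_deep _ _ _ Hz))).
  assert (HN : forall z, Bz z -> sq (psi z) <> RtoC 0) by (intros z Hz; apply (strip_sq_psi _ _ _ _ _ _ _ _ _ HS (HZ z Hz))).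
  induction n as [n IH] using (well_founded_induction lt_wf). intros Hn.
  destruct n as [|[|p]]; [lia| |].
  - destruct (nrm_L _ _ _ _ _ _ _ h He HC Hh) as [L1 L2].
    assert (HK : forall z, Bz z -> Kconv c m sq D fwd (fun x _ => Cfun c m x) (psi z) h /\
       Wn c m sq D fwd 1 (psi z) h = (sq (psi z) * hint (expo d h (fun z => Cfun c m (psi z) / peval c m (psi z))%C z))%C).
    { intros z Hz. rewrite Wn_1. apply (strip_Kop _ _ _ _ _ _ _ _ _ _ _ _ HS (HZ z Hz)). exact (L2 z Hz). }
    split.
    + eexists. apply nrm_le with (M * (h / 2)).
      { unfold cf, isq, al. simpl. replace (/ 2 * 1 * / (1 * 1)) with (/ 2) by field.
        apply Rmult_le_reg_r with (48 * h); [lra|]. replace (/ (24 * h) * / 2 * (48 * h)) with 1 by (field; lra). lra. }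
      refine (nrm_ext _ _ _ _ _ _ _ _ _ L1). intros z Hz. rewrite (proj2 (HK z Hz)). field. now apply HN.
    + intros z Hz. exact (proj1 (HK z Hz)).
  - set (n := Datatypes.S (Datatypes.S p)) in *. set (N := Datatypes.S p) in *.
    (* The derivatives are chosen for all indices at once, with a dummy function outside the range,
       so that finite sums over [i] can be formed from them. *)
    assert (H1 : forall i, exists G1, (1 <= i < n)%nat -> nrm Bz om kap d (G i) G1 (al * cf i)).
    { intros i. destruct (excluded_middle_informative (1 <= i < n)%nat) as [Hi|Hi].
      - destruct (IH i ltac:(lia) ltac:(lia)) as [[G1 X] _]. exists G1. now intros _.
      - exists (fun z => z). now intros. }
    set (G1 := fun i => proj1_sig (constructive_indefinite_description _ (H1 i))).
    assert (HG : forall i, (1 <= i < n)%nat -> nrm Bz om kap d (G i) (G1 i) (al * cf i)).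
    { intros i. unfold G1. apply proj2_sig. }
    set (Pr := fun i z => (G (Datatypes.S i) z * G (n - Datatypes.S i)%nat z)%C).
    assert (HP : forall i, (i < N)%nat -> exists P1, nrm Bz om kap d (Pr i) P1 (6 * (al * cf (Datatypes.S i) * (al * cf (n - Datatypes.S i))))).
    { intros i Hi. eexists. eapply nrm_mult; [exact He|apply HG|apply HG]; unfold n, N in *; lia. }
    assert (HL : forall i, exists L1, (i < N)%nat -> nrm Bz om kap d (fun z => hint (expo d h (Pr i) z)) L1
       (6 * (al * cf (Datatypes.S i) * (al * cf (n - Datatypes.S i))) * (h / 2)) /\
       forall z, Bz z -> half_int (expo d h (Pr i) z) (hint (expo d h (Pr i) z))).
    { intros i. destruct (excluded_middle_informative (i < N)%nat) as [Hi|Hi].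
      - destruct (HP i Hi) as [P1 X]. eexists. intros _. eapply nrm_L; [exact He|exact X|exact Hh].
      - exists (fun z => z). now intros. }
    set (L1 := fun i => proj1_sig (constructive_indefinite_description _ (HL i))).
    assert (HL1 : forall i, (i < N)%nat -> nrm Bz om kap d (fun z => hint (expo d h (Pr i) z)) (L1 i)
       (6 * (al * cf (Datatypes.S i) * (al * cf (n - Datatypes.S i))) * (h / 2)) /\
       forall z, Bz z -> half_int (expo d h (Pr i) z) (hint (expo d h (Pr i) z))).
    { intros i. unfold L1. apply (proj2_sig (constructive_indefinite_description _ (HL i))). }
    assert (HK : forall i z, (i < N)%nat -> Bz z ->
       Kconv c m sq D fwd (fmul (Wn c m sq D fwd (Datatypes.S i)) (Wn c m sq D fwd (n - Datatypes.S i))) (psi z) h /\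
       Kop c m sq D fwd (fmul (Wn c m sq D fwd (Datatypes.S i)) (Wn c m sq D fwd (n - Datatypes.S i))) (psi z) h =
         (sq (psi z) * hint (expo d h (Pr i) z))%C).
    { intros i z Hi Hz. apply (strip_Kop _ _ _ _ _ _ _ _ _ _ _ _ HS (HZ z Hz)).
      apply (half_int_ext (expo d h (Pr i) z)); [|now apply HL1]. intros u Hu. unfold expo. cbv beta.
      set (w := (z + RtoC (d * u))%C). assert (Hw : Bz w) by now apply (en_ray _ _ _ _ He).
      destruct (strip_sq_psi _ _ _ _ _ _ _ _ _ HS (HZ w Hw)) as [E [Nz _]].
      replace (Pr i w) with (fmul (Wn c m sq D fwd (Datatypes.S i)) (Wn c m sq D fwd (n - Datatypes.S i)) (psi w) h / peval c m (psi w))%C; [reflexivity|].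
      unfold Pr, G, fmul. rewrite <- E. field. exact Nz. }
    split.
    + exists (fun z => (- csum (fun i => L1 i z) N)%C).
      apply nrm_le with (rsum (fun i => 6 * (al * cf (Datatypes.S i) * (al * cf (n - Datatypes.S i))) * (h / 2)) N).
      { rewrite (rsum_ext _ (fun i => (3 * h * (al * al)) * (cf (Datatypes.S i) * cf (n - Datatypes.S i) + 0))) by (intros; field).
        rewrite rsum_lin. assert (X := cf_conv p). fold N in X. fold n in X.
        assert (E0 : rsum (fun _ => 0) N = 0) by (clear; induction N as [|k IH]; simpl; [easy|rewrite IH; ring]). rewrite E0.
        replace (al * cf n) with (3 * h * (al * al) * (8 * cf n)).
        - apply Rmult_le_compat_l; [|lra]. apply Rmult_le_pos; [lra|]. nra.
        - unfold al. field. lra. }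
      apply nrm_ext with (fun z => (- csum (fun i => hint (expo d h (Pr i) z)) N)%C).
      * intros z Hz. unfold n, N. rewrite Wn_S. fold N. fold n.
        rewrite (csum_ext (fun i => Kop c m sq D fwd (fmul (Wn c m sq D fwd (Datatypes.S i)) (Wn c m sq D fwd (n - Datatypes.S i))) (psi z) h)
          (fun i => sq (psi z) * hint (expo d h (Pr i) z))%C N) by (intros i Hi; exact (proj2 (HK i z Hi Hz))).
        rewrite csum_scal. field. now apply HN.
      * apply nrm_opp. apply (nrm_csum Bz om kap d (fun i z => hint (expo d h (Pr i) z)) L1). intros i Hi. now apply HL1.
    + intros z Hz i Hi. destruct i as [|i]; [lia|]. apply (HK i z); [unfold N, n in *; lia|exact Hz].
Qed.

Lemma W_sum_nrm c m D S sq psi Z fwd r kap F1 M h : strip c m D S sq psi Z fwd -> 0 < r ->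
  ray_env (wide Z r) (omega m psi) kap (dirn fwd) ->
  nrm (wide Z r) (omega m psi) kap (dirn fwd) (fun z => Cfun c m (psi z) / peval c m (psi z))%C F1 M ->
  0 < h -> 24 * M * (h * h) <= 1 ->
  (exists G1, nrm (wide Z r) (omega m psi) kap (dirn fwd) (fun z => gfun c m sq D fwd (psi z) h) G1 (/ (24 * h))) /\
  forall z, wide Z r z -> exists l, @is_series C_AbsRing C_NormedModule (Wseries c m sq D fwd (psi z) h) l.
Proof.
  intros HS Hr He HC Hh Hsm. assert (HW := W_nrm _ _ _ _ _ _ _ _ _ _ _ _ _ HS Hr He HC Hh Hsm).
  set (Bz := wide Z r) in *. set (om := omega m psi) in *. set (d := dirn fwd) in *.
  set (al := / (24 * h)) in *. assert (Hal : 0 < al) by (apply Rinv_0_lt_compat; lra).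
  set (G := fun n z => (Wn c m sq D fwd (Datatypes.S n) (psi z) h / sq (psi z))%C).
  set (G1 := fun n => proj1_sig (constructive_indefinite_description _ (proj1 (HW (Datatypes.S n) ltac:(lia))))).
  assert (HG : forall n, nrm Bz om kap d (G n) (G1 n) (al * cf (Datatypes.S n))).
  { intros n. unfold G, G1. apply (proj2_sig (constructive_indefinite_description _ (proj1 (HW (Datatypes.S n) ltac:(lia))))). }
  assert (HN : forall z, Bz z -> sq (psi z) <> RtoC 0).
  { intros z Hz. apply (strip_sq_psi _ _ _ _ _ _ _ _ _ HS (deep_center _ _ _ Hr (wide_deep _ _ _ Hz))). }
  assert (Hb : forall i z, Bz z -> Cmod (G i z) <= al * (/ 2) ^ i /\ Cmod (G1 i z) <= al * (/ 2) ^ i).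
  { intros i z Hz. destruct (proj2 (HG i) z 1 Hz (ray_bd_1 _ _ _ _ _ He)) as [A1 [A2 _]].
    assert (B := cf_bounds (Datatypes.S i) ltac:(lia)). simpl in B. assert (P : 0 < (/ 2) ^ i) by (apply pow_lt; lra).
    assert (X : al * cf (Datatypes.S i) * 1 <= al * (/ 2) ^ i) by (rewrite Rmult_1_r; apply Rmult_le_compat_l; lra). lra. }
  (* Convergence is proved for the terms divided by [sq], where the norm gives a geometric majorant,
     and then multiplied back to reach the series of the statement. *)
  assert (Hs : forall z, Bz z -> exists l, clim (csum (Wseries c m sq D fwd (psi z) h)) l /\
     clim (fun n => csum (fun i => G i z) n) (l / sq (psi z))%C).
  { intros z Hz. destruct (geometric_clim (fun i => G i z) al ltac:(lra) (fun i => proj1 (Hb i z Hz))) as [l Hl].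
    exists (sq (psi z) * l)%C. split.
    - intros e Hee. destruct (clim_scal _ (sq (psi z)) _ Hl e Hee) as [N0 K]. exists N0. intros n Hn. specialize (K n Hn).
      rewrite <- csum_scal in K. rewrite (csum_ext _ (fun i => sq (psi z) * G i z)%C); [exact K|].
      intros i _. unfold G, Wseries. field. now apply HN.
    - replace (sq (psi z) * l / sq (psi z))%C with l by (field; now apply HN). exact Hl. }
  assert (Hs1 : forall z, exists l, Bz z -> clim (fun n => csum (fun i => G1 i z) n) l).
  { intros z. destruct (excluded_middle_informative (Bz z)) as [Hz|Hz]; [|now exists 0].
    destruct (geometric_clim (fun i => G1 i z) al ltac:(lra) (fun i => proj2 (Hb i z Hz))) as [l Hl]. now exists l. }
  split.
  - exists (fun z => proj1_sig (constructive_indefinite_description _ (Hs1 z))).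
    apply (nrm_clim _ _ _ _ (fun n z => csum (fun i => G i z) n) (fun n z => csum (fun i => G1 i z) n)).
    + intros n. apply nrm_le with (rsum (fun i => al * cf (Datatypes.S i)) n).
      2:{ apply (nrm_csum Bz om kap d G G1 (fun i => al * cf (Datatypes.S i))). intros i _. apply HG. }
      apply Rle_trans with (al * (1 - (/ 2) ^ n)).
      2:{ assert (P : 0 < (/ 2) ^ n) by (apply pow_lt; lra). nra. }
      induction n as [|n IH]; simpl; [lra|]. assert (B := cf_bounds (Datatypes.S n) ltac:(lia)). simpl in B. nra.
    + intros z Hz. split.
      * destruct (Hs z Hz) as [l [X1 X2]]. unfold gfun.
        assert (E : Wsum c m sq D fwd (psi z) h = l).
        { apply clim_unique with (csum (Wseries c m sq D fwd (psi z) h)); [|exact X1]. apply is_series_clim.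
          unfold Wsum. apply epsilon_spec. exists l. now apply is_series_clim. }
        rewrite E. exact X2.
      * apply (proj2_sig (constructive_indefinite_description _ (Hs1 z)) Hz).
  - intros z Hz. destruct (Hs z Hz) as [l [X1 _]]. exists l. now apply is_series_clim.
Qed.

(** * The solutions *)

Lemma Cmod_cexp w : Cmod (cexp w) = exp (Re w).
Proof.
  unfold cexp. assert (E := exp_pos (Re w)). rewrite Cmod_mult, Cmod_R, Rabs_pos_eq by lra.
  rewrite <- (Rmult_1_r (exp (Re w))) at 2. f_equal. unfold Cmod. simpl fst. simpl snd.
  rewrite <- sqrt_1. f_equal. assert (X := sin2_cos2 (Im w)). unfold Rsqr in X. simpl. lra.
Qed.

Lemma cexp_ray k t : rder (fun t => cexp (RtoC t * k)%C) t (k * cexp (RtoC t * k))%C.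
Proof.
  destruct k as [x y].
  assert (D1 : is_derive (fun t => exp (t * x) * cos (t * y)) t (x * (exp (t * x) * cos (t * y)) - y * (exp (t * x) * sin (t * y)))).
  { auto_derive; [easy|]. ring. }
  assert (D2 : is_derive (fun t => exp (t * x) * sin (t * y)) t (y * (exp (t * x) * cos (t * y)) + x * (exp (t * x) * sin (t * y)))).
  { auto_derive; [easy|]. ring. }
  assert (D := deriv_plus _ _ _ _ _ _ (rder_of_real _ _ _ D1) (deriv_scal _ _ Ci _ _ (rder_of_real _ _ _ D2))).
  assert (E : forall t, (RtoC (exp (t * x) * cos (t * y)) + Ci * RtoC (exp (t * x) * sin (t * y)))%C = cexp (RtoC t * (x, y))%C).
  { intros s. unfold cexp. replace (Re (RtoC s * (x, y))%C) with (s * x) by (simpl; ring).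
    replace (Im (RtoC s * (x, y))%C) with (s * y) by (simpl; ring). apply C_ext; simpl; ring. }
  apply (deriv_ext _ _ _ _ _ 1 Rlt_0_1 (fun s _ => E s)).
  eapply deriv_eq; [exact D|]. rewrite <- E. apply C_ext; simpl; ring.
Qed.

(** The derivative along rays from 0 and two mean value inequalities give
    [|exp k - 1 - k| <= e |k|^2] for [|k| <= 1]; the addition formula moves this to [w]. *)
Lemma cder_cexp w : cder cexp w (cexp w).
Proof.
  assert (Hb : forall k t, Cmod k <= 1 -> 0 <= t <= 1 -> Cmod (cexp (RtoC t * k)%C) <= exp 1).
  { intros k t Hk Ht. rewrite Cmod_cexp. assert (A := re_le_Cmod (RtoC t * k)%C).
    rewrite Cmod_mult, Cmod_R, (Rabs_pos_eq t) in A by lra. assert (B := Rle_abs (Re (RtoC t * k)%C)).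
    assert (X := Cmod_ge_0 k). assert (L : Re (RtoC t * k)%C <= 1) by nra.
    destruct (Rle_lt_or_eq_dec _ _ L) as [L2|L2]; [apply Rlt_le, exp_increasing, L2|rewrite L2; lra]. }
  assert (E0 : cexp 0 = RtoC 1).
  { unfold cexp. simpl. rewrite exp_0, cos_0, sin_0. apply C_ext; simpl; ring. }
  assert (H1 : forall k t, Cmod k <= 1 -> 0 <= t <= 1 -> Cmod (cexp (RtoC t * k) - 1)%C <= exp 1 * Cmod k).
  { intros k t Hk Ht. assert (M := MVT_rder (fun t => cexp (RtoC t * k)%C) (fun t => k * cexp (RtoC t * k))%C 0 t (exp 1 * Cmod k) ltac:(lra)
      ltac:(intros; apply cexp_ray)).
    simpl in M. replace (RtoC 0 * k)%C with (RtoC 0) in M by ring. rewrite E0 in M.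
    assert (X := Cmod_ge_0 k). assert (Ex := exp_pos 1).
    eapply Rle_trans; [apply M|].
    - intros s Hs. rewrite Cmod_mult, Rmult_comm. apply Rmult_le_compat_r; [exact X|]. apply Hb; lra.
    - assert (0 <= exp 1 * Cmod k) by nra. nra. }
  assert (H2 : forall k, Cmod k <= 1 -> Cmod (cexp k - 1 - k)%C <= exp 1 * Cmod k * Cmod k).
  { intros k Hk. assert (X := Cmod_ge_0 k).
    assert (M := MVT_rder (fun t => cexp (RtoC t * k) - RtoC t * k)%C (fun t => k * cexp (RtoC t * k) - k)%C 0 1 (exp 1 * Cmod k * Cmod k) ltac:(lra)).
    cbv beta in M.
    replace (RtoC 1 * k)%C with k in M by ring. replace (RtoC 0 * k)%C with (RtoC 0) in M by ring. rewrite E0 in M.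
    replace (cexp k - 1 - k)%C with (cexp k - k - (1 - 0))%C by ring.
    eapply Rle_trans; [apply M|lra].
    - intros t Ht. apply deriv_minus; [apply cexp_ray|].
      apply (deriv_ext RtoC (fun t => k * RtoC t)%C _ _ _ 1); [lra|intros; ring|]. eapply deriv_eq; [apply deriv_scal, deriv_self|ring].
    - intros t Ht. replace (k * cexp (RtoC t * k) - k)%C with ((cexp (RtoC t * k) - 1) * k)%C by ring. rewrite Cmod_mult.
      apply Rmult_le_compat_r; [exact X|]. now apply H1. }
  intros e He. set (A := Cmod (cexp w)). assert (HA : 0 <= A) by apply Cmod_ge_0. assert (Ex := exp_pos 1).
  assert (P : 0 < A * exp 1 + 1) by nra. assert (Q : 0 < e / (A * exp 1 + 1)) by now apply Rdiv_lt_0_compat.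
  exists (Rmin 1 (e / (A * exp 1 + 1))). split; [apply Rmin_pos; lra|]. intros y Hy.
  assert (Q1 := Rmin_l 1 (e / (A * exp 1 + 1))). assert (Q2 := Rmin_r 1 (e / (A * exp 1 + 1))).
  set (k := (y - w)%C) in *. replace y with (w + k)%C by (unfold k; ring). rewrite cexp_add.
  replace (cexp w * cexp k - cexp w - cexp w * k)%C with (cexp w * (cexp k - 1 - k))%C by ring.
  rewrite Cmod_mult. fold A. specialize (H2 k ltac:(lra)). assert (X := Cmod_ge_0 k).
  apply Rle_trans with (A * (exp 1 * Cmod k * Cmod k)); [now apply Rmult_le_compat_l|].
  replace (A * (exp 1 * Cmod k * Cmod k)) with (A * exp 1 * Cmod k * Cmod k) by ring. apply Rmult_le_compat_r; [exact X|].
  apply Rle_trans with ((A * exp 1 + 1) * (e / (A * exp 1 + 1))); [|right; field; lra].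
  apply Rmult_le_compat; [nra|exact X|lra|lra].
Qed.

(** A bound of the weight valid from time [u] on is admissible in [nrm] at the point reached at time
    [u]. So a function of finite norm is [O((1 + u)^-2)] along the ray; the minimum with 1 meets the
    condition [lam <= 1]. *)
Lemma ray_weight c m D S sq psi Z fwd r z : strip c m D S sq psi Z fwd -> 0 < r -> wide Z r z ->
  exists K, 0 < K /\ forall u, 0 <= u ->
    ray_bd (omega m psi) (dirn fwd) (z + RtoC (dirn fwd * u))%C (Rmin 1 (K / ((1 + u) * (1 + u)))).
Proof.
  intros HS Hr Hz. destruct (ray_decay _ _ _ _ _ _ _ _ z r HS Hr (wide_deep _ _ _ Hz)) as [K [HK H]].
  exists K. split; [exact HK|]. intros u Hu.
  assert (P : 0 < K / ((1 + u) * (1 + u))) by (apply Rdiv_lt_0_compat; nra).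
  split; [split; [apply Rmin_glb; lra|apply Rmin_l]|]. intros v Hv.
  replace (z + RtoC (dirn fwd * u) + RtoC (dirn fwd * v))%C with (z + RtoC (dirn fwd * (u + v)))%C
    by (rewrite Rmult_plus_distr_l, RtoC_plus; ring).
  apply Rmin_glb; [apply (en_om _ _ _ _ (wide_env _ _ _ _ _ _ _ _ r 1 HS Hr ltac:(lra)))|].
  specialize (H (u + v) ltac:(lra)). unfold omega. set (W := (1 + Cmod (psi (z + RtoC (dirn fwd * (u + v)))%C)) ^ (m + 2)) in *.
  assert (HW : 0 < W) by nra.
  apply Rmult_le_reg_r with (W * ((1 + u) * (1 + u))); [apply Rmult_lt_0_compat; nra|].
  replace (/ W * (W * ((1 + u) * (1 + u)))) with ((1 + u) * (1 + u)) by (field; lra).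
  replace (K / ((1 + u) * (1 + u)) * (W * ((1 + u) * (1 + u)))) with (K * W) by (field; lra). nra.
Qed.

Definition ray_int (d : R) (F : C -> C) (z : C) : C := hint (fun u => RtoC (- d) * F (z + RtoC (d * u)))%C.

(** No exponential factor helps here. The decay from [ray_weight] bounds value, derivative and
    second order remainder alike, and the integrated remainder is [O(|k|^2)], which is
    differentiability. *)
Lemma ray_int_cder c m D S sq psi Z fwd r kap F F1 a : strip c m D S sq psi Z fwd -> 0 < r ->
  ray_env (wide Z r) (omega m psi) kap (dirn fwd) -> nrm (wide Z r) (omega m psi) kap (dirn fwd) F F1 a ->
  forall z, wide Z r z ->
   half_int (fun u => RtoC (- dirn fwd) * F (z + RtoC (dirn fwd * u)))%C (ray_int (dirn fwd) F z) /\
   cder (ray_int (dirn fwd) F) z (ray_int (dirn fwd) F1 z).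
Proof.
  intros HS Hr He Hn. set (d := dirn fwd) in *. assert (Hd := en_d _ _ _ _ He). assert (Ha := proj1 Hn).
  assert (Hw : forall x K u, 0 < K -> 0 <= u -> x <= a * Rmin 1 (K / ((1 + u) * (1 + u))) -> x <= a * K / ((1 + u) * (1 + u))).
  { intros x K u HK Hu Hx. eapply Rle_trans; [exact Hx|]. unfold Rdiv. rewrite Rmult_assoc. apply Rmult_le_compat_l; [exact Ha|]. apply Rmin_r. }
  assert (Hex : forall z, wide Z r z -> half_int (fun u => RtoC (- d) * F (z + RtoC (d * u)))%C (ray_int d F z) /\
     half_int (fun u => RtoC (- d) * F1 (z + RtoC (d * u)))%C (ray_int d F1 z)).
  { intros z Hz. destruct (ray_weight _ _ _ _ _ _ _ _ r z HS Hr Hz) as [K [HK Hl]]. fold d in Hl.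
    assert (T := tail_sqr (a * K) ltac:(apply Rmult_le_pos; lra)).
    assert (Hr' := fun u Hu => en_ray _ _ _ _ He z u Hz Hu).
    split; unfold ray_int, hint; apply epsilon_spec; apply (half_int_exists _ _ _ T).
    - intros u Hu. apply (cont_mult RtoC (fun _ => RtoC (- d))); [apply cont_const|]. apply ray_rcont.
      exact (deriv_cont _ _ _ _ (proj1 (nrm_cont _ _ _ _ _ _ _ _ He Hn (Hr' u Hu)))).
    - intros u Hu. rewrite Cmod_dir by exact Hd. apply Hw; [exact HK|exact Hu|]. apply (proj2 Hn _ _ (Hr' u Hu) (Hl u Hu)).
    - intros u Hu. apply (cont_mult RtoC (fun _ => RtoC (- d))); [apply cont_const|]. apply ray_rcont.
      exact (proj2 (nrm_cont _ _ _ _ _ _ _ _ He Hn (Hr' u Hu))).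
    - intros u Hu. rewrite Cmod_dir by exact Hd. apply Hw; [exact HK|exact Hu|]. apply (proj2 Hn _ _ (Hr' u Hu) (Hl u Hu)). }
  intros z Hz. destruct (Hex z Hz) as [X1 X2]. split; [exact X1|].
  destruct (ray_weight _ _ _ _ _ _ _ _ r z HS Hr Hz) as [K [HK Hl]]. fold d in Hl.
  destruct (en_open _ _ _ _ He z Hz) as [r0 [Hr0 Ho]]. assert (Hk := en_kap _ _ _ _ He).
  intros e Hee. set (A := a * K). assert (HA : 0 <= A) by (apply Rmult_le_pos; lra).
  assert (Q : 0 < e / (A + 1)) by (apply Rdiv_lt_0_compat; lra).
  exists (Rmin (Rmin r0 kap) (e / (A + 1))). split; [repeat apply Rmin_pos; lra|]. intros y Hy.
  assert (Q1 := Rmin_l (Rmin r0 kap) (e / (A + 1))). assert (Q2 := Rmin_r (Rmin r0 kap) (e / (A + 1))).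
  assert (Q3 := Rmin_l r0 kap). assert (Q4 := Rmin_r r0 kap).
  set (k := (y - z)%C) in *. replace y with (z + k)%C by (unfold k; ring).
  assert (Zk := Ho k ltac:(lra)). destruct (Hex _ Zk) as [Y1 _].
  set (q := Cmod k). assert (Hq : 0 <= q) by apply Cmod_ge_0.
  assert (X : Cmod (ray_int d F (z + k) - ray_int d F z - k * ray_int d F1 z)%C <= A * (q * q) / (1 + 0)).
  { apply (half_int_bound (fun u => RtoC (- d) * F (z + k + RtoC (d * u)) - RtoC (- d) * F (z + RtoC (d * u)) - k * (RtoC (- d) * F1 (z + RtoC (d * u))))%C
      _ _ (fun u => A * (q * q) / (1 + u)) (tail_sqr (A * (q * q)) ltac:(apply Rmult_le_pos; nra))).
    - intros u Hu. set (w := (z + RtoC (d * u))%C). replace (z + k + RtoC (d * u))%C with (w + k)%C by (unfold w; ring).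
      replace (RtoC (- d) * F (w + k) - RtoC (- d) * F w - k * (RtoC (- d) * F1 w))%C with (RtoC (- d) * (F (w + k) - F w - k * F1 w))%C by ring.
      rewrite Cmod_dir by exact Hd.
      destruct (proj2 Hn w _ (en_ray _ _ _ _ He z u Hz Hu) (Hl u Hu)) as [_ [_ B]].
      assert (Zw : wide Z r (w + k)%C) by (unfold w; replace (z + RtoC (d * u) + k)%C with (z + k + RtoC (d * u))%C by ring; now apply (en_ray _ _ _ _ He)).
      specialize (B k ltac:(lra) Zw). fold q in B. eapply Rle_trans; [exact B|].
      replace (A * (q * q) / ((1 + u) * (1 + u))) with (a * K / ((1 + u) * (1 + u)) * (q * q)) by (unfold A; field; lra).
      apply Rmult_le_compat_r; [nra|]. apply Hw; [exact HK|exact Hu|apply Rle_refl].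
    - apply half_int_minus; [apply half_int_minus; assumption|]. now apply half_int_scal. }
  replace (ray_int d F1 z * k)%C with (k * ray_int d F1 z)%C by ring. eapply Rle_trans; [exact X|].
  replace (A * (q * q) / (1 + 0)) with (A * q * q) by field. apply Rmult_le_compat_r; [exact Hq|].
  apply Rle_trans with ((A + 1) * (e / (A + 1))); [|right; field; lra]. apply Rmult_le_compat; unfold q in *; lra.
Qed.

Lemma U_holomorphic c m D S sq psi Z fwd r kap F1 M h (q4 : C -> C) : strip c m D S sq psi Z fwd -> 0 < r ->
  ray_env (wide Z r) (omega m psi) kap (dirn fwd) ->
  nrm (wide Z r) (omega m psi) kap (dirn fwd) (fun z => Cfun c m (psi z) / peval c m (psi z))%C F1 M ->
  0 < h -> 24 * M * (h * h) <= 1 ->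
  (forall x, D x -> cdiff q4 x /\ (q4 x * q4 x)%C = sq x) ->
  forall x, D x -> wide Z r (S x) -> U_defined c m sq D fwd x h /\ cdiff (fun x => Ufun c m sq q4 S D fwd x h) x.
Proof.
  intros HS Hr He HC Hh Hsm Hq4 x Hx HxZ. set (Bz := wide Z r) in *.
  assert (HZ : forall z, Bz z -> Z z) by (intros z Hz; exact (deep_center _ _ _ Hr (wide_deep _ _ _ Hz))).
  destruct (W_sum_nrm _ _ _ _ _ _ _ _ _ _ _ _ _ HS Hr He HC Hh Hsm) as [[G1 HG] Hser].
  set (F := fun z => gfun c m sq D fwd (psi z) h) in *.
  assert (HI := ray_int_cder _ _ _ _ _ _ _ _ _ _ _ _ _ HS Hr He HG).
  assert (Hgen : forall z, Bz z -> @ex_RInt_gen C_R_NormedModule (Uintegrand c m sq D fwd (psi z) h) (Klow fwd) (at_point 0) /\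
     @RInt_gen C_R_CompleteNormedModule (Uintegrand c m sq D fwd (psi z) h) (Klow fwd) (at_point 0) = ray_int (dirn fwd) F z).
  { intros z Hz. apply gen_value. apply (half_int_ext (fun u => RtoC (- dirn fwd) * F (z + RtoC (dirn fwd * u)))%C); [|now apply HI].
    intros u Hu. unfold Uintegrand. rewrite (strip_phi _ _ _ _ _ _ _ _ _ _ HS (HZ z Hz) Hu). reflexivity. }
  assert (Ex := sp_inv _ _ _ _ _ _ _ _ HS x Hx). split.
  - rewrite <- Ex. split; [|split; [|split]].
    + apply (strip_flow _ _ _ _ _ _ _ _ _ HS (HZ _ HxZ)).
    + intros n Hn. now apply (W_nrm _ _ _ _ _ _ _ _ _ _ _ _ _ HS Hr He HC Hh Hsm n Hn).
    + now apply Hser.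
    + now apply Hgen.
  - destruct (Hq4 x Hx) as [[l4 Hl4] Hsq]. apply cderiv_is_cder in Hl4.
    destruct (sp_sq _ _ _ _ _ _ _ _ HS x Hx) as [_ Nsq].
    assert (N4 : q4 x <> RtoC 0) by (intros E; apply Nsq; rewrite <- Hsq, E; ring).
    set (sg := RtoC (if fwd then -1 else 1)).
    assert (DS := sp_S _ _ _ _ _ _ _ _ HS x Hx).
    assert (D1 := deriv_plus _ _ _ _ _ _ (deriv_scal _ _ (sg * / RtoC h)%C _ _ DS)
       (deriv_comp _ S _ _ _ _ DS (proj2 (HI _ HxZ)))).
    assert (D2 := deriv_mult _ _ _ _ _ _ (deriv_inv _ _ _ _ N4 Hl4) (deriv_comp _ _ _ _ _ _ D1 (cder_cexp _))).
    destruct (en_open _ _ _ _ He _ HxZ) as [r0 [Hr0 Ho]].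
    assert (HD0 : deep Z r0 (S x)) by (intros k Hk; apply HZ, Ho, Hk).
    (* The derivative above is that of a formula in [ray_int] and [S]. It is transferred to [Ufun]
       because every point near [x] is [psi (S x + k)] with small [k], where the two coincide. *)
    destruct (strip_ball _ _ _ _ _ _ _ _ r0 (Cmod x) HS Hr0 (Cmod_ge_0 x)) as [d [Hd Hball]].
    eexists. apply cderiv_is_cder. refine (deriv_ext _ _ _ _ _ d Hd _ D2). intros y Hy.
    destruct (Hball (S x) y HD0 ltac:(rewrite Ex; lra) ltac:(rewrite Ex; exact Hy)) as [k [Hk Ek]].
    assert (Zk := Ho k Hk). assert (ES : S y = (S x + k)%C) by (rewrite <- Ek; apply (sp_psi _ _ _ _ _ _ _ _ HS _ (HZ _ Zk))).
    unfold Ufun. rewrite ES. rewrite <- Ek at 3. rewrite (proj2 (Hgen _ Zk)). fold sg. f_equal. f_equal. f_equal.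
    unfold Cdiv. ring.
Qed.

(** For [fwd = false] this is [zone]. The other sign is obtained in [setting_strip] from [zone] of
    the exchanged domains, reflected by [z] to [- z]. *)
Definition slit (fwd : bool) (Om Om' : C -> Prop) (S : C -> C) (z : C) : Prop :=
  (exists y, Om y /\ Im z < Im (S y)) /\ (exists y, Om' y /\ Im (S y) < Im z) /\ (Im z = 0 -> dirn fwd * Re z > 0).

Lemma Re_opp z : Re (- z)%C = - Re z.
Proof. reflexivity. Qed.

Lemma Re_plus x y : Re (x + y)%C = Re x + Re y.
Proof. reflexivity. Qed.

Lemma Im_plus x y : Im (x + y)%C = Im x + Im y.
Proof. reflexivity. Qed.

Lemma Im_plus_R z t : Im (z + RtoC t)%C = Im z.
Proof. destruct z. simpl. ring. Qed.

Lemma Re_plus_R z t : Re (z + RtoC t)%C = Re z + t.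
Proof. destruct z. reflexivity. Qed.

Lemma setting_strip c m Om Om' a gam S sq fwd : setting c m Om Om' a gam S sq ->
  (forall x, on_curve gam x -> x <> a -> dirn fwd * Re (S x) > 0) ->
  exists psi, strip c m (tilde Om Om' a gam) S sq psi (slit fwd Om Om' S) fwd.
Proof.
  intros HS Hsg. assert (HS' := setting_swap _ _ _ _ _ _ _ _ HS).
  assert (Hsq : forall x, tilde Om Om' a gam x -> (sq x * sq x)%C = peval c m x /\ sq x <> RtoC 0).
  { intros x Hx. split; [now apply (st_sq _ _ _ _ _ _ _ _ HS)|]. destruct Hx as [Hx|[Hx|[Hx Hxa]]].
    - apply (sheet_neq_0 _ _ _ _ _ _ (setting_sheet _ _ _ _ _ _ _ _ HS) Hx).
    - intros E. apply (proj2 (sheet_neq_0 _ _ _ _ _ _ (setting_sheet _ _ _ _ _ _ _ _ HS') Hx)). rewrite E. ring.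
    - apply (curve_facts _ _ _ _ _ _ _ _ _ HS Hx Hxa). }
  assert (Hray : forall z t, slit fwd Om Om' S z -> 0 <= t -> slit fwd Om Om' S (z + RtoC (dirn fwd * t))%C).
  { intros z t [A [B Hc]] Ht. unfold slit. rewrite Im_plus_R, Re_plus_R. split; [exact A|]. split; [exact B|].
    intros E. specialize (Hc E). assert (X := dirn_sqr fwd). nra. }
  destruct fwd; simpl in Hsg.
  - destruct (zone_inverse _ _ _ _ _ _ _ _ HS') as [psi [H1 H2]].
    { intros x Hx Hxa. rewrite Re_opp. specialize (Hsg x Hx Hxa). lra. }
    exists (fun z => psi (- z)%C). split; [apply HS|exact Hsq|apply HS|apply HS| | |exact Hray].
    + intros z [[y [Hy Ly]] [[y' [Hy' Ly']] Hc]]. destruct (H1 (- z)%C) as [B1 [B2 B3]].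
      { unfold zone. rewrite Im_opp, Re_opp. simpl in Hc. split; [|split].
        - exists y'. rewrite Im_opp. split; [exact Hy'|lra].
        - exists y. rewrite Im_opp. split; [exact Hy|lra].
        - intros E. assert (E2 : Im z = 0) by lra. specialize (Hc E2). lra. }
      apply tilde_swap in B1. split; [exact B1|]. split.
      * replace (S (psi (- z)%C)) with (- (- S (psi (- z))))%C by ring. rewrite B2. ring.
      * apply (deriv_eq _ _ _ (/ (- sq (psi (- z))) * - (1))%C).
        -- apply (deriv_comp _ (fun z => - z)%C psi); [apply deriv_opp, deriv_self|exact B3].
        -- field. now apply Hsq.
    + intros x Hx. rewrite <- (H2 x) at 2 by now apply tilde_swap. reflexivity.
  - destruct (zone_inverse _ _ _ _ _ _ _ _ HS) as [psi [H1 H2]].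
    { intros x Hx Hxa. specialize (Hsg x Hx Hxa). lra. }
    exists psi. split; [apply HS|exact Hsq|apply HS|apply HS| |exact H2|exact Hray].
    intros z [A [B Hc]]. apply H1. split; [exact A|]. split; [exact B|]. intros E. specialize (Hc E). simpl in Hc. lra.
Qed.

Lemma mu_sup_lt (S : C -> C) Om v delta : Rbar_lt (Finite v) (Rbar_minus (mu_sup S Om) (Finite delta)) ->
  exists y, Om y /\ v + delta < Im (S y).
Proof.
  intros H. apply NNPP. intros Hn.
  assert (L : Rbar_le (mu_sup S Om) (Finite (v + delta))).
  { unfold mu_sup. apply Lub_Rbar_correct. intros r [x [Hx ->]]. simpl. apply Rnot_lt_le. intros L. apply Hn. now exists x. }
  destruct (mu_sup S Om) as [s| |]; simpl in *; [lra|easy|easy].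
Qed.

Lemma mu_inf_lt (S : C -> C) Om v delta : Rbar_lt (Rbar_plus (mu_inf S Om) (Finite delta)) (Finite v) ->
  exists y, Om y /\ Im (S y) < v - delta.
Proof.
  intros H. apply NNPP. intros Hn.
  assert (L : Rbar_le (Finite (v - delta)) (mu_inf S Om)).
  { unfold mu_inf. apply Glb_Rbar_correct. intros r [x [Hx ->]]. simpl. apply Rnot_lt_le. intros L. apply Hn. now exists x. }
  destruct (mu_inf S Om) as [s| |]; simpl in *; [lra|easy|easy].
Qed.

(** The disc of radius [min eps delta] about [S x] stays off the edges of the strip. If it meets the
    real axis, then [|Im (S x)| < delta], and the removed set forces [Re (S x)] to be at least [eps]
    inside the open half-axis. Halving the radius leaves the room that [wide] asks for. *)
Lemma Omt_ed_wide Om Om' D S fwd eps delta x : 0 < eps -> 0 < delta -> Omt_ed S Om Om' D fwd eps delta x ->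
  D x /\ wide (slit fwd Om Om' S) (Rmin eps delta / 2) (S x).
Proof.
  intros He Hd [[Hx [Hl Hu]] Hn]. split; [exact Hx|].
  assert (Q1 := Rmin_l eps delta). assert (Q2 := Rmin_r eps delta). assert (Q3 : 0 < Rmin eps delta) by now apply Rmin_pos.
  exists (Rmin eps delta). split; [lra|]. intros k Hk.
  apply mu_sup_lt in Hu. apply mu_inf_lt in Hl. destruct Hu as [y [Hy Ly]]. destruct Hl as [y' [Hy' Ly']].
  assert (A := im_le_Cmod k). assert (B := re_le_Cmod k). apply Rabs_le_between in A. apply Rabs_le_between in B.
  unfold slit. rewrite Im_plus, Re_plus. split; [exists y; split; [exact Hy|lra]|]. split; [exists y'; split; [exact Hy'|lra]|].
  intros E. assert (HI : Rabs (Im (S x)) < delta) by (apply Rabs_def1; lra).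
  destruct fwd; simpl; apply Rnot_le_gt; intros L; apply Hn; (split; [exact Hx|split; [lra|exact HI]]).
Qed.

Lemma one_side c m Om Om' a gam S sq q4 fwd eps delta : setting c m Om Om' a gam S sq ->
  (forall x, tilde Om Om' a gam x -> cdiff q4 x /\ (q4 x * q4 x)%C = sq x) -> 0 < eps -> 0 < delta ->
  exists H, 0 < H /\ forall h, 0 < h < H -> (forall x, on_curve gam x -> x <> a -> dirn fwd * Re (S x) > 0) ->
    forall x, Omt_ed S Om Om' (tilde Om Om' a gam) fwd eps delta x ->
      U_defined c m sq (tilde Om Om' a gam) fwd x h /\
      cdiff (fun x => Ufun c m sq q4 S (tilde Om Om' a gam) fwd x h) x.
Proof.
  intros HS Hq4 He Hd.
  (* The sign condition does not involve [h], so it can be decided before [H] is chosen; when it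
     fails, any [H] serves. *)
  destruct (classic (forall x, on_curve gam x -> x <> a -> dirn fwd * Re (S x) > 0)) as [Hsg|Hsg];
    [|exists 1; split; [lra|]; intros h _ Hc; contradiction].
  destruct (setting_strip _ _ _ _ _ _ _ _ fwd HS Hsg) as [psi Hst].
  assert (Hr : 0 < Rmin eps delta / 2) by (assert (Q := Rmin_pos _ _ He Hd); lra).
  destruct (potential_nrm _ _ _ _ _ _ _ _ _ Hst Hr) as [F1 [M [kap [HM [Hk HC]]]]].
  assert (Henv := wide_env _ _ _ _ _ _ _ _ _ kap Hst Hr Hk).
  (* The bound [h <= 1] turns [24 M h <= 1] into the required [24 M h^2 <= 1] without a square
     root. *)
  exists (Rmin 1 (/ (24 * M))). assert (P : 0 < / (24 * M)) by (apply Rinv_0_lt_compat; lra).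
  split; [apply Rmin_pos; lra|]. intros h [Hh0 Hh] _ x Hx.
  assert (Q1 := Rmin_l 1 (/ (24 * M))). assert (Q2 := Rmin_r 1 (/ (24 * M))).
  destruct (Omt_ed_wide _ _ _ _ _ _ _ _ He Hd Hx) as [HxD Hw].
  apply (U_holomorphic _ _ _ _ _ _ _ _ _ _ _ _ _ _ Hst Hr Henv HC Hh0); try assumption.
  assert (X : 24 * M * h <= 1).
  { apply Rle_trans with (24 * M * / (24 * M)); [apply Rmult_le_compat_l; lra|right; apply Rinv_r; lra]. }
  nra.
Qed.

Theorem theorem4p4
  (c : nat -> C) (m : nat) (Hdeg : is_poly_deg c m)
  (Om Om' : C -> Prop) (a : C) (gam : R -> C)
  (HOm : stokes_domain c m Om) (HOm' : stokes_domain c m Om')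
  (* C = boundary(Om) ∩ boundary(Om') is a Stokes curve from a to infinity *)
  (Hgam : stokes_arc c m a gam p_infty)
  (Hinf : filterlim (fun t => Cmod (gam t)) (Rbar_locally p_infty) (Rbar_locally p_infty))
  (HC : forall x, (boundary Om x /\ boundary Om' x) <-> exists t, 0 <= t /\ gam t = x)
  (* branch of sqrt Q on Omega~ = Om ∪ Om' ∪ (C \ {a}) *)
  (sq : C -> C)
  (Hsq_hol : holomorphic_on
     (fun x => Om x \/ Om' x \/ ((exists t, 0 <= t /\ gam t = x) /\ x <> a)) sq)
  (Hsq : forall x, (Om x \/ Om' x \/ ((exists t, 0 <= t /\ gam t = x) /\ x <> a)) ->
           Cmult (sq x) (sq x) = peval c m x)
  (* S = S_a(x) = int_a^x sqrt Q *)
  (S : C -> C)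
  (HS : forall x, (Om x \/ Om' x \/ ((exists t, 0 <= t /\ gam t = x) /\ x <> a)) ->
          cderiv_is S x (sq x))
  (HSa : filterlim S
     (within (fun x => Om x \/ Om' x \/ ((exists t, 0 <= t /\ gam t = x) /\ x <> a))
        (locally a)) (locally (RtoC 0)))
  (HImp : forall x, Om x -> 0 < Im (S x))
  (HImn : forall x, Om' x -> Im (S x) < 0)
  (* branch Q^{1/4} with (Q^{1/4})^2 = sqrt Q *)
  (q4 : C -> C)
  (Hq4_hol : holomorphic_on
     (fun x => Om x \/ Om' x \/ ((exists t, 0 <= t /\ gam t = x) /\ x <> a)) q4)
  (Hq4 : forall x, (Om x \/ Om' x \/ ((exists t, 0 <= t /\ gam t = x) /\ x <> a)) ->
           Cmult (q4 x) (q4 x) = sq x) :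
  let Omt := fun x => Om x \/ Om' x \/ ((exists t, 0 <= t /\ gam t = x) /\ x <> a) in
  forall eps delta : R, 0 < eps -> 0 < delta ->
  exists H : R, 0 < H /\
  forall h : R, 0 < h < H ->
    ((forall x, (exists t, 0 <= t /\ gam t = x) -> x <> a -> Re (S x) < 0) ->
       (forall x, Omt_ed S Om Om' Omt false eps delta x ->
          U_defined c m sq Omt false x h) /\
       holomorphic_on (Omt_ed S Om Om' Omt false eps delta)
         (fun x => Ufun c m sq q4 S Omt false x h)) /\
    ((forall x, (exists t, 0 <= t /\ gam t = x) -> x <> a -> 0 < Re (S x)) ->
       (forall x, Omt_ed S Om Om' Omt true eps delta x ->
          U_defined c m sq Omt true x h) /\
       holomorphic_on (Omt_ed S Om Om' Omt true eps delta)
         (fun x => Ufun c m sq q4 S Omt true x h)).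
Proof.
  intros Omt eps delta He Hd. change Omt with (tilde Om Om' a gam). clear Omt.
  assert (Hset : setting c m Om Om' a gam S sq).
  { split; try assumption.
    - intros M. destruct (Hinf (fun r => M < r) (ex_intro _ M (fun x Hx => Hx))) as [t0 Ht0]. now exists t0.
    - intros x Hx. destruct (Hsq_hol x Hx) as [l Hl]. apply cderiv_is_cder in Hl. exact (deriv_cont _ _ _ _ Hl).
    - intros x Hx. now apply cderiv_is_cder, HS.
    - intros e Hee. specialize (HSa (fun z => Cmod z < e)).
      assert (Hloc : locally (RtoC 0) (fun z : C => Cmod z < e)).
      { apply (locally_le_locally_norm (V := C_R_NormedModule)). exists (mkposreal e Hee). intros y Hy.
        unfold ball_norm in Hy. rewrite C_R_norm_Cmod in Hy. simpl in Hy. replace y with (y - 0)%C by ring. exact Hy. }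
      destruct (HSa Hloc) as [d Hdd]. exists d. split; [apply cond_pos|]. intros x Hx Hxa. apply Hdd; [|exact Hx].
      apply (norm_compat1 (V := C_R_NormedModule)). rewrite C_R_norm_Cmod. exact Hxa. }
  assert (Hq : forall x, tilde Om Om' a gam x -> cdiff q4 x /\ (q4 x * q4 x)%C = sq x).
  { intros x Hx. split; [now apply Hq4_hol|now apply Hq4]. }
  destruct (one_side _ _ _ _ _ _ _ _ q4 false eps delta Hset Hq He Hd) as [H1 [P1 K1]].
  destruct (one_side _ _ _ _ _ _ _ _ q4 true eps delta Hset Hq He Hd) as [H2 [P2 K2]].
  exists (Rmin H1 H2). split; [now apply Rmin_pos|]. intros h Hh.
  assert (Q1 := Rmin_l H1 H2). assert (Q2 := Rmin_r H1 H2). split; intros Hsg.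
  - assert (Hsg' : forall x, on_curve gam x -> x <> a -> dirn false * Re (S x) > 0).
    { intros x Hx Hxa. specialize (Hsg x Hx Hxa). simpl. lra. }
    split; intros x Hx; now apply (K1 h ltac:(lra) Hsg').
  - assert (Hsg' : forall x, on_curve gam x -> x <> a -> dirn true * Re (S x) > 0).
    { intros x Hx Hxa. specialize (Hsg x Hx Hxa). simpl. lra. }
    split; intros x Hx; now apply (K2 h ltac:(lra) Hsg').
Qed.
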